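(* (i) There exists $N_1>0$ such that for all $\beta>0$ and $0<N<N_1$ there exist positive constants $c(N,\beta)$ and $C(N,\beta)$ such that the mean length of the $j$-th interval of instability satisfies $$\frac{c(N,\beta)}{j}\le \int_{\Omega_N}(\lambda_{2j}-\lambda_{2j-1})\,\nu_N^\beta(dq)\le \frac{C(N,\beta)}{j}\qquad (j=1,2,\dots).$$ (ii) For $\beta, N>0$, with probability one with respect to $\nu_N^\beta$, all the periodic eigenvalues are simple, so $\lambda_j<\lambda_{j+1}$ for all $j\ge 0$.
   Context: Let $\mathbf T=\mathbf R/2\pi\mathbf Z$ with normalized measure $dx/2\pi$, and for $N>0$ let $\Omega_N=\{\phi\in L^2(\mathbf T;\mathbf R):\int_{\mathbf T}\phi(x)^2\,dx/2\pi\le N\}$. Let $(\gamma_n)_{n\in\mathbf Z}$ be mutually independent standard Gaussian random variables and let $\gamma$ be the Gaussian probability measure on $L^2(\mathbf T;\mathbf R)$ which is the law of $\phi(x)=\gamma_0+\sum_{n=-\infty}^{-1}\gamma_n\frac{\sin nx}{n}+\sum_{n=1}^\infty\gamma_n\frac{\cos nx}{n}$. For $\beta\ge 0$ the KdV Gibbs measure (modified canonical ensemble) is the Radon probability measure on $\Omega_N$ $$\nu_N^\beta(d\phi)=Z_N(\beta)^{-1}\,\mathbf 1_{\Omega_N}(\phi)\exp\Bigl(\frac{\beta}{6}\int_{\mathbf T}\phi(x)^3\frac{dx}{2\pi}\Bigr)\gamma(d\phi),$$ with $Z_N(\beta)$ the normalizing constant. For $q\in\Omega_N$ (extended $2\pi$-periodically),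 the periodic spectrum of Hill's equation $-f''+qf=\lambda f$ is the sequence, listed with multiplicity, $\lambda_0<\lambda_1\le\lambda_2<\lambda_3\le\lambda_4<\cdots$ of real $\lambda$ for which there is a nontrivial solution that is either $2\pi$-periodic or $2\pi$-antiperiodic ($f(x+2\pi)=-f(x)$). The $j$-th interval of instability is $(\lambda_{2j-1},\lambda_{2j})$. Here $\lambda_j=\lambda_j(q)$ is a random variable on $(\Omega_N,\nu_N^\beta)$. *)

(* Defs.v *)
From HB Require Import structures.
From mathcomp Require Import all_boot all_order all_algebra.
From mathcomp Require Import all_classical all_reals all_analysis.
From mathcomp Require Import measurable_realfun.
Import Order.TTheory GRing.Theory Num.Theory.
Import numFieldNormedType.Exports.

Set Implicit Arguments.
Unset Strict Implicit.
Unset Printing Implicit Defensive.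

Local Open Scope classical_set_scope.
Local Open Scope ring_scope.

Lemma twopi_gt0 (R : realType) : (0 : R) < pi *+ 2.
Proof. by rewrite pmulrn_lgt0// pi_gt0. Qed.

(* The torus R/2piZ with measure dx/2pi is modelled by the uniform probability
   on the fundamental domain [0, 2pi], seen as a measure on R. *)
Definition muT (R : realType) : probability (measurableTypeR R) R :=
  uniform_prob (@twopi_gt0 R).

Definition L2 (R : realType) : Type := LspaceType2 (muT R).

(* A representative of the class q. Only its values on [0, 2pi], up to a null
   set, are meaningful, and every definition below depends only on these. *)
Definition L2fun (R : realType) (q : L2 R) : R -> R :=
  aqEqMfun_to_fun (LebesgueSpace.sort q).

Section L2_pointed.
Context (R : realType).

Definition L2zero_class :
    {mfun_ (muT R), measurableTypeR R >-> measurableTypeR R} :=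
  (\pi_({mfun_ (muT R), measurableTypeR R >-> measurableTypeR R})
    (cst 0 : {mfun measurableTypeR R >-> measurableTypeR R}))%qT.

Lemma L2zero_ae :
  ((L2zero_class : R -> R) : measurableTypeR R -> R) = cst 0 %[ae muT R].
Proof.
have /asboolP : ae_eq_op (muT R) (repr L2zero_class)
    (cst 0 : {mfun measurableTypeR R >-> measurableTypeR R}).
  by apply/eqmodP; rewrite reprK.
by [].
Qed.

Lemma L2zero_finite : finite_norm (muT R) 2%:E (L2zero_class : R -> R).
Proof.
rewrite /finite_norm unlock.
rewrite (ae_eq_integral (cst 0%E))//=; last first.
- case: L2zero_ae => A [mA A0 sub]; exists A; split => // x /= h; apply: sub => /= h'.
  by apply: h => _; rewrite h'//= normr0 powR0.
- apply/measurable_EFinP.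
  apply: (@measurableT_comp _ _ _ _ _ _ (fun x : R => x `^ 2)) => //.
  exact: measurableT_comp.
- by rewrite integral0 poweR0r// invr_neq0.
Qed.

HB.instance Definition _ := isFinLebesgue.Build _ _ R (muT R) 2%:E (lee1n 2)
  L2zero_class L2zero_finite.

HB.instance Definition _ := gen_eqMixin (L2 R).
HB.instance Definition _ := gen_choiceMixin (L2 R).
HB.instance Definition _ := isPointed.Build (L2 R)
  (L2zero_class : LspaceType2 (muT R)).

End L2_pointed.

Definition L2dist (R : realType) (f g : R -> R) : \bar R :=
  Lnorm (muT R) 2%:E (fun x => (f x - g x)%:E).

Definition L2open (R : realType) : set (set (L2 R)) :=
  [set U | forall q, U q -> exists2 e : R, 0 < e &
    forall q', (L2dist (L2fun q') (L2fun q) < e%:E)%E -> U q'].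

(* L^2(T; R) with its Borel sigma-algebra. *)
Definition L2T (R : realType) := g_sigma_algebraType (@L2open R).

Definition Omega_ (R : realType) (N : R) : set (L2T R) :=
  [set q | (\int[muT R]_x ((L2fun q x) ^+ 2)%:E <= N%:E)%E].

Definition mutually_independent (R : realType) (I : eqType)
    (d : measure_display) (Om : measurableType d) (P : probability Om R)
    (X : I -> {RV P >-> R}) : Prop :=
  forall (J : seq I) (B : I -> set R), uniq J ->
    (forall i, measurable (B i)) ->
    fine (P (\bigcap_(i in [set` J]) (X i @^-1` B i))) =
    \prod_(i <- J) fine (P (X i @^-1` B i)).

Definition standard_gaussian (R : realType) (d : measure_display)
    (Om : measurableType d) (P : probability Om R) (X : {RV P >-> R}) : Prop :=
  forall B : set R, measurable B -> distribution P X B = normal_prob 0 1 B.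

(* The M-th symmetric partial sum, at the point x, of the random series
   a_0 + sum_{n <= -1} a_n sin(nx)/n + sum_{n >= 1} a_n cos(nx)/n;
   the first sum is indexed by k = -n. *)
Definition gauss_partial (R : realType) (a : int -> R) (M : nat) (x : R) : R :=
  a 0 + \sum_(1 <= k < M.+1)
          (a (- k%:Z) * (sin ((- k%:Z)%:~R * x) / (- k%:Z)%:~R))
      + \sum_(1 <= k < M.+1)
          (a k%:Z * (cos (k%:Z%:~R * x) / k%:Z%:~R)).

(* gam is the law of the sum phi of the random series, which converges almost
   surely in L^2(T; R). *)
Definition is_gaussian_measure (R : realType) (gam : probability (L2T R) R)
    : Prop :=
  exists (d : measure_display) (Om : measurableType d) (P : probability Om R)
    (g : int -> {RV P >-> R}) (phi : {mfun Om >-> L2T R}),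
  [/\ mutually_independent g,
      forall n, standard_gaussian (g n),
      {ae P, forall w,
        L2dist (gauss_partial (fun n => g n w) M) (L2fun (phi w)) @[M --> \oo]
        --> 0%E} &
      forall A : set (L2T R), measurable A -> gam A = distribution P phi A].

(* The cubic integral is defined gam-almost everywhere; elsewhere Rintegral
   takes a junk value, which does not affect integrals against gam. *)
Definition gibbs_weight (R : realType) (beta : R) (q : L2T R) : R :=
  expR (beta / 6 * \int[muT R]_(x in setT) (L2fun q x ^+ 3)).

Definition gibbs_Z (R : realType) (gam : probability (L2T R) R) (N beta : R)
    : \bar R :=
  \int[gam]_(q in Omega_ N) (gibbs_weight beta q)%:E.

(* As nu is a probability, this forces 0 < gibbs_Z gam N beta < +oo. *)
Definition is_gibbs_measure (R : realType) (gam : probability (L2T R) R)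
    (N beta : R) (nu : probability (L2T R) R) : Prop :=
  forall A : set (L2T R), measurable A ->
    nu A = ((fine (gibbs_Z gam N beta))^-1%:E *
            \int[gam]_(q in A) ((\1_(Omega_ N) q)%:E * (gibbs_weight beta q)%:E))%E.

Definition periodize (R : realType) (q : L2 R) (x : R) : R :=
  L2fun q (x - (Num.floor (x / (pi *+ 2)))%:~R * (pi *+ 2)).

(* Solutions of -f'' + q f = l f for q locally square integrable: f is C^1 and
   f' is locally absolutely continuous with f'' = (q - l) f almost everywhere,
   i.e. f' is an indefinite integral of (q - l) f. *)
Definition hill_solution (R : realType) (q : L2 R) (l : R) (f : R -> R) : Prop :=
  (forall x : R, derivable (f : R^o -> R^o) x 1) /\
  (forall a b : R, a <= b ->
    derive1 f b - derive1 f a =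
    \int[lebesgue_measure]_(x in `[a, b]) ((periodize q x - l) * f x)).

(* At most one of the two alternatives has a nontrivial solution, because the
   monodromy matrix has determinant 1; so this is a linear space. *)
Definition hill_eigenspace (R : realType) (q : L2 R) (l : R) : set (R -> R) :=
  [set f | hill_solution q l f /\
           (periodic f (pi *+ 2) \/ alternating f (pi *+ 2))].

Definition has_dim (R : realType) (E : set (R -> R)) (n : nat) : Prop :=
  exists b : 'I_n -> (R -> R),
  [/\ forall i, E (b i),
      forall c : 'I_n -> R,
        (forall x, \sum_(i < n) c i * b i x = 0) -> forall i, c i = 0 &
      forall f, E f -> exists c : 'I_n -> R,
        forall x, f x = \sum_(i < n) c i * b i x].

(* lam lists in increasing order the real l with a nontrivial eigenspace, each
   repeated according to the dimension of that space. *)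
Definition is_periodic_spectrum (R : realType) (q : L2 R) (lam : nat -> R)
    : Prop :=
  nondecreasing_seq lam /\
  forall l : R, exists n : nat,
    has_dim (hill_eigenspace q l) n /\ ([set j | lam j = l] #= `I_n)%card.

(* Main.v *)
(* (i) Let q be small in L^2.  A Lyapunov-Schmidt reduction of Hill's equation
   near j^2/4 onto the span of cos (jx/2) and sin (jx/2) gives a symmetric
   2 x 2 matrix S(mu), with small Lipschitz constant in mu, and the two
   eigenvalues near j^2/4 correspond to the solutions of S(mu) u = mu u.  To
   first order S is given by the j-th Fourier coefficients of q, so the j-th gap
   is the length of (gamma_j, gamma_{-j}) / j up to O(|q|_2^2 / j).  Write
   q = p + t h_n with t standard Gaussian and independent of p: on Omega_N the
   Gibbs density varies along such a line by factors bounded uniformly in n.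
   This bounds the means of |gamma_j| and |gamma_{-j}| above, and bounds below
   the probability that |gamma_j| is of order 1 while q stays small.

   (ii) An eigenvalue is double exactly when the monodromy matrix is 1 or -1.
   By Green's identity, on the line p + t h_n the pairs (t, l) with l a double
   eigenvalue are isolated as long as a determinant D_n does not vanish there.
   Completeness of the trigonometric system makes some D_n nonzero, so each such
   line meets the n-th exceptional set in a countable, hence Gaussian-null,
   set. *)
Require Import Defs.
From HB Require Import structures.
From mathcomp Require Import all_boot all_order all_algebra.
From mathcomp Require Import all_classical all_reals all_analysis.
From mathcomp Require Import measurable_realfun ring lra zify.
Import Order.TTheory GRing.Theory Num.Theory.
Import numFieldNormedType.Exports.
Set Implicit Arguments.
Unset Strict Implicit.
Unset Printing Implicit Defensive.
Local Open Scope classical_set_scope.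
Local Open Scope ring_scope.

(** * Oriented integrals of locally integrable functions *)

Section OrientedIntegral.
Context {R : realType}.
Notation mu := (@lebesgue_measure R).
Implicit Types (f g : R -> R) (a b c x : R).

(** The windows around [j^2/4] have one radius [wr] for all [j] and all [q] of small L^1 norm: the
    Green operator at [j] has norm O(1/j), so the reduction is a contraction for every [j] at once.
    Green's identity, bounded by the maximum of an eigenfunction, places each eigenvalue in some
    window, and an induction on [j] identifies the two in window [j] as those of index [2j - 1] and
    [2j]. Only this spectral half restricts [N], so [N1] does not depend on [beta]. The cubic
    integral is not continuous on L^2 and may diverge. It changes by a bounded amount along [h_n]
    because staying in [Omega_N] forces [|t h_n| <= sqrt (2 N)] pointwise, whatever [n]. Two facts
    about the Gaussian law are used: each coordinate is standard normal and independent of the rest,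
    and balls around countably many trigonometric polynomials cover almost everything. As [lam] is
    not assumed measurable, gap integrals are compared by a monotonicity that holds for arbitrary
    nonnegative functions. In (ii) the potential is arbitrary: solutions come from a Volterra
    equation in an exponential weight, and compactness of bounded ranges of [l] makes the
    exceptional sets closed. *)

Definition locint f := forall a b, mu.-integrable `[a, b] (EFin \o f).

Definition prim f x :=
  if 0 <= x then \int[mu]_(t in `[0, x]) f t else - \int[mu]_(t in `[x, 0]) f t.

(** A difference of values of one primitive: Chasles' relation and the sign change under exchange of
    endpoints hold for every [f] and every order of the endpoints. *)
Definition itg f a b := prim f b - prim f a.

Lemma Rintegral_split f a b c : locint f -> a <= b -> b <= c ->
  \int[mu]_(t in `[a, c]) f t =
  \int[mu]_(t in `[a, b]) f t + \int[mu]_(t in `[b, c]) f t.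
Proof.
move=> lf ab bc; rewrite -(@Rintegral_itv_obnd_cbnd _ b); last first.
  by apply: integrableS (lf b c) => //; apply: subset_itvr; rewrite bnd_simp.
rewrite -(@Rintegral_itvB _ _ (BLeft a) (BRight c) b) ?bnd_simp//.
by rewrite addrC subrK.
Qed.

Lemma itgE f a b : locint f -> a <= b -> itg f a b = \int[mu]_(t in `[a, b]) f t.
Proof.
move=> lf ab; rewrite /itg /prim; case: (leP 0 a) => a0; case: (leP 0 b) => b0.
- by rewrite (Rintegral_split lf a0 ab) addrAC subrr add0r.
- by have := lt_le_trans b0 (le_trans a0 ab); rewrite ltxx.
- by rewrite (Rintegral_split lf (ltW a0) b0) opprK addrC.
- by rewrite (Rintegral_split lf ab (ltW b0)) opprK addrC addrK.
Qed.

Lemma itg_chasles f a b c : itg f a b + itg f b c = itg f a c.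
Proof. by rewrite /itg addrC addrA subrK. Qed.

Lemma itgN f a b : itg f a b = - itg f b a.
Proof. by rewrite /itg opprB. Qed.

Lemma itgxx f a : itg f a a = 0.
Proof. by rewrite /itg subrr. Qed.

Lemma itg_sub0 f a b : itg f a b = itg f 0 b - itg f 0 a.
Proof. by rewrite /itg; ring. Qed.

Lemma locintD f g : locint f -> locint g -> locint (fun x => f x + g x).
Proof. by move=> lf lg a b; apply: integrableD (lf a b) (lg a b). Qed.

Lemma locintZ k f : locint f -> locint (fun x => k * f x).
Proof.
move=> lf a b; have := @integrableZl _ _ _ mu _ (measurable_itv `[a, b]) k _ (lf a b).
by apply: eq_integrable => // x _.
Qed.

Lemma locintN f : locint f -> locint (fun x => - f x).
Proof.
by move=> /(locintZ (-1)) lf a b; apply: eq_integrable (lf a b) => // x _ /=; rewrite mulN1r.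
Qed.

Lemma locintB f g : locint f -> locint g -> locint (fun x => f x - g x).
Proof. by move=> lf /locintN; exact: locintD. Qed.

Lemma locint_norm f : locint f -> locint (fun x => `|f x|).
Proof. by move=> lf a b; have := integrable_norm (lf a b). Qed.

Lemma locint_meas f a b : locint f -> measurable_fun `[a, b] f.
Proof. by move=> lf; apply/measurable_EFinP; case/integrableP: (lf a b). Qed.

Lemma locint_measT f : locint f -> measurable_fun setT f.
Proof.
move=> lf; rewrite (_ : setT = \bigcup_n `[- n%:R, n%:R : R]%classic); last first.
  apply/esym; rewrite -subTset => x _.
  have [n xn] : exists n : nat, `|x| <= n%:R.
    by exists (Num.bound `|x|); rewrite ltW//; apply: archi_boundP.
  by exists n => //=; rewrite in_itv/=; move: xn; rewrite ler_norml.
by apply/measurable_fun_bigcup => // n; exact: locint_meas.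
Qed.

Lemma continuous_locint f : continuous f -> locint f.
Proof.
move=> cf a b; apply: continuous_compact_integrable; first exact: segment_compact.
exact: continuous_subspaceT.
Qed.

Lemma locint_cst k : locint (fun=> k).
Proof. by apply: continuous_locint => x; exact: cvg_cst. Qed.

Lemma continuous_itv_bounded f a b : continuous f ->
  exists2 M : R, 0 <= M & forall x, a <= x <= b -> `|f x| <= M.
Proof.
move=> cf; case: (leP a b) => ab; last first.
  by exists 0 => // x /andP[/le_trans h /h]; rewrite leNgt ab.
have cn : {within `[a, b], continuous (fun x => `|f x|)}.
  apply: continuous_subspaceT => x.
  by apply: continuous_comp; [exact: cf|exact: norm_continuous].
by have [c _ hc] := EVT_max ab cn; exists `|f c|.
Qed.

Lemma locintM f g : locint f -> continuous g -> locint (fun x => f x * g x).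
Proof.
move=> lf cg a b.
have [M M0 hM] := @continuous_itv_bounded g a b cg.
have lM := locint_norm (locintZ M lf).
apply: (le_integrable _ _ _ (lM a b)) => //.
  apply/measurable_EFinP; apply: measurable_funM; first exact: locint_meas.
  by apply: measurable_funTS; exact: continuous_measurable_fun.
move=> x; rewrite /= in_itv/= => axb; rewrite lee_fin.
rewrite [leRHS]ger0_norm// [leLHS]normrM [leRHS]normrM mulrC ler_wpM2r//.
by rewrite (ger0_norm M0) hM.
Qed.

Lemma itgD f g a b : locint f -> locint g ->
  itg (fun x => f x + g x) a b = itg f a b + itg g a b.
Proof.
wlog ab : a b / a <= b => [wl lf lg|lf lg].
  have [ab|/ltW ab] := leP a b; first exact: wl.
  by rewrite (itgN _ a) wl// (itgN f a) (itgN g a) opprD.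
rewrite !itgE//; last exact: locintD.
by rewrite RintegralD.
Qed.

Lemma itgZ k f a b : locint f -> itg (fun x => k * f x) a b = k * itg f a b.
Proof.
wlog ab : a b / a <= b => [wl lf|lf].
  have [ab|/ltW ab] := leP a b; first exact: wl.
  by rewrite (itgN _ a) wl// (itgN f a) mulrN.
rewrite !itgE//; last exact: locintZ.
by rewrite RintegralZl.
Qed.

Lemma eq_itg_on f g a b : a <= b -> locint f -> locint g ->
  (forall x, a <= x <= b -> f x = g x) -> itg f a b = itg g a b.
Proof.
move=> ab lf lg fg; rewrite !itgE//; apply: eq_Rintegral => x.
by rewrite inE/= in_itv/=; exact: fg.
Qed.

Lemma eq_itg f g a b : f =1 g -> itg f a b = itg g a b.
Proof. by move=> /funext ->. Qed.

Lemma itgNf f a b : locint f -> itg (fun x => - f x) a b = - itg f a b.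
Proof.
move=> lf; rewrite -mulN1r -itgZ//; apply: eq_itg => x; by rewrite mulN1r.
Qed.

Lemma itgB f g a b : locint f -> locint g ->
  itg (fun x => f x - g x) a b = itg f a b - itg g a b.
Proof. by move=> lf lg; rewrite itgD//; [rewrite itgNf|exact: locintN]. Qed.

Lemma le_itg f g a b : a <= b -> locint f -> locint g ->
  (forall x, a <= x <= b -> f x <= g x) -> itg f a b <= itg g a b.
Proof.
move=> ab lf lg fg; rewrite !itgE//; exact: le_Rintegral.
Qed.

Lemma itg_ge0 f a b : a <= b -> locint f ->
  (forall x, a <= x <= b -> 0 <= f x) -> 0 <= itg f a b.
Proof.
move=> ab lf f0; rewrite itgE//; apply: Rintegral_ge0 => x.
by rewrite /= in_itv/=; exact: f0.
Qed.

Lemma itg_cst k a b : itg (fun=> k) a b = k * (b - a).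
Proof.
wlog ab : a b / a <= b => [wl|].
  have [ab|/ltW ab] := leP a b; first exact: wl.
  by rewrite itgN wl// -mulrN opprB.
rewrite itgE//; last exact: locint_cst.
rewrite Rintegral_cst//= lebesgue_measure_itv/= lte_fin.
by move: ab; rewrite le_eqVlt => /predU1P[->|->]//; rewrite ltxx/= subrr.
Qed.

Lemma ler_norm_itg f a b : a <= b -> locint f ->
  `|itg f a b| <= itg (fun x => `|f x|) a b.
Proof.
move=> ab lf; rewrite !itgE//; last exact: locint_norm.
exact: le_normr_Rintegral.
Qed.

Lemma itg_norm_le f g a b : a <= b -> locint f -> locint g ->
  (forall x, a <= x <= b -> `|f x| <= g x) -> `|itg f a b| <= itg g a b.
Proof.
move=> ab lf lg fg; rewrite (le_trans (ler_norm_itg ab lf))// le_itg//.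
exact: locint_norm.
Qed.

Lemma itg_sub_le f a b c d : a <= c -> c <= d -> d <= b -> locint f ->
  (forall x, a <= x <= b -> 0 <= f x) -> itg f c d <= itg f a b.
Proof.
move=> ac cd db lf f0.
rewrite -(itg_chasles f a c b) -(itg_chasles f c d b).
have h1 : 0 <= itg f a c.
  by apply: itg_ge0 => // x /andP[ax xc]; rewrite f0// ax (le_trans xc)// (le_trans cd).
have h2 : 0 <= itg f d b.
  by apply: itg_ge0 => // x /andP[ax xc]; rewrite f0// xc andbT (le_trans _ ax)// (le_trans ac).
lra.
Qed.

(** Re-basing at [x - 1] makes [x] interior to an interval on which [itg] is an ordinary integral;
    the two base points differ by a constant. *)
Lemma prim_continuous f a : locint f -> continuous (itg f a).
Proof.
move=> lf x.
have h : {within `[x - 1, x + 1], continuous (fun y => \int[mu]_(t in `[x - 1, y]) f t)}.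
  by apply: parameterized_integral_continuous; [lra|exact: lf].
have x1 : x - 1 < x + 1 by lra.
have /continuous_within_itvP -/(_ x1) [h1 _ _] := h.
have xin : x \in `]x - 1, x + 1[ by rewrite in_itv/=; apply/andP; split; lra.
have h2 : {for x, continuous (fun y => \int[mu]_(t in `[x - 1, y]) f t)} by exact: h1.
rewrite (_ : itg f a = fun y => itg f a (x - 1) + itg f (x - 1) y); last first.
  by apply/funext => y; rewrite itg_chasles.
apply: cvgD; first exact: cvg_cst.
have e : \forall y \near x, itg f (x - 1) y = \int[mu]_(t in `[x - 1, y]) f t.
  near=> y; rewrite itgE//.
  near: y; apply: lt_le_nbhsr; lra.
rewrite itgE//; last lra.
apply: cvg_trans h2; apply: near_eq_cvg; near=> y; apply/esym; near: y; exact: e.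
Unshelve. all: by end_near. Qed.

Lemma itg_derive f a x : continuous f -> is_derive x (1 : R) (itg f a) (f x).
Proof.
move=> cf; have lf := continuous_locint cf.
have xx : x < x + 1 by lra.
have [] := @continuous_FTC1_closed R f (x - 1) x (x + 1) xx (lf _ _) _ (cf x).
  lra.
set F := (fun y => _) => dF FE.
have iF : is_derive x (1 : R) F (f x).
  by have := derivableP dF; rewrite -derive1E FE.
have e : {near x, (fun y => itg f a (x - 1) + F y) =1 itg f a}.
  near=> y; rewrite -(itg_chasles f a (x - 1) y); congr (_ + _); rewrite itgE//.
  near: y; apply: lt_le_nbhsr; lra.
apply: (near_eq_is_derive e).
have h := is_deriveD (is_derive_cst (itg f a (x - 1)) x (1 : R)) iF.
by rewrite add0r in h.
Unshelve. all: by end_near. Qed.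

Lemma is_derive_cont (f f1 : R -> R) :
  (forall x, is_derive x (1 : R) f (f1 x)) -> continuous f.
Proof.
move=> df x; apply: differentiable_continuous.
by apply/derivable1_diffP; case: (df x).
Qed.

Lemma itg_FTC (f f1 : R -> R) a b : (forall x, is_derive x (1 : R) f (f1 x)) ->
  continuous f1 -> itg f1 a b = f b - f a.
Proof.
move=> df cf1.
have cf := is_derive_cont df.
wlog ab : a b / a < b => [wl|].
  have [ab|ba|->] := ltgtP a b; [exact: wl| |by rewrite itgxx subrr].
  by rewrite itgN wl// opprB.
rewrite itgE ?(ltW ab)//; last exact: continuous_locint.
have -> // : \int[mu]_(t in `[a, b]) f1 t = fine ((f b)%:E - (f a)%:E)%E.
rewrite /Rintegral (@continuous_FTC2 _ _ f)//.
- exact: continuous_subspaceT.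
- split.
  + by move=> x _; case: (df x).
  + by apply: cvg_at_right_filter; exact: cf.
  + by apply: cvg_at_left_filter; exact: cf.
- by move=> x _; rewrite derive1E; case: (df x).
Qed.

End OrientedIntegral.

(** * Derivatives and continuity of pointwise expressions *)

Section Derivation.
Context {R : realType}.
Implicit Types (f g : R -> R) (x k : R).

Lemma der_cst k x : is_derive x (1 : R) (fun=> k) 0.
Proof. exact: is_derive_cst. Qed.

Lemma der_id x : is_derive x (1 : R) (fun y : R => y) 1.
Proof. exact: is_derive_id. Qed.

Lemma derD f g x df dg : is_derive x (1 : R) f df -> is_derive x (1 : R) g dg ->
  is_derive x (1 : R) (fun y => f y + g y) (df + dg).
Proof. by move=> hf hg; exact: is_deriveD. Qed.

Lemma derN f x df : is_derive x (1 : R) f df ->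
  is_derive x (1 : R) (fun y => - f y) (- df).
Proof. by move=> hf; exact: is_deriveN. Qed.

Lemma derB f g x df dg : is_derive x (1 : R) f df -> is_derive x (1 : R) g dg ->
  is_derive x (1 : R) (fun y => f y - g y) (df - dg).
Proof. by move=> hf hg; exact: is_deriveB. Qed.

Lemma derZ k f x df : is_derive x (1 : R) f df ->
  is_derive x (1 : R) (fun y => k * f y) (k * df).
Proof. by move=> hf; exact: is_deriveZ. Qed.

Lemma derM f g x df dg : is_derive x (1 : R) f df -> is_derive x (1 : R) g dg ->
  is_derive x (1 : R) (fun y => f y * g y) (f x * dg + g x * df).
Proof. by move=> hf hg; exact: is_deriveM. Qed.

Lemma der_eq f x df dg : is_derive x (1 : R) f df -> df = dg ->
  is_derive x (1 : R) f dg.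
Proof. by move=> + <-. Qed.

Lemma der_affine f df k c x : is_derive (k * x + c) (1 : R) f df ->
  is_derive x (1 : R) (fun y => f (k * y + c)) (k * df).
Proof.
move=> hf; have hg : is_derive x (1 : R) (fun y => k * y + c) k.
  apply: der_eq (derD (derZ k (der_id x)) (der_cst c x)) _.
  by rewrite mulr1 addr0.
exact: der_eq (@is_derive1_comp _ f (fun y => k * y + c) x df k hf hg) (mulrC _ _).
Qed.

Lemma der_shift f df c x : is_derive (x + c) (1 : R) f df ->
  is_derive x (1 : R) (fun y => f (y + c)) df.
Proof.
move=> hf; rewrite (_ : (fun y => f (y + c)) = (fun y => f (1 * y + c))).
  by apply: der_eq (@der_affine f df 1 c x _) (mul1r _); rewrite mul1r.
by apply/funext => y; rewrite mul1r.
Qed.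

Lemma der_uniq f x a b : is_derive x (1 : R) f a -> is_derive x (1 : R) f b -> a = b.
Proof. by case=> _ <- [_ <-]. Qed.

Lemma continuousZf k f : continuous f -> continuous (fun y => k * f y).
Proof. by move=> cf x; apply: cvgM; [exact: cvg_cst|exact: cf]. Qed.

Lemma continuousMf f g : continuous f -> continuous g -> continuous (fun y => f y * g y).
Proof. by move=> cf cg x; apply: cvgM; [exact: cf|exact: cg]. Qed.

Lemma continuousDf f g : continuous f -> continuous g -> continuous (fun y => f y + g y).
Proof. by move=> cf cg x; apply: cvgD; [exact: cf|exact: cg]. Qed.

Lemma continuousBf f g : continuous f -> continuous g -> continuous (fun y => f y - g y).
Proof. by move=> cf cg x; apply: cvgB; [exact: cf|exact: cg]. Qed.

Lemma continuousNf f : continuous f -> continuous (fun y => - f y).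
Proof. by move=> cf x; apply: cvgN; exact: cf. Qed.

Lemma continuous_cst k : continuous (fun _ : R => k : R).
Proof. by move=> x; exact: cvg_cst. Qed.

Lemma continuous_idf : continuous (fun y : R => y).
Proof. by move=> x. Qed.

Lemma continuous_normf f : continuous f -> continuous (fun y => `|f y|).
Proof.
by move=> cf x; apply: (@continuous_comp _ _ _ f (fun y : R => `|y|)) => //; [exact: cf|exact: norm_continuous].
Qed.

Lemma continuous_compf f g : continuous f -> continuous g -> continuous (fun y => f (g y)).
Proof. by move=> cf cg x; apply: (@continuous_comp _ _ _ g f) => //; [exact: cg|exact: cf]. Qed.

End Derivation.

(** * Translation invariance and integrals over a period *)

Section Shift.
Context {R : realType}.
Notation mu := (@lebesgue_measure R).
Implicit Types (f g : R -> R) (a b c x : R).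

Lemma measurable_shift c : measurable_fun setT (fun x : measurableTypeR R => x + c : measurableTypeR R).
Proof. by apply: measurable_funD => //; exact: measurable_cst. Qed.

(** Both measures give each interval its length, and this determines Lebesgue measure. *)
Lemma lebesgue_measure_shift c (A : set R) : measurable A ->
  pushforward mu (fun x : measurableTypeR R => x + c : measurableTypeR R) A = mu A.
Proof.
move=> mA.
pose h : {mfun _ >-> _} := HB.pack (fun x : measurableTypeR R => x + c : measurableTypeR R)
  (isMeasurableFun.Build _ _ _ _ _ (measurable_shift c)).
apply/esym.
apply: (@lebesgue_measure_unique _ (pushforward mu h)) => //.
move=> X [[a b] _ <-] /=.
rewrite /pushforward.
rewrite (_ : _ @^-1` _ = `]a - c, b - c]%classic); last first.
  apply/seteqP; split=> y /=; rewrite !in_itv/= => /andP[h1 h2]; apply/andP; split; lra.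
rewrite !lebesgue_measure_itv/= !lte_fin ltrD2r.
by case: ifP => // _; congr (_%:E); ring.
Qed.

Lemma integrable_shift f c a b : locint f ->
  mu.-integrable `[a, b] (EFin \o (fun x => f (x + c))).
Proof.
move=> lf.
have mf := locint_measT lf.
have E : `[a, b]%classic = (fun x : measurableTypeR R => x + c : measurableTypeR R) @^-1` `[a + c, b + c].
  by apply/seteqP; split=> y /=; rewrite !in_itv/= => /andP[h1 h2]; apply/andP; split; lra.
apply/integrableP; split.
  apply/measurable_EFinP; apply: measurable_funTS.
  by apply: (measurableT_comp mf); exact: measurable_shift.
have := (integrableP _ _ _ (lf (a + c) (b + c))).2.
rewrite E -(@ge0_integral_pushforward _ _ _ _ _ _ (measurable_shift c) mu _ (fun y => `|(f y)%:E|%E)) => //.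
  move=> h; rewrite (le_lt_trans _ h)// le_eqVlt; apply/orP; left; apply/eqP.
  apply: eq_measure_integral => [|? A mA _]; first exact: measurable_shift.
  exact: lebesgue_measure_shift.
by do 2 apply: measurableT_comp => //; exact: measurable_funTS.
Qed.

Lemma locint_shift f c : locint f -> locint (fun x => f (x + c)).
Proof. by move=> lf a b; exact: integrable_shift. Qed.

Lemma itg_shift f c a b : locint f ->
  itg (fun x => f (x + c)) a b = itg f (a + c) (b + c).
Proof.
move=> lf; wlog ab : a b / a <= b => [wl|].
  have [ab|/ltW ab] := leP a b; first exact: wl.
  by rewrite itgN wl// -itgN.
rewrite !itgE//; [|lra|exact: locint_shift].
have mf := locint_measT lf.
have E : `[a, b]%classic = (fun x : measurableTypeR R => x + c : measurableTypeR R) @^-1` `[a + c, b + c].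
  by apply/seteqP; split=> y /=; rewrite !in_itv/= => /andP[h1 h2]; apply/andP; split; lra.
rewrite /Rintegral; congr fine; rewrite E.
have := (@integral_pushforward _ _ _ _ _ _ (measurable_shift c) mu `[a + c, b + c] (EFin \o f)).
move=> <- //.
- apply: eq_measure_integral => [|? A mA _]; first exact: measurable_shift.
  exact: lebesgue_measure_shift.
- exact/measurable_EFinP.
- by rewrite -E; exact: integrable_shift.
Qed.

Lemma itg_period f T x : locint f -> (forall y, f (y + T) = f y) ->
  itg f x (x + T) = itg f 0 T.
Proof.
move=> lf fT.
have := itg_shift T 0 x lf; rewrite (eq_itg _ _ fT) add0r => h.
by rewrite (itg_sub0 f x) -(itg_chasles f 0 T (x + T)) -h addrK.
Qed.

End Shift.

(** * Integration by parts and weak second derivatives *)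

Section Parts.
Context {R : realType}.
Notation mu := (@lebesgue_measure R).
Implicit Types (f g v w p : R -> R) (a b c x F : R).

Lemma itg_approx v a b (e : R) : a <= b -> locint v -> 0 < e -> exists2 g : R -> R,
  continuous g & itg (fun x => `|v x - g x|) a b < e.
Proof.
move=> ab lv e0.
have fin : (mu `[a, b]%classic < +oo)%E.
  by rewrite lebesgue_measure_itv/=; case: ifP => // _; rewrite -EFinB ltry.
have [g_ [cg ig gl]] := approximation_continuous_integrable (measurable_itv `[a, b]) fin (lv a b).
have lvg n : locint (fun x => `|v x - g_ n x|).
  by apply: locint_norm; apply: locintB => //; exact: continuous_locint.
move/fine_cvgP: gl => [_ /cvgrPdist_lt /(_ e e0) [n _ /(_ n (leqnn n))]] /=.
rewrite sub0r normrN => h; exists (g_ n) => //.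
rewrite itgE//; apply: le_lt_trans h.
by rewrite /Rintegral; apply: le_trans (ler_norm _) _.
Qed.

Lemma itg_parts_cont v p p1 F0 a b : continuous v ->
  (forall x, is_derive x (1 : R) p (p1 x)) -> continuous p1 ->
  itg (fun x => v x * p x) a b =
  (F0 + itg v 0 b) * p b - (F0 + itg v 0 a) * p a - itg (fun x => (F0 + itg v 0 x) * p1 x) a b.
Proof.
move=> cv dp cp1; have cp := is_derive_cont dp.
have dF x : is_derive x (1 : R) (fun y => F0 + itg v 0 y) (v x).
  by apply: der_eq (derD (der_cst F0 x) (itg_derive 0 x cv)) (add0r _).
have cF := is_derive_cont dF.
have := @itg_FTC _ (fun y => (F0 + itg v 0 y) * p y)
   (fun y => (F0 + itg v 0 y) * p1 y + p y * v y) a b (fun x => derM (dF x) (dp x)).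
rewrite itgD; first last.
- by apply: continuous_locint; exact: continuousMf.
- by apply: continuous_locint; exact: continuousMf.
move=> <-; last by apply: continuousDf; exact: continuousMf.
rewrite (addrC (itg _ a b)) addrK; apply: eq_itg => x; exact: mulrC.
Qed.

(* Continuous functions are dense in L^1 and both sides are L^1-continuous in [v]. *)
Lemma itg_parts v p p1 F0 a b : locint v ->
  (forall x, is_derive x (1 : R) p (p1 x)) -> continuous p1 ->
  itg (fun x => v x * p x) a b =
  (F0 + itg v 0 b) * p b - (F0 + itg v 0 a) * p a - itg (fun x => (F0 + itg v 0 x) * p1 x) a b.
Proof.
move=> lv dp cp1; have cp := is_derive_cont dp.
wlog ab : a b / a <= b => [wl|].
  have [ab|/ltW ab] := leP a b; first exact: wl.
  by rewrite itgN wl// (itgN (fun x => (F0 + itg v 0 x) * p1 x) b a); ring.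
(* The identity involves primitives from 0 at points of [[a, b]], so [v] is approximated in L^1 on
   an interval that contains [a], [b] and 0. *)
pose m := Num.min a 0; pose M := Num.max b 0.
have ma : m <= a by rewrite ge_min lexx.
have m0 : m <= 0 by rewrite ge_min lexx orbT.
have bM : b <= M by rewrite le_max lexx.
have M0 : 0 <= M by rewrite le_max lexx orbT.
have mM : m <= M by exact: le_trans M0.
have [P P0 hP] := continuous_itv_bounded m M cp.
have [P1 P10 hP1] := continuous_itv_bounded m M cp1.
(* The error has three terms of size at most [P * d] and one of size at most [P1 * (b - a) * d],
   with [d] the L^1 distance; the final 1 makes [K] positive. *)
pose K := 3 * P + P1 * (b - a) + 1.
have K0 : 0 < K by rewrite /K; have := mulr_ge0 P10 (_ : 0 <= b - a); rewrite subr_ge0 => /(_ ab); lra.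
pose L := fun w => itg (fun x => w x * p x) a b -
  ((F0 + itg w 0 b) * p b - (F0 + itg w 0 a) * p a - itg (fun x => (F0 + itg w 0 x) * p1 x) a b).
suff : L v = 0 by move/eqP; rewrite subr_eq0 => /eqP.
apply/eqP; rewrite -normr_le0; apply/ler_addgt0Pr => e e0; rewrite add0r.
have [g cg hg] := itg_approx mM lv (divr_gt0 e0 K0).
have lg := continuous_locint cg.
set d := itg _ _ _ in hg.
have lvg : locint (fun x => v x - g x) by exact: locintB.
have lvgn : locint (fun x => `|v x - g x|) by exact: locint_norm.
have bd x : m <= x <= M -> `|itg (fun x => v x - g x) 0 x| <= d.
  move=> /andP[mx xM]; have [x0|/ltW x0] := leP 0 x.
    by rewrite (le_trans (ler_norm_itg _ _))//; apply: itg_sub_le => //.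
  by rewrite itgN normrN (le_trans (ler_norm_itg _ _))//; apply: itg_sub_le => //.
have Lg : L g = 0 by rewrite /L (itg_parts_cont F0 a b cg dp cp1) subrr.
have -> : L v = L v - L g by rewrite Lg subr0.
have cI w : locint w -> continuous (fun x => F0 + itg w 0 x).
  by move=> lw; apply: continuousDf; [exact: continuous_cst|exact: prim_continuous].
have -> : L v - L g = itg (fun x => (v x - g x) * p x) a b
   - itg (fun x => v x - g x) 0 b * p b + itg (fun x => v x - g x) 0 a * p a
   + itg (fun x => itg (fun x => v x - g x) 0 x * p1 x) a b.
  rewrite (@eq_itg _ (fun x => (v x - g x) * p x) (fun x => v x * p x - g x * p x)); last by move=> x; ring.
  rewrite (@eq_itg _ (fun x => itg (fun x => v x - g x) 0 x * p1 x)
    (fun x => (F0 + itg v 0 x) * p1 x - (F0 + itg g 0 x) * p1 x)); last first.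
    by move=> x; rewrite itgB//; ring.
  rewrite (@itgB _ (fun x => v x * p x) (fun x => g x * p x)); [|exact: locintM|exact: locintM].
  rewrite (@itgB _ (fun x => (F0 + itg v 0 x) * p1 x) (fun x => (F0 + itg g 0 x) * p1 x)).
  - rewrite (itgB 0 b lv lg) (itgB 0 a lv lg) /L.
    move: (itg (fun x => v x * p x) a b) (itg (fun x => g x * p x) a b)
      (itg v 0 b) (itg v 0 a) (itg g 0 b) (itg g 0 a)
      (itg (fun x => (F0 + itg v 0 x) * p1 x) a b)
      (itg (fun x => (F0 + itg g 0 x) * p1 x) a b) (p a) (p b).
    by move=> *; ring.
  - by apply: continuous_locint; apply: continuousMf => //; exact: cI.
  - by apply: continuous_locint; apply: continuousMf => //; exact: cI.
have h1 : `|itg (fun x => (v x - g x) * p x) a b| <= P * d.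
  apply: (@le_trans _ _ (itg (fun x => P * `|v x - g x|) a b)).
    apply: itg_norm_le => //; [exact: locintM|exact: locintZ|].
    move=> x /andP[ax xb]; rewrite normrM mulrC ler_wpM2r// hP//.
    by rewrite (le_trans ma)//= (le_trans xb).
  rewrite itgZ// ler_wpM2l//; apply: itg_sub_le => //.
have h2 : `|itg (fun x => v x - g x) 0 b * p b| <= P * d.
  rewrite normrM mulrC ler_pM// ?hP ?bd// ?bM ?(le_trans ma)//.
have h3 : `|itg (fun x => v x - g x) 0 a * p a| <= P * d.
  rewrite normrM mulrC ler_pM// ?hP ?bd// ?ma ?(le_trans ab)//.
have h4 : `|itg (fun x => itg (fun x => v x - g x) 0 x * p1 x) a b| <= (b - a) * (P1 * d).
  apply: (@le_trans _ _ (itg (fun=> P1 * d) a b)); last by rewrite itg_cst mulrC.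
  apply: itg_norm_le => //; [|exact: locint_cst|].
    by apply: continuous_locint; apply: continuousMf => //; exact: prim_continuous.
  move=> x /andP[ax xb]; have xm : m <= x <= M by rewrite (le_trans ma)//= (le_trans xb).
  by rewrite normrM mulrC ler_pM// ?hP1 ?bd.
have d0 : 0 <= d by apply: itg_ge0.
have : d * K < e by rewrite -ltr_pdivlMr.
rewrite /K; set A := itg _ a b in h1 *; set B := (_ * p b) in h2 *.
set C := (_ * p a) in h3 *; set D := itg _ a b in h4 *.
have t1 := ler_normD (A - B + C) D; have t2 := ler_normD (A - B) C; have t3 := ler_normB A B.
by move=> hh; nra.
Qed.

(** The weak form of [f'' = v]: [f] is C^1 with derivative [f1], and [f1] is an indefinite integral
    of [v], which is merely locally integrable, like the potential. *)
Definition D2 f f1 v := (forall x, is_derive x (1 : R) f (f1 x)) /\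
  locint v /\ (forall a b, f1 b - f1 a = itg v a b).

Lemma D2_locint f f1 v : D2 f f1 v -> locint v.
Proof. by case=> _ []. Qed.

Lemma D2_cont f f1 v : D2 f f1 v -> continuous f.
Proof. by case=> /is_derive_cont. Qed.

Lemma D2_cont1 f f1 v : D2 f f1 v -> continuous f1.
Proof.
case=> _ [lv h]; rewrite (_ : f1 = fun x => f1 0 + itg v 0 x); last first.
  by apply/funext => x; rewrite -h addrC subrK.
by apply: continuousDf; [exact: continuous_cst|exact: prim_continuous].
Qed.

Lemma D2_smooth f f1 f2 : (forall x, is_derive x (1 : R) f (f1 x)) ->
  (forall x, is_derive x (1 : R) f1 (f2 x)) -> continuous f2 -> D2 f f1 f2.
Proof.
move=> h1 h2 c2; split=> //; split; first exact: continuous_locint.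
by move=> a b; rewrite (itg_FTC _ _ h2).
Qed.

Lemma D2D f f1 v g g1 w : D2 f f1 v -> D2 g g1 w ->
  D2 (fun x => f x + g x) (fun x => f1 x + g1 x) (fun x => v x + w x).
Proof.
move=> [h1 [l1 i1]] [h2 [l2 i2]]; split; first by move=> x; exact: derD.
split; first exact: locintD.
by move=> a b; rewrite itgD// -i1 -i2; ring.
Qed.

Lemma D2Z k f f1 v : D2 f f1 v ->
  D2 (fun x => k * f x) (fun x => k * f1 x) (fun x => k * v x).
Proof.
move=> [h1 [l1 i1]]; split; first by move=> x; exact: derZ.
split; first exact: locintZ.
by move=> a b; rewrite itgZ// -i1; ring.
Qed.

Lemma D2_ext f f1 v f' f1' v' : f =1 f' -> f1 =1 f1' -> v =1 v' ->
  D2 f f1 v -> D2 f' f1' v'.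
Proof. by move=> /funext -> /funext -> /funext ->. Qed.

Lemma D2B f f1 v g g1 w : D2 f f1 v -> D2 g g1 w ->
  D2 (fun x => f x - g x) (fun x => f1 x - g1 x) (fun x => v x - w x).
Proof.
move=> h1 /(D2Z (-1)) h2; apply: D2_ext (D2D h1 h2) => x /=; by rewrite mulN1r.
Qed.

Lemma D2_shift f f1 v c : D2 f f1 v ->
  D2 (fun x => f (x + c)) (fun x => f1 (x + c)) (fun x => v (x + c)).
Proof.
move=> [h1 [l1 i1]]; split; first by move=> x; exact: der_shift.
split; first exact: locint_shift.
by move=> a b; rewrite itg_shift// -i1.
Qed.

Lemma D2_parts f f1 v p p1 a b : D2 f f1 v ->
  (forall x, is_derive x (1 : R) p (p1 x)) -> continuous p1 ->
  itg (fun x => v x * p x) a b = f1 b * p b - f1 a * p a - itg (fun x => f1 x * p1 x) a b.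
Proof.
move=> [h1 [l1 i1]] dp cp.
have E x : f1 x = f1 0 + itg v 0 x by rewrite -i1 addrC subrK.
rewrite (itg_parts (f1 0) a b l1 dp cp) -!E; congr (_ - _).
by apply: eq_itg => x; rewrite -E.
Qed.

(** Each product is integrated by parts and the terms in [f1 * g1] cancel. The localisation of
    eigenvalues, the symmetry of the reduced matrix and the isolation of double eigenvalues all come
    from this identity with suitable test functions. *)
Lemma green f f1 v g g1 w a b : D2 f f1 v -> D2 g g1 w ->
  itg (fun x => v x * g x - f x * w x) a b =
  (f1 b * g b - f b * g1 b) - (f1 a * g a - f a * g1 a).
Proof.
move=> Df Dg.
rewrite itgB; last first.
- rewrite (_ : (fun x => _) = (fun x => w x * f x)); last by apply/funext => x; rewrite mulrC.
  by apply: locintM; [exact: D2_locint Dg|exact: D2_cont Df].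
- by apply: locintM; [exact: D2_locint Df|exact: D2_cont Dg].
rewrite (D2_parts a b Df (proj1 Dg) (D2_cont1 Dg)).
rewrite (@eq_itg _ (fun x => f x * w x) (fun x => w x * f x)); last by move=> x; exact: mulrC.
rewrite (D2_parts a b Dg (proj1 Df) (D2_cont1 Df)).
rewrite (@eq_itg _ (fun x => g1 x * f1 x) (fun x => f1 x * g1 x)); last by move=> x; exact: mulrC.
ring.
Qed.

End Parts.

(** * A fixed-point theorem in a weighted sup norm *)

Section Contraction.
Context {R : realType}.
Implicit Types (f g u : R -> R) (x e M : R).

Lemma exists_half (A e : R) : 0 <= A -> 0 < e -> exists n : nat, A / 2 ^+ n < e.
Proof.
move=> A0 e0; exists (Num.bound (A / e)).
set n := Num.bound _.
have h1 : A / e < n%:R by apply: archi_boundP; rewrite divr_ge0// ltW.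
have h2 : (n%:R : R) < 2 ^+ n by rewrite -natrX ltr_nat ltn_expl.
have h3 := lt_trans h1 h2.
by rewrite ltr_pdivrMr ?exprn_gt0// mulrC -ltr_pdivrMr.
Qed.

(** The intervals of radius [A / 2 ^+ n] around [F n] are nested; the supremum of their left ends
    lies in all of them. *)
Lemma geometric_limit (F : nat -> R) (A : R) : 0 <= A ->
  (forall n, `|F n.+1 - F n| <= A / 2 ^+ n.+1) ->
  exists l, forall n, `|l - F n| <= A / 2 ^+ n.
Proof.
move=> A0 hF.
have p n : A / 2 ^+ n = A / 2 ^+ n.+1 + A / 2 ^+ n.+1 :> R.
  by rewrite exprS; field; rewrite expf_neq0.
have up n k : F (n + k)%N - A / 2 ^+ (n + k) >= F n - A / 2 ^+ n.
  elim: k => [|k IH]; first by rewrite addn0.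
  rewrite addnS; apply: le_trans IH _.
  by have := p (n + k)%N; have := hF (n + k)%N; rewrite ler_norml => /andP[]; lra.
have dn n k : F (n + k)%N + A / 2 ^+ (n + k) <= F n + A / 2 ^+ n.
  elim: k => [|k IH]; first by rewrite addn0.
  rewrite addnS; apply: le_trans _ IH.
  by have := p (n + k)%N; have := hF (n + k)%N; rewrite ler_norml => /andP[]; lra.
have An n : 0 <= A / 2 ^+ n by rewrite divr_ge0// exprn_ge0.
have cr m n : F m - A / 2 ^+ m <= F n + A / 2 ^+ n.
  have := up m n; have := dn n m; rewrite (addnC m n); have := An (n + m)%N.
  by rewrite addnC => h1 h2 h3; lra.
pose E := [set F m - A / 2 ^+ m | m in setT].
have E0 : E !=set0 by exists (F 0%N - A / 2 ^+ 0); exists 0%N.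
have Eub n : ubound E (F n + A / 2 ^+ n) by move=> _ [m _ <-]; exact: cr.
exists (sup E) => n; rewrite ler_norml; apply/andP; split.
  have : F n - A / 2 ^+ n <= sup E.
    by apply: ub_le_sup; [exists (F 0%N + A / 2 ^+ 0); exact: Eub|exists n].
  by move=> ?; lra.
have : sup E <= F n + A / 2 ^+ n by exact: ge_sup.
by move=> ?; lra.
Qed.

Lemma le_eps_half (a A : R) : 0 <= A -> (forall n : nat, a <= A / 2 ^+ n) -> a <= 0.
Proof.
move=> A0 h; case: leP => // a0; have [n hn] := exists_half A0 a0.
by have := lt_le_trans hn (h n); rewrite ltxx.
Qed.

Variables (w : R -> R) (T : (R -> R) -> R -> R) (Q : (R -> R) -> Prop) (W : R).
Hypothesis w0 : forall x, 0 < w x.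
Hypothesis wW : forall x, w x <= W.
Let C f := continuous f /\ Q f.
Hypothesis QD : forall f g, Q f -> Q g -> Q (fun x => f x + g x).
Hypothesis QB : forall f g, Q f -> Q g -> Q (fun x => f x - g x).
Hypothesis Qlim : forall (F : nat -> R -> R) f, (forall n, Q (F n)) ->
  (forall x e, 0 < e -> exists n, forall m, (n <= m)%N -> `|f x - F m x| < e) -> Q f.
Hypothesis TC : forall f, C f -> C (T f).
Hypothesis TB : forall f g, C f -> C g -> forall x,
  T (fun y => f y - g y) x = T f x - T g x.
Hypothesis Tle : forall f M, C f -> 0 <= M -> (forall x, `|f x| <= M * w x) ->
  forall x, `|T f x| <= M / 2 * w x.

(** Each use of [f = u + T f] halves the a priori constant [M]: after [n] steps the bound is
    [2 * M0 + M / 2 ^+ n], and [M] disappears in the limit. *)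
Lemma contraction_le f u M M0 : C f -> 0 <= M -> 0 <= M0 ->
  (forall x, `|f x| <= M * w x) -> (forall x, `|u x| <= M0 * w x) ->
  (forall x, f x = u x + T f x) -> forall x, `|f x| <= 2 * M0 * w x.
Proof.
move=> Cf M_ge0 M00 fM uM fT x.
have h n : forall x, `|f x| <= (2 * M0 + M / 2 ^+ n) * w x.
  elim: n => [|n IH] y.
    apply: le_trans (fM y) _; rewrite (ler_wpM2r (ltW (w0 y)))//.
    by rewrite expr0 divr1; lra.
  have IHM : 0 <= 2 * M0 + M / 2 ^+ n by rewrite addr_ge0 ?mulr_ge0 ?divr_ge0 ?exprn_ge0.
  have := Tle Cf IHM IH y; have := uM y; rewrite (fT y).
  have := ler_normD (u y) (T f y).
  have -> : M / 2 ^+ n = 2 * (M / 2 ^+ n.+1) by rewrite exprS; field; rewrite expf_neq0.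
  move=> h1 h2 h3; apply: (le_trans h1); apply: le_trans (lerD h2 h3) _.
  by rewrite le_eqVlt; apply/orP; left; apply/eqP; field.
suff : `|f x| - 2 * M0 * w x <= 0 by rewrite subr_le0.
apply: (@le_eps_half _ (M * w x)); first by rewrite mulr_ge0// ltW.
by move=> n; have := h n x; rewrite mulrDl => ?; rewrite lerBlDl (mulrAC M).
Qed.

(** Picard iteration from [u]. The side condition [Q] survives pointwise limits: it is
    quasi-periodicity, with weight 1, in the Lyapunov-Schmidt reduction, and trivial, with an
    exponential weight, for the Volterra equation. *)
Lemma contraction_fixpoint u M0 : C u -> 0 <= M0 -> (forall x, `|u x| <= M0 * w x) ->
  exists f, [/\ C f, forall x, f x = u x + T f x & forall x, `|f x| <= 2 * M0 * w x].
Proof.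
move=> Cu M00 uM.
pose F := fix F n := if n is n'.+1 then (fun x => u x + T (F n') x) else u.
have CF n : C (F n).
  elim: n => [//|n IH] /=; have [c1 q1] := Cu; have [c2 q2] := TC IH.
  by split; [exact: continuousDf|exact: QD].
have FB n m : C (fun x => F n x - F m x).
  by have [c1 q1] := CF n; have [c2 q2] := CF m; split; [exact: continuousBf|exact: QB].
have dF n : forall x, `|F n.+1 x - F n x| <= M0 / 2 ^+ n.+1 * w x.
  elim: n => [|n IH] x.
    rewrite /= addrAC subrr add0r; have := @Tle u M0 Cu M00 uM x.
    by rewrite expr1.
  have -> : F n.+2 x - F n.+1 x = T (fun y => F n.+1 y - F n y) x.
    by rewrite (TB (CF n.+1) (CF n)) /=; ring.
  have h : 0 <= M0 / 2 ^+ n.+1 by rewrite divr_ge0// exprn_ge0.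
  have := Tle (FB n.+1 n) h IH x.
  by rewrite (exprS _ n.+1) (mulrC (2 : R)) invfM mulrA.
have lim x : exists l, forall n, `|l - F n x| <= M0 * w x / 2 ^+ n.
  apply: (@geometric_limit (F ^~ x)); first by rewrite mulr_ge0// ltW.
  by move=> n; rewrite mulrAC; exact: dF.
pose f x := sval (cid (lim x)).
have fF x n : `|f x - F n x| <= M0 * w x / 2 ^+ n by rewrite /f; case: cid.
have W0 : 0 < W by exact: lt_le_trans (w0 0) (wW 0).
(* As [w] is bounded by [W], the iterates converge uniformly, and a three-epsilon argument
   applies. *)
have cf : continuous f.
  move=> x; apply/cvgrPdist_lt => e e0.
  have e30 : 0 < e / 3 by rewrite divr_gt0.
  have [n hn] := @exists_half (M0 * W) (e / 3) (mulr_ge0 M00 (ltW W0)) e30.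
  have hu y : `|f y - F n y| < e / 3.
    apply: le_lt_trans (fF y n) (le_lt_trans _ hn).
    by rewrite ler_wpM2r ?invr_ge0 ?exprn_ge0// (ler_wpM2l M00).
  have [cFn _] := CF n; have /cvgrPdist_lt /(_ (e / 3) e30) h := cFn x.
  near=> y.
  have hy : `|F n x - F n y| < e / 3 by near: y; exact: h.
  have := hu x; have := hu y.
  rewrite !ltr_norml in hy * => /andP[? ?] /andP[? ?].
  by move: hy => /andP[? ?]; apply/andP; split; lra.
have Cf : C f.
  split=> //; apply: (@Qlim F) => [n|x e e0]; first by case: (CF n).
  have [n hn] := @exists_half (M0 * w x) e (mulr_ge0 M00 (ltW (w0 x))) e0.
  exists n => m nm; apply: le_lt_trans (fF x m) (le_lt_trans _ hn).
  rewrite (ler_wpM2l (mulr_ge0 M00 (ltW (w0 x))))// lef_pV2 ?posrE ?exprn_gt0//.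
  by rewrite ler_weXn2l//; lra.
have fT x : f x = u x + T f x.
  apply/eqP; rewrite -subr_eq0 -normr_le0.
  apply: (@le_eps_half _ (M0 * w x)); first by rewrite mulr_ge0// ltW.
  move=> n.
  have Cd : C (fun y => f y - F n y).
    have [c1 q1] := Cf; have [c2 q2] := CF n.
    by split; [exact: continuousBf|exact: QB].
  have h : 0 <= M0 / 2 ^+ n by rewrite divr_ge0// exprn_ge0.
  have h1 y : `|f y - F n y| <= M0 / 2 ^+ n * w y by rewrite mulrAC; exact: fF.
  have := Tle Cd h h1 x; rewrite (TB Cf (CF n)).
  have := fF x n.+1; rewrite /= => h2 h3.
  have -> : f x - (u x + T f x) = (f x - (u x + T (F n) x)) - (T f x - T (F n) x) by ring.
  apply: le_trans (ler_normB _ _) _; apply: le_trans (lerD h2 h3) _.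
  by rewrite le_eqVlt; apply/orP; left; apply/eqP; rewrite exprS; field; rewrite expf_neq0.
exists f; split=> //.
apply: (@contraction_le f u (2 * M0)) => //; first by rewrite mulr_ge0.
move=> x; have := fF x 0%N; rewrite expr0 divr1 /= => h.
by have := ler_normD (f x - u x) (u x); rewrite subrK; have := uM x; lra.
Unshelve. all: by end_near. Qed.

End Contraction.

(** * Duhamel's formula for f'' + k^2 f = v *)

Section Duhamel.
Context {R : realType}.
Implicit Types (f g v z : R -> R) (a b c x k : R).

Lemma der_sink k x : is_derive x (1 : R) (fun y => sin (k * y)) (k * cos (k * x)).
Proof.
have := @der_affine R sin (cos (k * x + 0)) k 0 x (is_derive_sin _); rewrite addr0.
by rewrite (_ : (fun y => sin (k * y + 0)) = (fun y => sin (k * y)))//; apply/funext => y; rewrite addr0.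
Qed.

Lemma der_cosk k x : is_derive x (1 : R) (fun y => cos (k * y)) (- (k * sin (k * x))).
Proof.
have := @der_affine R cos (- sin (k * x + 0)) k 0 x (is_derive_cos _); rewrite addr0 mulrN.
by rewrite (_ : (fun y => cos (k * y + 0)) = (fun y => cos (k * y)))//; apply/funext => y; rewrite addr0.
Qed.

Lemma continuous_cosk k : continuous (fun x : R => cos (k * x)).
Proof. by apply: is_derive_cont => x; exact: der_cosk. Qed.

Lemma continuous_sink k : continuous (fun x : R => sin (k * x)).
Proof. by apply: is_derive_cont => x; exact: der_sink. Qed.

Lemma D2_cosk k : D2 (fun x => cos (k * x)) (fun x => - (k * sin (k * x)))
  (fun x => - k ^+ 2 * cos (k * x)).
Proof.
apply: D2_smooth => [x|x|]; first exact: der_cosk.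
  by apply: der_eq (derN (derZ k (der_sink k x))) _; ring.
by apply: continuousZf; exact: continuous_cosk.
Qed.

Lemma D2_sink k : D2 (fun x => sin (k * x)) (fun x => k * cos (k * x))
  (fun x => - k ^+ 2 * sin (k * x)).
Proof.
apply: D2_smooth => [x|x|]; first exact: der_sink.
  by apply: der_eq (derZ k (der_cosk k x)) _; ring.
by apply: continuousZf; exact: continuous_sink.
Qed.

(** The integral of [sin (k (x - t)) v(t) / k] over [[0, x]], with the sine expanded so that [x]
    enters the integrals only as an endpoint. Its derivative [duh'] has [cos (k (x - t))]
    instead. *)
Definition duh k v x :=
  (sin (k * x) * itg (fun t => v t * cos (k * t)) 0 x -
   cos (k * x) * itg (fun t => v t * sin (k * t)) 0 x) / k.

Definition duh' k v x :=
  cos (k * x) * itg (fun t => v t * cos (k * t)) 0 x +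
  sin (k * x) * itg (fun t => v t * sin (k * t)) 0 x.

Lemma D2_duh k v : k != 0 -> locint v ->
  D2 (duh k v) (duh' k v) (fun x => v x - k ^+ 2 * duh k v x).
Proof.
move=> k0 lv.
have cc := @continuous_cosk k; have cs := @continuous_sink k.
have lc : locint (fun t => v t * cos (k * t)) by exact: locintM.
have ls : locint (fun t => v t * sin (k * t)) by exact: locintM.
have cIc : continuous (itg (fun t => v t * cos (k * t)) 0) by exact: prim_continuous.
have cIs : continuous (itg (fun t => v t * sin (k * t)) 0) by exact: prim_continuous.
have cd' : continuous (duh' k v).
  by apply: continuousDf; exact: continuousMf.
have cd : continuous (duh k v).
  rewrite (_ : duh k v = fun x => k^-1 * (sin (k * x) * itg (fun t => v t * cos (k * t)) 0 x -
   cos (k * x) * itg (fun t => v t * sin (k * t)) 0 x)); last by apply/funext => x; rewrite mulrC.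
  by apply: continuousZf; apply: continuousBf; exact: continuousMf.
have E x : duh k v x = itg (duh' k v) 0 x.
  have dp1 y : is_derive y (1 : R) (fun t => k^-1 * sin (k * t)) (cos (k * y)).
    by apply: der_eq (derZ k^-1 (der_sink k y)) _; rewrite mulrA mulVf// mul1r.
  have dp2 y : is_derive y (1 : R) (fun t => - k^-1 * cos (k * t)) (sin (k * y)).
    by apply: der_eq (derZ (- k^-1) (der_cosk k y)) _; rewrite mulrNN mulrA mulVf// mul1r.
  have := itg_parts 0 0 x lc dp1 cc; have := itg_parts 0 0 x ls dp2 cs.
  rewrite !itgxx !addr0 !mul0r !subr0.
  have -> : itg (fun t => v t * sin (k * t) * (- k^-1 * cos (k * t))) 0 x =
     - itg (fun t => v t * cos (k * t) * (k^-1 * sin (k * t))) 0 x.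
    rewrite -itgNf; first by apply: eq_itg => t; ring.
    by apply: locintM => //; exact: continuousZf.
  rewrite (@itgD _ (fun x => cos (k * x) * _)).
  - rewrite (@eq_itg _ (fun t => cos (k * t) * _)
      (fun t => (0 + itg (fun t => v t * cos (k * t)) 0 t) * cos (k * t))); last by move=> t; ring.
    rewrite (@eq_itg _ (fun t => sin (k * t) * _)
      (fun t => (0 + itg (fun t => v t * sin (k * t)) 0 t) * sin (k * t))); last by move=> t; ring.
    by rewrite /duh => h1 h2; move: h1 h2; lra.
  - by apply: continuous_locint; exact: continuousMf.
  - by apply: continuous_locint; exact: continuousMf.
split.
  move=> x; rewrite (_ : duh k v = itg (duh' k v) 0); first exact: itg_derive.
  exact/funext.
have lw : locint (fun x => v x - k ^+ 2 * duh k v x).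
  by apply: locintB => //; apply: continuous_locint; exact: continuousZf.
split=> // a b.
have dc y := der_cosk k y; have ds y := der_sink k y.
have := itg_parts 0 a b lc dc (continuousNf (continuousZf (k := k) cs)).
have := itg_parts 0 a b ls ds (continuousZf (k := k) cc).
(* Inserting [cos^2 + sin^2 = 1] makes each half of [v] a product that can be integrated by
   parts. *)
have e1 : itg v a b = itg (fun x => v x * cos (k * x) * cos (k * x)) a b +
    itg (fun x => v x * sin (k * x) * sin (k * x)) a b.
  rewrite -itgD; [|exact: locintM|exact: locintM].
  by apply: eq_itg => x; rewrite -!mulrA -mulrDr -!expr2 cos2Dsin2 mulr1.
have e2 : k ^+ 2 * itg (duh k v) a b =
   - itg (fun x => (0 + itg (fun t => v t * cos (k * t)) 0 x) * - (k * sin (k * x))) a b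
   - itg (fun x => (0 + itg (fun t => v t * sin (k * t)) 0 x) * (k * cos (k * x))) a b.
  rewrite -itgZ; last exact: continuous_locint.
  rewrite -itgNf.
    rewrite -itgB.
    - by apply: eq_itg => x; rewrite /duh; field.
    - apply: continuous_locint; apply: continuousNf; apply: continuousMf.
        by apply: continuousDf => //; exact: continuous_cst.
      by apply: continuousNf; exact: continuousZf.
    - apply: continuous_locint; apply: continuousMf.
        by apply: continuousDf => //; exact: continuous_cst.
      exact: continuousZf.
  apply: continuous_locint; apply: continuousMf.
    by apply: continuousDf => //; exact: continuous_cst.
  by apply: continuousNf; exact: continuousZf.
rewrite itgB//; last by apply: continuous_locint; exact: continuousZf.
rewrite itgZ ?e2 ?e1; last exact: continuous_locint.
rewrite /duh' => -> ->; ring.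
Qed.

(** Green's identity on [[0, x0]] with [sin (k (x - x0))], which vanishes at [x0] with slope [k],
    reads [k * z x0] off the data at 0. *)
Lemma D2_uniq k z z1 : D2 z z1 (fun x => - k ^+ 2 * z x) ->
  forall x, k * z x = k * z 0 * cos (k * x) + z1 0 * sin (k * x).
Proof.
move=> Dz x0.
have Dg := D2_shift (- x0) (D2_sink k).
have := green 0 x0 Dz Dg.
rewrite (@eq_itg _ _ (fun=> 0)); last by move=> x; ring.
rewrite itg_cst mul0r subrr mulr0 sin0 cos0 add0r mulrN sinN cosN => h.
by move: h; lra.
Qed.

End Duhamel.

(** * Functions with multiplier s over a period, and their inner product *)

Section Parity.
Context {R : realType}.
Notation T := (pi *+ 2 : R).
Implicit Types (f g u v z : R -> R) (x s : R).

Definition par s f := forall x, f (x + T) = s * f x.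

Lemma T_gt0 : 0 < T. Proof. exact: twopi_gt0. Qed.

Lemma T_ge0 : 0 <= T. Proof. exact: ltW T_gt0. Qed.

Lemma parD s f g : par s f -> par s g -> par s (fun x => f x + g x).
Proof. by move=> pf pg x; rewrite pf pg mulrDr. Qed.

Lemma parZ s c f : par s f -> par s (fun x => c * f x).
Proof. by move=> pf x; rewrite pf mulrCA. Qed.

Lemma parB s f g : par s f -> par s g -> par s (fun x => f x - g x).
Proof. by move=> pf pg x; rewrite pf pg mulrBr. Qed.

Lemma par1M s q f : par 1 q -> par s f -> par s (fun x => q x * f x).
Proof. by move=> pq pf x; rewrite pq pf mul1r mulrCA. Qed.

Lemma par_cst (c : R) : par 1 (fun=> c).
Proof. by move=> x; rewrite mul1r. Qed.

Lemma parM s f g x : s * s = 1 -> par s f -> par s g ->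
  f (x + T) * g (x + T) = f x * g x.
Proof. by move=> ss pf pg; rewrite pf pg mulrACA ss mul1r. Qed.

Lemma par_lim s (F : nat -> R -> R) f : (forall n, par s (F n)) ->
  (forall x (e : R), 0 < e -> exists n, forall m, (n <= m)%N -> `|f x - F m x| < e) ->
  par s f.
Proof.
move=> pF hF x; apply/eqP; rewrite -subr_eq0 -normr_le0; apply/ler_addgt0Pr => e e0.
rewrite add0r.
have e1 : 0 < e / (1 + `|s|) by rewrite divr_gt0// ltr_pwDl.
have [n1 h1] := hF (x + T) _ e1; have [n2 h2] := hF x _ e1.
have := h1 _ (leq_maxl n1 n2); have := h2 _ (leq_maxr n1 n2).
set n := maxn _ _; rewrite pF => k1 k2.
have -> : f (x + T) - s * f x = (f (x + T) - s * F n x) - s * (f x - F n x) by ring.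
apply: le_trans (ler_normB _ _) _; rewrite normrM.
apply: (@le_trans _ _ (e / (1 + `|s|) + `|s| * (e / (1 + `|s|)))).
  by rewrite lerD ?(ltW k2)// ler_wpM2l// ltW.
have s0 : 1 + `|s| != 0 by rewrite gt_eqF// ltr_pwDl.
by rewrite le_eqVlt; apply/orP; left; apply/eqP; field.
Qed.

Lemma par_reduce s f x : `|s| = 1 -> par s f ->
  exists2 y, 0 <= y <= T & `|f x| = `|f y|.
Proof.
move=> s1 pf.
have pn y (n : nat) : `|f (y + T *+ n)| = `|f y|.
  elim: n => [|n IH]; first by rewrite mulr0n addr0.
  by rewrite mulrSr addrA pf normrM s1 mul1r.
pose z := Num.floor (x / T).
have zx := floor_itv (x / T).
have /andP[z1 z2] : z%:~R * T <= x < z%:~R * T + T.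
  move/andP: zx => [a b]; rewrite -ler_pdivlMr ?T_gt0// a/=.
  by move: b; rewrite ltr_pdivrMr ?T_gt0// intrD mulrDl mul1r.
exists (x - z%:~R * T); first by apply/andP; split; lra.
case: (z) => n.
  by rewrite -[in RHS](pn _ n) -(mulr_natl (pi *+ 2) n) -pmulrn subrK.
rewrite NegzE mulrNz mulNr opprK -pmulrn mulr_natl; exact/esym/pn.
Qed.

Lemma par_bounded s f : `|s| = 1 -> continuous f -> par s f ->
  exists2 M : R, 0 <= M & forall x, `|f x| <= M.
Proof.
move=> s1 cf pf; have [M M0 hM] := continuous_itv_bounded 0 T cf.
exists M => // x; have [y yT ->] := par_reduce x s1 pf; exact: hM.
Qed.

Lemma derive_par s f f1 : (forall x, is_derive x (1 : R) f (f1 x)) -> par s f -> par s f1.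
Proof.
move=> df pf x.
have h1 : is_derive x (1 : R) (fun y => f (y + T)) (f1 (x + T)) by exact: der_shift.
have h2 : is_derive x (1 : R) (fun y => f (y + T)) (s * f1 x).
  by rewrite (_ : (fun y => _) = (fun y => s * f y)); [exact: derZ|exact/funext].
exact: der_uniq h1 h2.
Qed.

Definition ip f g := itg (fun x => f x * g x) 0 T.

Lemma ipC f g : ip f g = ip g f.
Proof. by apply: eq_itg => x; exact: mulrC. Qed.

Lemma ipD f g v : locint f -> locint g -> continuous v ->
  ip (fun x => f x + g x) v = ip f v + ip g v.
Proof.
move=> lf lg cv; rewrite /ip -itgD; [|exact: locintM|exact: locintM].
by apply: eq_itg => x; rewrite mulrDl.
Qed.

Lemma ipZ c f v : locint f -> continuous v -> ip (fun x => c * f x) v = c * ip f v.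
Proof.
move=> lf cv; rewrite /ip -itgZ; last exact: locintM.
by apply: eq_itg => x; rewrite mulrA.
Qed.

Lemma ipB f g v : locint f -> locint g -> continuous v ->
  ip (fun x => f x - g x) v = ip f v - ip g v.
Proof.
move=> lf lg cv; rewrite /ip -itgB; [|exact: locintM|exact: locintM].
by apply: eq_itg => x; rewrite mulrBl.
Qed.

Lemma ip_norm_le f v M : locint f -> continuous v -> (forall x, `|v x| <= M) ->
  `|ip f v| <= M * itg (fun x => `|f x|) 0 T.
Proof.
move=> lf cv vM; rewrite -itgZ; last exact: locint_norm.
apply: itg_norm_le; [exact: T_ge0|exact: locintM| |].
  by apply: locintZ; exact: locint_norm.
by move=> x _; rewrite normrM mulrC ler_wpM2r.
Qed.

(** The orthogonal projection onto the span of [e1] and [e2] when these are orthogonal and each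
    nonzero one has squared norm [1 / kap]. *)
Definition Proj (kap : R) e1 e2 v x := kap * ip v e1 * e1 x + kap * ip v e2 * e2 x.

Lemma Proj_norm kap e1 e2 v x : 0 <= kap -> continuous e1 -> continuous e2 ->
  (forall x, `|e1 x| <= 1) -> (forall x, `|e2 x| <= 1) -> locint v ->
  `|Proj kap e1 e2 v x| <= 2 * kap * itg (fun t => `|v t|) 0 T.
Proof.
move=> k0 c1 c2 b1 b2 lv.
have h e : continuous e -> (forall x, `|e x| <= 1) ->
    `|kap * ip v e * e x| <= kap * itg (fun t => `|v t|) 0 T.
  move=> ce be; rewrite normrM -[leRHS]mulr1 ler_pM// normrM ger0_norm// ler_wpM2l//.
  by have := ip_norm_le lv ce be; rewrite mul1r.
by apply: le_trans (ler_normD _ _) _; have := h _ c1 b1; have := h _ c2 b2; lra.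
Qed.

(** The boundary terms are products of two functions with multiplier [s], so they agree at 0 and [T]
    because [s * s = 1]. *)
Lemma green_par s f f1 v g g1 w : s * s = 1 -> D2 f f1 v -> D2 g g1 w ->
  par s f -> par s f1 -> par s g -> par s g1 -> ip v g = ip w f.
Proof.
move=> ss Df Dg pf pf1 pg pg1.
have := green 0 T Df Dg.
have E a b : par s a -> par s b -> a T * b T = a 0 * b 0.
  by move=> pa pb; have := parM 0 ss pa pb; rewrite add0r.
rewrite !E// subrr itgB.
- by move/eqP; rewrite subr_eq0 => /eqP h; rewrite /ip h; exact: ipC.
- by apply: locintM; [exact: D2_locint Df|exact: D2_cont Dg].
- rewrite (_ : (fun x => _) = (fun x => w x * f x)); last by apply/funext => x; rewrite mulrC.
  by apply: locintM; [exact: D2_locint Dg|exact: D2_cont Df].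
Qed.

End Parity.


(** * The roots of S(mu) u = mu u for a slowly varying symmetric 2 x 2 matrix *)

Section TwoRoots.
Context {R : realType}.
Implicit Types (x y mu : R) (h A B C : R -> R).

(** The intermediate value theorem for [h - id], with the argument of [h] clamped to [[-r, r]] so
    that the function is continuous on the whole line; the Lipschitz constant below 1 gives
    uniqueness. *)
Lemma lipschitz_fixpoint h (r : R) : 0 < r ->
  (forall x, `|x| <= r -> `|h x| < r) ->
  (forall x y, `|x| <= r -> `|y| <= r -> `|h x - h y| <= 2^-1 * `|x - y|) ->
  exists x, [/\ `|x| < r, h x = x & forall y, `|y| <= r -> h y = y -> y = x].
Proof.
move=> r0 hr hl.
pose cl x := Num.max (- r) (Num.min x r).
have clr x : `|cl x| <= r.
  rewrite ler_norml /cl le_max lexx/= ge_max; apply/andP; split; first lra.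
  by rewrite ge_min lexx orbT.
have clE x : `|x| <= r -> cl x = x.
  rewrite ler_norml => /andP[h1 h2]; rewrite /cl.
  by rewrite (min_idPl h2); apply/max_idPr.
have cll x y : `|cl x - cl y| <= `|x - y|.
  have clP z : [\/ z <= - r /\ cl z = - r, - r <= z <= r /\ cl z = z | r <= z /\ cl z = r].
    have [z1|/ltW z1] := leP z (- r).
      by constructor 1; split=> //; apply/max_idPl; rewrite ge_min z1.
    have [z2|/ltW z2] := leP z r.
      by constructor 2; rewrite z1; split=> //; apply: clE; rewrite ler_norml z1.
    constructor 3; split=> //; rewrite /cl (min_idPr z2); apply/max_idPr; lra.
  have h1 := ler_norm (x - y); have h2 := ler_norm (y - x); rewrite distrC in h2.
  by rewrite ler_norml; apply/andP; split;
    case: (clP x) => -[? ->]; case: (clP y) => -[? ->]; lra.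
pose g x := h (cl x) - x.
have cg : continuous g.
  move=> x; apply: cvgB; last exact: cvg_id.
  apply/cvgrPdist_lt => e e0; near=> y.
  have : `|h (cl x) - h (cl y)| <= 2^-1 * `|x - y|.
    by apply: le_trans (hl _ _ (clr x) (clr y)) _; rewrite ler_wpM2l.
  have : `|x - y| < e.
    by near: y; exists e.
  by move=> h1 h2; have := normr_ge0 (x - y); lra.
have nr : `|- r| <= r by rewrite normrN ger0_norm// ltW.
have pr : `|r| <= r by rewrite ger0_norm// ltW.
have := @IVT R g (- r) r 0 ltac:(lra) (continuous_subspaceT cg).
have gr : g r < 0 by rewrite /g clE//; have := hr _ pr; rewrite ltr_norml => /andP[]; lra.
have gnr : 0 < g (- r) by rewrite /g clE//; have := hr _ nr; rewrite ltr_norml => /andP[]; lra.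
case.
  by rewrite ge_min le_max (ltW gr) (ltW gnr) orbT.
move=> x; rewrite in_itv/= => /andP[x1 x2] gx.
have xr : `|x| <= r by rewrite ler_norml x1.
have hx : h x = x by move: gx; rewrite /g clE// => /eqP; rewrite subr_eq0 => /eqP.
exists x; split=> //; first by rewrite -hx hr.
move=> y yr hy; have := hl _ _ yr xr; rewrite hx hy => hh.
apply/eqP; rewrite -subr_eq0 -normr_le0; have := normr_ge0 (y - x); lra.
Unshelve. all: by end_near. Qed.

Definition nrm2 (a b : R) : R := Num.sqrt (a ^+ 2 + b ^+ 2).

Lemma nrm2_ge0 a b : 0 <= nrm2 a b. Proof. exact: sqrtr_ge0. Qed.

Lemma nrm2_sqr a b : nrm2 a b ^+ 2 = a ^+ 2 + b ^+ 2.
Proof. by rewrite sqr_sqrtr// addr_ge0// sqr_ge0. Qed.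

Lemma le_nrm2 a b : `|a| <= nrm2 a b.
Proof. by rewrite -sqrtr_sqr ler_sqrt ?lerDl ?addr_ge0 ?sqr_ge0. Qed.

Lemma le_nrm2r a b : `|b| <= nrm2 a b.
Proof. by rewrite -sqrtr_sqr ler_sqrt ?lerDr ?addr_ge0 ?sqr_ge0. Qed.

Lemma nrm2_le a b : nrm2 a b <= `|a| + `|b|.
Proof.
rewrite -(@ler_pXn2r _ 2)// ?nnegrE ?nrm2_ge0 ?addr_ge0// nrm2_sqr.
have := normr_ge0 a; have := normr_ge0 b.
rewrite -(real_normK (num_real a)) -(real_normK (num_real b)); nra.
Qed.

Lemma nrm2_lip a b a' b' : nrm2 a b <= nrm2 a' b' + `|a - a'| + `|b - b'|.
Proof.
rewrite -(@ler_pXn2r _ 2)// ?nnegrE ?nrm2_ge0 ?addr_ge0 ?nrm2_ge0// nrm2_sqr.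
have h1 := le_nrm2 a' b'; have h2 := le_nrm2r a' b'; have h3 := nrm2_sqr a' b'.
have n0 := nrm2_ge0 a' b'; set n := nrm2 _ _ in h1 h2 h3 n0 *.
set d := a - a'; set e := b - b'.
have -> : a = a' + d by rewrite /d; ring.
have -> : b = b' + e by rewrite /e; ring.
have d0 := normr_ge0 d; have e0 := normr_ge0 e.
have hd := real_normK (num_real d); have he := real_normK (num_real e).
have t1 : a' * d <= n * `|d| by apply: le_trans (ler_norm _) _; rewrite normrM ler_wpM2r.
have t2 : b' * e <= n * `|e| by apply: le_trans (ler_norm _) _; rewrite normrM ler_wpM2r.
have t3 := mulr_ge0 d0 e0.
nra.
Qed.

Lemma nrm2_dist a b a' b' : `|nrm2 a b - nrm2 a' b'| <= `|a - a'| + `|b - b'|.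
Proof.
have := nrm2_lip a b a' b'; have := nrm2_lip a' b' a b.
by rewrite (distrC a') (distrC b') ler_norml => ? ?; apply/andP; split; lra.
Qed.

Variables (r : R) (A B C : R -> R).
Hypothesis r0 : 0 < r.
Hypotheses (Ar : forall x, `|x| <= r -> `|A x| <= r / 8)
  (Br : forall x, `|x| <= r -> `|B x| <= r / 8)
  (Cr : forall x, `|x| <= r -> `|C x| <= r / 8).
Hypotheses
  (Al : forall x y, `|x| <= r -> `|y| <= r -> `|A x - A y| <= 40^-1 * `|x - y|)
  (Bl : forall x y, `|x| <= r -> `|y| <= r -> `|B x - B y| <= 40^-1 * `|x - y|)
  (Cl : forall x y, `|x| <= r -> `|y| <= r -> `|C x - C y| <= 40^-1 * `|x - y|).

(** [up x] and [dn x] are the two eigenvalues of the symmetric matrix with rows [(A x, B x)] and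
    [(B x, C x)]. The square root is not smooth where they meet but is Lipschitz, which suffices:
    constants 1/40 for the mean and 1/20 for [N] add up to less than 1/8. *)
Let N x : R := nrm2 ((A x - C x) / 2) (B x).
Let up x := (A x + C x) / 2 + N x.
Let dn x := (A x + C x) / 2 - N x.

Let midl x y : `|x| <= r -> `|y| <= r ->
  `|(A x + C x) / 2 - (A y + C y) / 2| <= 40^-1 * `|x - y|.
Proof.
move=> xr yr; have := Al xr yr; have := Cl xr yr; rewrite !ler_norml.
by move=> /andP[? ?] /andP[? ?]; apply/andP; split; lra.
Qed.

Let Nl x y : `|x| <= r -> `|y| <= r -> `|N x - N y| <= 20^-1 * `|x - y|.
Proof.
move=> xr yr; apply: le_trans (nrm2_dist _ _ _ _) _.
have : `|(A x - C x) / 2 - (A y - C y) / 2| <= 40^-1 * `|x - y|.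
  have := Al xr yr; have := Cl xr yr; rewrite !ler_norml.
  by move=> /andP[? ?] /andP[? ?]; apply/andP; split; lra.
by have := Bl xr yr; lra.
Qed.

Let updn x : `|x| <= r -> `|up x| < r /\ `|dn x| < r.
Proof.
move=> xr; have : N x <= r / 4.
  apply: le_trans (nrm2_le _ _) _.
  have : `|(A x - C x) / 2| <= r / 8.
    have := Ar xr; have := Cr xr; rewrite !ler_norml.
    by move=> /andP[? ?] /andP[? ?]; apply/andP; split; lra.
  by have := Br xr; lra.
have := nrm2_ge0 ((A x - C x) / 2) (B x); rewrite -/(N x).
rewrite /up /dn; have := Ar xr; have := Cr xr; rewrite !ler_norml !ltr_norml.
move: (A x) (C x) (N x) r0 => a c n r0' /andP[? ?] /andP[? ?] ? ?.
by split; apply/andP; split; lra.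
Qed.

Let upl x y : `|x| <= r -> `|y| <= r -> `|up x - up y| <= 8^-1 * `|x - y|.
Proof.
move=> xr yr; have := midl xr yr; have := Nl xr yr; have := normr_ge0 (x - y).
rewrite /up !ler_norml => ? /andP[? ?] /andP[? ?]; apply/andP; split; lra.
Qed.

Let dnl x y : `|x| <= r -> `|y| <= r -> `|dn x - dn y| <= 8^-1 * `|x - y|.
Proof.
move=> xr yr; have := midl xr yr; have := Nl xr yr; have := normr_ge0 (x - y).
rewrite /dn !ler_norml => ? /andP[? ?] /andP[? ?]; apply/andP; split; lra.
Qed.

(** [x] is the fixed point of [dn] and [y] that of [up]. If they coincide then [N x = 0] and the
    matrix is scalar. As [dn y] is within [(y - x) / 8] of [x] and [y = dn y + 2 * N y], the gap and
    [2 * N y] agree up to factors 7/8 and 9/8, which gives both gap bounds. *)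
Lemma two_roots : exists x y,
  [/\ `|x| < r, `|y| < r, x <= y &
   [/\ forall mu, `|mu| <= r ->
        (A mu - mu) * (C mu - mu) = B mu ^+ 2 <-> (mu = x \/ mu = y),
      x = y -> [/\ A x = x, C x = x & B x = 0],
      x < y -> forall mu, mu = x \/ mu = y -> ~ [/\ A mu = mu, C mu = mu & B mu = 0],
      y - x <= 2 * (`|A y - C y| + 2 * `|B y|) &
      `|A y - C y| / 2 <= y - x]].
Proof.
have N0 x : 0 <= N x by exact: nrm2_ge0.
have NE x : N x ^+ 2 = ((A x - C x) / 2) ^+ 2 + B x ^+ 2 by exact: nrm2_sqr.
have half x y : 8^-1 * `|x - y| <= 2^-1 * `|x - y| by have := normr_ge0 (x - y); lra.
have [x [xr hx ux]] := @lipschitz_fixpoint dn r r0 (fun x xr => (updn xr).2)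
  (fun x y xr yr => le_trans (dnl xr yr) (half _ _)).
have [y [yr hy uy]] := @lipschitz_fixpoint up r r0 (fun x xr => (updn xr).1)
  (fun x y xr yr => le_trans (upl xr yr) (half _ _)).
have xy : x <= y.
  rewrite leNgt; apply/negP => yx.
  have := upl (ltW yr) (ltW xr); rewrite hy.
  rewrite ler_norml ltr0_norm ?subr_lt0// => /andP[h1 h2].
  have := N0 x; have : up x = dn x + 2 * N x by rewrite /up /dn; ring.
  by rewrite hx; lra.
have eqv mu : (A mu - mu) * (C mu - mu) = B mu ^+ 2 <-> (dn mu = mu \/ up mu = mu).
  have E : (dn mu - mu) * (up mu - mu) = (A mu - mu) * (C mu - mu) - B mu ^+ 2.
    rewrite /dn /up; have := NE mu; move: (N mu) (A mu) (B mu) (C mu) => n a b c h.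
    have -> : ((a + c) / 2 - n - mu) * ((a + c) / 2 + n - mu) = ((a + c) / 2 - mu) ^+ 2 - n ^+ 2 by ring.
    by rewrite h; field.
  split.
    move=> h; move: E; rewrite h subrr => /eqP; rewrite mulf_eq0 !subr_eq0.
    by move=> /orP[/eqP ->|/eqP ->]; [left|right].
  by move=> h; apply/eqP; rewrite -subr_eq0 -E mulf_eq0 !subr_eq0; case: h => ->; rewrite eqxx ?orbT.
have dbl mu : [/\ A mu = mu, C mu = mu & B mu = 0] -> up mu = mu /\ dn mu = mu.
  move=> [a c b]; have N00 : N mu = 0.
    by apply/eqP; rewrite -sqrf_eq0 NE a c b subrr mul0r !expr0n/= addr0.
  by rewrite /up /dn N00 a c; split; field.
exists x, y; split=> //; split.
- move=> mu mr; rewrite eqv; split.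
    by move=> [/(ux _ mr)|/(uy _ mr)] ->; [left|right].
  by move=> [->|->]; [left|right].
- move=> e; have hux : up x = x by rewrite e hy.
  have n0 : N x = 0 by have : up x - dn x = 2 * N x by [rewrite /up /dn; ring]; rewrite hux hx; lra.
  have := NE x; rewrite n0 expr0n /= => h.
  have b0 : B x = 0 by apply/eqP; rewrite -sqrf_eq0 eq_le sqr_ge0 andbT; have := sqr_ge0 ((A x - C x) / 2); lra.
  have a0 : (A x - C x) / 2 = 0 by apply/eqP; rewrite -sqrf_eq0 eq_le sqr_ge0 andbT; have := sqr_ge0 (B x); lra.
  by move: hux; rewrite /up n0; split=> //; lra.
- move=> ltxy mu [->|->] /dbl [u d].
    by have := uy _ (ltW xr) u; move: ltxy => /[swap] ->; rewrite ltxx.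
  by have := ux _ (ltW yr) d; move: ltxy => /[swap] ->; rewrite ltxx.
- have := dnl (ltW yr) (ltW xr); rewrite hx ler_norml ger0_norm ?subr_ge0// => /andP[h1 h2].
  have h3 : up y = dn y + 2 * N y by rewrite /up /dn; ring.
  have := nrm2_le ((A y - C y) / 2) (B y); rewrite -/(N y) normrM [X in _ * X]gtr0_norm//.
  by move: h3; rewrite hy; have := normr_ge0 (A y - C y); have := normr_ge0 (B y); lra.
- have := dnl (ltW yr) (ltW xr); rewrite hx ler_norml ger0_norm ?subr_ge0// => /andP[h1 h2].
  have h3 : up y = dn y + 2 * N y by rewrite /up /dn; ring.
  have := le_nrm2 ((A y - C y) / 2) (B y); rewrite -/(N y) normrM [X in _ * X <= _]gtr0_norm//.
  by move: h3; rewrite hy; lra.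
Qed.

End TwoRoots.

(** * Dimension of spaces of functions *)

Section HasDim.
Context {R : realType}.
Implicit Types (E : set (R -> R)) (f g : R -> R).

Lemma has_dim1 E g : E g -> (exists x, g x != 0) ->
  (forall f, E f -> exists c, forall x, f x = c * g x) -> has_dim E 1.
Proof.
move=> Eg [x0 gx0] sp; exists (fun _ => g); split=> // [c h i|f Ef].
  have := h x0; rewrite big_ord_recl big_ord0 addr0 => /eqP.
  by rewrite mulf_eq0 (negbTE gx0) orbF (ord1 i) => /eqP.
by have [c hc] := sp f Ef; exists (fun _ => c) => x; rewrite big_ord_recl big_ord0 addr0.
Qed.

Lemma has_dim2 E g1 g2 : E g1 -> E g2 ->
  (forall a b, (forall x, a * g1 x + b * g2 x = 0) -> a = 0 /\ b = 0) ->
  (forall f, E f -> exists a b, forall x, f x = a * g1 x + b * g2 x) -> has_dim E 2.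
Proof.
move=> E1 E2 li sp.
exists (fun i : 'I_2 => if i == 0 :> nat then g1 else g2); split.
- by move=> i; case: ifP.
- move=> c h i; have [] := li (c ord0) (c (lift ord0 ord0)).
    by move=> x; have := h x; rewrite !big_ord_recl big_ord0 addr0.
  by case: (unliftP ord0 i) => [k ->|->]; rewrite ?(ord1 k).
- move=> f Ef; have [a [b hab]] := sp f Ef.
  exists (fun i : 'I_2 => if i == 0 :> nat then a else b) => x.
  by rewrite !big_ord_recl big_ord0 addr0.
Qed.

(** If [m < n], the [n] by [m] matrix of coordinates has a nonzero vector in its left kernel, which
    is a linear relation between independent functions. *)
Lemma has_dim_le E n m : has_dim E n -> has_dim E m -> (n <= m)%N.
Proof.
move=> [b [Eb lib _]] [b' [_ _ sp']]; rewrite leqNgt; apply/negP => mn.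
have /choice [M hM] : forall i : 'I_n, exists c : 'I_m -> R, forall x, b i x = \sum_(k < m) c k * b' k x.
  by move=> i; exact: sp' (Eb i).
pose A := \matrix_(i < n, k < m) M i k.
have rk : (0 < \rank (kermx A))%N.
  by rewrite mxrank_ker subn_gt0 (leq_ltn_trans (rank_leq_col A)).
have : kermx A != 0 by rewrite -mxrank_eq0 -lt0n.
case/matrix0Pn => i0 [k0 hk].
pose c k := kermx A i0 k.
have cA : row i0 (kermx A) *m A = 0 by rewrite -row_mul mulmx_ker row0.
have c0 : forall i, c i = 0.
  apply: lib => x.
  have : \sum_(k < m) (row i0 (kermx A) *m A) 0 k * b' k x = 0.
    by rewrite cA big1// => k _; rewrite mxE mul0r.
  under eq_bigr do rewrite mxE mulr_suml.
  rewrite exchange_big /= => h; rewrite -[RHS]h; apply: eq_bigr => i _.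
  rewrite hM mulr_sumr; apply: eq_bigr => k _.
  by rewrite mxE [A i k]mxE -mulrA.
by move: hk; rewrite -/(c k0) c0 eqxx.
Qed.

Lemma has_dim_uniq E n m : has_dim E n -> has_dim E m -> n = m.
Proof. by move=> h1 h2; apply/eqP; rewrite eqn_leq (has_dim_le h1 h2) (has_dim_le h2 h1). Qed.

End HasDim.


(** * Eigenspaces and numerical constants *)

Section Constants.
Context {R : realType}.
Notation T := (pi *+ 2 : R).

Definition Vmul (q : R -> R) mu (f : R -> R) x : R := (q x - mu) * f x.

Definition eigset (s : R) (q : R -> R) (l : R) : set (R -> R) :=
  [set f | par s f /\ exists f', D2 f f' (fun x => Vmul q l f x)].

(* Two solutions u of S(mu) u = mu u are found for |mu| <= wr as soon as the
   L^1 norm of q is at most wm.  Both are made opaque below, so that the numerals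
   are never unfolded. *)
Definition wr : R := 20^-1 ^+ 3.
Definition wm : R := 10^-1 ^+ 5.

Lemma wr_gt0 : 0 < wr. Proof. by rewrite exprn_gt0// invr_gt0. Qed.

Lemma wm_gt0 : 0 < wm. Proof. by rewrite exprn_gt0// invr_gt0. Qed.

Lemma wr_small : 1000 * wr <= 1.
Proof. by rewrite /wr !exprS expr0; lra. Qed.

(** The factor 128 bounds the Green operators, whose norms are at most [100 / j] and [16 * T], and 8
    bounds [T]: this is the contraction condition. [wr_wm2] bounds the matrix entries by [wr / 8]
    and [wm3] their Lipschitz constants by 1/40, as [two_roots] demands; their factor 1/2 bounds
    [kap]. *)
Lemma wr_wm1 : 128 * (wm + 8 * wr) <= 2^-1.
Proof. by rewrite /wr /wm !exprS expr0; lra. Qed.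

Lemma wr_wm2 : 2^-1 * (2 * wm) <= wr / 8.
Proof. by rewrite /wr /wm !exprS expr0; lra. Qed.

Lemma wm3 : 2^-1 * (4 * (128 * 8 * wm)) <= 40^-1.
Proof. by rewrite /wm !exprS expr0; lra. Qed.

Lemma T_le8 : T <= 8.
Proof.
have := @pihalf_lt2 R; rewrite ltr_pdivrMr// => h.
by rewrite -(mulr_natl pi 2); lra.
Qed.

Lemma T_ge4 : 4 <= T.
Proof. by have := pi_ge2 R; rewrite -(mulr_natl pi 2); lra. Qed.

End Constants.

Global Opaque wr wm.


Lemma ler_normB2 (R : realType) (a b h : R) : `|a| <= h -> `|b| <= h -> `|a - b| <= 2 * h.
Proof. by move=> h1 h2; apply: le_trans (ler_normB _ _) _; lra. Qed.

Lemma ler_norm_near (R : realType) (a b h : R) : `|a - b| <= h -> `|a| <= `|b| + h.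
Proof. by move=> h1; have := ler_normD (a - b) b; rewrite subrK; lra. Qed.

Lemma combine_bounds (R : realType) (a b c d h : R) :
  a <= c + 2 * h -> b <= d + h -> a + 2 * b <= c + 2 * d + 4 * h.
Proof. lra. Qed.

(** A singular nonzero symmetric matrix of size 2 has rank one. Its kernel is spanned by
    [(b, mu - a)] unless [b = 0], when the matrix is diagonal. *)
Lemma sym2_kernel_line (R : realType) (a b c mu : R) :
  (a - mu) * (c - mu) = b ^+ 2 -> ~ [/\ a = mu, c = mu & b = 0] ->
  exists g1 g2 : R, [/\ (g1 != 0) || (g2 != 0),
    g1 * a + g2 * b = mu * g1, g1 * b + g2 * c = mu * g2 &
    forall u v : R, u * a + v * b = mu * u -> u * b + v * c = mu * v ->
      exists d, u = d * g1 /\ v = d * g2].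
Proof.
move=> dt nd.
have [b0|b0] := eqVneq b 0; last first.
  exists b, (mu - a); split; [by rewrite b0|ring| |].
    by move: dt; rewrite expr2; lra.
  move=> u v h1 h2; exists (u / b); split; first by rewrite mulfVK.
  apply: (mulIf b0); rewrite mulrAC mulfVK//; lra.
have [a0|a0] := eqVneq a mu.
  exists 1, 0; split; [by rewrite oner_eq0|by rewrite a0 b0; ring|by rewrite b0; ring|].
  move=> u v h1 h2; exists u; split; first by rewrite mulr1.
  rewrite mulr0; apply/eqP; apply: contraT => v0; exfalso; apply: nd; split=> //.
  by apply: (mulfI v0); move: h2; rewrite b0; lra.
have c0 : c = mu.
  move: dt; rewrite b0 expr0n/= => /eqP; rewrite mulf_eq0 !subr_eq0 (negbTE a0)/=.
  by move/eqP.
exists 0, 1; split; [by rewrite oner_eq0 orbT|by rewrite b0; ring|by rewrite c0; ring|].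
move=> u v h1 h2; exists v; split; last by rewrite mulr1.
rewrite mulr0; have a0' : a - mu != 0 by rewrite subr_eq0.
by apply: (mulIf a0'); move: h1; rewrite b0; lra.
Qed.

(* Lyapunov-Schmidt reduction for f'' = (q - k2 - mu) f among f with
   f (x + T) = s f x.  The plane span (e1, e2) is the kernel of f'' + k2 f (e2 = 0
   when k2 = 0), and K is the Green operator of f'' + k2 f on its complement. *)
Section Window.
Context {R : realType}.
Notation T := (pi *+ 2 : R).
Variables (s k2 kap H : R) (e1 e1' e2 e2' : R -> R) (K K1 : (R -> R) -> R -> R).
Implicit Types (f g u v z q : R -> R) (x mu : R).
Hypothesis ss : s * s = 1.
Hypothesis De1 : D2 e1 e1' (fun x => - k2 * e1 x).
Hypothesis De2 : D2 e2 e2' (fun x => - k2 * e2 x).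
Hypothesis pe1 : par s e1.
Hypothesis pe2 : par s e2.
Hypothesis be1 : forall x, `|e1 x| <= 1.
Hypothesis be2 : forall x, `|e2 x| <= 1.
Hypothesis o11 : kap * ip e1 e1 = 1.
Hypothesis o12 : ip e1 e2 = 0.
Hypothesis o22 : forall x, kap * ip e2 e2 * e2 x = e2 x.
Local Notation Pi := (Proj kap e1 e2).
Hypothesis H0 : 0 <= H.
Hypothesis HK : forall v, locint v -> par s v ->
  [/\ D2 (K v) (K1 v) (fun x => v x - Pi v x - k2 * K v x),
      par s (K v), ip (K v) e1 = 0, ip (K v) e2 = 0 &
      forall x, `|K v x| <= H * itg (fun t => `|v t|) 0 T].
Hypothesis HU : forall z z1, D2 z z1 (fun x => - k2 * z x) -> par s z ->
  forall x, z x = Pi z x.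

Let ce1 : continuous e1. Proof. exact: D2_cont De1. Qed.
Let ce2 : continuous e2. Proof. exact: D2_cont De2. Qed.
Let le1 : locint e1. Proof. exact: continuous_locint. Qed.
Let le2 : locint e2. Proof. exact: continuous_locint. Qed.
Let s1 : `|s| = 1.
Proof.
have : `|s| * `|s| = 1 by rewrite -normrM ss normr1.
have := normr_ge0 s; nra.
Qed.

(** The difference of [g] and [K v] solves the homogeneous equation, hence lies in the plane by
    [HU], and it is orthogonal to the plane. *)
Lemma window_uniq v g g1 : locint v -> par s v -> par s g ->
  D2 g g1 (fun x => v x - Pi v x - k2 * g x) -> ip g e1 = 0 -> ip g e2 = 0 ->
  forall x, g x = K v x.
Proof.
move=> lv pv pg Dg g1e g2e x; have [DK pK K1e K2e _] := HK lv pv.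
have Dz : D2 (fun x => g x - K v x) (fun x => g1 x - K1 v x)
    (fun x => - k2 * (g x - K v x)).
  by apply: D2_ext (D2B Dg DK) => y //; ring.
have := HU Dz (parB pg pK) x; rewrite /Proj.
have lg : locint g by apply: continuous_locint; exact: D2_cont Dg.
have lK : locint (K v) by apply: continuous_locint; exact: D2_cont DK.
rewrite !ipB// g1e g2e K1e K2e subrr mulr0 !mul0r addr0 => /eqP.
by rewrite subr_eq0 => /eqP.
Qed.

Lemma window_linear a b v w : locint v -> par s v -> locint w -> par s w ->
  forall x, K (fun x => a * v x + b * w x) x = a * K v x + b * K w x.
Proof.
move=> lv pv lw pw x; have [Dv pKv v1 v2 _] := HK lv pv; have [Dw pKw w1 w2 _] := HK lw pw.
have lKv : locint (K v) by apply: continuous_locint; exact: D2_cont Dv.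
have lKw : locint (K w) by apply: continuous_locint; exact: D2_cont Dw.
have lav : locint (fun x => a * v x) by exact: locintZ.
have lbw : locint (fun x => b * w x) by exact: locintZ.
apply/esym; apply: (@window_uniq _ (fun x => a * K v x + b * K w x)
  (fun x => a * K1 v x + b * K1 w x)).
- exact: locintD.
- by apply: parD; exact: parZ.
- by apply: parD; exact: parZ.
- apply: D2_ext (D2D (D2Z a Dv) (D2Z b Dw)) => y //=.
  by rewrite /Proj !ipD// !ipZ//; ring.
- by rewrite ipD ?ipZ ?v1 ?w1 ?mulr0 ?addr0//; exact: locintZ.
- by rewrite ipD ?ipZ ?v2 ?w2 ?mulr0 ?addr0//; exact: locintZ.
Qed.

(** On the plane [v - Pi v = 0], so the zero function has the properties that characterise [K v].
    The hypothesis [o22] carries a factor [e2 x] so that it also covers [e2 = 0]. *)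
Lemma window_ker a b x : K (fun x => a * e1 x + b * e2 x) x = 0.
Proof.
have l1 : locint (fun x => a * e1 x) by exact: locintZ.
have l2 : locint (fun x => b * e2 x) by exact: locintZ.
apply/esym; apply: (@window_uniq _ (fun=> 0) (fun=> 0)).
- exact: locintD.
- by apply: parD; exact: parZ.
- by move=> y; rewrite mulr0.
- have D0 : D2 (fun _ : R => 0 : R) (fun=> 0) (fun=> 0).
    by apply: D2_smooth; [move=> ?; exact: der_cst..|exact: continuous_cst].
  apply: D2_ext D0 => y //; rewrite /Proj !ipD// !ipZ// (ipC e2 e1) o12.
  rewrite -[X in a * X + _](mul1r (e1 y)) -o11.
  by rewrite -{1}(o22 y); ring.
- by rewrite /ip (@eq_itg _ _ (fun=> 0)) ?itg_cst ?mul0r// => y; rewrite mul0r.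
- by rewrite /ip (@eq_itg _ _ (fun=> 0)) ?itg_cst ?mul0r// => y; rewrite mul0r.
Qed.

Section Potential.
Variables (q : R -> R) (lq : locint q) (pq : par 1 q).
Let m := itg (fun x => `|q x|) 0 T.

Let m0 : 0 <= m.
Proof. by apply: itg_ge0; [exact: T_ge0|exact: locint_norm|]. Qed.

Local Notation Vmul := (Vmul q).

Lemma Vmul_locint mu f : continuous f -> locint (Vmul mu f).
Proof. by move=> cf; apply: locintM => //; apply: locintB => //; exact: locint_cst. Qed.

Lemma Vmul_par mu f : par s f -> par s (Vmul mu f).
Proof. by move=> pf; apply: par1M => //; apply: parB => //; exact: par_cst. Qed.

Lemma qmul_bound f M : continuous f -> (forall x, `|f x| <= M) ->
  itg (fun t => `|q t * f t|) 0 T <= M * m.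
Proof.
move=> cf fM; rewrite -itgZ; last exact: locint_norm.
apply: le_itg; [exact: T_ge0| | |].
- by apply: locint_norm; exact: locintM.
- by apply: locintZ; exact: locint_norm.
- by move=> x _; rewrite normrM mulrC ler_wpM2r.
Qed.

Lemma norm_bound f M : continuous f -> (forall x, `|f x| <= M) ->
  itg (fun t => `|f t|) 0 T <= M * T.
Proof.
move=> cf fM; have := @itg_cst R M 0 T; rewrite subr0 => <-.
apply: le_itg; [exact: T_ge0| |exact: locint_cst|by move=> x _; exact: fM].
by apply: locint_norm; exact: continuous_locint.
Qed.

Lemma Vmul_bound mu f M : continuous f -> (forall x, `|f x| <= M) ->
  itg (fun t => `|Vmul mu f t|) 0 T <= M * (m + T * `|mu|).
Proof.
move=> cf fM.
have lqf : locint (fun t => `|q t * f t|) by apply: locint_norm; exact: locintM.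
have lf : locint (fun t => `|mu| * `|f t|) by apply: locintZ; apply: locint_norm; exact: continuous_locint.
apply: (@le_trans _ _ (itg (fun t => `|q t * f t| + `|mu| * `|f t|) 0 T)).
  apply: le_itg; [exact: T_ge0|by apply: locint_norm; exact: Vmul_locint|exact: locintD|].
  by move=> x _; rewrite /Vmul mulrBl (le_trans (ler_normB _ _))// [X in _ + X <= _]normrM.
rewrite itgD// itgZ; last by apply: locint_norm; exact: continuous_locint.
rewrite (mulrDr M); apply: lerD; first exact: qmul_bound.
by rewrite mulrA mulrC ler_wpM2r// norm_bound.
Qed.

(** The range equation of the reduction: [f] has prescribed component [u] in the plane and solves
    the eigenvalue equation up to a term in the plane. *)
Definition isF mu u f := [/\ continuous f, par s f & forall x, f x = u x + K (Vmul mu f) x].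

(** Under this bound [f |-> K ((q - mu) f)] halves the sup norm, since the L^1 norm of [(q - mu) f]
    is at most [m + T * |mu|] times the sup norm of [f]. *)
Definition small mu := H * (m + T * `|mu|) <= 2^-1.

Lemma K_bound mu f M : small mu -> continuous f -> par s f -> 0 <= M ->
  (forall x, `|f x| <= M * 1) -> forall x, `|K (Vmul mu f) x| <= M / 2 * 1.
Proof.
move=> sm cf pf M0 fM x.
have [_ _ _ _ h] := HK (Vmul_locint mu cf) (Vmul_par mu pf).
apply: le_trans (h x) _; rewrite mulr1.
have fM' y : `|f y| <= M by rewrite -[leRHS]mulr1.
have := Vmul_bound mu cf fM'; have := sm; rewrite /small.
set A := itg _ _ _; set B := m + _ => h1 h2.
apply: le_trans (ler_wpM2l H0 h2) _; rewrite mulrCA.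
by rewrite ler_wpM2l.
Qed.

Lemma Vmul_B mu f g x : continuous f -> par s f -> continuous g -> par s g ->
  K (Vmul mu (fun y => f y - g y)) x = K (Vmul mu f) x - K (Vmul mu g) x.
Proof.
move=> cf pf cg pg.
have := @window_linear 1 (-1) (Vmul mu f) (Vmul mu g) (Vmul_locint mu cf)
  (Vmul_par mu pf) (Vmul_locint mu cg) (Vmul_par mu pg) x.
rewrite mul1r mulN1r => <-; congr (K _ _); apply/funext => y; rewrite /Vmul; ring.
Qed.

Lemma K_cont mu f : continuous f -> par s f -> continuous (K (Vmul mu f)) /\ par s (K (Vmul mu f)).
Proof.
move=> cf pf; have [D p _ _ _] := HK (Vmul_locint mu cf) (Vmul_par mu pf).
by split=> //; exact: D2_cont D.
Qed.

Lemma isF_exists mu u M : small mu -> continuous u -> par s u -> 0 <= M ->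
  (forall x, `|u x| <= M) -> exists f, isF mu u f /\ forall x, `|f x| <= 2 * M.
Proof.
move=> sm cu pu M0 uM.
have uM' x : `|u x| <= M * 1 by rewrite mulr1.
have [f [[cf pf] fE fM]] := @contraction_fixpoint R (fun=> 1) (fun f => K (Vmul mu f)) (par s) 1
  (fun _ => ltr01) (fun _ => lexx _) (@parD R s) (@parB R s) (@par_lim R s)
  (fun f '(conj cf pf) => K_cont mu cf pf)
  (fun f g '(conj cf pf) '(conj cg pg) x => Vmul_B mu x cf pf cg pg)
  (fun f M '(conj cf pf) M0 fM => K_bound sm cf pf M0 fM) u M (conj cu pu) M0 uM'.
by exists f; split=> // x; rewrite -[leRHS]mulr1.
Qed.

Lemma isF_le mu u f M : small mu -> isF mu u f -> 0 <= M -> (forall x, `|u x| <= M) ->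
  forall x, `|f x| <= 2 * M.
Proof.
move=> sm [cf pf fE] M0 uM x.
have [N N0 fN] := par_bounded s1 cf pf.
have uM' y : `|u y| <= M * 1 by rewrite mulr1.
have fN' y : `|f y| <= N * 1 by rewrite mulr1.
have := @contraction_le R (fun=> 1) (fun f => K (Vmul mu f)) (par s)
  (fun _ => ltr01)
  (fun f M '(conj cf pf) M0 fM => K_bound sm cf pf M0 fM) f u N M (conj cf pf) N0 M0 fN' uM' fE x.
by rewrite mulr1.
Qed.

Lemma isF_lin mu a b u v f g : isF mu u f -> isF mu v g ->
  isF mu (fun x => a * u x + b * v x) (fun x => a * f x + b * g x).
Proof.
move=> [cf pf fE] [cg pg gE]; split.
- by apply: continuousDf; exact: continuousZf.
- by apply: parD; exact: parZ.
move=> x; rewrite fE gE.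
have := @window_linear a b (Vmul mu f) (Vmul mu g) (Vmul_locint mu cf)
  (Vmul_par mu pf) (Vmul_locint mu cg) (Vmul_par mu pg) x.
rewrite (_ : (fun x => _) = Vmul mu (fun y => a * f y + b * g y)); last first.
  by apply/funext => y; rewrite /Vmul; ring.
by move=> ->; ring.
Qed.

Lemma isF_uniq mu u f g : small mu -> isF mu u f -> isF mu u g -> f =1 g.
Proof.
move=> sm Ff Fg x.
have := @isF_le mu (fun x => 1 * u x + -1 * u x) (fun x => 1 * f x + -1 * g x) 0 sm
  (isF_lin 1 (-1) Ff Fg) (lexx 0).
rewrite mulr0 => h; have /h h' : forall y, `|1 * u y + -1 * u y| <= 0.
  by move=> y; rewrite mul1r mulN1r subrr normr0.
have := h' x; rewrite normr_le0 mul1r mulN1r subr_eq0 => /eqP //.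
Qed.

Lemma isF_ip mu u f : continuous u -> isF mu u f ->
  ip f e1 = ip u e1 /\ ip f e2 = ip u e2.
Proof.
move=> cu [cf pf fE]; have [D p i1 i2 _] := HK (Vmul_locint mu cf) (Vmul_par mu pf).
have cK := D2_cont D.
have -> : f = fun x => u x + K (Vmul mu f) x by exact/funext.
by rewrite !ipD ?i1 ?i2 ?addr0//; exact: continuous_locint.
Qed.

Variables (mu : R) (sm : small mu) (f1 f2 : R -> R).
Hypotheses (F1 : isF mu e1 f1) (F2 : isF mu e2 f2).

(** [S e_i f_j] are the entries of the reduced matrix, up to the factor [kap]. The part in [mu] is
    diagonal and is moved to the right-hand side. *)
Definition S e f := ip (fun x => q x * f x) e.

Let cf1 : continuous f1. Proof. by case: F1. Qed.
Let cf2 : continuous f2. Proof. by case: F2. Qed.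

Lemma ip_Vmul f e : continuous f -> continuous e -> ip (Vmul mu f) e = S e f - mu * ip f e.
Proof.
move=> cf ce; rewrite /S -ipZ//; last exact: continuous_locint.
rewrite -ipB//; [|exact: locintM|by apply: locintZ; exact: continuous_locint].
by apply: eq_itg => x; rewrite /Vmul mulrBl.
Qed.

(** With [V = q - mu], the product of [V f1] with [e2 = f2 - K (V f2)] is symmetric in the two
    indices: multiplication by [V] is symmetric, and so is [K] by Green's identity over a period. *)
Lemma S_sym : S e1 f2 = S e2 f1.
Proof.
have [_ pf1 E1] := F1; have [_ pf2 E2] := F2.
have l1 := Vmul_locint mu cf1; have l2 := Vmul_locint mu cf2.
have [D1 p1 i11 i12 _] := HK l1 (Vmul_par mu pf1).
have [D2 p2 i21 i22 _] := HK l2 (Vmul_par mu pf2).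
have c1 := D2_cont D1; have c2 := D2_cont D2.
have dp1 := derive_par D1.1 p1; have dp2 := derive_par D2.1 p2.
have := green_par ss D1 D2 p1 dp1 p2 dp2.
(* For [g] orthogonal to the plane the projection term in the equation of [K v] drops out. *)
have lin v g : locint v -> continuous (K v) -> continuous g -> ip g e1 = 0 -> ip g e2 = 0 ->
    ip (fun x => v x - Pi v x - k2 * K v x) g = ip v g - k2 * ip (K v) g.
  move=> lv cK cg g1 g2; have lK := continuous_locint cK.
  have la : locint (fun x => kap * ip v e1 * e1 x) by exact: locintZ.
  have lb : locint (fun x => kap * ip v e2 * e2 x) by exact: locintZ.
  have lP : locint (Pi v) by exact: locintD.
  rewrite (@ipB R (fun x => v x - Pi v x))//; last 2 first.
  - exact: locintB.
  - exact: locintZ.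
  rewrite ipB// ipZ// /Proj ipD// !ipZ//.
  by rewrite (ipC e1) (ipC e2) g1 g2 !mulr0 addr0 subr0.
rewrite !lin// (ipC (K (Vmul mu f2)) (K (Vmul mu f1))) => /addIr sym.
have t1 : ip (Vmul mu f1) e2 = ip (Vmul mu f1) f2 - ip (Vmul mu f1) (K (Vmul mu f2)).
  rewrite !(ipC (Vmul mu f1)) /ip -itgB.
  - by apply: eq_itg => x; rewrite E2; ring.
  - by rewrite (_ : (fun x => _) = fun x => Vmul mu f1 x * f2 x); [exact: locintM|apply/funext => x; exact: mulrC].
  - by rewrite (_ : (fun x => _) = fun x => Vmul mu f1 x * K (Vmul mu f2) x); [exact: locintM|apply/funext => x; exact: mulrC].
have t2 : ip (Vmul mu f2) e1 = ip (Vmul mu f2) f1 - ip (Vmul mu f2) (K (Vmul mu f1)).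
  rewrite !(ipC (Vmul mu f2)) /ip -itgB.
  - by apply: eq_itg => x; rewrite E1; ring.
  - by rewrite (_ : (fun x => _) = fun x => Vmul mu f2 x * f1 x); [exact: locintM|apply/funext => x; exact: mulrC].
  - by rewrite (_ : (fun x => _) = fun x => Vmul mu f2 x * K (Vmul mu f1) x); [exact: locintM|apply/funext => x; exact: mulrC].
have t3 : ip (Vmul mu f1) f2 = ip (Vmul mu f2) f1.
  by apply: eq_itg => x; rewrite /Vmul; ring.
move: t1 t2; rewrite t3 sym => t1 t2.
have : ip (Vmul mu f1) e2 = ip (Vmul mu f2) e1 by rewrite t1 t2.
rewrite !ip_Vmul//.
have [_ ->] := isF_ip ce1 F1; have [-> _] := isF_ip ce2 F2.
by rewrite (ipC e2 e1) o12 !mulr0 !subr0.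
Qed.

(** Green's identity with [e1] and [e2] shows that [(q - mu) f] is orthogonal to the plane. Then
    [f - K ((q - mu) f)] solves the homogeneous equation, so it is [a e1 + b e2], and uniqueness in
    the range equation gives [f = a f1 + b f2]; the orthogonality becomes the linear system. *)
Lemma window_eigen f f' : D2 f f' (fun x => Vmul (k2 + mu) f x) -> par s f ->
  let a := kap * ip f e1 in let b := kap * ip f e2 in
  [/\ forall x, f x = a * f1 x + b * f2 x,
      a * S e1 f1 + b * S e1 f2 = mu * (a * ip e1 e1) &
      a * S e2 f1 + b * S e2 f2 = mu * (b * ip e2 e2)].
Proof.
move=> Df pf a b.
have cab : continuous (fun x => a * e1 x + b * e2 x) by apply: continuousDf; exact: continuousZf.
have cf := D2_cont Df; have lf := continuous_locint cf.
have pf' := derive_par Df.1 pf.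
have lV := Vmul_locint mu cf; have pV := Vmul_par mu pf.
have V0 e e' : D2 e e' (fun x => - k2 * e x) -> par s e -> ip (Vmul mu f) e = 0.
  move=> De pe; have := green_par ss Df De pf pf' pe (derive_par De.1 pe).
  have ce := D2_cont De; have le := continuous_locint ce.
  rewrite (ipZ _ le cf) (ipC e f).
  rewrite (_ : Vmul (k2 + mu) f = fun x => Vmul mu f x - k2 * f x); last first.
    by apply/funext => x; rewrite /Vmul; ring.
  rewrite ipB//; last exact: locintZ.
  by rewrite ipZ//; lra.
have z1 := V0 _ _ De1 pe1; have z2 := V0 _ _ De2 pe2.
have [DK pK i1 i2 _] := HK lV pV.
have cK := D2_cont DK; have lK := continuous_locint cK.
have Fz x : f x - K (Vmul mu f) x = a * e1 x + b * e2 x.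
  have Dz : D2 (fun x => f x - K (Vmul mu f) x) (fun x => f' x - K1 (Vmul mu f) x)
      (fun x => - k2 * (f x - K (Vmul mu f) x)).
    apply: D2_ext (D2B Df DK) => y //=; rewrite /Proj z1 z2 /Vmul; ring.
  have := HU Dz (parB pf pK) x; rewrite /Proj !ipB// i1 i2 !subr0.
  by move=> ->.
have Ff : isF mu (fun x => a * e1 x + b * e2 x) f.
  by split=> // x; rewrite -Fz subrK.
have fE x : f x = a * f1 x + b * f2 x.
  exact: (isF_uniq sm Ff (isF_lin a b F1 F2)).
split=> //.
- move: z1; rewrite ip_Vmul// => /eqP; rewrite subr_eq0 => /eqP.
  have [-> _] := isF_ip cab Ff.
  rewrite ipD//; [|exact: locintZ|exact: locintZ].
  rewrite !ipZ// (ipC e2 e1) o12 mulr0 addr0 => <-.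
  rewrite /S -!ipZ; [|exact: locintM|by []|exact: locintM|by []].
  rewrite -ipD//; [|by apply: locintZ; exact: locintM|by apply: locintZ; exact: locintM].
  by apply: eq_itg => x; rewrite fE; ring.
- move: z2; rewrite ip_Vmul// => /eqP; rewrite subr_eq0 => /eqP.
  have [_ ->] := isF_ip cab Ff.
  rewrite ipD//; [|exact: locintZ|exact: locintZ].
  rewrite !ipZ// o12 mulr0 add0r => <-.
  rewrite /S -!ipZ; [|exact: locintM|by []|exact: locintM|by []].
  rewrite -ipD//; [|by apply: locintZ; exact: locintM|by apply: locintZ; exact: locintM].
  by apply: eq_itg => x; rewrite fE; ring.
Qed.

(** The linear system says that [(q - mu) f] is orthogonal to the plane, so the projection term in
    the range equation vanishes and [f] is a genuine solution. *)
Lemma window_eigenC a b :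
  a * S e1 f1 + b * S e1 f2 = mu * (a * ip e1 e1) ->
  a * S e2 f1 + b * S e2 f2 = mu * (b * ip e2 e2) ->
  let f x := a * f1 x + b * f2 x in
  par s f /\ exists f', D2 f f' (fun x => Vmul (k2 + mu) f x).
Proof.
move=> h1 h2 f.
have cab : continuous (fun x => a * e1 x + b * e2 x) by apply: continuousDf; exact: continuousZf.
have [cf pf fE] := isF_lin a b F1 F2; split=> //.
have lV := Vmul_locint mu cf; have pV := Vmul_par mu pf.
have [DK pK i1 i2 _] := HK lV pV.
have z1 : ip (Vmul mu f) e1 = 0.
  rewrite ip_Vmul//; have [-> _] := isF_ip cab (isF_lin a b F1 F2).
  rewrite ipD//; [|exact: locintZ|exact: locintZ].
  rewrite !ipZ// (ipC e2 e1) o12 mulr0 addr0 -h1.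
  rewrite /S -!ipZ; [|exact: locintM|by []|exact: locintM|by []].
  rewrite -ipD//; [|by apply: locintZ; exact: locintM|by apply: locintZ; exact: locintM].
  by apply/eqP; rewrite subr_eq0; apply/eqP; apply: eq_itg => x; rewrite /f; ring.
have z2 : ip (Vmul mu f) e2 = 0.
  rewrite ip_Vmul//; have [_ ->] := isF_ip cab (isF_lin a b F1 F2).
  rewrite ipD//; [|exact: locintZ|exact: locintZ].
  rewrite !ipZ// o12 mulr0 add0r -h2.
  rewrite /S -!ipZ; [|exact: locintM|by []|exact: locintM|by []].
  rewrite -ipD//; [|by apply: locintZ; exact: locintM|by apply: locintZ; exact: locintM].
  by apply/eqP; rewrite subr_eq0; apply/eqP; apply: eq_itg => x; rewrite /f; ring.
exists (fun x => a * e1' x + b * e2' x + K1 (Vmul mu f) x).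
apply: D2_ext (D2D (D2D (D2Z a De1) (D2Z b De2)) DK) => x //=; first by rewrite -fE.
rewrite /Proj z1 z2 mulr0 !mul0r addr0 subr0.
have -> : Vmul (k2 + mu) f x = Vmul mu f x - k2 * f x by rewrite /Vmul; ring.
have := fE x; rewrite -/f -/(f x).
by move: (K _ x) (Vmul mu f x) (f x) => A B C ->; ring.
Qed.

(** The remainder [K ((q - mu) f)] itself solves the range equation, with source [K (q u)]: the part
    [mu u] is killed by [K u = 0], so no term of order [mu] is left. *)
Lemma isF_rem u f : continuous u -> par s u -> (forall x, `|u x| <= 1) ->
  (forall x, K u x = 0) -> isF mu u f -> forall x, `|K (Vmul mu f) x| <= 2 * (H * m).
Proof.
move=> cu pu bu Ku [cf pf fE].
have [cK pK] := K_cont mu cf pf.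
have lqu : locint (fun x => q x * u x) by exact: locintM.
have pqu : par s (fun x => q x * u x) by exact: par1M.
have [_ _ _ _ hb] := HK lqu pqu.
apply: (@isF_le mu (K (fun x => q x * u x))) => //; last 2 first.
- by rewrite mulr_ge0.
- move=> x; apply: le_trans (hb x) _; rewrite ler_wpM2l//.
  by rewrite -[leRHS]mul1r; exact: qmul_bound.
split=> // x.
have lu := continuous_locint cu.
have Vu : K (Vmul mu u) x = K (fun x => q x * u x) x.
  rewrite (_ : Vmul mu u = fun x => 1 * (q x * u x) + - mu * u x).
    by rewrite (window_linear 1 (- mu) lqu pqu lu pu) Ku mulr0 addr0 mul1r.
  by apply/funext => y; rewrite /Vmul; ring.
rewrite -Vu.
have := window_linear 1 1 (Vmul_locint mu cu) (Vmul_par mu pu)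
  (Vmul_locint mu cK) (Vmul_par mu pK) x.
rewrite !mul1r => <-; congr (K _ _); apply/funext => y; rewrite !mul1r {1}/Vmul fE /Vmul; ring.
Qed.

Lemma S_first_order e u f : continuous e -> (forall x, `|e x| <= 1) ->
  continuous u -> par s u -> (forall x, `|u x| <= 1) ->
  (forall x, K u x = 0) -> isF mu u f ->
  `|S e f - S e u| <= 2 * (H * m ^+ 2).
Proof.
move=> ce be cu pu bu Ku Ff.
have := isF_rem cu pu bu Ku Ff; case: Ff => [cf pf fE] hr.
have [cK pK] := K_cont mu cf pf.
rewrite /S -ipB//; [|exact: locintM|exact: locintM].
rewrite (_ : (fun x => _) = fun x => q x * K (Vmul mu f) x); last first.
  by apply/funext => x; rewrite {1}fE; ring.
apply: (le_trans (ip_norm_le (locintM lq cK) ce be)).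
rewrite mul1r; apply: (le_trans (qmul_bound cK hr)).
by rewrite expr2 !mulrA.
Qed.

End Potential.

(** [f - f'] solves the range equation at [mu] with source [(mu' - mu) K f']. *)
Lemma isF_lip q mu mu' u f f' : locint q -> par 1 q ->
  small q mu -> continuous u -> (forall x, `|u x| <= 1) ->
  (forall x, `|f' x| <= 2) ->
  isF q mu u f -> isF q mu' u f' ->
  forall x, `|f x - f' x| <= 4 * (H * T * `|mu - mu'|).
Proof.
move=> lq pq sm cu bu bf' [cf pf fE] [cf' pf' fE'] x.
have lf' := continuous_locint cf'.
have [DK pK _ _ hK] := HK lf' pf'.
have cK := D2_cont DK.
have Fd : isF q mu (fun x => (mu' - mu) * K f' x) (fun x => f x - f' x).
  split; [exact: continuousBf|exact: parB|move=> y].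
  rewrite Vmul_B// fE fE'.
  have -> : K (Vmul q mu' f') y = K (fun x => 1 * Vmul q mu f' x + - (mu' - mu) * f' x) y.
    by congr (K _ _); apply/funext => t; rewrite /Vmul; ring.
  rewrite window_linear//; [ring|exact: Vmul_locint|exact: Vmul_par].
have h : 0 <= 2 * (H * T * `|mu - mu'|) by rewrite !mulr_ge0// T_ge0.
have := @isF_le q lq pq mu _ _ _ sm Fd h.
move=> h'; apply: le_trans (h' _ x) _; last by rewrite le_eqVlt; apply/orP; left; apply/eqP; ring.
move=> y.
rewrite normrM distrC.
have := hK y; have := norm_bound cf' bf' => h1 h2.
have h3 : `|K f' y| <= H * (2 * T) by apply: le_trans h2 _; rewrite ler_wpM2l.
have := ler_wpM2l (normr_ge0 (mu - mu')) h3; move=> h4; apply: le_trans h4 _.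
by rewrite le_eqVlt; apply/orP; left; apply/eqP; ring.
Qed.

Lemma S_lip q mu mu' u f f' e : locint q -> par 1 q ->
  small q mu -> continuous u -> (forall x, `|u x| <= 1) ->
  continuous e -> (forall x, `|e x| <= 1) ->
  (forall x, `|f' x| <= 2) ->
  isF q mu u f -> isF q mu' u f' ->
  `|S q e f - S q e f'| <= 4 * (H * T * itg (fun x => `|q x|) 0 T) * `|mu - mu'|.
Proof.
move=> lq pq sm cu bu ce be bf' Ff Ff'.
have h := isF_lip lq pq sm cu bu bf' Ff Ff'.
have [cf _ _] := Ff; have [cf' _ _] := Ff'.
rewrite /S -ipB//; [|exact: locintM|exact: locintM].
rewrite (_ : (fun x => _) = fun x => q x * (f x - f' x)); last first.
  by apply/funext => x; ring.
have cd : continuous (fun x => f x - f' x) by exact: continuousBf.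
apply: (le_trans (ip_norm_le (locintM lq cd) ce be)).
rewrite mul1r; apply: (le_trans (qmul_bound lq cd h)).
by rewrite le_eqVlt; apply/orP; left; apply/eqP; ring.
Qed.


Section Roots.
Variable q : R -> R.
Hypotheses (lq : locint q) (pq : par 1 q).
Let m := itg (fun x => `|q x|) 0 T.
Hypothesis mw : m <= wm.
Hypotheses (kap0 : 0 < kap) (kap1 : kap <= 2^-1) (H128 : H <= 128).

Let m0 : 0 <= m.
Proof. by apply: itg_ge0; [exact: T_ge0|exact: locint_norm|]. Qed.

Let sm mu : `|mu| <= wr -> small q mu.
Proof.
move=> mr; rewrite /small -/m.
apply: (@le_trans _ _ (128 * (wm + 8 * wr))); last exact: wr_wm1.
apply: ler_pM => //; first by rewrite addr_ge0// mulr_ge0// T_ge0.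
apply: lerD; first exact: mw.
by apply: ler_pM; [exact: T_ge0|exact: normr_ge0|exact: T_le8|exact: mr].
Qed.

(** The bound on [mu] stands inside the existential so that the chosen [F1] and [F2] are total
    functions of [mu]. *)
Let Fex u mu : continuous u -> par s u -> (forall x, `|u x| <= 1) ->
  exists f, `|mu| <= wr -> isF q mu u f /\ forall x, `|f x| <= 2.
Proof.
move=> cu pu bu; have [mr|mr] := pselect (`|mu| <= wr); last by exists u.
have [f [Ff fb]] := isF_exists lq pq (sm mr) cu pu ler01 bu.
by exists f => _; split=> // x; have := fb x; rewrite mulr1.
Qed.

Let F1 mu := sval (cid (Fex mu ce1 pe1 be1)).
Let F2 mu := sval (cid (Fex mu ce2 pe2 be2)).
Let F1P mu (mr : `|mu| <= wr) : isF q mu e1 (F1 mu).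
Proof. by rewrite /F1; case: cid => f /= /(_ mr)[]. Qed.
Let F2P mu (mr : `|mu| <= wr) : isF q mu e2 (F2 mu).
Proof. by rewrite /F2; case: cid => f /= /(_ mr)[]. Qed.
Let F1b mu (mr : `|mu| <= wr) x : `|F1 mu x| <= 2.
Proof. by rewrite /F1; case: cid => f /= /(_ mr)[]. Qed.
Let F2b mu (mr : `|mu| <= wr) x : `|F2 mu x| <= 2.
Proof. by rewrite /F2; case: cid => f /= /(_ mr)[]. Qed.

Let A mu := kap * S q e1 (F1 mu).
Let B mu := kap * S q e1 (F2 mu).
Let C mu := kap * S q e2 (F2 mu).

Let Sb e f : continuous f -> (forall x, `|f x| <= 2) -> continuous e ->
  (forall x, `|e x| <= 1) -> `|kap * S q e f| <= wr / 8.
Proof.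
move=> cf fb ce be; rewrite normrM gtr0_norm//.
have h1 := ip_norm_le (locintM lq cf) ce be; rewrite mul1r in h1.
have h2 := qmul_bound lq cf fb.
apply: (@le_trans _ _ (2^-1 * (2 * wm))); last exact: wr_wm2.
rewrite ler_pM ?(ltW kap0)//; apply: (le_trans h1); apply: (le_trans h2).
by rewrite ler_wpM2l.
Qed.

Let Lc : kap * (4 * (H * T * m)) <= 40^-1.
Proof.
apply: (@le_trans _ _ (2^-1 * (4 * (128 * 8 * wm)))); last exact: wm3.
rewrite ler_pM ?(ltW kap0) ?mulr_ge0 ?T_ge0// ler_wpM2l// ler_pM ?mulr_ge0 ?T_ge0//.
by rewrite ler_pM ?T_ge0// T_le8.
Qed.

Let Sl e u f f' mu mu' : `|mu| <= wr -> continuous u -> (forall x, `|u x| <= 1) ->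
  continuous e -> (forall x, `|e x| <= 1) -> (forall x, `|f' x| <= 2) ->
  isF q mu u f -> isF q mu' u f' ->
  `|kap * S q e f - kap * S q e f'| <= 40^-1 * `|mu - mu'|.
Proof.
move=> mr cu bu ce be bf' Ff Ff'.
have := S_lip lq pq (sm mr) cu bu ce be bf' Ff Ff'; rewrite -/m => h.
rewrite -mulrBr normrM gtr0_norm//.
apply: le_trans (ler_wpM2l (ltW kap0) h) _; rewrite (mulrA kap (4 * _)).
by apply: ler_wpM2r Lc; exact: normr_ge0.
Qed.

Let ker_e a b x : K (fun x => a * e1 x + b * e2 x) x = 0.
Proof. exact: window_ker. Qed.

Let Ke1 x : K e1 x = 0.
Proof.
rewrite -(ker_e 1 0 x); congr (K _ _); apply/funext => y; by rewrite mul1r mul0r addr0.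
Qed.

Let Ke2 x : K e2 x = 0.
Proof.
rewrite -(ker_e 0 1 x); congr (K _ _); apply/funext => y; by rewrite mul1r mul0r add0r.
Qed.

Let fo e u f mu : `|mu| <= wr -> continuous u -> par s u -> (forall x, `|u x| <= 1) ->
  (forall x, K u x = 0) -> continuous e -> (forall x, `|e x| <= 1) ->
  isF q mu u f -> `|kap * S q e f - kap * S q e u| <= H * m ^+ 2.
Proof.
move=> mr cu pu bu Ku ce be Ff.
have := S_first_order lq pq (sm mr) ce be cu pu bu Ku Ff; rewrite -/m => h.
rewrite -mulrBr normrM gtr0_norm//.
have hm : 0 <= 2 * (H * m ^+ 2) by rewrite !mulr_ge0// sqr_ge0.
apply: le_trans (ler_pM (ltW kap0) (normr_ge0 _) kap1 h) _.
by rewrite le_eqVlt; apply/orP; left; apply/eqP; field.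
Qed.

Let s11 := kap * S q e1 e1.
Let s22 := kap * S q e2 e2.
Let s12 := kap * S q e1 e2.

Section TwoDimensional.
Hypothesis o22n : kap * ip e2 e2 = 1.

(** After multiplication by [kap] the reduced system is an eigenvalue problem for the matrix of [A],
    [B], [C], and independence of [F1], [F2] transfers its kernels to eigenspaces. In the gap bounds
    the entries at [y] are replaced by their first-order values [s11], [s12], [s22], each with error
    [H * m ^+ 2]. *)
Lemma window_two_roots : exists x y : R,
  [/\ `|x - k2| < wr, `|y - k2| < wr, x <= y &
   [/\ forall l f, `|l - k2| <= wr -> l <> x -> l <> y -> eigset s q l f -> forall t, f t = 0,
       x = y -> has_dim (eigset s q x) 2,
       x < y -> has_dim (eigset s q x) 1 /\ has_dim (eigset s q y) 1,
       y - x <= 2 * (`|s11 - s22| + 2 * `|s12| + 4 * (H * m ^+ 2)) &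
       (`|s11 - s22| - 2 * (H * m ^+ 2)) / 2 <= y - x]].
Proof.
have cF1 mu (mr : `|mu| <= wr) : continuous (F1 mu) by have [] := F1P mr.
have cF2 mu (mr : `|mu| <= wr) : continuous (F2 mu) by have [] := F2P mr.
have wr0 := @wr_gt0 R.
have [x [y [xr yr xy [root dbl sgl gu gl]]]] := @two_roots R wr A B C wr0
  (fun mu mr => Sb (cF1 _ mr) (F1b mr) ce1 be1)
  (fun mu mr => Sb (cF2 _ mr) (F2b mr) ce1 be1)
  (fun mu mr => Sb (cF2 _ mr) (F2b mr) ce2 be2)
  (fun mu mu' mr mr' => Sl mr ce1 be1 ce1 be1 (F1b mr') (F1P mr) (F1P mr'))
  (fun mu mu' mr mr' => Sl mr ce2 be2 ce1 be1 (F2b mr') (F2P mr) (F2P mr'))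
  (fun mu mu' mr mr' => Sl mr ce2 be2 ce2 be2 (F2b mr') (F2P mr) (F2P mr')).
have kap0' : kap != 0 by rewrite gt_eqF.
have sym mu (mr : `|mu| <= wr) : kap * S q e2 (F1 mu) = B mu.
  by rewrite /B (S_sym lq pq (F1P mr) (F2P mr)).
have eigE mu (mr : `|mu| <= wr) f : eigset s q (k2 + mu) f ->
    exists a b, [/\ forall t, f t = a * F1 mu t + b * F2 mu t,
      a * A mu + b * B mu = mu * a & a * B mu + b * C mu = mu * b].
  move=> [pf [f' Df]].
  have [E1 E2 E3] := window_eigen lq pq (sm mr) (F1P mr) (F2P mr) Df pf.
  exists (kap * ip f e1), (kap * ip f e2); split=> //.
    move: (congr1 (fun r : R => kap * r) E2); rewrite mulrDr !(mulrCA kap) -/(A mu) -/(B mu).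
    by rewrite o11 mulr1.
  move: (congr1 (fun r : R => kap * r) E3); rewrite mulrDr !(mulrCA kap) (sym mu mr) -/(C mu).
  by rewrite o22n mulr1.
have eigC mu (mr : `|mu| <= wr) a b : a * A mu + b * B mu = mu * a ->
    a * B mu + b * C mu = mu * b ->
    eigset s q (k2 + mu) (fun t => a * F1 mu t + b * F2 mu t).
  move=> h1 h2.
  apply: (window_eigenC lq pq (F1P mr) (F2P mr)).
    apply: (mulfI kap0'); rewrite mulrDr !(mulrCA kap) -/(A mu) -/(B mu) h1.
    by rewrite o11 mulr1.
  apply: (mulfI kap0'); rewrite mulrDr !(mulrCA kap) (sym mu mr) -/(C mu) h2.
  by rewrite o22n mulr1.
have indep mu (mr : `|mu| <= wr) a b : (forall t, a * F1 mu t + b * F2 mu t = 0) ->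
    a = 0 /\ b = 0.
  move=> h.
  have lF1 : locint (F1 mu) by apply: continuous_locint; exact: cF1.
  have lF2 : locint (F2 mu) by apply: continuous_locint; exact: cF2.
  have [i11 i12] := isF_ip lq pq ce1 (F1P mr).
  have [i21 i22] := isF_ip lq pq ce2 (F2P mr).
  have z e : continuous e -> a * ip (F1 mu) e + b * ip (F2 mu) e = 0.
    move=> ce; rewrite -!ipZ// -ipD//; [|exact: locintZ|exact: locintZ].
    by rewrite /ip (@eq_itg _ _ (fun=> 0)) ?itg_cst ?mul0r// => t; rewrite h mul0r.
  have := z _ ce1; have := z _ ce2; rewrite i11 i12 i21 i22 (ipC e2 e1) o12 !mulr0 addr0 add0r.
  move=> h2 h1; split.
    by have := congr1 (fun r : R => kap * r) h1; rewrite mulrCA o11 mulr1 mulr0.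
  by have := congr1 (fun r : R => kap * r) h2; rewrite mulrCA o22n mulr1 mulr0.
exists (k2 + x), (k2 + y).
have dE (r : R) : k2 + r - k2 = r by ring.
rewrite !dE; split=> //; first by rewrite lerD2l.
have single mu : mu = x \/ mu = y -> x < y -> has_dim (eigset s q (k2 + mu)) 1.
  move=> muxy ltxy.
  have mr : `|mu| <= wr by case: muxy => ->; exact: ltW.
  have nd := sgl ltxy mu muxy.
  have dt := (root mu mr).2 muxy.
  have [g1 [g2 [gn gA gB gs]]] := sym2_kernel_line dt nd.
  apply: (@has_dim1 _ _ (fun t => g1 * F1 mu t + g2 * F2 mu t)).
  - exact: eigC.
  - apply: contrapT => h; have [|u v] := indep mu mr g1 g2.
      by move=> t; apply/eqP; apply: contraT => ht; exfalso; apply: h; exists t.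
    by move: gn; rewrite u v eqxx.
  - move=> f /(eigE mu mr) [a [b [fE h1 h2]]]; have [c [ca cb]] := gs a b h1 h2.
    by exists c => t; rewrite fE ca cb; ring.
have e12 := fo (ltW yr) ce1 pe1 be1 Ke1 ce1 be1 (F1P (ltW yr)).
have e22 := fo (ltW yr) ce2 pe2 be2 Ke2 ce2 be2 (F2P (ltW yr)).
have eb := fo (ltW yr) ce2 pe2 be2 Ke2 ce1 be1 (F2P (ltW yr)).
rewrite -/(A y) in e12; rewrite -/(C y) in e22; rewrite -/(B y) -/s12 in eb.
rewrite -/s11 in e12; rewrite -/s22 in e22.
have gapE : k2 + y - (k2 + x) = y - x by ring.
have AC : `|(A y - C y) - (s11 - s22)| <= 2 * (H * m ^+ 2).
  have -> : A y - C y - (s11 - s22) = (A y - s11) - (C y - s22) by ring.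
  exact: ler_normB2.
split.
- move=> l f lr lx ly ef t.
  pose mu := l - k2; have lE : l = k2 + mu by rewrite /mu; ring.
  move: ef; rewrite lE => /(eigE mu lr) [a [b [-> h1 h2]]].
  have nr : ~ (mu = x \/ mu = y).
    by move=> [e|e]; [apply: lx|apply: ly]; rewrite lE e.
  have dt : (A mu - mu) * (C mu - mu) - B mu ^+ 2 != 0.
    by apply/eqP => /eqP; rewrite subr_eq0 => /eqP /(root mu lr).
  (* Cramer's rule: the determinant times each unknown is a combination of the two equations. *)
  have a0 : a = 0.
    apply: (mulIf dt); rewrite mul0r.
    have : (C mu - mu) * (a * A mu + b * B mu - mu * a) - B mu * (a * B mu + b * C mu - mu * b) = 0.
      by rewrite h1 h2 !subrr !mulr0 subr0.
    by move=> <-; ring.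
  have b0 : b = 0.
    apply: (mulIf dt); rewrite mul0r.
    have : (A mu - mu) * (a * B mu + b * C mu - mu * b) - B mu * (a * A mu + b * B mu - mu * a) = 0.
      by rewrite h1 h2 !subrr !mulr0 subr0.
    by move=> <-; ring.
  by rewrite a0 b0 !mul0r addr0.
- move=> /addrI e; have [Ax Cx Bx] := dbl e; have mr := ltW xr.
  apply: (@has_dim2 _ _ (F1 x) (F2 x)).
  + have := eigC x mr 1 0; rewrite Ax Bx => /(_ ltac:(ring) ltac:(ring)).
    by rewrite (_ : (fun t => _) = F1 x)//; apply/funext => t; ring.
  + have := eigC x mr 0 1; rewrite Cx Bx => /(_ ltac:(ring) ltac:(ring)).
    by rewrite (_ : (fun t => _) = F2 x)//; apply/funext => t; ring.
  + exact: indep.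
  + by move=> f /(eigE x mr) [a [b [fE _ _]]]; exists a, b.
- rewrite ltrD2l => ltxy; split; apply: single => //; by [left|right].
- rewrite gapE; apply: le_trans gu _; rewrite ler_wpM2l//.
  exact: combine_bounds (ler_norm_near AC) (ler_norm_near eb).
- rewrite gapE; apply: le_trans _ gl; rewrite ler_wpM2r// lerBlDr.
  by apply: ler_norm_near; rewrite distrC.
Qed.

End TwoDimensional.

(** The reduced matrix has a single entry, so one fixed point replaces the two branches. *)
Lemma window_one_root : (forall x, e2 x = 0) -> exists x : R,
  [/\ `|x - k2| < wr, has_dim (eigset s q x) 1 &
      forall l f, `|l - k2| <= wr -> l <> x -> eigset s q l f -> forall t, f t = 0].
Proof.
move=> e20.
have wr0 := @wr_gt0 R.
have cF1 mu (mr : `|mu| <= wr) : continuous (F1 mu) by have [] := F1P mr.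
have h8 : wr / 8 < wr :> R by rewrite ltr_pdivrMr// ltr_pMr//; lra.
have h40 : 40^-1 <= 2^-1 :> R by lra.
have [x [xr hx ux]] := @lipschitz_fixpoint R A wr wr0
  (fun mu mr => le_lt_trans (Sb (cF1 _ mr) (F1b mr) ce1 be1) h8)
  (fun mu mu' mr mr' => le_trans (Sl mr ce1 be1 ce1 be1 (F1b mr') (F1P mr) (F1P mr'))
     (ler_wpM2r (normr_ge0 _) h40)).
have F20 mu : isF q mu e2 e2.
  split=> // t; rewrite e20 add0r.
  rewrite (_ : Vmul q mu e2 = fun x => 0 * e1 x + 0 * e2 x) ?ker_e//.
  by apply/funext => y; rewrite /Vmul e20 !mulr0 mul0r addr0.
have S20 e : continuous e -> S q e e2 = 0.
  by move=> ce; rewrite /S /ip (@eq_itg _ _ (fun=> 0)) ?itg_cst ?mul0r// => t; rewrite e20 mulr0 mul0r.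
have S02 f : S q e2 f = 0.
  by rewrite /S /ip (@eq_itg _ _ (fun=> 0)) ?itg_cst ?mul0r// => t; rewrite e20 mulr0.
have i22 : ip e2 e2 = 0.
  by rewrite /ip (@eq_itg _ _ (fun=> 0)) ?itg_cst ?mul0r// => t; rewrite e20 mulr0.
have kap0' : kap != 0 by rewrite gt_eqF.
have eigE mu (mr : `|mu| <= wr) f : eigset s q (k2 + mu) f ->
    exists a, (forall t, f t = a * F1 mu t) /\ a * A mu = mu * a.
  move=> [pf [f' Df]].
  have [E1 E2 E3] := window_eigen lq pq (sm mr) (F1P mr) (F20 mu) Df pf.
  exists (kap * ip f e1); split; first by move=> t; rewrite E1 e20 mulr0 addr0.
  move: (congr1 (fun r : R => kap * r) E2); rewrite S20// mulr0 addr0 mulrCA -/(A mu) => ->.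
  by rewrite !(mulrCA kap) o11 mulr1.
have eigC mu (mr : `|mu| <= wr) : A mu = mu -> eigset s q (k2 + mu) (F1 mu).
  move=> h1.
  have := @window_eigenC q lq pq mu (F1 mu) e2 (F1P mr) (F20 mu) 1 0.
  rewrite !S20// S02 i22 !mulr0 !addr0 !mul1r => /(_ _ erefl).
  rewrite (_ : (fun x => _) = F1 mu); last by apply/funext => t; rewrite mul1r mul0r addr0.
  by apply; apply: (mulfI kap0'); rewrite -/(A mu) h1 mulrCA o11 mulr1.
exists (k2 + x); split; first by rewrite addrAC subrr add0r.
  apply: (@has_dim1 _ _ (F1 x)).
  - exact: eigC (ltW xr) hx.
  - apply: contrapT => h.
    have F0 t : F1 x t = 0 by apply/eqP; apply: contraT => ht; exfalso; apply: h; exists t.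
    have [i1 _] := isF_ip lq pq ce1 (F1P (ltW xr)).
    have : ip (F1 x) e1 = 0 by rewrite /ip (@eq_itg _ _ (fun=> 0)) ?itg_cst ?mul0r// => t; rewrite F0 mul0r.
    by rewrite i1 => i0; move: o11; rewrite i0 mulr0 => /eqP; rewrite eq_sym oner_eq0.
  - by move=> f /(eigE x (ltW xr)) [a [fE _]]; exists a.
move=> l f lr lx ef t.
pose mu := l - k2; have lE : l = k2 + mu by rewrite /mu; ring.
move: ef; rewrite lE => /(eigE mu lr) [a [-> h1]].
have [->|a0] := eqVneq a 0; first by rewrite mul0r.
exfalso; apply: lx; rewrite lE; congr (_ + _); apply: ux => //.
by apply: (mulfI a0); rewrite h1 mulrC.
Qed.

End Roots.

End Window.

(** * Parities and mean values of trigonometric functions *)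

Section Trig.
Context {R : realType}.
Notation T := (pi *+ 2 : R).

Lemma cosDpin (x : R) n : cos (x + pi *+ n) = (-1) ^+ n * cos x.
Proof. by rewrite (alternatingn (@cosDpi R)). Qed.

Lemma sinDpin (x : R) n : sin (x + pi *+ n) = (-1) ^+ n * sin x.
Proof. by rewrite (alternatingn (@sinDpi R)). Qed.

Lemma sgn_sqr n : ((-1) ^+ n * (-1) ^+ n : R) = 1.
Proof. by rewrite -expr2 sqrr_sign. Qed.

Lemma par_cosh (n : nat) : par ((-1) ^+ n) (fun x : R => cos (n%:R / 2 * x)).
Proof.
move=> x; rewrite -cosDpin; congr cos.
by rewrite -(mulr_natl pi n) -(mulr_natl pi 2); field.
Qed.

Lemma par_sinh (n : nat) : par ((-1) ^+ n) (fun x : R => sin (n%:R / 2 * x)).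
Proof.
move=> x; rewrite -sinDpin; congr sin.
by rewrite -(mulr_natl pi n) -(mulr_natl pi 2); field.
Qed.

Lemma sinnT (n : nat) : sin (n%:R * T) = 0.
Proof.
have := sinDpin 0 (n * 2)%N; rewrite add0r sin0 mulr0 => <-; congr sin.
by rewrite mulr_natl -mulrnA mulnC.
Qed.

Lemma cosnT (n : nat) : cos (n%:R * T) = 1.
Proof.
have := cosDpin 0 (n * 2)%N; rewrite add0r cos0 mulr1 exprM -signr_odd => h.
rewrite (_ : n%:R * T = pi *+ (n * 2)); last first.
  by rewrite mulr_natl -mulrnA mulnC.
by rewrite h sqrr_sign.
Qed.

Lemma itg_cosn (n : nat) : (0 < n)%N -> itg (fun x : R => cos (n%:R * x)) 0 T = 0.
Proof.
move=> n0; have n0' : n%:R != 0 :> R by rewrite pnatr_eq0 -lt0n.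
have dF (x : R) : is_derive x (1 : R) (fun y => n%:R^-1 * sin (n%:R * y)) (cos (n%:R * x)).
  by apply: der_eq (derZ n%:R^-1 (der_sink n%:R x)) _; rewrite mulrA mulVf// mul1r.
rewrite (itg_FTC 0 T dF); last exact: continuous_cosk.
by rewrite sinnT !mulr0 sin0 mulr0 subrr.
Qed.

Lemma itg_sinn (n : nat) : itg (fun x : R => sin (n%:R * x)) 0 T = 0.
Proof.
case: n => [|n].
  by rewrite (@eq_itg _ _ (fun=> 0)) ?itg_cst ?mul0r// => x; rewrite mul0r sin0.
have n0' : n.+1%:R != 0 :> R by rewrite pnatr_eq0.
have dF (x : R) : is_derive x (1 : R) (fun y => - n.+1%:R^-1 * cos (n.+1%:R * y)) (sin (n.+1%:R * x)).
  by apply: der_eq (derZ (- n.+1%:R^-1) (der_cosk n.+1%:R x)) _; rewrite mulrNN mulrA mulVf// mul1r.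
rewrite (itg_FTC 0 T dF); last exact: continuous_sink.
by rewrite cosnT mulr0 cos0 subrr.
Qed.

End Trig.

(** * The Green operator at j^2/4 for j > 0 *)

Section OscillatingWindow.
Context {R : realType}.
Notation T := (pi *+ 2 : R).
Variable j : nat.
Hypothesis j0 : (0 < j)%N.
Let k : R := j%:R / 2.
Let s : R := (-1) ^+ j.
Let kap : R := pi^-1.
Let e1 (x : R) := cos (k * x).
Let e2 (x : R) := sin (k * x).
Let j0R : 0 < j%:R :> R. Proof. by rewrite ltr0n. Qed.

Let k0 : 0 < k. Proof. by rewrite divr_gt0. Qed.
Let k0' : k != 0. Proof. by rewrite gt_eqF. Qed.
Let ce1 : continuous e1. Proof. exact: continuous_cosk. Qed.
Let ce2 : continuous e2. Proof. exact: continuous_sink. Qed.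
Let le1 : locint e1. Proof. exact: continuous_locint. Qed.
Let le2 : locint e2. Proof. exact: continuous_locint. Qed.
Let be1 x : `|e1 x| <= 1. Proof. exact: cos_max. Qed.
Let be2 x : `|e2 x| <= 1. Proof. exact: sin_max. Qed.
Let pe1 : par s e1. Proof. exact: par_cosh. Qed.
Let pe2 : par s e2. Proof. exact: par_sinh. Qed.
Let s1 : `|s| = 1. Proof. by rewrite normrX normrN1 expr1n. Qed.
Let ss : s * s = 1. Proof. exact: sgn_sqr. Qed.
Let kap0 : 0 <= kap. Proof. by rewrite invr_ge0 pi_ge0. Qed.

Lemma half_double x : j%:R * x = k * x + k * x :> R.
Proof. by rewrite /k; field. Qed.

Lemma osc_o11 : kap * ip e1 e1 = 1.
Proof.
rewrite /ip (@eq_itg _ _ (fun x => 2^-1 + 2^-1 * cos (j%:R * x))); last first.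
  by move=> x; rewrite half_double cosD -!expr2 sin2cos2 /e1; field.
rewrite itgD; [|exact: locint_cst|by apply: locintZ; apply: continuous_locint; exact: continuous_cosk].
rewrite itg_cst itgZ ?itg_cosn//; last by apply: continuous_locint; exact: continuous_cosk.
rewrite mulr0 addr0 subr0 /kap -(mulr_natl pi 2).
by move: (pi : R) (gt_eqF (pi_gt0 R)) => p /negbT p0; field.
Qed.

Lemma osc_o22 : kap * ip e2 e2 = 1.
Proof.
rewrite /ip (@eq_itg _ _ (fun x => 2^-1 + - 2^-1 * cos (j%:R * x))); last first.
  by move=> x; rewrite half_double cosD -!expr2 cos2sin2 /e2; field.
rewrite itgD; [|exact: locint_cst|by apply: locintZ; apply: continuous_locint; exact: continuous_cosk].
rewrite itg_cst itgZ ?itg_cosn//; last by apply: continuous_locint; exact: continuous_cosk.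
rewrite mulr0 addr0 subr0 /kap -(mulr_natl pi 2).
by move: (pi : R) (gt_eqF (pi_gt0 R)) => p /negbT p0; field.
Qed.

Lemma osc_o12 : ip e1 e2 = 0.
Proof.
rewrite /ip (@eq_itg _ _ (fun x => 2^-1 * sin (j%:R * x))); last first.
  by move=> x; rewrite half_double sinD /e1 /e2; field.
by rewrite itgZ ?itg_sinn ?mulr0//; apply: continuous_locint; exact: continuous_sink.
Qed.

Local Notation Pi := (Proj kap e1 e2).

(** Duhamel's formula picks the solution with zero data at 0; subtracting its projection picks the
    one orthogonal to the kernel. *)
Definition oscK v x := let D := duh k (fun t => v t - Pi v t) in D x - Pi D x.
Definition oscK' v x := let D := duh k (fun t => v t - Pi v t) in
  duh' k (fun t => v t - Pi v t) x -
  (kap * ip D e1 * - (k * sin (k * x)) + kap * ip D e2 * (k * cos (k * x))).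

Lemma Pi_locint v : locint v -> locint (Pi v).
Proof. by move=> lv; apply: locintD; exact: locintZ. Qed.

Lemma Pi_orth v : locint v ->
  ip (fun t => v t - Pi v t) e1 = 0 /\ ip (fun t => v t - Pi v t) e2 = 0.
Proof.
move=> lv; have lP := Pi_locint lv.
rewrite !ipB// /Proj !ipD//; [|exact: locintZ..].
rewrite !ipZ// (ipC e2 e1) osc_o12.
have h1 := osc_o11; have h2 := osc_o22.
by split; [move: h1|move: h2]; move: (ip v _) (ip _ _) => A B h;
   rewrite -[X in X - _ = _](mulr1 A) -h; ring.
Qed.

(** With [N] the L^1 norm of [v], that of [v - Pi v] is at most [5 N], Duhamel's formula then gives
    at most [10 N / k] and the projection [40 N / k]; the total [50 / k] is [100 / j]. This decay in
    [j] makes the second-order part of the gap O(1/j). *)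
Lemma oscK_spec v : locint v -> par s v ->
  [/\ D2 (oscK v) (oscK' v) (fun x => v x - Pi v x - k ^+ 2 * oscK v x),
      par s (oscK v), ip (oscK v) e1 = 0, ip (oscK v) e2 = 0 &
      forall x, `|oscK v x| <= 100 / j%:R * itg (fun t => `|v t|) 0 T].
Proof.
move=> lv pv; have lP := Pi_locint lv.
pose w t := v t - Pi v t.
have lw : locint w by exact: locintB.
have pw : par s w by apply: parB => //; apply: parD; exact: parZ.
have [w1 w2] := Pi_orth lv.
have DD := D2_duh k0' lw.
have cD := D2_cont DD; have lD := continuous_locint cD.
(* Orthogonality of [w] to the kernel makes these primitives periodic, hence [duh k w] has
   multiplier [s]: this is the solvability condition. *)
have pI e : continuous e -> par s e -> ip w e = 0 -> forall x,
    itg (fun t => w t * e t) 0 (x + T) = itg (fun t => w t * e t) 0 x.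
  move=> ce pe we x.
  have lwe : locint (fun t => w t * e t) by exact: locintM.
  rewrite -(itg_chasles _ 0 T) -/(ip w e) we add0r.
  have := itg_shift T 0 x lwe; rewrite add0r => <-.
  by apply: eq_itg => t; exact: (parM t ss pw pe).
have pD : par s (duh k w).
  move=> x; rewrite /duh (pI _ ce1 pe1 w1) (pI _ ce2 pe2 w2).
  by have := pe1 x; have := pe2 x; rewrite /e1 /e2 => -> ->; ring.
have [oD1 oD2] := Pi_orth lD.
split.
- have := D2B DD (D2D (D2Z (kap * ip (duh k w) e1) (D2_cosk k)) (D2Z (kap * ip (duh k w) e2) (D2_sink k))).
  apply: D2_ext => x //; rewrite -[v x - Pi v x]/(w x).
  have -> : oscK v x = duh k w x - (kap * ip (duh k w) e1 * cos (k * x) + kap * ip (duh k w) e2 * sin (k * x)) by [].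
  by move: (w x) (duh k w x) (ip (duh k w) e1) (ip (duh k w) e2) (cos _) (sin _) => *; ring.
- by apply: parB => //; apply: parD; exact: parZ.
- exact: oD1.
- exact: oD2.
set N := itg _ _ _.
have N0 : 0 <= N by apply: itg_ge0; [exact: T_ge0|exact: locint_norm|].
have pi0 := @pi_gt0 R.
have lwn : locint (fun t => `|w t|) by exact: locint_norm.
have wN : itg (fun t => `|w t|) 0 T <= 5 * N.
  apply: (@le_trans _ _ (itg (fun t => `|v t| + 2 * kap * N) 0 T)).
    apply: le_itg; [exact: T_ge0|by []|by apply: locintD; [exact: locint_norm|exact: locint_cst]|].
    move=> x _; apply: le_trans (ler_normB _ _) _; rewrite lerD2l.
    exact: Proj_norm.
  rewrite itgD; [|exact: locint_norm|exact: locint_cst].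
  rewrite itg_cst subr0 -/N -(mulr_natl pi 2) /kap.
  rewrite le_eqVlt; apply/orP; left; apply/eqP.
  by move: (pi : R) (gt_eqF pi0) => p /negbT p0; field.
have DN x : 0 <= x <= T -> `|duh k w x| <= 10 / k * N.
  move=> /andP[x0 xT].
  have bI e : continuous e -> (forall x, `|e x| <= 1) -> `|itg (fun t => w t * e t) 0 x| <= 5 * N.
    move=> ce be; apply: le_trans _ wN.
    apply: (@le_trans _ _ (itg (fun t => `|w t|) 0 x)).
      apply: itg_norm_le => //; first exact: locintM.
      by move=> t _; rewrite normrM -[leRHS]mulr1 ler_wpM2l.
    by apply: itg_sub_le.
  rewrite /duh normrM [X in _ * X]gtr0_norm ?invr_gt0// -mulrA (mulrC k^-1) mulrA.
  rewrite ler_wpM2r ?invr_ge0 ?(ltW k0)//.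
  have h1 := bI _ ce1 be1; have h2 := bI _ ce2 be2.
  apply: le_trans (ler_normB _ _) _; rewrite !normrM.
  have := ler_pM (normr_ge0 _) (normr_ge0 _) (be2 x) h1.
  have := ler_pM (normr_ge0 _) (normr_ge0 _) (be1 x) h2.
  move=> t1 t2; rewrite (_ : 10 * N = 1 * (5 * N) + 1 * (5 * N)); last by ring.
  exact: lerD t2 t1.
have DN' x : `|duh k w x| <= 10 / k * N.
  by have [y yT ->] := par_reduce x s1 pD; exact: DN.
move=> x; rewrite /oscK -/w.
have PN := Proj_norm x kap0 ce1 ce2 be1 be2 lD.
have iD : itg (fun t => `|duh k w t|) 0 T <= 10 / k * N * T.
  have := @itg_cst R (10 / k * N) 0 T; rewrite subr0 => <-.
  by apply: le_itg; [exact: T_ge0|exact: locint_norm|exact: locint_cst|move=> t _; exact: DN'].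
apply: le_trans (ler_normB _ _) _.
have : 2 * kap * itg (fun t => `|duh k w t|) 0 T <= 40 / k * N.
  apply: le_trans (ler_wpM2l _ iD) _; first by rewrite mulr_ge0.
  rewrite /kap -(mulr_natl pi 2) le_eqVlt; apply/orP; left; apply/eqP.
  by move: (pi : R) (gt_eqF pi0) => p /negbT p0; field; rewrite k0' p0.
have -> : 100 / j%:R * N = 50 / k * N by rewrite /k; field; rewrite gt_eqF.
move=> h; have -> : 50 / k * N = 10 / k * N + 40 / k * N by rewrite -!mulrDl -natrD.
exact: lerD (DN' x) (le_trans PN h).
Qed.

Lemma osc_HU z z1 : D2 z z1 (fun x => - k ^+ 2 * z x) -> par s z ->
  forall x, z x = Pi z x.
Proof.
move=> Dz _.
have E x : z x = z 0 * e1 x + z1 0 / k * e2 x.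
  have := D2_uniq Dz x => h; apply: (mulfI k0'); rewrite h /e1 /e2; field.
  by rewrite k0'.
move=> x; rewrite /Proj.
have -> : ip z e1 = z 0 * ip e1 e1.
  transitivity (ip (fun x => z 0 * e1 x + z1 0 / k * e2 x) e1); first by apply: eq_itg => t; rewrite E.
  by rewrite ipD//; [|exact: locintZ..]; rewrite !ipZ// (ipC e2) osc_o12 mulr0 addr0.
have -> : ip z e2 = z1 0 / k * ip e2 e2.
  transitivity (ip (fun x => z 0 * e1 x + z1 0 / k * e2 x) e2); first by apply: eq_itg => t; rewrite E.
  by rewrite ipD//; [|exact: locintZ..]; rewrite !ipZ// osc_o12 mulr0 add0r.
rewrite E !(mulrCA kap) osc_o11 osc_o22; ring.
Qed.

End OscillatingWindow.

(** * The Green operator at 0 *)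

Section ConstantWindow.
Context {R : realType}.
Notation T := (pi *+ 2 : R).
Let kap : R := T^-1.
Let e1 (x : R) : R := 1.
Let e2 (x : R) : R := 0.
Let T0 : 0 < T. Proof. exact: T_gt0. Qed.
Let T0' : T != 0. Proof. by rewrite gt_eqF. Qed.
Let ce1 : continuous e1. Proof. exact: continuous_cst. Qed.
Let ce2 : continuous e2. Proof. exact: continuous_cst. Qed.
Let le1 : locint e1. Proof. exact: continuous_locint. Qed.
Let le2 : locint e2. Proof. exact: continuous_locint. Qed.
Let be1 x : `|e1 x| <= 1. Proof. by rewrite normr1. Qed.
Let be2 x : `|e2 x| <= 1. Proof. by rewrite normr0. Qed.
Let kap0 : 0 <= kap. Proof. by rewrite invr_ge0 ltW. Qed.

Lemma ip_cst1 v : ip v e1 = itg v 0 T.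
Proof. by apply: eq_itg => t; rewrite mulr1. Qed.

Lemma ip_cst0 v : ip v e2 = 0.
Proof. by rewrite /ip (@eq_itg _ _ (fun=> 0)) ?itg_cst ?mul0r// => t; rewrite mulr0. Qed.

Local Notation Pi := (Proj kap e1 e2).

Lemma cst_Proj v x : Pi v x = itg v 0 T / T.
Proof. by rewrite /Proj ip_cst1 ip_cst0 !mulr0 addr0 mulr1 mulrC. Qed.

(** Two integrations, each preceded by removal of the mean so that the primitive is periodic; the
    last mean is removed in [cstK] to make the result orthogonal to constants. *)
Definition cstW (v : R -> R) := itg (fun t => v t - itg v 0 T / T) 0.
Definition cstD (v : R -> R) := itg (fun x => cstW v x - itg (cstW v) 0 T / T) 0.
Definition cstK (v : R -> R) x := cstD v x - itg (cstD v) 0 T / T.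
Definition cstK' (v : R -> R) x := cstW v x - itg (cstW v) 0 T / T.

Lemma itg_mean0 (v : R -> R) : locint v -> itg (fun t => v t - itg v 0 T / T) 0 T = 0.
Proof.
move=> lv; rewrite itgB//; last exact: locint_cst.
by rewrite itg_cst subr0 mulfVK// subrr.
Qed.

Lemma cstK_spec v : locint v -> par 1 v ->
  [/\ D2 (cstK v) (cstK' v) (fun x => v x - Pi v x - 0 * cstK v x),
      par 1 (cstK v), ip (cstK v) e1 = 0, ip (cstK v) e2 = 0 &
      forall x, `|cstK v x| <= 16 * T * itg (fun t => `|v t|) 0 T].
Proof.
move=> lv pv.
pose w t := v t - itg v 0 T / T.
have lw : locint w by apply: locintB => //; exact: locint_cst.
have cW : continuous (cstW v) by exact: prim_continuous.
have lW := continuous_locint cW.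
have cK' : continuous (cstK' v) by apply: continuousBf => //; exact: continuous_cst.
have cD : continuous (cstD v) by apply: prim_continuous; exact: continuous_locint.
have lD := continuous_locint cD.
have pW x : cstW v (x + T) = cstW v x.
  have wT y : w (y + T) = w y by rewrite /w pv mul1r.
  have := itg_period x lw wT; rewrite {2}/w itg_mean0// => h.
  by rewrite /cstW -(itg_chasles _ 0 x) -/w h addr0.
have pD x : cstD v (x + T) = cstD v x.
  have h := @itg_period R (cstK' v) T x (continuous_locint cK').
  by rewrite /cstD -(itg_chasles _ 0 x) -/(cstK' v) h ?itg_mean0 ?addr0// => y; rewrite /cstK' pW.
have DD : D2 (cstK v) (cstK' v) w.
  split; last split; [|exact: lw|].
    move=> x; apply: der_eq (derB (itg_derive 0 x cK') (der_cst _ x)) _; by rewrite subr0.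
  by move=> a b; rewrite /cstK' /cstW [LHS](_ : _ = itg w 0 b - itg w 0 a); [rewrite -itg_sub0|ring].
split.
- by apply: D2_ext DD => x //; rewrite cst_Proj mul0r subr0.
- by move=> x; rewrite /cstK pD mul1r.
- by rewrite ip_cst1 /cstK itg_mean0.
- exact: ip_cst0.
set N := itg _ _ _.
have N0 : 0 <= N by apply: itg_ge0; [exact: T_ge0|exact: locint_norm|].
have mean f M : locint f -> (forall x, 0 <= x <= T -> `|f x| <= M) -> `|itg f 0 T / T| <= M.
  move=> lf fM; rewrite normrM [X in _ * X]gtr0_norm ?invr_gt0// ler_pdivrMr//.
  have := @itg_cst R M 0 T; rewrite subr0 => <-.
  by apply: itg_norm_le => //; [exact: ltW|exact: locint_cst].
have vN : `|itg v 0 T| <= N by apply: ler_norm_itg => //; exact: ltW.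
have lvn : locint (fun x => `|v x|) by exact: locint_norm.
have wN : itg (fun t => `|w t|) 0 T <= 2 * N.
  apply: (@le_trans _ _ (itg (fun t => `|v t| + N / T) 0 T)).
    apply: le_itg; [exact: T_ge0|exact: locint_norm|by apply: locintD; [exact: locint_norm|exact: locint_cst]|].
    move=> x _; apply: le_trans (ler_normB _ _) _; rewrite lerD2l.
    by rewrite normrM [X in _ * X]gtr0_norm ?invr_gt0// ler_wpM2r// invr_ge0 ltW.
  rewrite itgD; [|by []|exact: locint_cst].
  by rewrite itg_cst subr0 -/N mulfVK//; lra.
have WN x : 0 <= x <= T -> `|cstW v x| <= 2 * N.
  move=> /andP[x0 xT]; apply: le_trans (ler_norm_itg x0 lw) (le_trans _ wN).
  by apply: itg_sub_le => //; exact: locint_norm.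
have KN x : 0 <= x <= T -> `|cstK' v x| <= 4 * N.
  move=> xT; apply: le_trans (ler_normB _ _) _.
  by have := mean _ _ lW WN; have := WN x xT; lra.
have DN x : 0 <= x <= T -> `|cstD v x| <= 8 * T * N.
  move=> /andP[x0 xT].
  apply: (@le_trans _ _ (itg (fun=> 4 * N) 0 x)).
    apply: itg_norm_le => //; [exact: continuous_locint|exact: locint_cst|].
    by move=> t /andP[t0 tx]; apply: KN; rewrite t0 (le_trans tx).
  by rewrite itg_cst subr0; have := ltW T0; nra.
move=> x.
have [y yT ->] := @par_reduce R 1 (cstK v) x (normr1 _) (fun x => ltac:(by rewrite /cstK pD mul1r)).
apply: le_trans (ler_normB _ _) _.
by have := mean _ _ lD DN; have := DN y yT; lra.
Qed.

(** A solution of [z'' = 0] is affine, and periodicity forces slope 0. *)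
Lemma cst_HU z z1 : D2 z z1 (fun x => - 0 * z x) -> par 1 z ->
  forall x, z x = Pi z x.
Proof.
move=> Dz pz.
have [dz [_ z1E]] := Dz.
have z1c x : z1 x = z1 0.
  apply/eqP; rewrite -subr_eq0 z1E (@eq_itg _ _ (fun=> 0)) ?itg_cst ?mul0r//.
  by move=> t; rewrite oppr0 mul0r.
have zE a b : z b - z a = z1 0 * (b - a).
  rewrite -itg_cst -(itg_FTC a b dz); last exact: D2_cont1 Dz.
  by apply: eq_itg.
have z10 : z1 0 = 0.
  have := zE 0 T; have := pz 0; rewrite add0r mul1r => ->; rewrite subrr subr0 => /esym/eqP.
  by rewrite mulf_eq0 (negbTE T0') orbF => /eqP.
have zc x : z x = z 0 by apply/eqP; rewrite -subr_eq0 zE z10 mul0r.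
move=> x; rewrite cst_Proj (@eq_itg _ _ (fun=> z 0))// itg_cst subr0 mulfK//.
Qed.

End ConstantWindow.

(** * The windows of a potential of small L^1 norm *)

Section WindowInstances.
Context {R : realType}.
Notation T := (pi *+ 2 : R).
Variable q : R -> R.
Hypotheses (lq : locint q) (pq : par 1 q).
Let m := itg (fun x => `|q x|) 0 T.
Hypothesis mw : m <= wm.

(** The kernel functions have frequency [j / 2], and the combinations [cos^2 - sin^2] and
    [2 sin cos] in the reduced matrix double it: the frequency [j] Fourier coefficients of [q]
    appear. *)
Definition gap_cos (j : nat) : R := pi^-1 * itg (fun x => q x * cos (j%:R * x)) 0 T.
Definition gap_sin (j : nat) : R := pi^-1 * itg (fun x => q x * sin (j%:R * x)) 0 T.

Let S11 j : let k : R := j%:R / 2 in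
  pi^-1 * S q (fun x => cos (k * x)) (fun x => cos (k * x)) -
  pi^-1 * S q (fun x => sin (k * x)) (fun x => sin (k * x)) = gap_cos j.
Proof.
move=> k; have ce1 := @continuous_cosk R k; have ce2 := @continuous_sink R k.
rewrite -mulrBr /gap_cos /S /ip -itgB.
- by congr (_ * _); apply: eq_itg => x; rewrite half_double cosD -/k; ring.
- by apply: locintM => //; exact: locintM.
- by apply: locintM => //; exact: locintM.
Qed.

Let S12 j : let k : R := j%:R / 2 in
  pi^-1 * S q (fun x => cos (k * x)) (fun x => sin (k * x)) = gap_sin j / 2.
Proof.
move=> k; have ce1 := @continuous_cosk R k; have ce2 := @continuous_sink R k.
rewrite /gap_sin /S /ip -mulrA; congr (_ * _); rewrite mulrC -itgZ.
- by apply: eq_itg => x; rewrite half_double sinD -/k; field.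
- by apply: locintM => //; exact: continuous_sink.
Qed.

Lemma osc_window (j : nat) : (0 < j)%N -> exists x y : R,
  [/\ `|x - (j%:R / 2) ^+ 2| < wr, `|y - (j%:R / 2) ^+ 2| < wr, x <= y &
   [/\ forall l f, `|l - (j%:R / 2) ^+ 2| <= wr -> l <> x -> l <> y ->
         eigset ((-1) ^+ j) q l f -> forall t, f t = 0,
       x = y -> has_dim (eigset ((-1) ^+ j) q x) 2,
       x < y -> has_dim (eigset ((-1) ^+ j) q x) 1 /\ has_dim (eigset ((-1) ^+ j) q y) 1,
       y - x <= 2 * (`|gap_cos j| + `|gap_sin j| + 400 * m ^+ 2 / j%:R) &
       (`|gap_cos j| - 200 * m ^+ 2 / j%:R) / 2 <= y - x]].
Proof.
move=> j0; pose k : R := j%:R / 2.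
pose e1 x := cos (k * x); pose e2 x := sin (k * x).
have ce1 : continuous e1 by exact: continuous_cosk.
have ce2 : continuous e2 by exact: continuous_sink.
have o22 x : pi^-1 * ip e2 e2 * e2 x = e2 x by rewrite osc_o22// mul1r.
have H0 : 0 <= 100 / j%:R :> R by rewrite divr_ge0.
have H128 : 100 / j%:R <= 128 :> R.
  by apply: (@le_trans _ _ 100); [rewrite ler_pdivrMr ?ltr0n// ler_peMr// ler1n|lra].
have kap0 : 0 < pi^-1 :> R by rewrite invr_gt0 pi_gt0.
have kap1 : pi^-1 <= 2^-1 :> R by rewrite lef_pV2 ?posrE ?pi_gt0// pi_ge2.
have [x [y [xr yr xy [r0 r1 r2 r3 r4]]]] := window_two_roots (@sgn_sqr R j)
  (D2_cosk k) (D2_sink k) (@par_cosh R j) (@par_sinh R j) (fun x => cos_max _)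
  (fun x => sin_max _) (@osc_o11 R j j0) (@osc_o12 R j) o22 H0
  (@oscK_spec R j j0) (@osc_HU R j j0) lq pq mw kap0 kap1 H128 (@osc_o22 R j j0).
have e2' : 2 * `|gap_sin j / 2| = `|gap_sin j|.
  by rewrite normrM [`|2^-1|]gtr0_norm// mulrC mulfVK.
have e4 (u v : R) : 4 * (100 * u * v) = 400 * v * u by ring.
have e2'' (u v : R) : 2 * (100 * u * v) = 200 * v * u by ring.
exists x, y; split=> //; split=> //.
  by move: r3; rewrite S11 S12 e2' e4.
by move: r4; rewrite S11 e2''.
Qed.

Lemma cst_window : exists x : R,
  [/\ `|x| < wr, has_dim (eigset 1 q x) 1 &
      forall l f, `|l| <= wr -> l <> x -> eigset 1 q l f -> forall t, f t = 0].
Proof.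
have T0 := @T_gt0 R; have T4 := @T_ge4 R; have T8 := @T_le8 R.
have De (c : R) : D2 (fun=> c : R) (fun=> 0) (fun x => - 0 * ((fun=> c) x : R)).
  have D0 : D2 (fun _ : R => c) (fun=> 0) (fun=> 0).
    by apply: D2_smooth; [move=> ?; exact: der_cst..|exact: continuous_cst].
  by apply: D2_ext D0 => y //; rewrite oppr0 mul0r.
have H0 : 0 <= 16 * T by rewrite mulr_ge0// ltW.
have H128 : 16 * T <= 128 by lra.
have kap0 : 0 < T^-1 by rewrite invr_gt0.
have kap1 : T^-1 <= 2^-1 by rewrite lef_pV2 ?posrE//; lra.
have o11 : T^-1 * ip (fun=> 1) (fun=> 1) = 1 :> R.
  by rewrite ip_cst1 itg_cst subr0 mul1r mulVf// gt_eqF.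
have [x [xr x1 x2]] := window_one_root (mulr1 1) (De 1) (De 0) (@par_cst R 1) (@par_cst R 0)
  (fun x => ltac:(by rewrite normr1)) o11
  (@ip_cst0 R _) (fun x => ltac:(by rewrite mulr0)) H0
  (@cstK_spec R) (@cst_HU R) lq pq mw kap0 kap1 H128 (fun x => erefl).
by exists x; split=> //; [rewrite -[x]subr0|move=> l f lr; apply: x2; rewrite subr0].
Qed.

End WindowInstances.

(** * Every eigenvalue lies in a window *)

Section Localisation.
Context {R : realType}.
Notation T := (pi *+ 2 : R).
Implicit Types (f g q : R -> R) (x y a k l M : R).

Lemma sin_le_id x : 0 <= x -> sin x <= x.
Proof.
move=> x0; have [c _] := @MVT_segment R sin cos 0 x x0 (fun y _ => is_derive_sin y)
  (continuous_subspaceT (@continuous_sin R)).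
by rewrite sin0 !subr0 => ->; rewrite ler_piMl// cos_le1.
Qed.

Lemma sin_ge_half x : 0 <= x <= 1 -> x / 2 <= sin x.
Proof.
move=> /andP[x0 x1]; have [c] := @MVT_segment R sin cos 0 x x0 (fun y _ => is_derive_sin y)
  (continuous_subspaceT (@continuous_sin R)).
rewrite in_itv/= sin0 !subr0 => /andP[c0 cx] ->; rewrite mulrC ler_wpM2r//.
have s0 : 0 <= sin (c / 2).
  by apply: sin_ge0_pi; rewrite divr_ge0//=; have := pi_ge2 R; lra.
have s1 : sin (c / 2) <= c / 2 by rewrite sin_le_id// divr_ge0.
have -> : cos c = 1 - 2 * sin (c / 2) ^+ 2.
  have := cosD (c / 2) (c / 2); rewrite -splitr -!expr2 => ->; rewrite cos2sin2; ring.
nra.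
Qed.

Lemma sin_ge_quarter x : 0 <= x <= pi / 2 -> x / 4 <= sin x.
Proof.
move=> /andP[x0 xpi]; have := @pihalf_lt2 R => p2; have := @pihalf_ge1 R => p1.
case: (leP x 1) => x1; first by have := @sin_ge_half x; rewrite x0 x1 => /(_ isT); lra.
have s1 : 1 / 2 <= sin (1 : R) by apply: sin_ge_half; lra.
have : sin 1 < sin x by rewrite ltr_sin// in_itv/= ?xpi ?p1 ?andbT; lra.
by move: s1 => /[swap] ? ?; lra.
Qed.

Lemma abs_sin_ge (d : R) : `|d| <= 2^-1 -> `|d| / 2 <= `|sin (d * pi)| :> R.
Proof.
move=> d2; have p0 := @pi_gt0 R; have p2 := @pi_ge2 R.
have -> : `|sin (d * pi)| = `|sin (`|d| * pi)|.
  by case: (ger0P d) => _ //; rewrite mulNr sinN normrN.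
have d0 := normr_ge0 d.
have h : `|d| * pi / 4 <= sin (`|d| * pi).
  by apply: sin_ge_quarter; rewrite mulr_ge0 ?(ltW p0)//= mulrC ler_wpM2l// (ltW p0).
apply: (le_trans _ (le_trans h (ler_norm _))); nra.
Qed.

Section Eigenfunction.
Variables (q : R -> R) (s l : R) (f f' : R -> R) (a : R).
Hypotheses (lq : locint q) (s1 : s = 1 \/ s = -1).
Hypotheses (Df : D2 f f' (Vmul q l f)) (pf : par s f).
Hypotheses (fa : forall x, `|f x| <= `|f a|) (fa0 : f a != 0) (pq : par 1 q).
Let m := itg (fun x => `|q x|) 0 T.

Let pf' : par s f'. Proof. exact: derive_par Df.1 pf. Qed.
Let m0 : 0 <= m.
Proof. by apply: itg_ge0; [exact: T_ge0|exact: locint_norm|]. Qed.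
Let fan : 0 < `|f a|. Proof. by rewrite normr_gt0. Qed.

(** Green's identity over the period starting at a maximum point [a] of [|f|]: testing with a free
    solution [g] leaves only the integral of [q f g], which is bounded by [|f a|]. The data [f a]
    and the unknown [f' a] appear on the left. *)
Lemma green_test g g' G : D2 g g' (fun x => - l * g x) ->
  (forall x, a <= x <= a + T -> `|g x| <= G) ->
  `|f' a * (s * g (a + T) - g a) - f a * (s * g' (a + T) - g' a)| <= `|f a| * (G * m).
Proof.
move=> Dg gG; have T0 := @T_ge0 R.
have cf := D2_cont Df; have cg := D2_cont Dg.
have := green a (a + T) Df Dg; rewrite pf pf'.
rewrite (_ : _ - _ = f' a * (s * g (a + T) - g a) - f a * (s * g' (a + T) - g' a)); last by ring.
move=> <-.
rewrite (@eq_itg _ _ (fun x => q x * (f x * g x))); last by move=> x; rewrite /Vmul; ring.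
have lqn : locint (fun x => `|q x|) by exact: locint_norm.
have -> : `|f a| * (G * m) = itg (fun x => `|f a| * G * `|q x|) a (a + T).
  rewrite itgZ// (itg_period _ lqn) ?mulrA// => y.
  by rewrite pq mul1r.
apply: itg_norm_le; [by rewrite lerDl| |exact: locintZ|].
  by apply: locintM => //; exact: continuousMf.
move=> x xa; rewrite !normrM mulrC ler_wpM2r// ler_pM//; exact: gG.
Qed.

(** The test function [cos (k (x - a - pi))] is even about the midpoint of the period, so its two
    end values agree and [f' a] drops out; [|f a|] is then cancelled. *)
Lemma periodic_sine k : l = k ^+ 2 -> 0 <= k -> s = 1 -> 2 * k * `|sin (k * pi)| <= m.
Proof.
move=> lk k0 se.
pose g x := cos (k * (x + (- (a + pi)))); pose g' x := - (k * sin (k * (x + (- (a + pi))))).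
have Dg : D2 g g' (fun x => - l * g x) by rewrite lk; exact: D2_shift (D2_cosk k).
have := green_test (G := 1) Dg (fun x _ => cos_max _).
rewrite se !mul1r /g /g' -(mulr_natl pi 2).
have -> : a + 2 * pi + - (a + pi) = pi :> R by ring.
have -> : k * (a - (a + pi)) = - (k * pi) by ring.
rewrite cosN sinN subrr mulr0 sub0r normrN normrM ler_pM2l//.
have -> : - (k * sin (k * pi)) - - (k * - sin (k * pi)) = - (2 * k * sin (k * pi)) by ring.
by rewrite normrN normrM [`|2 * k|]ger0_norm// mulr_ge0.
Qed.

(** With multiplier -1 the odd test function [sin (k (x - a - pi))] eliminates [f' a]. *)
Lemma antiperiodic_cosine k : l = k ^+ 2 -> 0 <= k -> s = -1 -> 2 * k * `|cos (k * pi)| <= m.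
Proof.
move=> lk k0 se.
pose g x := sin (k * (x + (- (a + pi)))); pose g' x := k * cos (k * (x + (- (a + pi)))).
have Dg : D2 g g' (fun x => - l * g x) by rewrite lk; exact: D2_shift (D2_sink k).
have := green_test (G := 1) Dg (fun x _ => sin_max _).
rewrite se !mulN1r mul1r /g /g' -(mulr_natl pi 2).
have -> : a + 2 * pi + - (a + pi) = pi :> R by ring.
have -> : k * (a - (a + pi)) = - (k * pi) by ring.
rewrite cosN sinN subrr mulr0 sub0r normrN normrM ler_pM2l//.
have -> : - (k * cos (k * pi)) - (k * cos (k * pi)) = - (2 * k * cos (k * pi)) by ring.
by rewrite normrN normrM [`|2 * k|]ger0_norm// mulr_ge0.
Qed.

(** The factor [k] makes the cosine bound useless near [l = 0]. An affine test function, zero at the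
    midpoint of the period, shows that no antiperiodic eigenvalue is close to 0. *)
Lemma antiperiodic_linear : s = -1 -> 2 <= T * (m + T * `|l|).
Proof.
move=> se; have T0 := @T_gt0 R; have cf := D2_cont Df.
have Dg : D2 (fun x => x - (a + pi)) (fun=> 1) (fun=> 0 : R).
  have d x : is_derive x (1 : R) (fun x => x - (a + pi)) 1.
    by apply: der_eq (derB (der_id x) (der_cst _ x)) _; rewrite subr0.
  by apply: (D2_smooth d (fun x => der_cst _ x)); exact: continuous_cst.
have := green a (a + T) Df Dg; rewrite pf pf' se.
rewrite (_ : _ - _ = 2 * f a); last by rewrite -(mulr_natl pi 2); ring.
have cl : continuous (fun x : R => x - (a + pi)) by exact: D2_cont Dg.
have lv : locint (Vmul q l f) by exact: Vmul_locint.
move=> h.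
move: h; rewrite (@eq_itg _ _ (fun x => Vmul q l f x * (x - (a + pi)))); last first.
  by move=> x; rewrite mulr0 subr0.
move=> h; have : `|2 * f a| <= itg (fun x => pi * `|Vmul q l f x|) a (a + T).
  rewrite -h; apply: itg_norm_le; [by rewrite lerDl ltW| | |].
  - exact: locintM.
  - by apply: locintZ; exact: locint_norm.
  move=> x /andP[x1 x2]; rewrite normrM mulrC ler_wpM2r//.
  by rewrite ler_norml; move: x1 x2; rewrite -(mulr_natl pi 2); lra.
rewrite itgZ; last exact: locint_norm.
rewrite (itg_period _ (locint_norm lv)); last first.
  by move=> y; rewrite (Vmul_par pq _ pf) se mulN1r normrN.
have := Vmul_bound lq l cf fa; rewrite -/m.
rewrite normrM [`|2|]ger0_norm//; set I := itg _ _ _ => h1 h2.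
have pi0 := @pi_gt0 R.
rewrite -(ler_pM2r fan); apply: le_trans h2 _.
apply: le_trans (ler_wpM2l (ltW pi0) h1) _.
have X0 : 0 <= m + T * `|l| := addr_ge0 m0 (mulr_ge0 (ltW T0) (normr_ge0 l)).
rewrite (_ : T * _ * _ = pi * (`|f a| * (m + T * `|l|)) + pi * (`|f a| * (m + T * `|l|))).
  by rewrite lerDl (mulr_ge0 (ltW pi0)) ?(mulr_ge0 (ltW fan) X0).
by rewrite -(mulr_natl pi 2); ring.
Qed.

Lemma D2_exp k c : D2 (fun x => expR (k * x + c)) (fun x => k * expR (k * x + c))
  (fun x => - (- k ^+ 2) * expR (k * x + c)).
Proof.
have d x : is_derive x (1 : R) (fun y => expR (k * y + c)) (k * expR (k * x + c)).
  exact: der_affine (is_derive_expR _).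
apply: (D2_smooth d) => [x|].
  by apply: der_eq (derZ k (d x)) _; ring.
by apply: continuousZf; apply: is_derive_cont => x; exact: d.
Qed.

(** The growing and the decaying exponential give two inequalities; their sum for [s = 1], and their
    difference for [s = -1], is free of [f' a]. *)
Lemma negative_bound k : l = - k ^+ 2 -> 0 < k -> k * (1 - expR (- (k * T))) <= m.
Proof.
move=> lk k0; have T0 := @T_gt0 R.
pose E := expR (k * T).
have E1 : 1 <= E by rewrite /E -expR0 ler_expR mulr_ge0// ltW.
have D1 := D2_exp k (- (k * a)); have D2' := D2_exp (- k) (k * (a + T)).
rewrite sqrrN in D2'.
have Ea : expR (k * a + - (k * a)) = 1 by rewrite subrr expR0.
have EaT : expR (k * (a + T) + - (k * a)) = E by congr expR; ring.
have Ga : expR (- k * a + k * (a + T)) = E by congr expR; ring.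
have GaT : expR (- k * (a + T) + k * (a + T)) = 1 by rewrite mulNr addNr expR0.
have b1 x : a <= x <= a + T -> `|expR (k * x + - (k * a))| <= E.
  move=> /andP[_ xT]; rewrite ger0_norm ?expR_ge0// ler_expR.
  by have := ler_wpM2l (ltW k0) xT; lra.
have b2 x : a <= x <= a + T -> `|expR (- k * x + k * (a + T))| <= E.
  move=> /andP[xa _]; rewrite ger0_norm ?expR_ge0// ler_expR.
  by have := ler_wpM2l (ltW k0) xa; lra.
have := green_test (G := E) (eq_ind _ (fun r => D2 _ _ (fun x => - r * _)) D1 _ (esym lk)) b1.
have := green_test (G := E) (eq_ind _ (fun r => D2 _ _ (fun x => - r * _)) D2' _ (esym lk)) b2.
rewrite Ea EaT Ga GaT.
have Em : E * expR (- (k * T)) = 1 by rewrite /E -expRD subrr expR0.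
have E0 : 0 < E by lra.
move=> h2 h1; rewrite -(ler_pM2l E0) (mulrCA E k) (mulrBr E) mulr1 Em.
rewrite -(ler_pM2l fan).
have key : 2 * (`|f a| * (k * (E - 1))) <= 2 * (`|f a| * (E * m)).
  case: s1 => se; rewrite se in h1 h2.
    have := ler_normB _ _ => /(_ _ _ (f' a * (1 * E - 1) - f a * (1 * (k * E) - k * 1))
      (- (f' a * (1 * 1 - E) - f a * (1 * (- k * 1) - - k * E)))).
    rewrite normrN opprK (_ : _ + _ = - (f a * (2 * (k * (E - 1))))); last by ring.
    rewrite normrN normrM [`|2 * _|]ger0_norm; last by rewrite !mulr_ge0 ?subr_ge0// ltW.
    by move: h1 h2; lra.
  have := ler_normB (f' a * (-1 * E - 1) - f a * (-1 * (k * E) - k * 1))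
      (f' a * (-1 * 1 - E) - f a * (-1 * (- k * 1) - - k * E)).
  rewrite (_ : _ - _ = f a * (2 * (k * (E + 1)))); last by ring.
  rewrite normrM [`|2 * _|]ger0_norm; last by rewrite !mulr_ge0 ?addr_ge0 ?ltW.
  have : `|f a| * (k * (E - 1)) <= `|f a| * (k * (E + 1)).
    by rewrite ler_wpM2l ?normr_ge0// ler_wpM2l ?(ltW k0)//; lra.
  by move: h1 h2; lra.
by rewrite ler_pM2l// in key.
Qed.

End Eigenfunction.

(** In the second case [k + x <= 2 k + |k - x| <= 2 k + 1/2 <= 4 k]. *)
Lemma near_square_bound (k x m : R) : 0 <= k -> 0 <= x -> `|k - x| <= 2^-1 ->
  x = 0 \/ 4^-1 <= k -> k * `|k - x| <= m -> `|k ^+ 2 - x ^+ 2| <= 4 * m.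
Proof.
move=> k0 x0 kx hk; have n0 := normr_ge0 (k - x).
rewrite subr_sqr normrM [`|k + x|]ger0_norm ?addr_ge0//.
move: kx n0; case: hk => [->|k4].
  by rewrite subr0 addr0 ger0_norm//; nra.
have : x <= k + `|k - x| by have := ler_norm (x - k); rewrite distrC; lra.
by set d := `|_|; nra.
Qed.

(** The sine and cosine bounds, with a linear lower bound for the sine, put [sqrt l] near an integer
    if [s = 1] and near a half-integer if [s = -1]. Negative and very small [l] are treated apart,
    since they must fall into the window at 0, which is periodic. *)
Lemma eig_localise (q : R -> R) (s l : R) f : locint q -> par 1 q ->
  itg (fun x => `|q x|) 0 T <= wm -> s = 1 \/ s = -1 -> eigset s q l f ->
  (exists x, f x != 0) ->
  exists j : nat, (-1) ^+ j = s /\ `|l - (j%:R / 2) ^+ 2| < wr.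
Proof.
move=> lq pq mw s1 [pf [f' Df]] [x0 fx0].
have sn : `|s| = 1 by case: s1 => ->; rewrite ?normrN normr1.
have cf := D2_cont Df; have T0 := @T_gt0 R; have T4 := @T_ge4 R; have T8 := @T_le8 R.
have [a _ fa] : exists2 a, a \in `[0, T] & forall x, x \in `[0, T] -> `|f x| <= `|f a|.
  apply: EVT_max; first exact: ltW.
  by apply: continuous_subspaceT; exact: continuous_normf.
have fa' x : `|f x| <= `|f a|.
  by have [y yT ->] := par_reduce x sn pf; apply: fa; rewrite in_itv.
have fa0 : f a != 0.
  by apply: contra_neq fx0 => h; apply/eqP; rewrite -normr_le0 -(normr0 R) -h.
have m0 : 0 <= itg (fun x => `|q x|) 0 T.
  by apply: itg_ge0; [exact: T_ge0|exact: locint_norm|].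
have wr0 := @wr_gt0 R; have w1 := @wr_wm1 R; have w2 := @wr_wm2 R.
have pS := periodic_sine lq Df pf fa' fa0 pq.
have pC := antiperiodic_cosine lq Df pf fa' fa0 pq.
have pL := antiperiodic_linear lq Df pf fa' fa0 pq.
have pN := negative_bound lq s1 Df pf fa' fa0 pq.
move: pS pC pL pN m0 mw; set m := itg _ _ _ => pS pC pL pN m0 mw.
have m4 : 4 * m < wr by lra.
(* The window at 0 contains no antiperiodic eigenvalue. *)
have lin : `|l| <= wr -> s = 1.
  move=> lr; case: s1 => // /pL.
  have : T * (m + T * `|l|) <= 8 * (wm + 8 * wr).
    apply: ler_pM; [exact: ltW|by rewrite addr_ge0// mulr_ge0// ltW|by []|].
    by apply: lerD => //; apply: ler_pM => //; exact: ltW.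
  by move=> h1 h2; lra.
have [l0|l0] := leP 0 l; last first.
  pose k := Num.sqrt (- l).
  have k0 : 0 < k by rewrite sqrtr_gt0 oppr_gt0.
  have lk : l = - k ^+ 2 by rewrite sqr_sqrtr ?opprK// oppr_ge0 ltW.
  have := pN k lk k0; have u0 := expR_gt0 (- (k * T)).
  (* From [expR (k T) >= 1 + k T]; this turns the exponential bound into the polynomial one
     [k^2 T <= m (1 + k T)]. *)
  have : expR (- (k * T)) * (1 + k * T) <= 1.
    apply: le_trans (ler_wpM2l (ltW u0) (expR_ge1Dx _)) _.
    by rewrite -expRD addNr expR0.
  set u := expR _ in u0 *; move=> h1 h2.
  have h3 : k ^+ 2 * T <= m + m * (k * T).
    have : k * (1 - u) * (1 + k * T) <= m * (1 + k * T).
      by rewrite ler_wpM2r// addr_ge0// mulr_ge0// ltW.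
    have : k * (u * (1 + k * T)) <= k * 1 by rewrite ler_wpM2l// ltW.
    by rewrite expr2; lra.
  have h4 : k ^+ 2 * 4 <= m + m * (k * 8).
    apply: le_trans (le_trans h3 _); first by rewrite ler_wpM2l// sqr_ge0.
    by rewrite lerD2l ler_wpM2l// ler_wpM2l// ltW.
  have h5 : k ^+ 2 <= 4 * m.
    have m1 : m <= 8^-1 by have := @wr_small R; lra.
    have [k1|k1] := leP k 1; last by nra.
    by have := ler_wpM2l m0 k1; lra.
  have lr : `|l| < wr by rewrite lk normrN ger0_norm ?sqr_ge0//; exact: le_lt_trans h5 m4.
  by exists 0%N; rewrite expr0 (lin (ltW lr)) mul0r expr0n subr0.
pose k := Num.sqrt l.
have k0 : 0 <= k by rewrite sqrtr_ge0.
have lk : l = k ^+ 2 by rewrite sqr_sqrtr.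
case: (s1) => se.
  (* The integer nearest to [k]; the window has the even index [2 n]. *)
  pose n := Num.truncn (k + 2^-1).
  have /andP[n1 n2] : n%:R <= k + 2^-1 < n.+1%:R by apply: truncn_itv; lra.
  rewrite -(natr1 n) in n2.
  have d2 : `|k - n%:R| <= 2^-1 by rewrite ler_norml; lra.
  have := pS k lk k0 se.
  have -> : k * pi = (k - n%:R) * pi + pi *+ n by rewrite -(mulr_natl pi n); ring.
  rewrite sinDpin normrM normrX normrN1 expr1n mul1r => h.
  exists (2 * n)%N; rewrite exprM sqrrN expr1n expr1n; split=> //.
  rewrite lk natrM mulrAC mulfV// mul1r; apply: le_lt_trans m4.
  apply: near_square_bound => //.
    by case: n n1 {n2 d2 h} => [|n] n1; [left|right; move: n1; rewrite -(natr1 n); have := ler0n R n; lra].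
  have h2 := abs_sin_ge d2.
  by have := ler_wpM2l (mulr_ge0 (ler0n R 2) k0) h2; lra.
(* The half-integer nearest to [k] is [n + 1/2], and the window has the odd index [2 n + 1]. *)
pose n := Num.truncn k.
have /andP[n1 n2] : n%:R <= k < n.+1%:R by exact: truncn_itv.
rewrite -(natr1 n) in n2.
have d2 : `|k - (n%:R + 2^-1)| <= 2^-1 by rewrite ler_norml; lra.
have := pC k lk k0 se.
have -> : k * pi = (k - (n%:R + 2^-1)) * pi + pi *+ n + pi / 2 by rewrite -(mulr_natl pi n); lra.
rewrite cosDpihalf normrN sinDpin normrM normrX normrN1 expr1n mul1r => h.
have h2 := abs_sin_ge d2.
have h3 : k * `|k - (n%:R + 2^-1)| <= m.
  by have := ler_wpM2l (mulr_ge0 (ler0n R 2) k0) h2; lra.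
have [k4|k4] := leP (4^-1) k.
  exists (2 * n + 1)%N; rewrite exprD exprM sqrrN expr1n expr1n expr1 mul1r; split=> //.
  rewrite lk (_ : (2 * n + 1)%:R / 2 = n%:R + 2^-1); last by rewrite natrD natrM; field.
  by apply: le_lt_trans m4; apply: near_square_bound => //; right.
(* For [k < 1/4] the nearest half-integer is at distance at least 1/4, so [k] and hence [l] are
   tiny, which contradicts [lin]. *)
have k4m : k <= 4 * m.
  have : 4^-1 <= `|k - (n%:R + 2^-1)|.
    by rewrite distrC; apply: le_trans (ler_norm _); have := ler0n R n; lra.
  by move=> h4; have := ler_wpM2l k0 h4; lra.
have : s = 1.
  apply: lin; rewrite lk ger0_norm ?sqr_ge0// expr2.
  have : k * k <= k * 1 by rewrite ler_wpM2l//; lra.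
  by lra.
by rewrite se; lra.
Qed.

End Localisation.

(** * Counting eigenvalues window by window *)

Section Counting.
Context {R : realType}.
Implicit Types (E : set (R -> R)) (x y l : R).

Lemma has_dim_nonzero E n : has_dim E n.+1 -> exists2 f, E f & exists x, f x != 0.
Proof.
move=> [b [Eb lib _]]; exists (b ord0) => //; apply: contrapT => h.
have /(_ ord0) : forall i : 'I_n.+1, (i == ord0)%:R = 0 :> R.
  apply: (lib (fun i => (i == ord0)%:R)) => x; rewrite big_ord_recl eqxx mul1r big1 ?addr0.
    by apply/eqP; apply: contraT => hx; exfalso; apply: h; exists x.
  by move=> i _; rewrite mul0r.
by rewrite eqxx => /eqP; rewrite oner_eq0.
Qed.

Lemma card_eq_I1 (A : set nat) : (A #= `I_1)%card -> exists a, forall i, A i <-> i = a.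
Proof.
rewrite card_eq_sym => /card_set_bijP [f [fA _ fS]]; exists (f 0%N) => i; split=> [|->].
  by move=> /fS [k] /=; rewrite ltnS leqn0 => /eqP -> <-.
exact: fA.
Qed.

Lemma card_eq_I2 (A : set nat) : (A #= `I_2)%card ->
  exists a b, (a < b)%N /\ forall i, A i <-> i = a \/ i = b.
Proof.
rewrite card_eq_sym => /card_set_bijP [f [fA fI fS]].
have fE i : A i <-> i = f 0%N \/ i = f 1%N.
  split=> [|[]->]; [|exact: fA..].
  by move=> /fS [[|[|k]] //=] _ <-; [left|right].
have [h|h|h] := ltngtP (f 0%N) (f 1%N).
- by exists (f 0%N), (f 1%N).
- by exists (f 1%N), (f 0%N); split=> // i; rewrite fE; split=> -[]; auto.
- by have := fI 0%N 1%N (mem_set (isT : 0 < 2)%N) (mem_set (isT : 1 < 2)%N) h.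
Qed.

Variables (lam : nat -> R) (E : R -> set (R -> R)).
Hypothesis lam_nd : nondecreasing_seq lam.
Hypothesis spec : forall l, exists n, has_dim (E l) n /\ ([set j | lam j = l] #= `I_n)%card.
Let ctr (j : nat) : R := (j%:R / 2) ^+ 2.
Hypothesis loc : forall l f, E l f -> (exists x, f x != 0) -> exists j, `|l - ctr j| < wr.

Lemma spec_dim l n : has_dim (E l) n -> ([set j | lam j = l] #= `I_n)%card.
Proof. by move=> h; have [k [hk]] := spec l; rewrite (has_dim_uniq h hk). Qed.

Lemma lam_eigen i : exists2 f, E (lam i) f & exists x, f x != 0.
Proof.
have [[|n] [hn]] := spec (lam i); last by move=> _; exact: has_dim_nonzero hn.
by rewrite II0 card_eq0 => /eqP h; have : [set j | lam j = lam i] i by []; rewrite h.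
Qed.

Lemma lam_window i : exists j, `|lam i - ctr j| < wr.
Proof. by have [f Ef fx] := lam_eigen i; exact: loc Ef fx. Qed.

(** Distinct centres are at least 1/4 apart, more than [wr + 1/8]. *)
Lemma window_sep (i j : nat) x : `|x - ctr i| < wr -> `|x - ctr j| < 8^-1 -> i = j.
Proof.
have w := @wr_small R; have w0 := @wr_gt0 R.
have key (a b : nat) : (a < b)%N -> ctr a + 4^-1 <= ctr b.
  move=> ab; have h : a%:R + 1 <= b%:R :> R by rewrite natr1 ler_nat.
  have a0 := ler0n R a; rewrite /ctr !expr2; nra.
rewrite !ltr_norml => h1 h2; have [h|h|//] := ltngtP i j; exfalso; have := key _ _ h; lra.
Qed.

(** The invariant of the induction: the cut-off [ctr j + 1/8] lies between windows [j] and [j + 1],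
    and below it are exactly the eigenvalues of index at most [2 j]. *)
Let below j := forall i, (lam i < ctr j + 8^-1) = (i <= 2 * j)%N.

Lemma window_zero : (exists x, [/\ `|x| < wr, has_dim (E x) 1 &
    forall l f, `|l| <= wr -> l <> x -> E l f -> forall t, f t = 0]) -> below 0.
Proof.
have w := @wr_small R; have w0 := @wr_gt0 R.
have c0 : ctr 0 = 0 by rewrite /ctr mul0r expr0n.
move=> [x [xr /spec_dim /card_eq_I1 [a ha] ux]].
have in0 i : lam i < 8^-1 -> i = a.
  move=> li; have [j hj] := lam_window i.
  have j0 : j = 0%N.
    apply/eqP; apply: contraLR li; rewrite -lt0n -leNgt => j0.
    have : (1 : R) <= j%:R by rewrite ler1n.
    by move: hj; rewrite ltr_norml /ctr expr2 => ? ?; nra.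
  move: hj; rewrite j0 c0 subr0 => li0; apply/ha; apply: contrapT => nx.
  by have [f Ef [t]] := lam_eigen i; rewrite (ux _ f (ltW li0) nx Ef) eqxx.
have xa : lam a = x by apply/ha.
have a8 : lam a < 8^-1 by rewrite xa; move: xr; rewrite ltr_norml; lra.
have a0 : a = 0%N.
  by apply/esym/in0; apply: le_lt_trans a8; exact: lam_nd.
move=> i; rewrite c0 add0r muln0 leqn0; apply/idP/eqP => [/in0 ->//|->].
by move: a8; rewrite a0.
Qed.

(** By the invariant the indices above [2 j] are those with eigenvalue beyond the cut-off, and the
    lowest place available to them is window [j + 1]. Exactly two indices live there, so by
    monotonicity they are [2 j + 1] and [2 j + 2]. *)
Lemma window_step j x y : below j -> `|x - ctr j.+1| < wr -> `|y - ctr j.+1| < wr -> x <= y ->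
  (forall l f, `|l - ctr j.+1| <= wr -> l <> x -> l <> y -> E l f -> forall t, f t = 0) ->
  (x = y -> has_dim (E x) 2) -> (x < y -> has_dim (E x) 1 /\ has_dim (E y) 1) ->
  [/\ below j.+1, lam (2 * j).+1 = x & lam (2 * j).+2 = y].
Proof.
move=> bj xr yr xy un dbl sgl.
have w := @wr_small R; have w0 := @wr_gt0 R.
(* A double value carried by two indices and two simple values are brought to a common form: two
   indices [a < b] with values [x] and [y]. *)
have [a [b [ab hab]]] : exists a b, (a < b)%N /\
    [/\ forall i, lam i = x \/ lam i = y <-> i = a \/ i = b, lam a = x & lam b = y].
  have [e|ne] := eqVneq x y.
    have [a [b [ab h]]] := card_eq_I2 (spec_dim (dbl e)).
    exists a, b; split=> //; rewrite -e; split; [|by apply/h; left|by apply/h; right].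
    by move=> i; rewrite -h /=; split=> [[]|]; auto.
  have lxy : x < y by rewrite lt_neqAle ne.
  have [/spec_dim/card_eq_I1[a ha] /spec_dim/card_eq_I1[b hb]] := sgl lxy.
  have la : lam a = x by apply/ha.
  have lb : lam b = y by apply/hb.
  exists a, b; split; last by split=> // i; rewrite -ha -hb.
  by rewrite ltnNge; apply/negP => /lam_nd; rewrite la lb leNgt lxy.
case: hab => hab la lb.
have inw i : `|lam i - ctr j.+1| < 8^-1 -> i = a \/ i = b.
  move=> hi; have [k hk] := lam_window i.
  have kj := window_sep hk hi; rewrite kj in hk; apply/hab; apply: contrapT => /not_orP[nx ny].
  by have [f Ef [t]] := lam_eigen i; rewrite (un _ f (ltW hk) nx ny Ef) eqxx.
have gap : ctr j + 4^-1 <= ctr j.+1.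
  by rewrite /ctr -(natr1 j) !expr2; have := ler0n R j; nra.
have ge_lo i : ctr j + 8^-1 <= lam i -> ctr j.+1 - 8^-1 < lam i.
  move=> hi; have [k hk] := lam_window i.
  have jk : (j < k)%N.
    rewrite ltnNge; apply/negP => kj.
    have : ctr k <= ctr j.
      by rewrite /ctr ler_pXn2r// ?nnegrE ?divr_ge0// ler_wpM2r// ler_nat.
    by move: hk; rewrite ltr_norml; lra.
  have : ctr j.+1 <= ctr k.
    by rewrite /ctr ler_pXn2r// ?nnegrE ?divr_ge0// ler_wpM2r// ler_nat.
  by move: hk; rewrite ltr_norml; lra.
move: (xr) (yr); rewrite !ltr_norml => xr' yr'.
have ltE i : (2 * j < i)%N -> ctr j.+1 - 8^-1 < lam i.
  by move=> h; apply: ge_lo; rewrite leNgt bj -ltnNge.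
have a_gt : (2 * j < a)%N by rewrite ltnNge -bj -leNgt la; lra.
(* Otherwise index [2 j + 1] would come before [a] while its eigenvalue, squeezed between the
   cut-off and [x], lies in the window. *)
have aE : a = (2 * j).+1.
  apply/eqP; rewrite eqn_leq a_gt andbT leqNgt; apply/negP => h.
  have := lam_nd (ltnW h); have := ltE _ (ltnSn (2 * j)); rewrite la => h1 h2.
  have [|e|e] := inw (2 * j).+1; [rewrite ltr_norml; lra| |].
    by rewrite e ltnn in h.
  by move: (ltn_trans h ab); rewrite e ltnn.
have bE : b = (2 * j).+2.
  apply/eqP; rewrite eqn_leq -{2}aE ab andbT leqNgt; apply/negP => h.
  have := lam_nd (ltnW h); have := ltE _ (leqnSn (2 * j).+1); rewrite lb => h1 h2.
  have [|e|e] := inw (2 * j).+2; [rewrite ltr_norml; lra| |].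
    by move/eqP: e; rewrite aE eqn_leq ltnn.
  by rewrite e ltnn in h.
rewrite -bE -aE; split=> // i.
have -> : (2 * j.+1)%N = b by rewrite bE mulnS.
apply/idP/idP => [h|ib].
  rewrite leqNgt; apply/negP => bi.
  have := ltE i (ltn_trans a_gt (ltn_trans ab bi)) => h'.
  have [|e|e] := inw i; [rewrite ltr_norml; lra| |].
    by move: (ltn_trans ab bi); rewrite e ltnn.
  by rewrite e ltnn in bi.
by apply: le_lt_trans (lam_nd ib) _; rewrite lb; lra.
Qed.

End Counting.

(** * The measure of the torus and periodization *)

Section Torus.
Context {R : realType}.
Notation T := (pi *+ 2 : R).
Notation mu := (@lebesgue_measure R).
Notation muT := (muT R).
Implicit Types (f g : R -> R).

Definition avg f : R := \int[muT]_x f x.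

Lemma muT_ge0_integral (f : R -> \bar R) : measurable_fun setT f -> (forall x, 0 <= f x)%E ->
  (\int[muT]_x f x = T^-1%:E * \int[mu]_(x in `[0%R, T]) f x)%E.
Proof. by move=> mf f0; rewrite /muT integral_uniform// subr0. Qed.

Let Ti0 : 0 < T^-1. Proof. by rewrite invr_gt0 T_gt0. Qed.

Lemma muT_integrable f : measurable_fun setT f ->
  muT.-integrable setT (EFin \o f) <-> mu.-integrable `[0, T] (EFin \o f).
Proof.
move=> mf.
have mn : measurable_fun setT (fun x => `|(f x)%:E|%E).
  by do 2 apply: measurableT_comp => //.
have h := muT_ge0_integral mn (fun x => abse_ge0 _).
split=> /integrableP[_ hf]; apply/integrableP; split.
- by apply/measurable_EFinP; exact: measurable_funTS.
- move: hf; rewrite h; apply: contraTT; rewrite -!leNgt !leye_eq => /eqP ->.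
  by rewrite gt0_muley ?lte_fin.
- exact/measurable_EFinP.
- by rewrite h; apply: lte_mul_pinfty => //; rewrite lee_fin ltW.
Qed.

Lemma avgE f : measurable_fun setT f -> muT.-integrable setT (EFin \o f) ->
  avg f = T^-1 * itg f 0 T.
Proof.
move=> mf intf; have if' := (muT_integrable mf).1 intf.
rewrite /itg /prim T_ge0 lexx set_itv1 Rintegral_set1 subr0 /avg /Rintegral.
rewrite integralE [X in _ = _ * fine X]integralE.
have mfE : measurable_fun setT (EFin \o f) by exact/measurable_EFinP.
rewrite !muT_ge0_integral//; [|exact: measurable_funeneg|exact: measurable_funepos].
have f1 := integrable_pos_fin_num _ if'; have f2 := integrable_neg_fin_num _ if'.
have g1 := f1 (measurable_itv _); have g2 := f2 (measurable_itv _).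
rewrite -muleBr//; last exact: fin_num_adde_defr.
by rewrite fineM// fin_numB g1 g2.
Qed.

Section Periodization.
Variable f : R -> R.
Hypothesis intf : mu.-integrable `[0, T] (EFin \o f).
Let pf x := f (x - (Num.floor (x / T))%:~R * T).
Let f1 := f \_ `[0, T[.

(** On a bounded interval the periodization is a finite sum of translates of the restriction of [f]
    to [[0, T[]; with [N] beyond [|a / T| + |b / T| + 1], the [2 N] translates listed cover the
    interval, and one contains each point. *)
Lemma locint_periodize : locint pf.
Proof.
have T0 := @T_gt0 R.
have l1 : locint f1.
  move=> a b; apply: (@integrableS _ _ _ _ setT) => //.
  have := (@integrable_mkcond _ _ _ mu _ (EFin \o f) (measurable_itv `[0, T[)).1.
  rewrite -/f1 => h; rewrite (_ : EFin \o f1 = (EFin \o f) \_ `[0, T[); last first.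
    by apply/funext => x; rewrite /f1 /= !patchE; case: ifP.
  apply: h; apply: integrableS intf => //.
  by apply: subset_itvl; rewrite bnd_simp.
move=> a b.
pose N := Num.bound (`|a / T| + `|b / T| + 1).
pose g x := \sum_(k < 2 * N) f1 (x + (N%:R - k%:R) * T).
have lg : locint g.
  rewrite /g; elim: (2 * N)%N => [|n IH].
    rewrite (_ : (fun x => _) = fun=> 0); first exact: locint_cst.
    by apply/funext => x; rewrite big_ord0.
  rewrite (_ : (fun x => _) = fun x => \sum_(k < n) f1 (x + (N%:R - k%:R) * T) +
     f1 (x + (N%:R - n%:R) * T)); last by apply/funext => x; rewrite big_ord_recr.
  by apply: locintD => //; exact: locint_shift.
apply: eq_integrable (lg a b) => // x; rewrite inE/= in_itv/= => /andP[ax xb].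
congr EFin; rewrite /g /pf.
have hN : `|a / T| + `|b / T| + 1 < N%:R by apply: archi_boundP; rewrite !addr_ge0.
set z := Num.floor (x / T).
have [z1 z2] : z%:~R <= x / T /\ x / T < z%:~R + 1.
  by have /andP[] := floor_itv (x / T); rewrite intrD.
have aT : a / T <= x / T by rewrite ler_pM2r// invr_gt0.
have bT : x / T <= b / T by rewrite ler_pM2r// invr_gt0.
have : 0 <= z + N%:Z < (2 * N)%:Z.
  have := ler_norm (b / T); have := lerNnormlW (lexx `|a / T|).
  have n1 := normr_ge0 (a / T); have n2 := normr_ge0 (b / T) => h1 h2.
  by rewrite -(ler_int R) -(ltr_int R) !intrD -!pmulrn natrM ?mulr0z ?mulr0n; lra.
case/andP; case E : (z + N%:Z) => [k|//] _ kN.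
have zE : z%:~R = k%:R - N%:R :> R.
  by have := congr1 (fun i : int => i%:~R : R) E; rewrite intrD -!pmulrn; lra.
rewrite (bigD1 (Ordinal (kN : (k < 2 * N)%N)))//= big1 ?addr0; last first.
  move=> i ik; rewrite /f1 patchE memNset//=; rewrite in_itv/= => /andP[h1 h2].
  move/negP: ik; apply; apply/eqP/val_inj => /=.
  have hx : x = x / T * T by rewrite mulfVK// gt_eqF.
  have h3 : 0 <= x / T + (N%:R - i%:R).
    by rewrite -(pmulr_lge0 _ T0) mulrDl -hx.
  have h4 : x / T + (N%:R - i%:R) < 1.
    by rewrite -(ltr_pM2r T0) mulrDl -hx mul1r.
  rewrite zE in z1 z2.
  have d1 : i%:R < k%:R + 1 :> R by clear -z1 z2 h3 h4; lra.
  have d2 : k%:R < i%:R + 1 :> R by clear -z1 z2 h3 h4; lra.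
  by move: d1 d2; rewrite !natr1 !ltr_nat !ltnS => ik ki; apply/eqP; rewrite eqn_leq ik ki.
rewrite /f1 patchE zE mem_set/=; last first.
  have hx : x = x / T * T by rewrite mulfVK// gt_eqF.
  rewrite in_itv/= hx -mulrDl pmulr_lge0// -[ltRHS]mul1r ltr_pM2r//.
  by rewrite zE in z1 z2; lra.
by congr f; ring.
Qed.

Lemma par_periodize : par 1 pf.
Proof.
move=> x; rewrite mul1r /pf mulrDl divff ?gt_eqF ?T_gt0//.
rewrite floorDrz ?rpred1// (_ : Num.floor 1 = 1); last exact: floor1.
by rewrite intrD; congr f; ring.
Qed.

Lemma periodize_id x : 0 <= x < T -> pf x = f x.
Proof.
move=> /andP[x0 xT]; rewrite /pf (_ : Num.floor (x / T) = 0); last first.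
  apply/floor_def; rewrite add0r divr_ge0 ?T_ge0//= ltr_pdivrMr ?T_gt0//.
  by rewrite mul1r.
by rewrite mul0r subr0.
Qed.

End Periodization.

(** Periodization changes the value at [T], a null set, so agreement on the half-open period is
    enough. *)
Lemma eq_itg_periodize f g : measurable_fun setT f -> measurable_fun setT g ->
  (forall x, 0 <= x < T -> f x = g x) -> itg f 0 T = itg g 0 T.
Proof.
move=> mf mg fg; rewrite /itg /prim T_ge0 lexx set_itv1 !Rintegral_set1 !subr0.
rewrite /Rintegral -!integral_itv_bndo_bndc; last 2 first.
- exact/measurable_EFinP/measurable_funTS.
- exact/measurable_EFinP/measurable_funTS.
by congr fine; apply: eq_integral => x; rewrite inE/= in_itv/= => /fg ->.
Qed.

End Torus.

(** * Square-integrable functions and Fourier coordinates *)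

Section L2Basics.
Context {R : realType}.
Notation T := (pi *+ 2 : R).
Notation mu := (@lebesgue_measure R).
Notation muT := (muT R).
Implicit Types (f g h : R -> R) (q : L2 R).

Lemma muT1 : muT [set: measurableTypeR R] = 1%E.
Proof. exact: probability_setT. Qed.

Lemma L2fun_meas q : measurable_fun setT (L2fun q).
Proof. exact: (@measurable_funPT _ _ (measurableTypeR R) (measurableTypeR R) (repr _)). Qed.

Lemma L2fun_Lfun q : L2fun q \in Lfun muT 2%:E.
Proof.
rewrite inE; apply/andP; split; rewrite inE/=; first exact: L2fun_meas.
exact: (@Lebesgue_finite _ _ _ _ _ _ q).
Qed.

Definition bdd f := exists M, forall x, `|f x| <= M.

Lemma bdd_Lfun f : measurable_fun setT f -> bdd f -> f \in Lfun muT 2%:E.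
Proof.
move=> mf [M hM].
have M0 : 0 <= M := le_trans (normr_ge0 _) (hM 0).
rewrite inE; apply/andP; split; rewrite inE//= /finite_norm unlock.
apply: poweR_lty.
have mF : measurable_fun setT (fun x : measurableTypeR R => (`|f x| `^ 2)%:E).
  apply/measurable_EFinP; apply: (measurableT_comp (measurable_powR _)).
  exact: measurableT_comp.
apply: (@le_lt_trans _ _ (\int[muT]_x (cst (M `^ 2)%:E x))%E).
  apply: ge0_le_integral => //=.
  by move=> x _; rewrite lee_fin ge0_ler_powR// ?nnegrE.
by rewrite integral_cst// [X in (_ * X)%E]muT1 mule1 ltry.
Qed.

Lemma Lfun2_int f : f \in Lfun muT 2%:E -> muT.-integrable setT (EFin \o f).
Proof.
move=> lf; apply/Lfun1_integrable; apply: Lfun_subset12 lf.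
exact: fin_num_measure.
Qed.

Lemma Lfun2_mul_int f g : f \in Lfun muT 2%:E -> g \in Lfun muT 2%:E ->
  muT.-integrable setT (EFin \o (fun x => f x * g x)).
Proof. by move=> lf lg; apply/Lfun1_integrable; exact: Lfun2_mul_Lfun1. Qed.

Lemma Lfun_meas f p : f \in Lfun muT p -> measurable_fun setT f.
Proof. by rewrite inE => /andP[]; rewrite inE. Qed.

Lemma avgD f g : muT.-integrable setT (EFin \o f) -> muT.-integrable setT (EFin \o g) ->
  avg (fun x => f x + g x) = avg f + avg g.
Proof. by move=> lf lg; rewrite /avg RintegralD. Qed.

Lemma avgB f g : muT.-integrable setT (EFin \o f) -> muT.-integrable setT (EFin \o g) ->
  avg (fun x => f x - g x) = avg f - avg g.
Proof. by move=> lf lg; rewrite /avg RintegralB. Qed.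

Lemma avgZ c f : muT.-integrable setT (EFin \o f) -> avg (fun x => c * f x) = c * avg f.
Proof. by move=> lf; rewrite /avg RintegralZl. Qed.

Lemma avg_cst (c : R) : avg (fun _ : R => c) = c.
Proof. by rewrite /avg Rintegral_cst// [X in fine X]muT1/= mulr1. Qed.

Lemma avg_ge0 f : (forall x, 0 <= f x) -> 0 <= avg f.
Proof. by move=> f0; apply: Rintegral_ge0. Qed.

(** The mean of [(|f| - c)^2] is nonnegative for [c] the mean of [|f|]. *)
Lemma avg_abs_sqr f : f \in Lfun muT 2%:E ->
  avg (fun x => `|f x|) ^+ 2 <= avg (fun x => f x ^+ 2).
Proof.
move=> lf; set c := avg _.
have i1 : muT.-integrable setT (EFin \o (fun x => `|f x|)).
  by have := integrable_norm (Lfun2_int lf).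
have i2 : muT.-integrable setT (EFin \o (fun x => f x ^+ 2)) by exact: Lfun2_integrable_sqr.
have i0 : muT.-integrable setT (EFin \o (fun=> c ^+ 2)) by exact: finite_measure_integrable_cst.
have i3 : muT.-integrable setT (EFin \o (fun x => 2 * c * `|f x|)).
  by have := integrableZl measurableT (2 * c) i1; apply: eq_integrable.
have i4 : muT.-integrable setT (EFin \o (fun x => f x ^+ 2 - 2 * c * `|f x|)).
  by have := integrableB measurableT i2 i3; apply: eq_integrable.
have : 0 <= avg (fun x => f x ^+ 2 - 2 * c * `|f x| + c ^+ 2).
  apply: avg_ge0 => x.
  rewrite (_ : _ + _ = (`|f x| - c) ^+ 2) ?sqr_ge0//.
  by rewrite sqrrB real_normK ?num_real// -mulr_natl; ring.
rewrite avgD// avgB// avgZ// avg_cst -/c; lra.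
Qed.

Definition norm2 q : R := avg (fun x => L2fun q x ^+ 2).

Lemma Omega_norm2 (q : L2T R) (N : R) : Omega_ N q <-> norm2 q <= N.
Proof.
have i2 : muT.-integrable setT (EFin \o (fun x => L2fun q x ^+ 2)).
  exact: Lfun2_integrable_sqr (L2fun_Lfun q).
rewrite /Omega_ /= /norm2 /avg /Rintegral.
have h : (\int[muT]_x (L2fun q x ^+ 2)%:E)%E \is a fin_num := integrable_fin_num measurableT i2.
by rewrite -lee_fin fineK.
Qed.

Lemma norm2_ge0 q : 0 <= norm2 q.
Proof. by apply: avg_ge0 => x; exact: sqr_ge0. Qed.

Lemma L2fun_loc q : mu.-integrable `[0, T] (EFin \o L2fun q).
Proof. by apply/muT_integrable; [exact: L2fun_meas|exact: Lfun2_int (L2fun_Lfun q)]. Qed.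

Lemma periodize_locint q : locint (periodize q).
Proof. exact: (@locint_periodize R (L2fun q) (L2fun_loc q)). Qed.

Lemma periodize_par q : par 1 (periodize q).
Proof. exact: par_periodize. Qed.

Lemma periodize_eq q x : 0 <= x < T -> periodize q x = L2fun q x.
Proof. exact: (@periodize_id R (L2fun q)). Qed.

Lemma itg_periodize q g : g \in Lfun muT 2%:E ->
  itg (fun x => periodize q x * g x) 0 T = T * avg (fun x => L2fun q x * g x).
Proof.
move=> lg; have mg := Lfun_meas lg.
have mp := locint_measT (periodize_locint q).
rewrite avgE; last exact: Lfun2_mul_int (L2fun_Lfun q) lg.
  rewrite mulrA divff ?gt_eqF ?T_gt0// mul1r.
  apply: eq_itg_periodize; [exact: measurable_funM|exact: measurable_funM (L2fun_meas q) mg|].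
  by move=> x hx; rewrite periodize_eq.
exact: measurable_funM (L2fun_meas q) mg.
Qed.

Lemma itg_periodize_norm q : itg (fun x => `|periodize q x|) 0 T = T * avg (fun x => `|L2fun q x|).
Proof.
have mp := locint_measT (periodize_locint q).
have mq : measurable_fun setT (fun x => `|L2fun q x|).
  by apply: measurableT_comp => //; exact: L2fun_meas.
rewrite avgE//; last by have := integrable_norm (Lfun2_int (L2fun_Lfun q)).
rewrite mulrA divff ?gt_eqF ?T_gt0// mul1r.
apply: eq_itg_periodize => //; first exact: measurableT_comp.
by move=> x hx; rewrite periodize_eq.
Qed.

(** The functions of the random series. They are orthogonal with [hw n] the inverse of the squared
    norm of [hb n], so [coef n] recovers the Gaussian coordinate of index [n]. *)
Definition hb (n : int) (x : R) : R :=
  if n == 0 then 1 else if n < 0 then sin (n%:~R * x) / n%:~R else cos (n%:~R * x) / n%:~R.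

Definition hw (n : int) : R := if n == 0 then 1 else 2 * n%:~R ^+ 2.

Definition coef (n : int) q : R := hw n * avg (fun x => L2fun q x * hb n x).

Lemma hb_cont n : continuous (hb n).
Proof.
have cs : continuous (fun x : R => sin (n%:~R * x) / n%:~R : R).
  rewrite (_ : (fun x => _) = fun x => n%:~R^-1 * sin (n%:~R * x)).
    by apply: continuousZf; exact: continuous_sink.
  by apply/funext => x; rewrite mulrC.
have cc : continuous (fun x : R => cos (n%:~R * x) / n%:~R : R).
  rewrite (_ : (fun x => _) = fun x => n%:~R^-1 * cos (n%:~R * x)).
    by apply: continuousZf; exact: continuous_cosk.
  by apply/funext => x; rewrite mulrC.
have c1 : continuous (fun _ : R => 1 : R) by exact: continuous_cst.
by rewrite /hb; case: (n == 0) => //; case: (n < 0).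
Qed.

Lemma hb_le1 n x : `|hb n x| <= 1.
Proof.
rewrite /hb; case: eqP => [_|/eqP n0]; first by rewrite normr1.
have n1 : (1 : R) <= `|n%:~R|.
  by rewrite -intr_norm ler1z -gtz0_ge1 normr_gt0.
by case: ifP => _; rewrite normrM normfV ler_pdivrMr ?mul1r ?(lt_le_trans ltr01)//;
  apply: le_trans n1; [exact: sin_max|exact: cos_max].
Qed.

Lemma hb_Lfun n : hb n \in Lfun muT 2%:E.
Proof.
apply: bdd_Lfun; first exact: continuous_measurable_fun (@hb_cont n).
by exists 1 => x; exact: hb_le1.
Qed.

Lemma hbP (j : nat) x : (0 < j)%N -> hb j%:Z x = cos (j%:R * x) / j%:R.
Proof. by case: j. Qed.

Lemma hbN (j : nat) x : (0 < j)%N -> hb (- j%:Z) x = sin (j%:R * x) / j%:R.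
Proof.
case: j => // j _; have n0 : (- j.+1%:Z < 0)%R by [].
by rewrite /hb (lt_eqF n0) n0 mulrNz mulNr sinN invrN mulrNN.
Qed.

(** Here the rate [1 / j] originates: a Gaussian coordinate of order 1 multiplies a function of size
    [1 / j]. *)
Lemma coef_gap_cos (j : nat) q : (0 < j)%N -> coef j%:Z q = j%:R * gap_cos (periodize q) j.
Proof.
move=> j0; have jn : j%:R != 0 :> R by rewrite pnatr_eq0 -lt0n.
rewrite /coef /gap_cos (_ : avg _ = T^-1 * itg (fun x => periodize q x * hb j%:Z x) 0 T); last first.
  by rewrite itg_periodize ?hb_Lfun// mulrA mulVf ?mul1r// gt_eqF ?T_gt0.
rewrite (@eq_itg _ _ (fun x => j%:R^-1 * (periodize q x * cos (j%:R * x)))); last first.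
  by move=> x; rewrite hbP//; ring.
rewrite itgZ; last by apply: locintM (periodize_locint q) _; exact: continuous_cosk.
move: (itg _ _ _) => I; rewrite /hw eqz_nat (gtn_eqF j0) -pmulrn -(mulr_natl pi 2).
by move: (pi : R) (gt_eqF (pi_gt0 R)) => p /negbT p0; field; rewrite jn p0.
Qed.

Lemma coef_gap_sin (j : nat) q : (0 < j)%N -> coef (- j%:Z) q = j%:R * gap_sin (periodize q) j.
Proof.
move=> j0; have jn : j%:R != 0 :> R by rewrite pnatr_eq0 -lt0n.
rewrite /coef /gap_sin (_ : avg _ = T^-1 * itg (fun x => periodize q x * hb (- j%:Z) x) 0 T); last first.
  by rewrite itg_periodize ?hb_Lfun// mulrA mulVf ?mul1r// gt_eqF ?T_gt0.
rewrite (@eq_itg _ _ (fun x => j%:R^-1 * (periodize q x * sin (j%:R * x)))); last first.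
  by move=> x; rewrite hbN//; ring.
rewrite itgZ; last by apply: locintM (periodize_locint q) _; exact: continuous_sink.
move: (itg _ _ _) => I; rewrite /hw oppr_eq0 eqz_nat (gtn_eqF j0) mulrNz sqrrN -pmulrn -(mulr_natl pi 2).
by move: (pi : R) (gt_eqF (pi_gt0 R)) => p /negbT p0; field; rewrite jn p0.
Qed.

End L2Basics.

(** * The j-th gap of a small potential *)

Section HillSpectrum.
Context {R : realType}.
Notation T := (pi *+ 2 : R).
Implicit Types (q : L2 R).

Lemma hill_eigset q l f :
  hill_eigenspace q l f <-> eigset 1 (periodize q) l f \/ eigset (-1) (periodize q) l f.
Proof.
have lq := periodize_locint q.
have DE : hill_solution q l f <-> exists f', D2 f f' (fun x => Vmul (periodize q) l f x).
  split=> [[df h]|[f' Df]].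
    have hd x : is_derive x (1 : R) f (derive1 f x) by split; [exact: df|rewrite derive1E].
    have lv : locint (Vmul (periodize q) l f).
      by apply: Vmul_locint => //; exact: is_derive_cont hd.
    exists (derive1 f); split=> //; split=> // a b.
    have [ab|/ltW ab] := leP a b; first by rewrite h// itgE.
    by rewrite itgN itgE// -h// opprB.
  have [df [lv E]] := Df.
  have fE : derive1 f = f' by apply/funext => x; rewrite derive1E; case: (df x).
  split=> [x|a b ab]; first by case: (df x).
  by rewrite fE E itgE.
split=> [[/DE Df [p|p]]|[[p Df]|[p Df]]].
- by left; split=> // x; rewrite mul1r p.
- by right; split=> // x; rewrite mulN1r p.
- by split; [exact/DE|left => x; rewrite p mul1r].
- by split; [exact/DE|right => x; rewrite p mulN1r].
Qed.

Lemma eigset_zero (s : R) (v : R -> R) l f : (forall x, f x = 0) -> eigset s v l f.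
Proof.
move=> f0; have -> : f = fun=> 0 by apply/funext.
split=> [x|]; first by rewrite mulr0.
exists (fun=> 0); split=> [x|]; first exact: der_cst.
rewrite (_ : (fun x => _) = fun=> 0); last by apply/funext => x; rewrite /Vmul mulr0.
by split=> [|a b]; [exact: locint_cst|rewrite itg_cst mul0r subrr].
Qed.

Lemma double_succ (i : nat) : (2 * i.+1 - 1 = (2 * i).+1)%N /\ (2 * i.+1 = (2 * i).+2)%N.
Proof. by lia. Qed.

Section SmallPotential.
Variables (q : L2 R) (lam : nat -> R).
Hypothesis Hlam : is_periodic_spectrum q lam.
Hypothesis q_small : norm2 q <= (wm / 8) ^+ 2.

Let lq := periodize_locint q.
Let pq := periodize_par q.
Let m := itg (fun x => `|periodize q x|) 0 T.

Let m2 : m ^+ 2 <= 64 * norm2 q.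
Proof.
rewrite /m itg_periodize_norm exprMn.
have h := avg_abs_sqr (L2fun_Lfun q).
have T8 := @T_le8 R; have T0 := @T_ge0 R.
apply: ler_pM => //; [exact: sqr_ge0|exact: sqr_ge0|].
by apply: le_trans (_ : 8 ^+ 2 <= _); [rewrite ler_pXn2r// nnegrE|rewrite -natrX].
Qed.

Let mw : m <= wm.
Proof.
have w0 := @wm_gt0 R.
rewrite -(@ler_pXn2r _ 2)// ?nnegrE ?(ltW w0)//; last first.
  by apply: itg_ge0; [exact: T_ge0|exact: locint_norm|].
apply: le_trans m2 _; apply: le_trans (ler_wpM2l _ q_small) _ => //.
by rewrite exprMn exprVn -natrX mulrCA divff ?mulr1.
Qed.

Let ctr (j : nat) : R := (j%:R / 2) ^+ 2.
Let E l := hill_eigenspace q l.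

Let loc l f : E l f -> (exists x, f x != 0) -> exists j : nat, `|l - ctr j| < wr.
Proof.
move=> /hill_eigset[] e f0.
  by have [j [_ hj]] := eig_localise lq pq mw (or_introl erefl) e f0; exists j.
by have [j [_ hj]] := eig_localise lq pq mw (or_intror erefl) e f0; exists j.
Qed.

(** Localisation and separation of the windows leave nonzero eigenfunctions of multiplier
    [(-1) ^+ j] only; the zero function belongs to both sides. *)
Let EE j l : `|l - ctr j| <= wr -> E l = eigset ((-1) ^+ j) (periodize q) l.
Proof.
move=> hl; apply/seteqP; split=> f.
  have [f0|f0] := pselect (exists x, f x != 0); last first.
    move=> _; apply: eigset_zero => // x; apply/eqP/negPn/negP => h; apply: f0.
    by exists x.
  have w := @wr_small R; have w0 := @wr_gt0 R.
  have hl' : `|l - ctr j| < 8^-1 by apply: le_lt_trans hl _; lra.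
  move=> /hill_eigset[] e.
    have [i [si hi]] := eig_localise lq pq mw (or_introl erefl) e f0.
    by rewrite -(window_sep hi hl') si.
  have [i [si hi]] := eig_localise lq pq mw (or_intror erefl) e f0.
  by rewrite -(window_sep hi hl') si.
by move=> e; apply/hill_eigset; rewrite -signr_odd in e; move: e; case: odd; [right|left].
Qed.

(** Windows 0, 1, ... are processed by induction, which identifies the two roots in window [j]. The
    factor 64 comes from [m <= T * |q|_2] with [T <= 8], and so does the 8 in the bound on
    [norm2 q]. *)
Lemma spectral_gap (j : nat) : (0 < j)%N ->
  [/\ 0 <= lam (2 * j)%N - lam (2 * j - 1)%N,
      lam (2 * j)%N - lam (2 * j - 1)%N <=
        2 * (`|coef j%:Z q| + `|coef (- j%:Z) q| + 400 * 64 * norm2 q) / j%:R &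
      (`|coef j%:Z q| - 200 * 64 * norm2 q) / (2 * j%:R) <= lam (2 * j)%N - lam (2 * j - 1)%N].
Proof.
have [nd spec] := Hlam.
have w0 := @wr_gt0 R.
have win i : exists x y, [/\ `|x - ctr i.+1| < wr, `|y - ctr i.+1| < wr, x <= y &
   [/\ forall l f, `|l - ctr i.+1| <= wr -> l <> x -> l <> y -> E l f -> forall t, f t = 0,
       x = y -> has_dim (E x) 2,
       x < y -> has_dim (E x) 1 /\ has_dim (E y) 1,
       y - x <= 2 * (`|gap_cos (periodize q) i.+1| + `|gap_sin (periodize q) i.+1| + 400 * m ^+ 2 / i.+1%:R) &
       (`|gap_cos (periodize q) i.+1| - 200 * m ^+ 2 / i.+1%:R) / 2 <= y - x]].
  have [x [y [xr yr xy [h0 h1 h2 h3 h4]]]] := osc_window lq pq mw (ltn0Sn i).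
  exists x, y; split=> //; split=> //.
  - by move=> l f hl; rewrite (EE hl); exact: h0.
  - by rewrite (EE (ltW xr)).
  - by rewrite (EE (ltW xr)) (EE (ltW yr)).
have c0 : ctr 0 = 0 by rewrite /ctr mul0r expr0n.
have b0 : forall i, (lam i < ctr 0 + 8^-1) = (i <= 2 * 0)%N.
  apply: (window_zero nd spec loc).
  have [x [xr hx ux]] := cst_window lq pq mw.
  have E0 l : `|l| <= wr -> E l = eigset 1 (periodize q) l.
    by move=> hl; rewrite (@EE 0%N) ?expr0// c0 subr0.
  exists x; split=> //; first by rewrite -/(E x) E0// ltW.
  by move=> l f hl; rewrite -/(E l) E0//; exact: ux.
have bel : forall i, forall k, (lam k < ctr i + 8^-1) = (k <= 2 * i)%N.
  elim=> [//|i IH]; have [x [y [xr yr xy [h0 h1 h2 _ _]]]] := win i.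
  by have [] := window_step nd spec loc IH xr yr xy h0 h1 h2.
case: j => // i _; have [x [y [xr yr xy [h0 h1 h2 h3 h4]]]] := win i.
have [_ e1 e2] := window_step nd spec loc (bel i) xr yr xy h0 h1 h2.
have [d1 d2] := double_succ i; rewrite d1 d2.
rewrite e1 e2 coef_gap_cos// coef_gap_sin// !(normrM i.+1%:R).
have -> : `|i.+1%:R| = i.+1%:R :> R by rewrite ger0_norm.
have jn : (0 : R) < i.+1%:R by rewrite ltr0n.
move: m2 h3 h4; set M := m ^+ 2; set g1 := `|gap_cos _ _|; set g2 := `|gap_sin _ _|.
set J : R := i.+1%:R in jn * => mN h3 h4.
have hM : M / J <= 64 * norm2 q / J by rewrite ler_pM2r// invr_gt0.
split; first by rewrite subr_ge0.
  apply: le_trans h3 _.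
  rewrite (_ : 2 * _ / J = 2 * (g1 + g2 + 400 * (64 * norm2 q / J))); last by field; rewrite gt_eqF.
  by rewrite -mulrA; exact: ler_wpM2l (ler0n R 2) _ _ (lerD (lexx _) (ler_wpM2l (ler0n R 400) hM)).
apply: le_trans h4.
rewrite (_ : _ / (2 * J) = (g1 - 200 * (64 * norm2 q / J)) / 2); last by field; rewrite gt_eqF.
by rewrite -(mulrA 200) ler_wpM2r// lerB// ler_wpM2l.
Qed.

End SmallPotential.
End HillSpectrum.

(** * The L^2 distance and Borel measurability *)

Section L2Norm.
Context {R : realType}.
Notation T := (pi *+ 2 : R).
Notation muT := (muT R).
Notation L := (Lfun muT 2%:E).
Implicit Types (f g h : R -> R).

Lemma Lfun2D f g : f \in L -> g \in L -> (fun x => f x + g x) \in L.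
Proof. by have [_] := @Lfun_addr_closed _ _ R muT _ (lee1n 2); exact. Qed.

Lemma Lfun2Z c f : f \in L -> (fun x => c * f x) \in L.
Proof.
move=> lf; have [_ h] := @Lfun_submod_closed _ _ R muT _ (lee1n 2).
have L0 : (0 : R -> R) \in L by have [] := @Lfun_addr_closed _ _ R muT _ (lee1n 2).
by have := h c f 0 lf L0; rewrite addr0.
Qed.

Lemma Lfun2N f : f \in L -> (fun x => - f x) \in L.
Proof. by move=> /(Lfun2Z (-1)); congr (_ \in L); apply/funext => x; rewrite mulN1r. Qed.

Lemma Lfun2B f g : f \in L -> g \in L -> (fun x => f x - g x) \in L.
Proof. by move=> lf /Lfun2N; exact: Lfun2D. Qed.

Lemma Lfun2_cst c : (fun _ : R => c) \in L.
Proof. by apply: bdd_Lfun => //; exists `|c|. Qed.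

Definition nrm f : R := Num.sqrt (avg (fun x => f x ^+ 2)).

Lemma nrm_ge0 f : 0 <= nrm f. Proof. exact: sqrtr_ge0. Qed.

Lemma nrm_sqr f : nrm f ^+ 2 = avg (fun x => f x ^+ 2).
Proof. by rewrite sqr_sqrtr// avg_ge0// => x; exact: sqr_ge0. Qed.

Lemma Lnorm2E f : f \in L -> ('N[muT]_2%:E[EFin \o f])%E = (nrm f)%:E.
Proof.
move=> lf; rewrite unlock /nrm /avg /Rintegral.
under eq_integral do rewrite abse_EFin poweR_EFin powR_mulrn// real_normK ?num_real//.
have fi : (\int[muT]_x (f x ^+ 2)%:E)%E \is a fin_num.
  by apply: integrable_fin_num => //; exact: Lfun2_integrable_sqr.
rewrite -{1}(fineK fi) poweR_EFin powR12_sqrt// fine_ge0// integral_ge0// => x _.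
by rewrite lee_fin sqr_ge0.
Qed.

Lemma nrmD f g : f \in L -> g \in L -> nrm (fun x => f x + g x) <= nrm f + nrm g.
Proof.
move=> lf lg; rewrite -lee_fin EFinD -!Lnorm2E//; last exact: Lfun2D.
exact: (@minkowski_EFin _ _ _ muT f g 2 (Lfun_meas lf) (Lfun_meas lg) (ler1n R 2)).
Qed.

Lemma nrmZ c f : f \in L -> nrm (fun x => c * f x) = `|c| * nrm f.
Proof.
move=> lf; rewrite /nrm -sqrtr_sqr -sqrtrM ?sqr_ge0// -avgZ; last exact: Lfun2_integrable_sqr.
by congr (Num.sqrt (avg _)); apply/funext => x; rewrite exprMn.
Qed.

Lemma nrmN f : nrm (fun x => - f x) = nrm f.
Proof. by rewrite /nrm; congr (Num.sqrt (avg _)); apply/funext => x; rewrite sqrrN. Qed.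

Lemma nrmBC f g : nrm (fun x => f x - g x) = nrm (fun x => g x - f x).
Proof. by rewrite -nrmN; congr nrm; apply/funext => x; rewrite opprB. Qed.

Lemma nrm_tri f g h : f \in L -> g \in L -> h \in L ->
  nrm (fun x => f x - h x) <= nrm (fun x => f x - g x) + nrm (fun x => g x - h x).
Proof.
move=> lf lg lh; apply: le_trans (nrmD (Lfun2B lf lg) (Lfun2B lg lh)).
by rewrite le_eqVlt; apply/orP; left; apply/eqP; congr nrm; apply/funext => x; ring.
Qed.

Lemma avg_abs_le f : f \in L -> avg (fun x => `|f x|) <= nrm f.
Proof.
move=> lf; rewrite -(@ler_pXn2r _ 2)// ?nnegrE ?nrm_ge0// ?avg_ge0//.
by rewrite nrm_sqr; exact: avg_abs_sqr.
Qed.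

Lemma le_avg f g : muT.-integrable setT (EFin \o f) -> muT.-integrable setT (EFin \o g) ->
  (forall x, f x <= g x) -> avg f <= avg g.
Proof. by move=> lf lg fg; apply: le_Rintegral. Qed.

Lemma avg_norm f : muT.-integrable setT (EFin \o f) -> `|avg f| <= avg (fun x => `|f x|).
Proof. by move=> lf; apply: le_normr_Rintegral. Qed.

Lemma nrm_le_bound f M : f \in L -> 0 <= M -> (forall x, `|f x| <= M) -> nrm f <= M.
Proof.
move=> lf M0 fM; rewrite -(@ler_pXn2r _ 2)// ?nnegrE ?nrm_ge0// nrm_sqr -[leRHS]avg_cst.
apply: le_avg; [exact: Lfun2_integrable_sqr|exact: finite_measure_integrable_cst|].
by move=> x; rewrite -[leLHS]real_normK ?num_real//; rewrite ler_pXn2r ?nnegrE.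
Qed.

Lemma ae_muT_imp (P Q : R -> Prop) : (forall x, P x -> Q x) ->
  (\forall x \ae muT, P x) -> \forall x \ae muT, Q x.
Proof.
move=> PQ [A [mA A0 sub]]; exists A; split=> // x /= nQ; apply: sub => /= Px.
exact/nQ/PQ.
Qed.

Lemma avg_ae f g : measurable_fun setT f -> measurable_fun setT g ->
  f = g %[ae muT] -> avg f = avg g.
Proof.
move=> mf mg fg; rewrite /avg /Rintegral; congr fine.
apply: ae_eq_integral => //; [exact/measurable_EFinP|exact/measurable_EFinP|].
by apply: ae_muT_imp fg => x /= h _; rewrite h.
Qed.

Lemma ae_Lfun f g : f \in L -> measurable_fun setT g -> g = f %[ae muT] -> g \in L.
Proof.
move=> lf mg gf; rewrite inE; apply/andP; split; rewrite inE//= /finite_norm.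
rewrite (_ : 'N[muT]_2%:E[EFin \o g] = 'N[muT]_2%:E[EFin \o f])%E.
  by rewrite Lnorm2E// ltry.
rewrite unlock; apply: (congr1 (fun y => poweR y 2^-1)).
have mp h : measurable_fun setT h -> measurable_fun setT (fun x : measurableTypeR R => (`|(EFin \o h) x| `^ 2)%E).
  move=> mh; apply: (measurableT_comp (measurable_poweR _)).
  by apply: measurableT_comp => //; exact/measurable_EFinP.
apply: ae_eq_integral => //; [exact: mp|exact: mp (Lfun_meas lf)|].
by apply: ae_muT_imp gf => x /= h _; rewrite /= h.
Qed.

Lemma nrm_ae f g : measurable_fun setT f -> measurable_fun setT g ->
  f = g %[ae muT] -> nrm f = nrm g.
Proof.
move=> mf mg fg; congr Num.sqrt; apply: avg_ae; [exact: measurable_funX..|].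
by apply: ae_muT_imp fg => x h h2; rewrite h.
Qed.

Lemma mkL2_subproof f : f \in L -> {q : L2 R | L2fun q = f %[ae muT]}.
Proof.
move=> lf; have mf := Lfun_meas lf.
pose m : {mfun measurableTypeR R >-> measurableTypeR R} :=
  HB.pack (f : measurableTypeR R -> measurableTypeR R)
    (isMeasurableFun.Build _ _ (measurableTypeR R) (measurableTypeR R) f mf).
pose c : {mfun_ muT, measurableTypeR R >-> measurableTypeR R} :=
  (\pi_({mfun_ muT, measurableTypeR R >-> measurableTypeR R}) m)%qT.
have ce : (c : R -> R) = f %[ae muT].
  have /asboolP : ae_eq_op muT (repr c) m by apply/eqmodP; rewrite reprK.
  by [].
have cm : measurable_fun setT (c : R -> R).
  exact: (@measurable_funPT _ _ (measurableTypeR R) (measurableTypeR R) (repr c)).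
have cf : finite_norm muT 2%:E (c : R -> R).
  by have := ae_Lfun lf cm ce; rewrite inE => /andP[_]; rewrite inE.
pose q : LspaceType2 muT := HB.pack c (isFinLebesgue.Build _ _ R muT 2%:E (lee1n 2) c cf).
by exists q.
Qed.

(** [point] is a default value outside L^2. *)
Definition mkL2 f : L2 R :=
  if pselect (f \in L) is left lf then sval (mkL2_subproof lf) else point.

Lemma mkL2E f : f \in L -> L2fun (mkL2 f) = f %[ae muT].
Proof. by move=> lf; rewrite /mkL2; case: pselect => // lf'; case: (mkL2_subproof lf'). Qed.

(** An element is an almost-everywhere class packed with a proof of finite norm: the classes agree
    by the quotient, the proofs by irrelevance. *)
Lemma L2_ext (p q : L2 R) : L2fun p = L2fun q %[ae muT] -> p = q.
Proof.
move=> pq.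
have : LebesgueSpace.sort p = LebesgueSpace.sort q.
  rewrite -[LebesgueSpace.sort p]reprK -[LebesgueSpace.sort q]reprK.
  by apply/eqmodP/asboolP.
case: p q {pq} => p [[cp]] [q [[cq]]] /= e.
by case: _ / e in cq *; rewrite (Prop_irrelevance cp cq).
Qed.

Definition dst (p q : L2 R) : R := nrm (fun x => L2fun p x - L2fun q x).

Lemma L2distE (p q : L2 R) : L2dist (L2fun p) (L2fun q) = (dst p q)%:E.
Proof. by rewrite /L2dist /dst -Lnorm2E//; exact: Lfun2B (L2fun_Lfun _) (L2fun_Lfun _). Qed.

Lemma dst_tri (a b c : L2 R) : dst a c <= dst a b + dst b c.
Proof. exact: nrm_tri (L2fun_Lfun _) (L2fun_Lfun _) (L2fun_Lfun _). Qed.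

Lemma dstC (a b : L2 R) : dst a b = dst b a. Proof. exact: nrmBC. Qed.

Lemma dst_xx (a : L2 R) : dst a a = 0.
Proof.
rewrite /dst /nrm (_ : (fun x => _) = fun=> 0); first by rewrite avg_cst sqrtr0.
by apply/funext => x; rewrite subrr expr0n.
Qed.

Lemma L2openP (U : set (L2 R)) : @L2open R U <->
  forall q, U q -> exists2 e, 0 < e & forall p, dst p q < e -> U p.
Proof.
split=> h q /h [e e0 he]; exists e => // p; last by rewrite L2distE lte_fin; exact: he.
by move=> pq; apply: he; rewrite L2distE lte_fin.
Qed.

Lemma open_measurable_L2 (U : set (L2T R)) :
  (forall q, U q -> exists2 e, 0 < e & forall p : L2T R, dst p q < e -> U p) -> measurable U.
Proof. by move=> h; apply: sub_sigma_algebra; apply/L2openP. Qed.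

Lemma closed_measurable_L2 (C : set (L2T R)) :
  (forall q, ~ C q -> exists2 e, 0 < e & forall p : L2T R, dst p q < e -> ~ C p) -> measurable C.
Proof. by move=> h; rewrite -[C]setCK; apply: measurableC; exact: open_measurable_L2. Qed.

Lemma measurable_fun_open d (A : measurableType d) (F : A -> L2T R) :
  (forall U : set (L2T R), @L2open R U -> measurable (F @^-1` U)) -> measurable_fun setT F.
Proof.
move=> h; apply: (@measurability _ _ A (L2T R) setT F (@L2open R) erefl) => //.
by move=> _ [U oU <-]; rewrite setTI; exact: h.
Qed.

Lemma continuous_L2_real (F : L2T R -> R) :
  (forall q (e : R), 0 < e -> exists2 d, 0 < d & forall p : L2T R, dst p q < d -> `|F p - F q| < e) ->
  measurable_fun setT F.
Proof.
move=> cF; apply: (measurability _ (RGenOInfty.measurableE R)) => //.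
move=> _ [_ [a ->] <-]; rewrite setTI; apply: open_measurable_L2 => q /=.
rewrite in_itv/= andbT => aq; have [d d0 hd] := cF q (F q - a) ltac:(by rewrite subr_gt0).
exists d => // p /hd; rewrite in_itv/= andbT ltr_norml => /andP[+ _]; lra.
Qed.

Lemma lipschitz_L2_real (F : L2T R -> R) C :
  (forall p q : L2T R, `|F p - F q| <= C * dst p q) -> measurable_fun setT F.
Proof.
move=> cF; apply: continuous_L2_real => q e e0.
have C1 : 0 < `|C| + 1 by rewrite ltr_wpDl.
exists (e / (`|C| + 1)); first by rewrite divr_gt0.
move=> p; rewrite ltr_pdivlMr// => h; apply: le_lt_trans (cF p q) (le_lt_trans _ h).
rewrite mulrC ler_wpM2l ?nrm_ge0//; have := ler_norm C; lra.
Qed.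

End L2Norm.

(** * Translations q + t h *)

Section L2Translation.
Context {R : realType}.
Notation muT := (muT R).
Notation L := (Lfun muT 2%:E).
Implicit Types (h : R -> R) (p q : L2T R) (s t : R).

Definition ah h q t : L2T R := mkL2 (fun x => L2fun q x + t * h x).

Section Direction.
Variable h : R -> R.
Hypothesis lh : h \in L.

Lemma ah_Lfun q t : (fun x => L2fun q x + t * h x) \in L.
Proof. by apply: Lfun2D; [exact: L2fun_Lfun|exact: Lfun2Z]. Qed.

Lemma ahE q t : L2fun (ah h q t) = (fun x => L2fun q x + t * h x) %[ae muT].
Proof. by apply: mkL2E; exact: ah_Lfun. Qed.

Lemma ae_muT_and (P Q : R -> Prop) : (\forall x \ae muT, P x) -> (\forall x \ae muT, Q x) ->
  \forall x \ae muT, P x /\ Q x.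
Proof.
move=> [A [mA A0 sA]] [B [mB B0 sB]]; exists (A `|` B); split.
- exact: measurableU.
- by rewrite measureU0.
- move=> x /= /not_andP[nP|nQ]; [left; exact: sA|right; exact: sB].
Qed.

Lemma dst_ah p q s t : dst (ah h p s) (ah h q t) =
  nrm (fun x => (L2fun p x + s * h x) - (L2fun q x + t * h x)).
Proof.
apply: nrm_ae.
- by apply: measurable_funB; exact: L2fun_meas.
- by apply: measurable_funB; exact: Lfun_meas (ah_Lfun _ _).
- by apply: ae_muT_imp (ae_muT_and (ahE p s) (ahE q t)) => x [h1 h2] xT; rewrite h1// h2.
Qed.

Lemma ah_ah q s t : ah h (ah h q s) t = ah h q (s + t).
Proof.
apply: L2_ext; apply: ae_muT_imp (ae_muT_and (ahE (ah h q s) t) (ae_muT_and (ahE q s) (ahE q (s + t)))).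
by move=> x [h1 [h2 h3]] xT; rewrite h1// h2// h3//; ring.
Qed.

Lemma ah0 q : ah h q 0 = q.
Proof.
by apply: L2_ext; apply: ae_muT_imp (ahE q 0) => x h1 xT; rewrite h1// mul0r addr0.
Qed.

Lemma dst_ah_same p q t : dst (ah h p t) (ah h q t) = dst p q.
Proof. by rewrite dst_ah; congr nrm; apply/funext => x; ring. Qed.

Lemma dst_ah_move q s t : dst (ah h q s) (ah h q t) = `|s - t| * nrm h.
Proof. by rewrite dst_ah -nrmZ//; congr nrm; apply/funext => x; ring. Qed.

Lemma dst_ah_le p q s t : dst (ah h p s) (ah h q t) <= dst p q + `|s - t| * nrm h.
Proof. by have := dst_tri (ah h p s) (ah h q s) (ah h q t); rewrite dst_ah_same dst_ah_move. Qed.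

End Direction.

(** The centres of balls of radius [1 / (k + 1)] inside [U]. These sets are closed, and they exhaust
    an open [U]; a limit lies in [U] as soon as close approximations lie in one of them. *)
Definition shrink (U : set (L2T R)) (k : nat) : set (L2T R) :=
  [set p | forall p' : L2T R, dst p' p < k.+1%:R^-1 -> U p'].

Lemma shrink_measurable U k : measurable (shrink U k).
Proof.
apply: closed_measurable_L2 => q /existsNP[p' /not_implyP[h nU]].
exists (k.+1%:R^-1 - dst p' q); first by rewrite subr_gt0.
move=> p hp /(_ p') hU; apply/nU/hU.
by apply: le_lt_trans (dst_tri _ q _) _; rewrite (dstC q) -ltrBrDl.
Qed.

Lemma shrink_nbhs U q : @L2open R U -> U q ->
  exists k, forall p, dst p q < k.+1%:R^-1 -> shrink U k p.
Proof.
move=> /L2openP oU /oU[e e0 he].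
have [k hk] : exists k : nat, k.+1%:R^-1 < e / 2.
  have e2 : 0 < e / 2 by rewrite divr_gt0.
  exists (Num.bound (e / 2)^-1).
  rewrite invf_plt ?posrE//; apply: lt_trans (archi_boundP _) _.
    by rewrite invr_ge0 ltW.
  by rewrite ltr_nat.
exists k => p hp p' hp'; apply: he.
apply: le_lt_trans (dst_tri _ p _) (lt_trans (ltrD hp' hp) _).
by rewrite (splitr e) ltrD.
Qed.

Lemma ah_measurable1 h t : h \in L -> measurable_fun setT (fun q => ah h q t).
Proof.
move=> lh; apply: measurable_fun_open => U oU; apply: open_measurable_L2 => q /= /((L2openP U).1 oU)[e e0 he].
by exists e => // p hp; apply: he; rewrite dst_ah_same.
Qed.

(** Joint continuity only makes preimages open in the product topology; for the product
    sigma-algebra they are written as countable unions of measurable rectangles. *)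
Lemma ah_measurable h : h \in L ->
  measurable_fun setT (fun z : L2T R * measurableTypeR R => ah h z.1 z.2).
Proof.
move=> lh; apply: measurable_fun_open => U oU.
(* [t] is replaced by a rational [r]; the error [|t - r| * nrm h] is absorbed by passing from [U] to
   [shrink U k]. *)
pose A (k : nat) (r : rat) := (fun q => ah h q (ratr r)) @^-1` shrink U k `*`
  [set t : measurableTypeR R | `|t - ratr r| * (nrm h + 1) < k.+1%:R^-1].
have nh : 0 < nrm h + 1 by rewrite ltr_wpDl ?nrm_ge0.
have -> : (fun z : L2T R * measurableTypeR R => ah h z.1 z.2) @^-1` U =
    \bigcup_k \bigcup_r A k r.
  apply/seteqP; split=> [[q t] /= Uq|[q t] [k _ [r _ [/= hq ht]]]].
    have [k hk] := shrink_nbhs oU Uq; exists k => //.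
    have d0 : 0 < k.+1%:R^-1 / (nrm h + 1) by rewrite divr_gt0.
    have tl : t - k.+1%:R^-1 / (nrm h + 1) < t by rewrite ltrBlDr ltrDl.
    have [r] := rat_in_itvoo tl.
    rewrite in_itv/= => /andP[r1 r2].
    have tr : `|t - ratr r| * (nrm h + 1) < k.+1%:R^-1.
      by rewrite -ltr_pdivlMr// ger0_norm ?subr_ge0 ?(ltW r2)// ltrBlDr addrC -ltrBlDr.
    exists r; [by []|split; [|exact: tr]]; apply: (hk (ah h q (ratr r))).
    rewrite dst_ah_move// distrC; apply: le_lt_trans tr.
    by rewrite ler_wpM2l// lerDl.
  apply: (hq); rewrite dst_ah_move//; apply: le_lt_trans ht.
  by rewrite ler_wpM2l// lerDl.
apply: bigcup_measurable => k _; apply: bigcupT_measurable_rat => r.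
apply: measurableX.
  by rewrite -[X in measurable X]setTI; apply: ah_measurable1 => //; exact: shrink_measurable.
rewrite (_ : [set t | _] = (fun t : measurableTypeR R => `|t - ratr r| * (nrm h + 1)) @^-1` `]-oo, k.+1%:R^-1[).
  rewrite -[X in measurable X]setTI.
  apply: (_ : measurable_fun setT (fun t : measurableTypeR R => `|t - ratr r| * (nrm h + 1) : measurableTypeR R)) => //.
  apply: measurable_funM => //; apply: measurableT_comp => //.
  exact: measurable_funB.
by apply/seteqP; split=> t /=; rewrite in_itv.
Qed.

End L2Translation.

(** * Orthogonality and trigonometric polynomials *)

Section Coefficients.
Context {R : realType}.
Notation T := (pi *+ 2 : R).
Notation muT := (muT R).
Notation L := (Lfun muT 2%:E).
Implicit Types (n m : int) (p q : L2T R) (t : R).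

Lemma avg_itg (f : R -> R) : continuous f -> (exists M, forall x, `|f x| <= M) ->
  avg f = T^-1 * itg f 0 T.
Proof.
move=> cf bf; have mf := continuous_measurable_fun cf.
by apply: avgE => //; apply: Lfun2_int; exact: bdd_Lfun.
Qed.

Lemma avg_cosz m : avg (fun x : R => cos (m%:~R * x)) = (m == 0)%:R.
Proof.
rewrite avg_itg; [|exact: continuous_cosk|by exists 1 => x; exact: cos_max].
have T0 := @T_gt0 R.
have pos k : (0 < k)%N -> itg (fun x : R => cos (k%:R * x)) 0 T = 0 by exact: itg_cosn.
case: m => [[|k]|k].
- rewrite (@eq_itg _ _ (fun=> 1)); last by move=> x; rewrite mul0r cos0.
  by rewrite itg_cst subr0 mul1r mulVf// gt_eqF.
- by rewrite -[X in itg X]/(fun x : R => cos (k.+1%:R * x)) pos// mulr0.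
- rewrite (@eq_itg _ _ (fun x : R => cos (k.+1%:R * x))) ?pos ?mulr0// => x.
  by rewrite NegzE mulrNz mulNr cosN.
Qed.

Lemma avg_sinz m : avg (fun x : R => sin (m%:~R * x)) = 0.
Proof.
rewrite avg_itg; [|exact: continuous_sink|by exists 1 => x; exact: sin_max].
case: m => k; first by rewrite -[X in itg X]/(fun x : R => sin (k%:R * x)) itg_sinn mulr0.
rewrite (@eq_itg _ _ (fun x : R => -1 * sin (k.+1%:R * x))).
  rewrite itgZ ?itg_sinn ?mulr0//; apply: continuous_locint; exact: continuous_sink.
move=> x; rewrite (_ : (Negz k)%:~R * x = - (k.+1%:R * x)) ?sinN ?mulN1r//.
by rewrite NegzE mulrNz mulNr.
Qed.

Let ic m : muT.-integrable setT (EFin \o (fun x : R => cos (m%:~R * x))).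
Proof.
apply: Lfun2_int; apply: bdd_Lfun; first exact: continuous_measurable_fun (@continuous_cosk R _).
by exists 1 => x; exact: cos_max.
Qed.

Let isn m : muT.-integrable setT (EFin \o (fun x : R => sin (m%:~R * x))).
Proof.
apply: Lfun2_int; apply: bdd_Lfun; first exact: continuous_measurable_fun (@continuous_sink R _).
by exists 1 => x; exact: sin_max.
Qed.

Let intZ c (f : R -> R) : muT.-integrable setT (EFin \o f) ->
  muT.-integrable setT (EFin \o (fun x => c * f x)).
Proof. by move=> /(integrableZl measurableT c); apply: eq_integrable. Qed.

Lemma hb_orth n m : (hw n : R) * avg (fun x => hb m x * hb n x) = (n == m)%:R.
Proof.
have cc (i j : int) : avg (fun x : R => cos (i%:~R * x) * cos (j%:~R * x)) =
    2^-1 * ((i - j == 0)%:R + (i + j == 0)%:R).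
  rewrite -!avg_cosz -avgD// -avgZ; last by have := integrableD measurableT (ic (i - j)) (ic (i + j)); apply: eq_integrable.
  by congr avg; apply/funext => x; rewrite !intrD !mulrNz !mulrDl !mulNr cosB cosD; field.
have ss (i j : int) : avg (fun x : R => sin (i%:~R * x) * sin (j%:~R * x)) =
    2^-1 * ((i - j == 0)%:R - (i + j == 0)%:R).
  rewrite -!avg_cosz -avgB// -avgZ; last by have := integrableB measurableT (ic (i - j)) (ic (i + j)); apply: eq_integrable.
  by congr avg; apply/funext => x; rewrite !intrD !mulrNz !mulrDl !mulNr cosB cosD; field.
have sc (i j : int) : avg (fun x : R => sin (i%:~R * x) * cos (j%:~R * x)) = 0.
  rewrite -[RHS](mulr0 2^-1) -[X in _ * X](addr0 0) -{1}(avg_sinz (i + j)) -(avg_sinz (i - j)) -avgD// -avgZ; last first.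
    by have := integrableD measurableT (isn (i + j)) (isn (i - j)); apply: eq_integrable.
  by congr avg; apply/funext => x; rewrite !intrD !mulrNz !mulrDl !mulNr sinB sinD; field.
rewrite /hb /hw.
have [n0|n0] := eqVneq n 0; have [m0|m0] := eqVneq m 0; rewrite /=.
- by rewrite n0 m0 eqxx (_ : (fun x => _) = fun=> 1) ?avg_cst ?mulr1//; apply/funext => x; rewrite mulr1.
- rewrite n0 mul1r (eq_sym 0) (negbTE m0); case: (m < 0).
    rewrite (_ : (fun x => _) = fun x => m%:~R^-1 * sin (m%:~R * x)).
      by rewrite avgZ// avg_sinz mulr0.
    by apply/funext => x; rewrite mulr1 mulrC.
  rewrite (_ : (fun x => _) = fun x => m%:~R^-1 * cos (m%:~R * x)).
    by rewrite avgZ// avg_cosz (negbTE m0) mulr0.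
  by apply/funext => x; rewrite mulr1 mulrC.
- rewrite m0 (negbTE n0); case: (n < 0).
    rewrite (_ : (fun x => _) = fun x => n%:~R^-1 * sin (n%:~R * x)).
      by rewrite avgZ// avg_sinz !mulr0.
    by apply/funext => x; rewrite mul1r mulrC.
  rewrite (_ : (fun x => _) = fun x => n%:~R^-1 * cos (n%:~R * x)).
    by rewrite avgZ// avg_cosz (negbTE n0) !mulr0.
  by apply/funext => x; rewrite mul1r mulrC.
have nR : n%:~R != 0 :> R by rewrite intr_eq0.
have mR : m%:~R != 0 :> R by rewrite intr_eq0.
have ec : (n == m)%:R = (m - n == 0)%:R :> R by rewrite subr_eq0 eq_sym.
have iM (f g : R -> R) : f \in L -> g \in L ->
   muT.-integrable setT (EFin \o (fun x => f x * g x)) by exact: Lfun2_mul_int.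
have lc (i : int) : (fun x : R => cos (i%:~R * x)) \in L.
  apply: bdd_Lfun; first exact: continuous_measurable_fun (@continuous_cosk R _).
  by exists 1 => x; exact: cos_max.
have ls (i : int) : (fun x : R => sin (i%:~R * x)) \in L.
  apply: bdd_Lfun; first exact: continuous_measurable_fun (@continuous_sink R _).
  by exists 1 => x; exact: sin_max.
have key (f g : R -> R) : f \in L -> g \in L ->
   avg (fun x => f x / m%:~R * (g x / n%:~R)) = (m%:~R^-1 / n%:~R) * avg (fun x => f x * g x).
  move=> lf lg; rewrite -avgZ; last exact: iM.
  by congr avg; apply/funext => x; rewrite mulrACA mulrC.
case: (ltgtP m 0) m0 => // m0 _; case: (ltgtP n 0) n0 => // n0 _; rewrite key//.
- rewrite ss ec (_ : (m + n == 0) = false) ?subr0; last by rewrite lt_eqF// -(addr0 0) ltrD.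
  have [e|] := eqVneq (m - n) 0; last by rewrite !mulr0.
  by move/eqP: e; rewrite subr_eq0 => /eqP ->; field.
- rewrite sc !mulr0 ec (_ : (m - n == 0) = false)//.
  by rewrite lt_eqF// subr_lt0 (lt_trans m0).
- rewrite (_ : (fun x => _) = fun x => sin (n%:~R * x) * cos (m%:~R * x)); last first.
    by apply/funext => x; rewrite mulrC.
  rewrite sc !mulr0 ec (_ : (m - n == 0) = false)//.
  by rewrite gt_eqF// subr_gt0 (lt_trans n0).
- rewrite cc ec (_ : (m + n == 0) = false) ?addr0; last by rewrite gt_eqF// addr_gt0.
  have [e|] := eqVneq (m - n) 0; last by rewrite !mulr0.
  by move/eqP: e; rewrite subr_eq0 => /eqP ->; field.
Qed.

Lemma coef_lip n p q : `|coef n p - coef n q| <= `|hw n : R| * dst p q.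
Proof.
have ih q' : muT.-integrable setT (EFin \o (fun x => L2fun q' x * hb n x)).
  by apply: Lfun2_mul_int; [exact: L2fun_Lfun|exact: hb_Lfun].
rewrite /coef -mulrBr normrM ler_wpM2l// -avgB//.
have l := Lfun2B (L2fun_Lfun p) (L2fun_Lfun q).
apply: le_trans (avg_abs_le l).
rewrite (_ : (fun x => _) = fun x => (L2fun p x - L2fun q x) * hb n x); last first.
  by apply/funext => x; rewrite mulrBl.
have i1 := Lfun2_mul_int l (hb_Lfun n).
apply: le_trans (avg_norm i1) _; apply: le_avg.
- by have := integrable_norm i1.
- by have := integrable_norm (Lfun2_int l).
- by move=> x; rewrite normrM ler_piMr// hb_le1.
Qed.

Lemma coef_ah n m q t : coef n (ah (hb m) q t) = coef n q + t * (n == m)%:R.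
Proof.
have ih q' : muT.-integrable setT (EFin \o (fun x => L2fun q' x * hb n x)).
  by apply: Lfun2_mul_int; [exact: L2fun_Lfun|exact: hb_Lfun].
have im := Lfun2_mul_int (@hb_Lfun R m) (hb_Lfun n).
have mhb := Lfun_meas (@hb_Lfun R n).
rewrite /coef (@avg_ae _ _ (fun x => L2fun q x * hb n x + t * (hb m x * hb n x))).
- rewrite avgD//; last exact: intZ.
  by rewrite avgZ// mulrDr mulrCA hb_orth.
- exact: measurable_funM (L2fun_meas _) mhb.
- apply: measurable_funD; first exact: measurable_funM (L2fun_meas _) mhb.
  by apply: measurable_funM => //; apply: measurable_funM => //; exact: Lfun_meas (hb_Lfun m).
- by apply: ae_muT_imp (ahE (@hb_Lfun R m) q t) => x h xT; rewrite h//; ring.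
Qed.

Definition zeroL2 : L2T R := mkL2 (fun=> 0).

Lemma zeroL2E : L2fun zeroL2 = (fun=> 0) %[ae muT].
Proof. by apply: mkL2E; exact: Lfun2_cst. Qed.

Lemma coef_zero n : coef n zeroL2 = 0.
Proof.
rewrite /coef (@avg_ae _ _ (fun=> 0)) ?avg_cst ?mulr0//.
  exact: measurable_funM (L2fun_meas _) (Lfun_meas (@hb_Lfun R n)).
by apply: ae_muT_imp zeroL2E => x h xT; rewrite h// mul0r.
Qed.

Lemma dst_zero q : dst q zeroL2 = nrm (L2fun q).
Proof.
apply: nrm_ae; [by apply: measurable_funB; exact: L2fun_meas|exact: L2fun_meas|].
by apply: ae_muT_imp zeroL2E => x h xT; rewrite h// subr0.
Qed.

(** Built from successive translations, so that its measurability in random coefficients follows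
    from that of [ah]. *)
Definition trigpoly (a : int -> R) (s : seq int) : L2T R :=
  foldr (fun i q => ah (hb i) q (a i)) zeroL2 s.

Lemma trigpolyE a s : L2fun (trigpoly a s) = (fun x => \sum_(i <- s) a i * hb i x) %[ae muT].
Proof.
elim: s => [|i s IH] /=.
  by apply: ae_muT_imp zeroL2E => x h xT; rewrite h// big_nil.
apply: ae_muT_imp (ae_muT_and (ahE (@hb_Lfun R i) (trigpoly a s) (a i)) IH) => x [h1 h2] xT.
by rewrite h1// h2// big_cons addrC.
Qed.

Lemma coef_trigpoly n a s : n \notin s -> coef n (trigpoly a s) = 0.
Proof.
elim: s => [_|i s IH] /=; first exact: coef_zero.
by rewrite inE negb_or => /andP[ni ns]; rewrite coef_ah IH// (negbTE ni) mulr0 addr0.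
Qed.

Definition idx (M : nat) : seq int :=
  0 :: [seq - k%:Z | k <- iota 1 M] ++ [seq k%:Z | k <- iota 1 M].

Lemma idx_uniq M : uniq (idx M).
Proof.
rewrite /idx /= mem_cat negb_or cat_uniq !map_inj_uniq ?iota_uniq ?andbT/=; last 2 first.
- by move=> i j [].
- by move=> i j /oppr_inj [].
rewrite -andbA; apply/and3P; split.
- by apply/negP => /mapP [k]; rewrite mem_iota => /andP[k0 _] /eqP; rewrite eq_sym oppr_eq0 => /eqP [kk]; rewrite kk in k0.
- by apply/negP => /mapP [k]; rewrite mem_iota => /andP[k0 _] [kk]; rewrite -kk in k0.
- apply/hasPn => x /mapP[k]; rewrite mem_iota => /andP[k0 _] ->; apply/negP => /mapP[j].
  by rewrite mem_iota; case: k k0 => // k _; case: j.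
Qed.

Lemma mem_idx n M : (`|n| <= M)%N -> n \in idx M.
Proof.
case: n => [[|k]|k] h; rewrite /idx inE ?mem_cat//; apply/orP; right; apply/orP.
- by right; apply/mapP; exists k.+1 => //; rewrite mem_iota.
- by left; apply/mapP; exists k.+1 => //; rewrite mem_iota.
Qed.

Lemma gauss_partial_idx (a : int -> R) M x :
  gauss_partial a M x = \sum_(i <- idx M) a i * hb i x.
Proof.
rewrite /gauss_partial /idx big_cons big_cat !big_map/= addrA /index_iota subn1 /=.
congr (_ + _ + _); first by rewrite /hb eqxx mulr1.
  rewrite !big_seq; apply: eq_bigr => k; rewrite mem_iota => /andP[k0 _].
  by case: k k0.
rewrite !big_seq; apply: eq_bigr => k; rewrite mem_iota => /andP[k0 _].
by case: k k0.
Qed.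

End Coefficients.

Lemma probability_ae_eq d (Om : measurableType d) (R : realType) (P : probability Om R)
  (A B : set Om) : measurable A -> measurable B ->
  {ae P, forall w, A w <-> B w} -> P A = P B.
Proof.
move=> mA mB [N [mN N0 sN]].
have AN : P (A `|` N) = P A by rewrite measureU0.
have BN : P (B `|` N) = P B by rewrite measureU0.
rewrite -AN -BN; congr (P _); apply/seteqP; split=> w /= [h|h]; try by right.
  have [e|ne] := pselect (A w <-> B w); first by left; apply/e.
  by right; exact: sN.
have [e|ne] := pselect (A w <-> B w); first by left; apply/e.
by right; exact: sN.
Qed.

(** * Independence of one Gaussian coordinate from the rest of the series *)

Section Independence.
Context {R : realType} {d : measure_display} {Om : measurableType d}.
Variables (P : probability Om R) (g : int -> {RV P >-> R}) (phi : {mfun Om >-> L2T R}).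
Hypothesis g_indep : mutually_independent g.
Hypothesis g_gauss : forall n, standard_gaussian (g n).
Hypothesis phi_sum : {ae P, forall w,
  L2dist (gauss_partial (fun n => g n w) M) (L2fun (phi w)) @[M --> \oo] --> 0%E}.
Variable n : int.
Notation muT := (muT R).

(** The sum of the random series with the term of index [n] removed. *)
Definition psi w : L2T R := ah (hb n) (phi w) (- g n w).

Let lh : hb n \in Lfun muT 2%:E. Proof. exact: hb_Lfun. Qed.
Let mg : measurable_fun setT (g n : Om -> measurableTypeR R).
Proof. by have h := @measurable_funPT _ _ _ _ (g n); exact: h. Qed.

Lemma psi_measurable : measurable_fun setT psi.
Proof.
have mp : measurable_fun setT (fun w => (phi w : L2T R, - g n w : measurableTypeR R)).
  apply/measurable_fun_pairP; split; first exact: measurable_funPT.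
  exact: (measurableT_comp (@oppr_measurable R setT) mg).
exact: (measurableT_comp (ah_measurable lh) mp).
Qed.

Lemma phi_psi w : phi w = ah (hb n) (psi w) (g n w).
Proof. by rewrite /psi ah_ah// addNr ah0. Qed.

Definition others M := rem n (idx M).

Lemma others_notin M : n \notin others M.
Proof. by rewrite mem_rem_uniq ?idx_uniq// !inE eqxx. Qed.

(** The term of index [n] occurs both in the partial sum and in [phi] and cancels in the
    difference. *)
Lemma psi_dist w M : (`|n| <= M)%N ->
  L2dist (gauss_partial (fun i => g i w) M) (L2fun (phi w)) =
  (dst (psi w) (trigpoly (fun i => g i w) (others M)))%:E.
Proof.
move=> nM; rewrite /L2dist.
have lg : gauss_partial (fun i => g i w) M \in Lfun muT 2%:E.
  rewrite (_ : gauss_partial _ _ = fun x => \sum_(i <- idx M) g i w * hb i x); last first.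
    by apply/funext => x; exact: gauss_partial_idx.
  elim: (idx M) => [|i s IH].
    rewrite (_ : (fun x => _) = fun=> 0); first exact: Lfun2_cst.
    by apply/funext => x; rewrite big_nil.
  rewrite (_ : (fun x => _) = fun x => g i w * hb i x + \sum_(j <- s) g j w * hb j x); last first.
    by apply/funext => x; rewrite big_cons.
  by apply: Lfun2D => //; apply: Lfun2Z; exact: hb_Lfun.
rewrite [LHS](Lnorm2E (Lfun2B lg (L2fun_Lfun (phi w)))) nrmBC; congr EFin; apply/esym/nrm_ae.
- by apply: measurable_funB; exact: L2fun_meas.
- by apply: measurable_funB; [exact: L2fun_meas|exact: Lfun_meas lg].
apply: ae_muT_imp (ae_muT_and (ahE lh (phi w) (- g n w)) (trigpolyE (fun i => g i w) (others M))).
move=> x [h1 h2] xT; rewrite h1// h2// gauss_partial_idx.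
rewrite (perm_big _ (perm_to_rem (mem_idx nM)))/= big_cons; ring.
Qed.

Lemma psi_limit : {ae P, forall w, forall e : R, 0 < e -> exists M0, forall M, (M0 <= M)%N ->
  dst (psi w) (trigpoly (fun i => g i w) (others M)) < e}.
Proof.
apply: filterS phi_sum => w /fine_cvgP[_ /cvgrPdist_lt h] e e0.
have [M0 _ hM] := h e e0; exists (maxn M0 `|n|) => M; rewrite geq_max => /andP[h1 h2].
have := hM M h1; rewrite /= psi_dist// sub0r normrN.
by apply: le_lt_trans; exact: ler_norm.
Qed.

(** [psi] is almost surely a limit of trigonometric polynomials without [hb n], and [coef n] is
    continuous. *)
Lemma coef_psi : {ae P, forall w, coef n (psi w) = 0}.
Proof.
apply: filterS psi_limit => w h; apply/eqP; rewrite -normr_le0; apply/ler_addgt0Pr => e e0.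
have k0 : 0 < `|hw n : R| + 1 by rewrite ltr_wpDl.
have [M hM] := h (e / (`|hw n : R| + 1)) (divr_gt0 e0 k0).
have := hM M (leqnn M); rewrite ltr_pdivlMr// => h1.
have := coef_lip n (psi w) (trigpoly (fun i => g i w) (others M)).
rewrite coef_trigpoly ?others_notin// subr0 add0r => h2; apply: (le_trans h2).
apply: ltW; apply: le_lt_trans h1; rewrite mulrC ler_wpM2l ?nrm_ge0// lerDl//.
Qed.

(** A pi-system that generates the events depending on the coordinates other than [n]. *)
Definition cylinder : set (set Om) :=
  [set A | exists (J : seq int) (B : int -> set R), [/\ uniq J, n \notin J,
     forall i, measurable (B i) & A = \bigcap_(i in [set` J]) (g i @^-1` B i)]].

Lemma cylinder_setI : setI_closed cylinder.
Proof.
move=> _ _ [J [B [uJ nJ mB ->]]] [J' [B' [uJ' nJ' mB' ->]]].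
exists (undup (J ++ J')), (fun i => (if i \in J then B i else setT) `&` (if i \in J' then B' i else setT)).
split.
- exact: undup_uniq.
- by rewrite mem_undup mem_cat negb_or nJ.
- by move=> i; apply: measurableI; case: ifP.
apply/seteqP; split=> w /=.
  move=> [h h'] i; rewrite /= mem_undup mem_cat => _.
  by split; case: ifP => // ii; [exact: h|exact: h'].
move=> h; split=> i /= ii; have := h i; rewrite /= mem_undup mem_cat ii ?orbT => /(_ isT)[] //.
Qed.

Lemma cylinder_measurable : cylinder `<=` measurable.
Proof.
move=> _ [J [B [_ _ mB ->]]]; apply: fin_bigcap_measurable => // i _.
by rewrite -[X in measurable X]setTI; exact: measurable_funPT.
Qed.

Lemma cylinderT : cylinder setT.
Proof. by exists [::], (fun=> setT); split=> //; apply/esym/seteqP; split. Qed.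

(** The measures [P (. & C)] and [P C * P (.)] agree on cylinders by mutual independence, hence on
    the generated sigma-algebra. *)
Lemma cylinder_indep (A : set Om) (B : set R) : <<s cylinder >> A -> measurable B ->
  P (A `&` g n @^-1` B) = (P A * P (g n @^-1` B))%E.
Proof.
move=> cA mB; set C := g n @^-1` B.
have mC : measurable C by rewrite -[C]setTI; exact: measurable_funPT.
have c0 : 0 <= fine (P C) by exact: fine_ge0.
have finP X : measurable X -> P X \is a fin_num by move=> mX; exact: fin_num_measure.
pose m1 : {measure set Om -> \bar R} := mrestr P mC.
pose m2 : {measure set Om -> \bar R} := mscale (NngNum c0) P.
have m2E X : m2 X = (P X * P C)%E.
  have -> : m2 X = ((fine (P C))%:E * P X)%E by [].
  by rewrite fineK ?finP// muleC.
rewrite -m2E; apply: (g_sigma_algebra_measure_unique cylinder cylinder_measurable (fun=> setT) (fun=> cylinderT) _ m1 m2 cylinder_setI _ _ A cA).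
- by apply/seteqP; split=> // w _; exists 0%N.
- move=> _ [J [B' [uJ nJ mB' ->]]]; rewrite m2E /m1 /= /mrestr.
  (* The condition on the coordinate [n] is added to the cylinder, so that mutual independence
     applies to [n :: J]. *)
  pose B'' i := if i == n then B else B' i.
  have mB'' i : measurable (B'' i) by rewrite /B''; case: ifP.
  have J'E : \bigcap_(i in [set` J]) (g i @^-1` B' i) = \bigcap_(i in [set` J]) (g i @^-1` B'' i).
    apply: eq_bigcapr => i /= iJ; rewrite /B'' ifN//; apply: contraNneq nJ => <-//.
  have JE : \bigcap_(i in [set` J]) (g i @^-1` B' i) `&` C = \bigcap_(i in [set` n :: J]) (g i @^-1` B'' i).
    rewrite J'E; apply/seteqP; split=> w /=.
      move=> [h hC] i /=; rewrite inE => /orP[/eqP ->|iJ]; last exact: h.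
      by rewrite /B'' eqxx.
    move=> h; split; first by move=> i /= iJ; apply: h; rewrite /= inE iJ orbT.
    by have := h n; rewrite /= inE eqxx /B'' eqxx => /(_ isT).
  have h1 := g_indep uJ mB''.
  have h2 := @g_indep (n :: J) B'' _ mB''.
  have mI : measurable (\bigcap_(i in [set` J]) (g i @^-1` B' i)).
    by apply: cylinder_measurable; exists J, B'.
  rewrite JE -[LHS]fineK; last by rewrite finP// -JE; exact: measurableI.
  rewrite h2 /= ?nJ// big_cons -h1 -J'E /B'' eqxx -/C EFinM !fineK ?finP//.
  by rewrite muleC.
- by move=> _; rewrite /m1 /= /mrestr setTI ltey_eq finP.
Qed.

Let trig_meas (J : seq int) : n \notin J ->
  measurable_fun setT (fun w : g_sigma_algebraType cylinder => trigpoly (fun i => g i w) J).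
Proof.
elim: J => [_|i J IH] /=; first exact: measurable_cst.
rewrite inE negb_or => /andP[ni nJ].
have mp : measurable_fun setT (fun w : g_sigma_algebraType cylinder =>
    (trigpoly (fun i => g i w) J : L2T R, g i w : measurableTypeR R)).
  apply/measurable_fun_pairP; split; first exact: IH.
  move=> _ B mB; rewrite setTI; apply: sub_sigma_algebra.
  exists [:: i], (fun=> B); split=> //; first by rewrite inE.
  by apply/seteqP; split=> w /=; [move=> h j /=; rewrite inE => /eqP ->|apply; rewrite /= inE].
exact: (measurableT_comp (ah_measurable (hb_Lfun i)) mp).
Qed.

(** An event in the coordinates other than [n] that is almost surely [psi] in [U]: from some rank
    on, all partial sums lie in one [shrink U k]. The detour is needed because [psi] is only an
    almost sure limit. *)
Let Ev (U : set (L2T R)) : set Om := \bigcup_k \bigcup_M0 \bigcap_(M in [set M | (M0 <= M)%N])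
  [set w | shrink U k (trigpoly (fun i => g i w) (others M))].

Let Ev_cyl U : <<s cylinder >> (Ev U).
Proof.
apply: (@bigcupT_measurable _ (g_sigma_algebraType cylinder)) => k.
apply: (@bigcupT_measurable _ (g_sigma_algebraType cylinder)) => M0.
apply: (@bigcap_measurable _ (g_sigma_algebraType cylinder)); first by exists M0 => /=.
move=> M _; have := trig_meas (others_notin M) measurableT (shrink_measurable U k).
by rewrite setTI.
Qed.

Let Ev_psi U : @L2open R U -> {ae P, forall w, (psi @^-1` U) w <-> Ev U w}.
Proof.
move=> oU; apply: filterS psi_limit => w h; split=> [Uw|[k _ [M0 _ hM]]].
  have [k hk] := shrink_nbhs oU Uw.
  have [M0 hM] := h k.+1%:R^-1 ltac:(by rewrite invr_gt0).
  by exists k => //; exists M0 => // M /= M0M; apply: hk; rewrite dstC; exact: hM.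
have [M1 hM1] := h k.+1%:R^-1 ltac:(by rewrite invr_gt0).
exact: (hM (maxn M0 M1) (leq_maxl _ _) (psi w) (hM1 _ (leq_maxr _ _))).
Qed.

Let mpsi (A : set (L2T R)) : measurable A -> measurable (psi @^-1` A).
Proof. by move=> mA; rewrite -[X in measurable X]setTI; exact: psi_measurable. Qed.

(** Open sets form a pi-system generating the Borel sets; for open [U] the event [psi] in [U] is
    replaced by [Ev U], to which [cylinder_indep] applies. *)
Lemma psi_indep (A : set (L2T R)) (B : set R) : measurable A -> measurable B ->
  P (psi @^-1` A `&` g n @^-1` B) = (P (psi @^-1` A) * P (g n @^-1` B))%E.
Proof.
move=> mA mB; set C := g n @^-1` B.
have mC : measurable C by rewrite -[C]setTI; exact: measurable_funPT.
have c0 : 0 <= fine (P C) by exact: fine_ge0.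
have finP X : measurable X -> P X \is a fin_num by move=> mX; exact: fin_num_measure.
pose psim : {mfun Om >-> L2T R} := HB.pack psi (isMeasurableFun.Build _ _ _ _ _ psi_measurable).
pose m1f : {measure set (L2T R) -> \bar R} := pushforward (mrestr P mC) psim.
pose m1 := m1f psi_measurable.
pose m2 : {measure set (L2T R) -> \bar R} := mscale (NngNum c0) (distribution P psim).
have m2E X : m2 X = (P (psi @^-1` X) * P C)%E.
  have -> : m2 X = ((fine (P C))%:E * P (psi @^-1` X))%E by [].
  by rewrite fineK ?finP// muleC.
rewrite -m2E -[LHS]/(m1 A); apply: (@measure_unique _ R (L2T R) (@L2open R) (fun=> setT) erefl _ _ _ m1 m2).
- move=> U V /L2openP oU /L2openP oV; apply/L2openP => q [/oU[e e0 he] /oV[e' e'0 he']].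
  exists (Num.min e e'); first by rewrite lt_min e0.
  by move=> p; rewrite lt_min => /andP[h h']; split; [exact: he|exact: he'].
- by move=> _; apply/L2openP => q _; exists 1.
- by apply/seteqP; split=> // w _; exists 0%N.
- move=> U oU; rewrite m2E /m1 /= /pushforward /mrestr/=.
  have mU : measurable (U : set (L2T R)) by exact: sub_sigma_algebra.
  have mE : measurable (Ev U).
    have sub := smallest_sub (@sigma_algebra_measurable _ Om) cylinder_measurable.
    by apply: sub; exact: Ev_cyl.
  rewrite (@probability_ae_eq _ _ _ P (psi @^-1` U) (Ev U) (mpsi mU) mE (Ev_psi oU)).
  rewrite -(cylinder_indep (Ev_cyl U) mB).
  apply: probability_ae_eq; [apply: measurableI => //; exact: mpsi|exact: measurableI|].
  by apply: filterS (Ev_psi oU) => w e; split=> -[h1 h2]; split=> //; apply/e.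
- by move=> _; rewrite /m1 /= /pushforward /mrestr preimage_setT setTI ltey_eq finP.
- exact: mA.
Qed.

Variable gam : probability (L2T R) R.
Hypothesis gam_law : forall A : set (L2T R), measurable A -> gam A = distribution P phi A.

(** The joint law of [psi] and [g n] is a product, [phi] is [psi] translated by [g n] along [hb n],
    and Tonelli's theorem does the rest, with [rho] the law of [psi]. *)
Lemma gauss_disintegration : exists rho : probability (L2T R) R,
  {ae rho, forall p, coef n p = 0} /\
  forall F : L2T R -> \bar R, measurable_fun setT F -> (forall q, 0 <= F q)%E ->
    (\int[gam]_q F q = \int[rho]_p \int[normal_prob (0 : R) 1]_t F (ah (hb n) p t))%E.
Proof.
pose psim : {mfun Om >-> L2T R} := HB.pack psi (isMeasurableFun.Build _ _ _ _ _ psi_measurable).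
exists (distribution P psim); split.
  have := coef_psi; move=> [N [mN N0 sN]].
  exists [set p | coef n p <> 0]; split=> //.
    rewrite (_ : [set p | _] = ~` (@coef R n @^-1` [set 0])); last by apply/seteqP; split.
    apply: measurableC; rewrite -[X in measurable X]setTI.
    by apply: (lipschitz_L2_real (@coef_lip R n)) => //; exact: measurable_set1.
  apply/eqP; rewrite eq_le measure_ge0 andbT -N0.
  apply: (@le_measure _ _ _ P (psi @^-1` [set p | coef n p <> 0])) => //; rewrite ?inE//.
  rewrite -[X in measurable X]setTI; apply: psi_measurable => //.
  rewrite (_ : [set p | _] = ~` (@coef R n @^-1` [set 0])); last by apply/seteqP; split.
  apply: measurableC; rewrite -[X in measurable X]setTI.
  by apply: (lipschitz_L2_real (@coef_lip R n)) => //; exact: measurable_set1.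
move=> F mF F0.
have -> : (\int[gam]_q F q = \int[distribution P phi]_q F q)%E.
  by apply: eq_measure_integral => A mA _; exact: gam_law.
rewrite ge0_integral_distribution//.
have mpair : measurable_fun setT (fun w => (psi w, g n w : measurableTypeR R)).
  by apply/measurable_fun_pairP; split; [exact: psi_measurable|exact: mg].
pose pr : {mfun Om >-> (L2T R * measurableTypeR R)%type} := HB.pack (fun w => (psi w, g n w : measurableTypeR R))
  (isMeasurableFun.Build _ _ _ _ _ mpair).
pose G z := F (ah (hb n) z.1 z.2).
have mG : measurable_fun setT (G : L2T R * measurableTypeR R -> \bar R).
  exact: (measurableT_comp mF (ah_measurable lh)).
have -> : (\int[P]_w (F \o phi) w = \int[distribution P pr]_z G z)%E.
  rewrite ge0_integral_distribution; [|exact: mG|by move=> z; exact: F0].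
  apply: eq_integral => w _.
  by rewrite /= /G /= -phi_psi.
rewrite -(@fubini_tonelli1 _ _ (L2T R) (measurableTypeR R) R (distribution P psim) (normal_prob 0 1) G mG (fun z => F0 _)).
apply: eq_measure_integral => A mA _; apply/esym; apply: product_measure_unique => // B C mB mC.
rewrite /= /distribution /pushforward /=.
have := psi_indep mB mC; rewrite -(g_gauss n mC) => <-.
by congr (P _); apply/seteqP; split.
Qed.

End Independence.

(** * Null sets of the normal law *)

Section NormalNull.
Context {R : realType}.
Notation mu := (@lebesgue_measure R).

(** The normal density is positive everywhere. Normal null sets are therefore the Lebesgue null
    ones, and so translation invariant. *)
Lemma normal_prob_null (B : set (measurableTypeR R)) : measurable B ->
  normal_prob (0 : R) 1 B = 0%E -> mu B = 0%E.
Proof.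
move=> mB B0.
have p0 x : 0 < normal_pdf (0 : R) 1 x.
  by rewrite normal_pdfE ?oner_eq0// mulr_gt0 ?normal_peak_gt0 ?oner_eq0// expR_gt0.
have mp : measurable_fun B (fun x => (normal_pdf (0 : R) 1 x)%:E).
  by apply/measurable_EFinP/measurable_funTS; exact: measurable_normal_pdf.
have [h _] := @ae_eq_integral_abs _ _ _ mu B mB _ mp.
have {h} [N [mN N0 sN]] : ae_eq mu B (fun x => (normal_pdf (0 : R) 1 x)%:E) (cst 0%E).
  apply: h; rewrite -[RHS]B0; apply: eq_integral => x _.
  by rewrite gee0_abs// lee_fin normal_pdf_ge0.
apply/eqP; rewrite -measure_le0 -N0; apply: le_measure; rewrite ?inE// => x Bx.
apply: sN => /= h; have := h Bx => /= -[e]; by have := p0 x; rewrite e ltxx.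
Qed.

Lemma normal_prob_shift_null (B : set (measurableTypeR R)) c : measurable B ->
  normal_prob (0 : R) 1 B = 0%E ->
  normal_prob (0 : R) 1 ((fun x : measurableTypeR R => x + c : measurableTypeR R) @^-1` B) = 0%E.
Proof.
move=> mB B0; have h := lebesgue_measure_shift c mB.
have m1 : measurable ((fun x : measurableTypeR R => x + c : measurableTypeR R) @^-1` B).
  by rewrite -[X in measurable X]setTI; apply: measurable_funD => //; exact: measurable_cst.
by move/null_content_dominatesP: (@normal_prob_dominates R 0 1); apply => //; rewrite -[RHS](normal_prob_null mB B0) -h.
Qed.

End NormalNull.

(** * Quasi-invariance and the support of the Gaussian measure *)

Section GaussianSupport.
Context {R : realType}.

(** The form in which the Gaussian law is used: in each direction [hb n] it is a mixture of standard
    normal laws on parallel lines through points with vanishing coordinate. *)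
Definition disintegrates (gam : probability (L2T R) R) := forall n,
  exists rho : probability (L2T R) R,
  {ae rho, forall p, coef n p = 0} /\
  forall F : L2T R -> \bar R, measurable_fun setT F -> (forall q, 0 <= F q)%E ->
    (\int[gam]_q F q = \int[rho]_p \int[normal_prob (0 : R) 1]_t F (ah (hb n) p t))%E.

(** Rational coefficients make the family countable. *)
Definition tpoly (s : seq (int * rat)) : L2T R :=
  foldr (fun ir q => ah (hb ir.1) q (ratr ir.2)) zeroL2 s.

Definition L2ball (p : L2T R) (e : R) : set (L2T R) := [set q | dst q p < e].

Definition densely_supported (gam : probability (L2T R) R) := forall e, 0 < e ->
  {ae gam, forall q, exists s, L2ball (tpoly s) e q}.

Lemma L2ball_measurable p e : measurable (L2ball p e).
Proof.
apply: open_measurable_L2 => q /= h; exists (e - dst q p); first by rewrite subr_gt0.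
by move=> r /= hr; have := dst_tri r q p; rewrite /L2ball/=; lra.
Qed.

Lemma nrm_hb n : nrm (hb n : R -> R) <= 1.
Proof. by apply: nrm_le_bound => //; [exact: hb_Lfun|exact: hb_le1]. Qed.

Lemma tpoly_dense (a : int -> R) s e : 0 < e -> exists s', dst (trigpoly a s) (tpoly s') < e.
Proof.
elim: s e => [|i s IH] e e0; first by exists [::]; rewrite dst_xx.
have e2 : 0 < e / 2 by rewrite divr_gt0.
have [s' hs'] := IH _ e2.
have tl : a i - e / 2 < a i by rewrite ltrBlDr ltrDl.
have [r] := rat_in_itvoo tl; rewrite in_itv/= => /andP[r1 r2].
exists ((i, r) :: s') => /=.
apply: le_lt_trans (dst_ah_le (@hb_Lfun R i) _ _ _ _) _.
have h : `|a i - ratr r| < e / 2 by rewrite ger0_norm ?subr_ge0 ?(ltW r2)//; lra.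
have := ler_wpM2l (normr_ge0 (a i - ratr r)) (nrm_hb i); rewrite mulr1.
lra.
Qed.

Lemma gaussian_disintegrates gam : is_gaussian_measure gam -> disintegrates gam.
Proof.
by move=> [d [Om [P [g [phi [h1 h2 h3 h4]]]]]] n; exact: (gauss_disintegration h1 h2 h3 n h4).
Qed.

Lemma gaussian_densely_supported gam : is_gaussian_measure gam -> densely_supported gam.
Proof.
move=> [d [Om [P [g [phi [h1 h2 h3 h4]]]]]] e e0.
have mU : measurable [set q | exists s, L2ball (tpoly s) e q].
  apply: open_measurable_L2 => q [s hs]; exists (e - dst q (tpoly s)); first by rewrite subr_gt0.
  by move=> r /= hr; exists s; have := dst_tri r q (tpoly s); move: hr hs; rewrite /L2ball/=; lra.
exists (~` [set q | exists s, L2ball (tpoly s) e q]); split=> //; first exact: measurableC.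
rewrite h4; last exact: measurableC.
have [N [mN N0 sN]] := psi_limit h3 0.
apply/eqP; rewrite /distribution /pushforward -measure_le0 -N0.
apply: le_measure; rewrite ?inE//.
  by rewrite -[X in measurable X]setTI; apply: measurable_funPT => //; exact: measurableC.
move=> w /= ne; apply: sN => /= h; apply: ne.
have e2 : 0 < e / 2 by rewrite divr_gt0.
have [M hM] := h _ e2.
have [s hs] := tpoly_dense (fun i => g i w) (0 :: others 0 M) e2.
exists s; rewrite /L2ball/= (splitr e); apply: le_lt_trans (dst_tri _ _ _) (ltrD _ hs).
by have := hM M (leqnn M); rewrite (phi_psi g phi 0 w) /= dst_ah_same//; exact: hb_Lfun.
Qed.

(* The law of q is quasi-invariant under q |-> q + t h_n, so balls around the
   trigonometric polynomials, which cannot all be null, force those around 0 to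
   have positive measure. *)
Section QuasiInvariance.
Variable gam : probability (L2T R) R.
Hypothesis gam_dis : disintegrates gam.
Hypothesis gam_dense : densely_supported gam.

Let secm n (B : set (L2T R)) p : measurable B ->
  measurable ((fun s : measurableTypeR R => ah (hb n) p s) @^-1` B).
Proof.
move=> mB; rewrite -[X in measurable X]setTI.
exact: (measurable_fun_pair2 p (ah_measurable (@hb_Lfun R n))).
Qed.

Let jointm n (B : set (L2T R)) : measurable B ->
  measurable ((fun z : L2T R * measurableTypeR R => ah (hb n) z.1 z.2) @^-1` B).
Proof. by move=> mB; rewrite -[X in measurable X]setTI; exact: (ah_measurable (@hb_Lfun R n)). Qed.

(** A set is null exactly when almost all of its sections along [hb n] are normal null, and
    translating the set by [t] translates its sections. *)
Lemma shift_null n t (A : set (L2T R)) : measurable A -> gam A = 0%E ->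
  gam ((fun q => ah (hb n) q t) @^-1` A) = 0%E.
Proof.
move=> mA A0; have [rho [_ dis]] := gam_dis n.
have lh := @hb_Lfun R n.
pose sec (B : set (L2T R)) p := (fun s : measurableTypeR R => ah (hb n) p s) @^-1` B.
have disI (B : set (L2T R)) : measurable B -> gam B = (\int[rho]_p normal_prob (0 : R) 1 (sec B p))%E.
  move=> mB; have mi : measurable_fun setT (fun q => (\1_B q)%:E : \bar R).
    by apply/measurable_EFinP; exact: measurable_indic.
  have -> : gam B = (\int[gam]_q (\1_B q)%:E)%E by rewrite integral_indic// setIT.
  rewrite (dis _ mi); last by move=> q; rewrite lee_fin.
  apply: eq_integral => p _.
  have -> : (fun x => (\1_B (ah (hb n) p x))%:E) = (fun x => (\1_(sec B p) x)%:E : \bar R) by [].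
  by rewrite integral_indic ?setIT//; exact: secm.
have mN (B : set (L2T R)) : measurable B ->
    measurable_fun setT (fun p : L2T R => normal_prob (0 : R) 1 (sec B p)).
  move=> mB; have := @measurable_fun_xsection _ _ (L2T R) (measurableTypeR R) R (normal_prob (0:R) 1) _ (jointm n mB).
  by congr measurable_fun; apply/funext => p; congr (normal_prob _ _ _); apply/seteqP; split=> s;
    rewrite /xsection /= inE.
have mA' : measurable ((fun q => ah (hb n) q t) @^-1` A).
  by rewrite -[X in measurable X]setTI; exact: (ah_measurable1 t lh).
rewrite disI//.
have [_ [N [mN' N0 sN]]] : True /\ ae_eq rho setT (fun p => normal_prob (0 : R) 1 (sec A p)) (cst 0%E).
  split=> //; apply/(ae_eq_integral_abs rho measurableT (mN _ mA)).
  rewrite -[RHS]A0 disI//; apply: eq_integral => p _.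
  by rewrite gee0_abs.
rewrite -[LHS](_ : \int[rho]_p `|normal_prob (0 : R) 1 (sec ((ah (hb n))^~ t @^-1` A) p)| = _)%E.
  apply/(ae_eq_integral_abs rho measurableT (mN _ mA')).
  exists N; split=> // p /= h; apply: sN => /= h'; apply: h => _.
  have -> : sec ((ah (hb n))^~ t @^-1` A) p = (fun x : measurableTypeR R => x + t : measurableTypeR R) @^-1` sec A p.
    by apply/seteqP; split=> s; rewrite /sec /= ah_ah.
  by apply: normal_prob_shift_null; [exact: secm|exact: h'].
by apply: eq_integral => p _; rewrite gee0_abs.
Qed.

Lemma ball_tpoly_null e s : gam (L2ball zeroL2 e) = 0%E -> gam (L2ball (tpoly s) e) = 0%E.
Proof.
move=> e0; elim: s => [//|[i r] s IH].
rewrite (_ : L2ball _ _ = (fun q => ah (hb i) q (- ratr r)) @^-1` L2ball (tpoly s) e).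
  by apply: shift_null => //; exact: L2ball_measurable.
have lh := @hb_Lfun R i.
have E q : dst (ah (hb i) q (- ratr r)) (tpoly s) = dst q (ah (hb i) (tpoly s) (ratr r)).
  by rewrite -(dst_ah_same lh _ (tpoly s) (ratr r)) ah_ah// addNr ah0.
by apply/seteqP; split=> q; rewrite /L2ball/= E.
Qed.

Lemma gam_ball_gt0 e : 0 < e -> (0 < gam (L2ball zeroL2 e))%E.
Proof.
move=> e0; rewrite lt0e measure_ge0 andbT; apply/eqP => g0.
have [N [mN N0 sN]] := gam_dense e0.
(* If the ball at 0 were null, so would be the balls around the countably many polynomials, and
   these cover almost everything. *)
have : gam.-negligible (\bigcup_k [set q | exists2 s, unpickle k = Some s & L2ball (tpoly s) e q]).
  apply: negligible_bigcup => k; case uk : (@unpickle (seq (int * rat)) k) => [s|].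
    exists (L2ball (tpoly s) e); split; [exact: L2ball_measurable|exact: ball_tpoly_null|].
    by move=> q [s' [<-]].
  by exists set0; split=> // q [].
move=> [N' [mN' N'0 sN']].
have : gam setT = 0%E.
  apply/eqP; rewrite -measure_le0.
  apply: (@le_trans _ _ (gam (N `|` N'))); last first.
    by rewrite (measureU0 mN mN' N'0); move/eqP: N0; rewrite -measure_le0.
  apply: le_measure; rewrite ?inE//; first exact: measurableU.
  move=> q _; have [[s hs]|h] := pselect (exists s, L2ball (tpoly s) e q).
    by right; apply: sN'; exists (pickle s) => //=; exists s => //; rewrite pickleK.
  by left; exact: sN.
by rewrite probability_setT => /eqP; rewrite onee_eq0.
Qed.

End QuasiInvariance.
End GaussianSupport.

(** * Monotonicity for arbitrary functions, and change of density *)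

Section IntegralComplements.
Context d (X : measurableType d) (R : realType).
Import HBNNSimple.

(** The integral of a nonnegative function is a supremum over simple functions below it, hence
    monotone for arbitrary functions. The spectral gaps, whose measurability in [q] is not
    established, are estimated this way. *)
Lemma ge0_le_integral_nm (mu : {measure set X -> \bar R}) (D : set X) (f g : X -> \bar R) :
  (forall x, D x -> 0 <= f x)%E -> (forall x, D x -> f x <= g x)%E ->
  (\int[mu]_(x in D) f x <= \int[mu]_(x in D) g x)%E.
Proof.
move=> f0 fg.
have g0 x : D x -> (0 <= g x)%E by move=> Dx; exact: le_trans (f0 _ Dx) (fg _ Dx).
rewrite !ge0_integralE//; apply: ereal_sup_le => _ [h hf <-].
exists h => // x /=.
by apply: (le_trans (hf x)); rewrite !patchE; case: ifPn => // /set_mem; exact: fg.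
Qed.

Section Density.
Variables (mu nu : {measure set X -> \bar R}) (f : X -> R).
Hypothesis mf : measurable_fun setT f.
Hypothesis f0 : forall x, 0 <= f x.
Hypothesis nuE : forall A, measurable A -> nu A = (\int[mu]_(x in A) (f x)%:E)%E.

Let mEf : measurable_fun setT (EFin \o f). Proof. exact/measurable_EFinP. Qed.

Let density_nnsfun (h : {nnsfun X >-> R}) :
  (\int[nu]_x (h x)%:E = \int[mu]_x ((h x)%:E * (f x)%:E))%E.
Proof.
under [LHS]eq_integral do rewrite fimfunE -fsumEFin//.
rewrite [LHS]ge0_integral_fsum//; last 2 first.
- by move=> r; exact/measurable_EFinP/measurableT_comp.
- by move=> n x _; rewrite EFinM nnfun_muleindic_ge0.
under [RHS]eq_integral.
  move=> x xD; rewrite fimfunE -fsumEFin// ge0_mule_fsuml; last first.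
    by move=> r; rewrite EFinM nnfun_muleindic_ge0.
  over.
have m1 r : measurable_fun setT (fun x => (\1_(h @^-1` [set r]) x)%:E * (f x)%:E : \bar R)%E.
  by apply: emeasurable_funM => //; apply/measurable_EFinP; exact: measurable_indic.
rewrite [RHS]ge0_integral_fsum//; last 2 first.
- move=> r; under eq_fun do rewrite EFinM -muleA.
  by apply: emeasurable_funM => //; exact: measurable_cst.
- move=> r x _; apply: mule_ge0; last by rewrite lee_fin.
  by rewrite EFinM nnfun_muleindic_ge0.
apply: eq_fsbigr => r _.
rewrite integralZl_indic_nnsfun//= integral_indic//= setIT nuE//.
have [r0|r0] := leP 0 r; last first.
  rewrite (_ : h @^-1` [set r] = set0); last first.
    by apply/seteqP; split=> x //= e; have : 0 <= h x by []; rewrite e leNgt r0.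
  rewrite integral_set0 mule0; apply/esym; rewrite -[RHS](integral0 mu setT).
  by apply: eq_integral => x _; rewrite indic0 mulr0 mul0e.
rewrite integral_mkcond -ge0_integralZl//.
- apply: eq_integral => x _; rewrite patchE indicE.
  by case: ifPn => _; rewrite ?mulr1 ?mulr0 ?mule0 ?mul0e.
- apply: eq_measurable_fun (m1 r) => x _; rewrite patchE indicE.
  by case: ifPn => _; rewrite ?mul1e ?mul0e.
- by move=> x _; rewrite patchE; case: ifPn => // _; rewrite lee_fin.
Qed.

(** Known for simple functions, then passed to the limit by monotone convergence on both sides. *)
Lemma integral_density (F : X -> \bar R) : measurable_fun setT F -> (forall x, 0 <= F x)%E ->
  (\int[nu]_x F x = \int[mu]_x (F x * (f x)%:E))%E.
Proof.
move=> mF F0; pose F_ := nnsfun_approx measurableT mF.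
have F_cvg x : ((F_ n x)%:E @[n --> \oo] --> F x)%E by exact: cvg_nnsfun_approx.
have F_nd x : {homo (fun n => (F_ n x)%:E) : m n / (m <= n)%N >-> (m <= n)%E}.
  by move=> m n mn; rewrite lee_fin; exact/lefP/nd_nnsfun_approx.
have := @cvg_monotone_convergence _ _ _ nu _ measurableT (fun n x => (F_ n x)%:E).
have := @cvg_monotone_convergence _ _ _ mu _ measurableT (fun n x => (F_ n x)%:E * (f x)%:E)%E.
rewrite (eq_integral (fun x => F x * (f x)%:E)%E); last first.
  by move=> x _; apply: cvg_lim => //; exact: cvgeZr.
move=> /[swap]; rewrite (eq_integral F); last first.
  by move=> x _; apply: cvg_lim => //; exact: F_cvg.
move=> h2 h1.
have m1 n : measurable_fun setT (fun x => (F_ n x)%:E).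
  exact/measurable_EFinP/measurable_funTS.
have p1 n x : setT x -> (0 <= (F_ n x)%:E)%E by move=> _; rewrite lee_fin.
have {m1 p1}h2 := h2 m1 p1 (fun x _ => F_nd x).
apply: (cvg_unique _ h2) => //=.
rewrite (_ : (fun n => _) = (fun n => \int[mu]_x ((F_ n x)%:E * (f x)%:E))%E); last first.
  by apply/funext => n; exact: density_nnsfun.
apply: h1.
- by move=> n; apply: emeasurable_funM => //; exact/measurable_EFinP/measurable_funTS.
- by move=> n x _; rewrite mule_ge0// lee_fin.
- by move=> x _ m n mn; rewrite lee_wpmul2r ?lee_fin// -lee_fin; exact: F_nd.
Qed.

End Density.
End IntegralComplements.

(** * Measurability of the Gibbs weight *)

Section GibbsMeasurable.
Context {R : realType}.
Notation muT := (muT R).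
Implicit Type q : L2T R.

Lemma norm2_dst q : norm2 q = dst q zeroL2 ^+ 2.
Proof. by rewrite dst_zero nrm_sqr. Qed.

Lemma dst_measurable p : measurable_fun setT (fun q : L2T R => dst q p).
Proof.
apply: (@lipschitz_L2_real _ _ 1) => q r; rewrite mul1r ler_norml.
have := dst_tri q r p; have := dst_tri r q p; rewrite (dstC r q); lra.
Qed.

Lemma norm2_measurable : measurable_fun setT (@norm2 R : L2T R -> R).
Proof.
rewrite (_ : @norm2 R = fun q => dst q zeroL2 ^+ 2); last by apply/funext => q; exact: norm2_dst.
by apply: measurable_funX; exact: dst_measurable.
Qed.

Lemma coef_measurable n : measurable_fun setT (coef n : L2T R -> R).
Proof. exact: (lipschitz_L2_real (@coef_lip R n)). Qed.

Lemma norm2_le_measurable (N : R) : measurable [set q : L2T R | norm2 q <= N].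
Proof.
rewrite (_ : [set _ | _] = (@norm2 R : L2T R -> R) @^-1` `]-oo, N]); last first.
  by apply/seteqP; split=> q; rewrite /= in_itv.
by rewrite -[X in measurable X]setTI; exact: norm2_measurable.
Qed.

(** The positive part truncated at [m]. Its cube is bounded and Lipschitz, so the mean of that cube
    is Lipschitz on L^2, which fails for the cube itself. *)
Definition clip (m : nat) (y : R) : R := Num.min (Num.max y 0) m%:R.

Lemma clip_ge0 m y : 0 <= clip m y.
Proof. by rewrite /clip le_min le_max lexx orbT ler0n. Qed.

Lemma clip_le m y : clip m y <= m%:R.
Proof. by rewrite /clip ge_min lexx orbT. Qed.

Lemma clip_lip m y z : `|clip m y - clip m z| <= `|y - z|.
Proof.
have := @ler0n R m; rewrite /clip /Num.min /Num.max => m0.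
have D (a b e : R) : - e <= a - b <= e -> `|a - b| <= e by rewrite ler_norml.
apply: D; case: (ler0P (y - z)) => yz; case: (ltrP y 0) => y0; case: (ltrP z 0) => z0;
  do 2?[case: ltrP => ?]; lra.
Qed.

Lemma clip_cube_lip m y z : `|clip m y ^+ 3 - clip m z ^+ 3| <= 3 * m%:R ^+ 2 * `|y - z|.
Proof.
set a := clip m y; set b := clip m z.
rewrite (_ : a ^+ 3 - b ^+ 3 = (a ^+ 2 + a * b + b ^+ 2) * (a - b)); last by ring.
have a0 : 0 <= a := clip_ge0 m y. have b0 : 0 <= b := clip_ge0 m z.
have am : a <= m%:R := clip_le m y. have bm : b <= m%:R := clip_le m z.
rewrite normrM; apply: ler_pM => //; last exact: clip_lip.
by rewrite ger0_norm ?addr_ge0 ?mulr_ge0 ?sqr_ge0//; nra.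
Qed.

Lemma clip_measurable m : measurable_fun setT (clip m : measurableTypeR R -> measurableTypeR R).
Proof.
by apply: measurable_minr; [apply: measurable_maxr => //; exact: measurable_cst|exact: measurable_cst].
Qed.

Section CubePart.
Variable s : R.
Hypothesis s1 : `|s| = 1.

Let cm m q x := clip m (s * L2fun q x) ^+ 3.

Let cm_meas m q : measurable_fun setT (cm m q).
Proof.
apply: measurable_funX; apply: measurableT_comp; first exact: clip_measurable.
by apply: measurable_funM; [exact: measurable_cst|exact: L2fun_meas].
Qed.

Let cm_Lfun m q : cm m q \in Lfun muT 2%:E.
Proof.
apply: bdd_Lfun => //; exists (m%:R ^+ 3) => x.
by rewrite ger0_norm ?exprn_ge0 ?clip_ge0// lerXn2r ?nnegrE ?clip_ge0 ?clip_le ?ler0n.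
Qed.

Let cm_measurable m : measurable_fun setT (fun q : L2T R => avg (cm m q)).
Proof.
apply: (@lipschitz_L2_real _ _ (3 * m%:R ^+ 2)) => p q.
rewrite -avgB; [|exact: Lfun2_int..].
have lpq := Lfun2B (L2fun_Lfun p) (L2fun_Lfun q).
apply: le_trans (avg_norm (Lfun2_int (Lfun2B (cm_Lfun m p) (cm_Lfun m q)))) _.
apply: (@le_trans _ _ (avg (fun x => 3 * m%:R ^+ 2 * `|L2fun p x - L2fun q x|))).
  apply: le_avg.
  - by have := Lfun2_int (Lfun2B (cm_Lfun m p) (cm_Lfun m q)) => /integrable_abse.
  - rewrite (_ : _ \o _ = (fun x => (3 * m%:R ^+ 2)%:E * `|(L2fun p x - L2fun q x)%:E|)%E) //.
    by apply: integrableZl => //; exact: integrable_abse (Lfun2_int lpq).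
  - move=> x; apply: le_trans (clip_cube_lip _ _ _) _.
    by rewrite -mulrBr normrM s1 mul1r.
rewrite avgZ; last by have := Lfun2_int lpq => /integrable_abse.
by rewrite ler_wpM2l ?mulr_ge0 ?sqr_ge0//; exact: avg_abs_le.
Qed.

(** The integral is the monotone limit of those of the truncated cubes, which are Lipschitz in [q];
    the sign [s] serves for the positive and the negative part. *)
Lemma cube_part_measurable :
  measurable_fun setT (fun q : L2T R => \int[muT]_x (Num.max (s * L2fun q x) 0 ^+ 3)%:E)%E.
Proof.
apply: (@emeasurable_fun_cvg _ _ _ _ (fun m q => (avg (cm m q))%:E)).
  by move=> m; apply/measurable_EFinP; exact: cm_measurable.
move=> q _.
have -> : (fun m => (avg (cm m q))%:E) = (fun m => \int[muT]_x (cm m q x)%:E)%E.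
  by apply/funext => m; rewrite /avg /Rintegral fineK//; apply: integrable_fin_num => //; exact: Lfun2_int.
rewrite [X in _ --> X](_ : _ = \int[muT]_x limn (fun m => (cm m q x)%:E))%E; last first.
  apply: eq_integral =>  x _; apply/esym/cvg_lim => //; apply: cvg_near_cst; near=> m.
  congr (_ ^+ 3)%:E; rewrite /clip; apply/min_idPl.
  near: m; exact: nbhs_infty_ger.
apply: (@cvg_monotone_convergence _ _ _ muT _ measurableT (fun m x => (cm m q x)%:E)).
- by move=> m; apply/measurable_EFinP; exact: cm_meas.
- by move=> m x _; rewrite lee_fin exprn_ge0// clip_ge0.
- move=> x _ m n mn; rewrite lee_fin lerXn2r ?nnegrE ?clip_ge0//.
  by rewrite /clip le_min ge_min lexx /= ge_min ler_nat mn orbT.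
Unshelve. all: by end_near. Qed.

End CubePart.

Definition cub q : R := avg (fun x => L2fun q x ^+ 3).

Lemma cub_measurable : measurable_fun setT cub.
Proof.
rewrite (_ : cub = fine \o (fun q => \int[muT]_x (Num.max (1 * L2fun q x) 0 ^+ 3)%:E -
    \int[muT]_x (Num.max (-1 * L2fun q x) 0 ^+ 3)%:E)%E).
  apply: measurableT_comp; first exact: fine_measurable.
  by apply: emeasurable_funB; apply: cube_part_measurable; rewrite ?normrN normr1.
apply/funext => q; rewrite /cub /avg /Rintegral /= integralE.
have oddc (y : R) : Num.max (y ^+ 3) 0 = Num.max y 0 ^+ 3.
  have [y0|y0] := leP 0 y; first by rewrite !max_l ?exprn_ge0.
  rewrite !max_r ?(ltW y0) ?expr0n//.
  have -> : y ^+ 3 = y ^+ 2 * y by ring.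
  by rewrite mulr_ge0_le0 ?sqr_ge0// ltW.
congr (fine (_ - _)%E); apply: eq_integral => x _.
  by rewrite funeposE mul1r -oddc /= EFin_max.
rewrite funenegE mulN1r -oddc /= EFin_max; congr (Order.max _%:E _); ring.
Qed.

Lemma gibbs_weightE beta q : gibbs_weight beta q = expR (beta / 6 * cub q).
Proof. by []. Qed.

Lemma gibbs_weight_gt0 beta q : 0 < gibbs_weight beta q.
Proof. exact: expR_gt0. Qed.

Lemma gibbs_weight_measurable beta : measurable_fun setT (@gibbs_weight R beta).
Proof.
apply: measurableT_comp => //.
by apply: measurable_funM; [exact: measurable_cst|exact: cub_measurable].
Qed.

Lemma Omega_measurable (N : R) : measurable (Omega_ N).
Proof.
rewrite (_ : Omega_ N = [set q : L2T R | norm2 q <= N]); first exact: norm2_le_measurable.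
by apply/seteqP; split=> q /Omega_norm2.
Qed.

End GibbsMeasurable.

(** * Integration against the Gibbs measure *)

Section GibbsMeasure.
Context {R : realType}.
Variables (gam : probability (L2T R) R) (N beta : R) (nu : probability (L2T R) R).
Hypothesis Hnu : is_gibbs_measure gam N beta nu.

Let Z := fine (gibbs_Z gam N beta).
Let F q : R := \1_(Omega_ N) q * gibbs_weight beta q.

Let F0 q : 0 <= F q.
Proof. by rewrite mulr_ge0// ltW// gibbs_weight_gt0. Qed.

Let mF : measurable_fun setT F.
Proof.
by apply: measurable_funM; [apply: measurable_indic; exact: Omega_measurable|exact: gibbs_weight_measurable].
Qed.

(** [fine] sends 0 and [+oo] to 0, and the inverse of 0 is 0: in these cases the total mass of [nu]
    would be 0. *)
Lemma gibbs_Z_gt0 : 0 < fine (gibbs_Z gam N beta).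
Proof.
rewrite lt0r fine_ge0 ?andbT; last by apply: integral_ge0 => q _; rewrite lee_fin ltW// gibbs_weight_gt0.
apply/eqP => Z0; have := Hnu measurableT; rewrite Z0 invr0 mul0e probability_setT => /eqP.
by rewrite onee_eq0.
Qed.

Lemma gibbs_dominates A : measurable A -> gam A = 0%E -> nu A = 0%E.
Proof.
move=> mA A0; rewrite (Hnu mA) null_set_integral ?mule0//.
by apply/measurable_EFinP/measurable_funTS; exact: mF.
Qed.

Lemma gibbs_integral (G : L2T R -> \bar R) : measurable_fun setT G -> (forall q, 0 <= G q)%E ->
  (\int[nu]_q G q = Z^-1%:E * \int[gam]_q (G q * (F q)%:E))%E.
Proof.
move=> mG G0; have Z0 := gibbs_Z_gt0.
have Zi : 0 <= Z^-1 by rewrite invr_ge0 ltW.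
rewrite (@integral_density _ _ R gam nu (fun q => Z^-1 * F q)) //.
- rewrite -ge0_integralZl//.
  + by apply: eq_integral => q _; rewrite EFinM muleCA.
  + by apply: emeasurable_funM => //; exact/measurable_EFinP.
  + by move=> q _; rewrite mule_ge0// lee_fin.
- by apply: measurable_funM => //; exact: measurable_cst.
- by move=> q; rewrite mulr_ge0.
- move=> A mA; apply: (eq_trans (Hnu mA)); rewrite -ge0_integralZl//.
  + exact/measurable_EFinP/measurable_funTS.
  + by move=> q _; rewrite -EFinM lee_fin F0.
Qed.

End GibbsMeasure.

(** * The first absolute moment of the normal law *)

Section NormalMoment.
Context {R : realType}.
Notation mu := (@lebesgue_measure R).
Notation Nm := (normal_prob (0 : R) 1).

Lemma normal_itv_gt0 (a b : R) : a < b -> (0 < Nm `[a, b])%E.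
Proof.
move=> ab; rewrite lt0e measure_ge0 andbT; apply/eqP => h.
have := normal_prob_null (@measurable_itv R `[a, b]) h.
rewrite lebesgue_measure_itv/= lte_fin ab -EFinD => -[] /eqP.
by rewrite subr_eq0 gt_eqF.
Qed.

(* [|t| <= exp (t^2 / 4)] turns the moment into the mass of a wider Gaussian. *)
Lemma normal_abs_moment : (\int[Nm]_t `|t|%:E < +oo)%E.
Proof.
have mabs : measurable_fun setT (fun t : measurableTypeR R => `|t|%:E : \bar R).
  by apply/measurable_EFinP; exact: normr_measurable.
rewrite (@integral_density _ _ R mu Nm (normal_pdf (0 : R) 1)) //; last 2 first.
- exact: measurable_normal_pdf.
- by move=> x; exact: normal_pdf_ge0.
have s2 : Num.sqrt 2 != 0 :> R by rewrite gt_eqF// sqrtr_gt0.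
set s := Num.sqrt 2 in s2.
pose c := normal_peak (1 : R) / normal_peak s.
have p0 : 0 < normal_peak s by exact: normal_peak_gt0.
have c0 : 0 <= c by rewrite divr_ge0 ?normal_peak_ge0.
apply: (@le_lt_trans _ _ (\int[mu]_t (c%:E * (normal_pdf 0 s t)%:E))%E); last first.
  rewrite ge0_integralZl//.
  - by rewrite integral_normal_pdf mule1 ltry.
  - by apply/measurable_EFinP; exact: measurable_normal_pdf.
  - by move=> x _; rewrite lee_fin normal_pdf_ge0.
apply: ge0_le_integral_nm => t _; first by rewrite mule_ge0// lee_fin normal_pdf_ge0.
rewrite -!EFinM lee_fin !normal_pdfE ?oner_eq0// /c /normal_fun subr0.
rewrite expr1n sqr_sqrtr// mulrCA -mulrA ler_wpM2l ?normal_peak_ge0//.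
rewrite mulrA mulVf ?gt_eqF// mul1r -ler_pdivlMr ?expR_gt0// -expRN -expRD.
(* [(|t| - 2)^2 >= 0] gives [|t| <= 1 + t^2 / 4]. *)
apply: le_trans (expR_ge1Dx _); rewrite -(real_normK (num_real t)).
have := sqr_ge0 (`|t| - 2); set y := `|t|; nra.
Qed.

End NormalMoment.

(** * Comparison of integrals line by line *)

Section Comparison.
Context {R : realType}.
Variables (gam : probability (L2T R) R).
Hypothesis gam_dis : disintegrates gam.
Notation Nm := (normal_prob (0 : R) 1).

(** It is enough to compare on each line in direction [hb n], and only through points of coordinate
    0, which carry all the mass of [rho]. *)
Lemma disint_le n (F G : L2T R -> \bar R) (C : R) :
  measurable_fun setT F -> measurable_fun setT G ->
  (forall q, 0 <= F q)%E -> (forall q, 0 <= G q)%E -> 0 <= C ->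
  (forall p, coef n p = 0 -> (\int[Nm]_t F (ah (hb n) p t) <= C%:E * \int[Nm]_t G (ah (hb n) p t))%E) ->
  (\int[gam]_q F q <= C%:E * \int[gam]_q G q)%E.
Proof.
move=> mF mG F0 G0 C0 h; have [rho [rho0 dis]] := gam_dis n.
have mI (H : L2T R -> \bar R) : measurable_fun setT H -> (forall q, 0 <= H q)%E ->
    measurable_fun setT (fun p => \int[Nm]_t H (ah (hb n) p t))%E.
  move=> mH H0.
  have mHa : measurable_fun setT (fun z : L2T R * measurableTypeR R => H (ah (hb n) z.1 z.2)).
    exact: (measurableT_comp mH (ah_measurable (@hb_Lfun R n))).
  exact: (@measurable_fun_fubini_tonelli_F _ _ (L2T R) (measurableTypeR R) R Nm _ mHa (fun z => H0 _)).
rewrite !dis// -ge0_integralZl//; last 2 first.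
- exact: mI.
- by move=> p _; apply: integral_ge0.
apply: ae_ge0_le_integral => //.
- by move=> p _; apply: integral_ge0.
- exact: mI.
- by move=> p _; apply: mule_ge0 => //; apply: integral_ge0.
- by apply: emeasurable_funM; [exact: measurable_cst|exact: mI].
case: rho0 => A [mA A0 sA]; exists A; split=> // p /= hn; apply: sA => /= e; apply: hn => _; exact: h.
Qed.

End Comparison.

Lemma cube_diff_bound (R : realDomainType) (y z a : R) : `|z| <= a ->
  `|3 * y ^+ 2 * z + 3 * y * z ^+ 2 + z ^+ 3| <= 3 * a * y ^+ 2 + (3 * a ^+ 2 * `|y| + a ^+ 3).
Proof.
move=> za; have a0 : 0 <= a by exact: le_trans za.
apply: le_trans (ler_normD _ _) _; rewrite addrA; apply: lerD.
  apply: le_trans (ler_normD _ _) _; rewrite !normrM normr_nat; apply: lerD.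
    by rewrite -expr2 real_normK ?num_real// mulrAC ler_wpM2r ?sqr_ge0// ler_wpM2l.
  by rewrite -expr2 mulrAC ler_wpM2r// ler_wpM2l// lerXn2r// nnegrE.
by rewrite normrX lerXn2r// nnegrE.
Qed.

(** The positive or the negative part has infinite integral, the extended integral is not finite,
    and [fine] returns 0. *)
Lemma avg_nonintegrable (R : realType) (f : R -> R) : measurable_fun setT f ->
  ~ (muT R).-integrable setT (EFin \o f) -> avg f = 0.
Proof.
move=> mf nf; have mE : measurable_fun setT (EFin \o f : measurableTypeR R -> \bar R) by exact/measurable_EFinP.
rewrite /avg /Rintegral integralE.
have mp := measurable_funepos mE. have mn := measurable_funeneg mE.
have p0 : (0 <= \int[muT R]_x ((EFin \o f)^\+ x))%E by exact: integral_ge0.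
have n0 : (0 <= \int[muT R]_x ((EFin \o f)^\- x))%E by exact: integral_ge0.
have : (\int[muT R]_x ((EFin \o f)^\+ x) + \int[muT R]_x ((EFin \o f)^\- x) = +oo)%E.
  apply/eqP; rewrite -leye_eq leNgt; apply/negP => h; apply: nf; apply/integrableP; split=> //.
  rewrite [X in (X < _)%E](_ : _ = \int[muT R]_x ((EFin \o f)^\+ x + (EFin \o f)^\- x))%E.
    by rewrite ge0_integralD.
  apply: eq_integral.
  by move=> x _; have := congr1 (fun F => F x) (fune_abse (EFin \o f)).
move: p0 n0; rewrite /comp.
case: (\int[muT R]_x _)%E => [x| |]; case: (\int[muT R]_x _)%E => [y| |] //=.
Qed.

(** * Variation of the norm and of the cubic integral along one direction *)

Section Direction.
Context {R : realType}.
Notation muT := (muT R).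
Variable n : int.
Hypothesis n0 : n != 0.

Lemma hw_gt0 : 0 < hw n :> R.
Proof. by rewrite /hw (negbTE n0) mulr_gt0// exprn_even_gt0//= intr_eq0. Qed.

Lemma hw_ge2 : 2 <= hw n :> R.
Proof.
rewrite /hw (negbTE n0) ler_peMr// -rmorphXn/= -[1]/(1%:~R) ler_int -gtz0_ge1.
by rewrite exprn_even_gt0.
Qed.

Lemma hb_sqr x : hw n * hb n x ^+ 2 <= 2 :> R.
Proof.
have nn : (n%:~R : R) != 0 by rewrite intr_eq0.
have E (y : R) : 2 * n%:~R ^+ 2 * (y / n%:~R) ^+ 2 = 2 * y ^+ 2.
  by field.
rewrite /hw /hb (negbTE n0); case: (n < 0); rewrite E ler_piMr// -real_normK ?num_real// expr_le1//;
  by rewrite ler_norml ?sin_le1 ?sin_geN1 ?cos_le1 ?cos_geN1.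
Qed.

Variables (p : L2T R) (t : R).
Hypothesis p0 : coef n p = 0.
Let q := ah (hb n) p t.
Let lh := @hb_Lfun R n.
Let lp := L2fun_Lfun p.
Let r x := t * hb n x.
Let lr : r \in Lfun muT 2%:E. Proof. exact: Lfun2Z. Qed.

Let qE : L2fun q = (fun x => L2fun p x + r x) %[ae muT].
Proof. exact: ahE. Qed.

Let avg_ph : avg (fun x => L2fun p x * r x) = 0.
Proof.
have h : avg (fun x => L2fun p x * hb n x) = 0.
  by move: p0 => /eqP; rewrite /coef mulf_eq0 gt_eqF ?hw_gt0//= => /eqP.
rewrite (_ : (fun x => _) = fun x => t * (L2fun p x * hb n x)); last by apply/funext => x; rewrite /r; ring.
by rewrite avgZ ?h ?mulr0//; exact: Lfun2_mul_int.
Qed.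

Let avg_rr : avg (fun x => r x * r x) = t ^+ 2 / hw n.
Proof.
rewrite (_ : (fun x => _) = fun x => t ^+ 2 * (hb n x * hb n x)); last by apply/funext => x; rewrite /r; ring.
rewrite avgZ; last exact: Lfun2_mul_int.
congr (_ * _); have := @hb_orth R n n; rewrite eqxx => h.
by apply: (mulfI (lt0r_neq0 hw_gt0)); rewrite h divff// gt_eqF// hw_gt0.
Qed.

(** Pythagoras: [p] is orthogonal to [hb n]. *)
Lemma norm2_ah : norm2 (ah (hb n) p t) = norm2 p + t ^+ 2 / hw n.
Proof.
rewrite /norm2 (@avg_ae _ _ (fun x => L2fun p x * L2fun p x + (2 * (L2fun p x * r x) + r x * r x))); last 3 first.
- by apply: measurable_funX; exact: L2fun_meas.
- have mp := L2fun_meas p; have mr := Lfun_meas lr.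
  by apply: measurable_funD; [exact: measurable_funM|apply: measurable_funD; [apply: measurable_funM => //; exact: measurable_funM|exact: measurable_funM]].
- by apply: ae_muT_imp qE => x h xT; rewrite h//; ring.
have i1 := Lfun2_mul_int lp lp. have i2 := Lfun2_mul_int lp lr. have i3 := Lfun2_mul_int lr lr.
have i2' : muT.-integrable setT (EFin \o (fun x => 2 * (L2fun p x * r x))).
  by have := integrableZl measurableT 2 i2; apply: eq_integrable.
rewrite avgD//; last first.
  by have := integrableD measurableT i2' i3; apply: eq_integrable.
by rewrite avgD// avgZ// avg_ph mulr0 add0r avg_rr.
Qed.

Variable N : R.
Hypothesis qN : norm2 q <= N.

(** The mean of [3 a p^2 + 3 a^2 |p| + a^3] with [a = sqrt (2 N)], which bounds [|t h_n|], when the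
    mean of [p^2] is at most [N] and that of [|p|] at most [sqrt N]. It does not involve [n]. *)
Definition cub_osc (N : R) : R := 3 * Num.sqrt (2 * N) * N + 3 * (2 * N) * Num.sqrt N + Num.sqrt (2 * N) ^+ 3.

Let pN : norm2 p <= N.
Proof. by move: qN; rewrite /q norm2_ah; apply: le_trans; rewrite lerDl divr_ge0 ?sqr_ge0// ltW// hw_gt0. Qed.

Let N0 : 0 <= N. Proof. exact: le_trans (norm2_ge0 _) qN. Qed.

Let r_sqr x : r x ^+ 2 <= 2 * N.
Proof.
have tN : t ^+ 2 <= hw n * N.
  have : t ^+ 2 / hw n <= N.
    by move: qN; rewrite /q norm2_ah; apply: le_trans; rewrite lerDr norm2_ge0.
  by rewrite ler_pdivrMr ?hw_gt0// mulrC.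
rewrite /r exprMn; apply: (@le_trans _ _ (hw n * N * hb n x ^+ 2)); first by rewrite ler_wpM2r ?sqr_ge0.
by rewrite mulrAC ler_wpM2r// hb_sqr.
Qed.

Let r_le x : `|r x| <= Num.sqrt (2 * N).
Proof. by rewrite -sqrtr_sqr ler_wsqrtr. Qed.

Let a := Num.sqrt (2 * N).
Let a0 : 0 <= a. Proof. exact: sqrtr_ge0. Qed.
Let D x := 3 * L2fun p x ^+ 2 * r x + 3 * L2fun p x * r x ^+ 2 + r x ^+ 3.
Let B x := 3 * a * L2fun p x ^+ 2 + (3 * a ^+ 2 * `|L2fun p x| + a ^+ 3).

Let mp : measurable_fun setT (L2fun p). Proof. exact: L2fun_meas. Qed.
Let mr : measurable_fun setT r. Proof. exact: Lfun_meas lr. Qed.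

Let mD : measurable_fun setT D.
Proof.
have mc (c : R) : measurable_fun setT (fun _ : measurableTypeR R => c) by exact: measurable_cst.
apply: measurable_funD; [apply: measurable_funD|exact: measurable_funX].
- by apply: measurable_funM => //; apply: measurable_funM => //; exact: measurable_funX.
- by apply: measurable_funM; [exact: measurable_funM|exact: measurable_funX].
Qed.

Let DB x : `|D x| <= B x.
Proof.
exact: cube_diff_bound (r_le x).
Qed.

Let ip2 : muT.-integrable setT (EFin \o (fun x => L2fun p x ^+ 2)).
Proof. by have := Lfun2_mul_int lp lp; apply: eq_integrable => // x _; rewrite /= expr2. Qed.

Let ipa : muT.-integrable setT (EFin \o (fun x => `|L2fun p x|)).
Proof. by have := integrable_abse (Lfun2_int lp). Qed.

Let icst (c : R) : muT.-integrable setT (EFin \o (fun=> c)).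
Proof. exact: Lfun2_int (Lfun2_cst _). Qed.

Let iZ c (f : R -> R) : muT.-integrable setT (EFin \o f) ->
  muT.-integrable setT (EFin \o (fun x => c * f x)).
Proof. by move=> /(integrableZl measurableT c); apply: eq_integrable. Qed.

Let iD (f g : R -> R) : muT.-integrable setT (EFin \o f) -> muT.-integrable setT (EFin \o g) ->
  muT.-integrable setT (EFin \o (fun x => f x + g x)).
Proof. by move=> h1 h2; have := integrableD measurableT h1 h2; apply: eq_integrable. Qed.

Let iB : muT.-integrable setT (EFin \o B).
Proof. by apply: iD; [exact: iZ|apply: iD => //; exact: iZ]. Qed.

Let intD : muT.-integrable setT (EFin \o D).
Proof.
apply: le_integrable iB => //; first exact/measurable_EFinP.
by move=> x _; rewrite /= lee_fin; apply: le_trans (DB x) (ler_norm _).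
Qed.

(** In [Omega_N] Pythagoras gives [t^2 <= hw n * N], and [hw n * h_n^2 <= 2] pointwise, so
    [|t h_n| <= sqrt (2 N)]; the cube then changes by an integrable amount [D]. *)
Lemma cub_ah : `|cub (ah (hb n) p t) - cub p| <= cub_osc N.
Proof.
have mpc : measurable_fun setT (fun x => L2fun p x ^+ 3) by exact: measurable_funX.
have -> : cub (ah (hb n) p t) = avg (fun x => L2fun p x ^+ 3 + D x).
  rewrite /cub; apply: avg_ae; [apply: measurable_funX; exact: L2fun_meas|exact: measurable_funD|].
  by apply: ae_muT_imp qE => x h xT; rewrite h// /D; ring.
have avgDN : `|avg D| <= cub_osc N.
  apply: le_trans (avg_norm intD) _; apply: (@le_trans _ _ (avg B)).
    apply: le_avg; [have := integrable_abse intD; exact: eq_integrable|exact: iB|exact: DB].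
  rewrite /B avgD; [|exact: iZ|apply: iD => //; exact: iZ].
  rewrite avgD ?avgZ ?avg_cst//; [|exact: iZ].
  rewrite /cub_osc -/a addrA; apply: lerD => //.
  have e2 : a ^+ 2 = 2 * N by rewrite sqr_sqrtr// mulr_ge0.
  rewrite e2; apply: lerD; first by rewrite ler_wpM2l ?mulr_ge0.
  rewrite ler_wpM2l ?mulr_ge0//; apply: le_trans (avg_abs_le lp) _.
  by rewrite /nrm ler_wsqrtr.
(* If the cube of [p] is not integrable, neither is that of the translate, and both values of [cub]
   are the default 0. *)
have [ip3|np3] := pselect (muT.-integrable setT (EFin \o (fun x => L2fun p x ^+ 3))).
  by rewrite avgD// /cub addrAC subrr add0r.
rewrite /cub (avg_nonintegrable mpc np3) avg_nonintegrable ?subrr ?normr0//.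
- by rewrite /cub_osc !addr_ge0 ?mulr_ge0 ?exprn_ge0 ?sqrtr_ge0.
- exact: measurable_funD.
- move=> h; apply: np3; have := integrableB measurableT h intD.
  by apply: eq_integrable => // x _; rewrite /= -EFinB; congr EFin; ring.
Qed.

End Direction.

(** * Truncated moments of the normal law *)

Section TruncatedMoment.
Context {R : realType}.
Notation Nm := (normal_prob (0 : R) 1).
Notation mR := (measurableTypeR R).

Definition abs_moment_ratio : R := 1 + fine (\int[Nm]_t `|t|%:E) / fine (Nm `[-1, 1]).

Let S (c : R) : set mR := [set t : mR | t ^+ 2 <= c].

Let mS c : measurable (S c).
Proof.
rewrite (_ : S c = (fun t : mR => t ^+ 2 : mR) @^-1` `]-oo, c]); last first.
  by apply/seteqP; split=> t; rewrite /= in_itv.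
rewrite -[X in measurable X]setTI.
exact: (_ : measurable_fun setT (fun t : mR => t ^+ 2 : mR)).
Qed.

(** The mean of [|t|] conditioned on [t^2 <= c] is bounded uniformly in [c]: for [c <= 1] by 1, and
    for [c > 1] by the full moment divided by the mass of [[-1, 1]]. The constant is the sum of both
    bounds. *)
Lemma truncated_moment c :
  (\int[Nm]_t (`|t| * \1_(S c) t)%:E <= abs_moment_ratio%:E * Nm (S c))%E.
Proof.
have m0 : (0 <= \int[Nm]_t `|t|%:E)%E by apply: integral_ge0 => t _; rewrite lee_fin.
have mfin : (\int[Nm]_t `|t|%:E)%E \is a fin_num by rewrite ge0_fin_numE// normal_abs_moment.
have Nfin A : measurable A -> Nm A \is a fin_num by move=> mA; exact: fin_num_measure.
have r0 : 0 <= fine (\int[Nm]_t `|t|%:E) / fine (Nm `[-1, 1]) by rewrite divr_ge0 ?fine_ge0.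
have [c1|c1] := leP c 1.
  apply: (@le_trans _ _ (\int[Nm]_t (\1_(S c) t)%:E)%E).
    apply: ge0_le_integral_nm => t _; first by rewrite lee_fin mulr_ge0.
    rewrite lee_fin indicE; case: (boolP (t \in S c)) => [|_]; last by rewrite mulr0.
    rewrite inE /S/= => tc; rewrite mulr1 -(expr_le1 (n := 2))// real_normK ?num_real//.
    exact: le_trans c1.
  have -> : (\int[Nm]_t (\1_(S c) t)%:E = Nm (S c))%E by rewrite integral_indic ?setIT//; exact: mS.
  by rewrite -[leLHS]mul1e lee_wpmul2r// lee_fin lerDl.
have sub : `[-1, 1]%classic `<=` S c.
  move=> t; rewrite /S /= in_itv/= -ler_norml => t1.
  by apply: le_trans (ltW c1); rewrite -(real_normK (num_real t)) expr_le1.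
have N0 := @normal_itv_gt0 R (-1) 1 ltac:(lra).
have Nf0 : 0 < fine (Nm `[-1, 1]) by rewrite fine_gt0// N0/= ltey_eq Nfin.
apply: (@le_trans _ _ (\int[Nm]_t `|t|%:E)%E).
  apply: ge0_le_integral_nm => t _; first by rewrite lee_fin mulr_ge0.
  by rewrite lee_fin ler_piMr// indicE lern1 leq_b1.
rewrite /abs_moment_ratio; move: r0; set k : R := (_ / _)%R => r0.
apply: (@le_trans _ _ (k%:E * Nm (S c))%E).
  apply: (@le_trans _ _ (k%:E * (fine (Nm `[-1, 1]))%:E)%E).
    by rewrite -EFinM divfK ?gt_eqF// fineK.
  by rewrite fineK ?Nfin// lee_wpmul2l//; apply: le_measure; rewrite ?inE//; exact: mS.
by rewrite lee_wpmul2r// lee_fin lerDr.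
Qed.

Lemma abs_moment_ratio_gt0 : 0 < abs_moment_ratio.
Proof. by rewrite ltr_pwDl// divr_ge0// fine_ge0// integral_ge0// => t _; rewrite lee_fin. Qed.

End TruncatedMoment.

(** The constant of [spectral_gap] becomes an abstract [K], out of reach of numeral computations. *)
Lemma gap_bounds (R : realType) : exists2 K : R, 0 < K &
  forall (q : L2 R) (lam : nat -> R) (j : nat), is_periodic_spectrum q lam ->
    norm2 q <= (wm / 8) ^+ 2 -> (0 < j)%N ->
  [/\ 0 <= lam (2 * j)%N - lam (2 * j - 1)%N,
      lam (2 * j)%N - lam (2 * j - 1)%N <=
        2 * (`|coef j%:Z q| + `|coef (- j%:Z) q| + 2 * K * norm2 q) / j%:R &
      (`|coef j%:Z q| - K * norm2 q) / (2 * j%:R) <= lam (2 * j)%N - lam (2 * j - 1)%N].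
Proof.
exists (200 * 64); first by rewrite mulr_gt0// ltr0Sn.
move=> q lam j h1 h2 h3; have := spectral_gap h1 h2 h3.
by rewrite (mulrA 2) -(natrM R 2 200).
Qed.

(** * Mean gap under the Gibbs measure *)

Section GibbsGap.
Context {R : realType}.
Variables (gam : probability (L2T R) R) (N beta : R) (nu : probability (L2T R) R).
Hypothesis gam_dis : disintegrates gam.
Hypothesis gam_dense : densely_supported gam.
Hypothesis beta0 : 0 < beta.
Hypothesis N0 : 0 < N.
Hypothesis Hnu : is_gibbs_measure gam N beta nu.
Notation Nm := (normal_prob (0 : R) 1).
Notation mR := (measurableTypeR R).
Notation w := (@gibbs_weight R beta).

Let kap : R := beta / 6 * cub_osc N.
Let wF q : R := \1_(Omega_ N) q * w q.

Let w0 q : 0 < w q. Proof. exact: gibbs_weight_gt0. Qed.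
Let w0' q : 0 <= w q. Proof. exact: ltW. Qed.

Let weight_ratio n p t : n != 0 -> coef n p = 0 -> norm2 (ah (hb n) p t) <= N ->
  w (ah (hb n) p t) <= expR kap * w p /\ w p <= expR kap * w (ah (hb n) p t).
Proof.
move=> n0 p0 qN; have h := cub_ah n0 p0 qN.
have b6 : 0 <= beta / 6 by rewrite divr_ge0// ltW.
rewrite !gibbs_weightE -!expRD !ler_expR /kap -!mulrDr; split; rewrite ler_wpM2l//.
  by rewrite -lerBlDr; exact: le_trans (ler_norm _) h.
by rewrite -lerBlDr; apply: le_trans (ler_norm _) _; rewrite distrC.
Qed.

Let mO : measurable (Omega_ N : set (L2T R)). Proof. exact: Omega_measurable. Qed.

Let mw : measurable_fun setT w. Proof. exact: gibbs_weight_measurable. Qed.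

Let mwF : measurable_fun setT wF.
Proof. by apply: measurable_funM => //; apply: measurable_indic. Qed.

Let mc n : measurable_fun setT (fun q : L2T R => `|coef n q|).
Proof. by apply: measurableT_comp => //; exact: coef_measurable. Qed.

Let Cu : R := expR kap ^+ 2 * abs_moment_ratio.

(** On each line the weight inside [Omega_N] is [w p] up to a factor [expR kap] either way, and
    [Omega_N] restricts [t] to a symmetric interval; what remains is a truncated normal moment.
    Replacing the weight twice accounts for [expR kap ^+ 2] in [Cu]. *)
Lemma gibbs_coef_mean n : n != 0 -> (\int[nu]_q `|coef n q|%:E <= Cu%:E)%E.
Proof.
move=> n0; have Cu0 : 0 <= Cu by rewrite mulr_ge0 ?exprn_ge0 ?expR_ge0// ltW// abs_moment_ratio_gt0.
have -> : Cu%:E = (Cu%:E * \int[nu]_q (cst 1%E q))%E.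
  rewrite (_ : \int[nu]_q _ = 1)%E ?mule1//.
  by rewrite integral_cst// mul1e; exact: (@probability_setT _ _ _ nu).
have Z0 := gibbs_Z_gt0 Hnu.
have mcE : measurable_fun setT (fun q : L2T R => `|coef n q|%:E : \bar R) by apply/measurable_EFinP; exact: mc.
rewrite (gibbs_integral Hnu mcE) ?(gibbs_integral Hnu)//.
rewrite muleCA lee_wpmul2l ?lee_fin ?invr_ge0 ?(ltW Z0)//.
apply: (disint_le gam_dis (n := n)) => //.
- by apply: emeasurable_funM; [exact: mcE|exact/measurable_EFinP].
- by apply: emeasurable_funM; [exact: measurable_cst|exact/measurable_EFinP].
- by move=> q; rewrite -EFinM lee_fin !mulr_ge0.
- by move=> q; rewrite mul1e lee_fin mulr_ge0.
(* By Pythagoras, [p + t h_n] lies in [Omega_N] exactly when [t^2 <= c]; for negative [c] the line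
   misses it. *)
move=> p p0; pose c := hw n * (N - norm2 p).
have OE t : \1_(Omega_ N) (ah (hb n) p t) = \1_[set t : mR | t ^+ 2 <= c] t :> R.
  rewrite !indicE; congr (_%:R); congr nat_of_bool; apply/idP/idP; rewrite !inE/= Omega_norm2 (norm2_ah n0 _ p0).
    by rewrite -lerBrDl ler_pdivrMr ?hw_gt0// mulrC.
  by rewrite -lerBrDl ler_pdivrMr ?hw_gt0// mulrC.
have cE t : coef n (ah (hb n) p t) = t by rewrite coef_ah eqxx mulr1 p0 add0r.
have inO t : \1_(Omega_ N) (ah (hb n) p t) != 0 :> R -> norm2 (ah (hb n) p t) <= N.
  by rewrite indicE; case: (boolP (_ \in _)) => [|]; rewrite ?eqxx// inE => /Omega_norm2.
have K0 : 0 <= expR kap := expR_ge0 _.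
apply: (@le_trans _ _ (\int[Nm]_t ((expR kap * w p)%:E * (`|t| * \1_[set t : mR | t ^+ 2 <= c] t)%:E))%E).
  apply: ge0_le_integral_nm => t _; first by rewrite -EFinM lee_fin !mulr_ge0.
  rewrite -!EFinM lee_fin cE /wF -OE.
  have [->|/inO h] := eqVneq (\1_(Omega_ N) (ah (hb n) p t) : R) 0; first by rewrite mul0r !mulr0.
  have [h1 _] := weight_ratio n0 p0 h.
  by rewrite mulrA mulrC ler_wpM2r// mulr_ge0.
have mS : measurable [set t : mR | t ^+ 2 <= c].
  rewrite (_ : [set t : mR | _] = (fun t : mR => t ^+ 2 : mR) @^-1` `]-oo, c]); last first.
    by apply/seteqP; split=> t; rewrite /= in_itv.
  rewrite -[X in measurable X]setTI.
  exact: (_ : measurable_fun setT (fun t : mR => t ^+ 2 : mR)).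
have mI : measurable_fun setT (fun t : mR => (`|t| * \1_[set t : mR | t ^+ 2 <= c] t)%:E : \bar R).
  apply/measurable_EFinP; apply: measurable_funM; first exact: normr_measurable.
  exact: measurable_indic.
have k0 : (0 <= (expR kap * w p)%:E :> \bar R)%E by rewrite lee_fin mulr_ge0.
rewrite (ge0_integralZl _ measurableT mI _ k0); last by move=> t _; rewrite lee_fin mulr_ge0.
apply: (le_trans (lee_wpmul2l _ (truncated_moment c))); first by rewrite lee_fin mulr_ge0.
(* The constant weight [w p] is turned back into the weight along the line, at the cost of the
   second factor [expR kap]. *)
apply: (@le_trans _ _ (Cu%:E * \int[Nm]_t ((expR (- kap) * w p)%:E * (\1_[set t : mR | t ^+ 2 <= c] t)%:E))%E); last first.
  rewrite lee_wpmul2l ?lee_fin//; apply: ge0_le_integral_nm => t _.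
    by rewrite -EFinM lee_fin !mulr_ge0// expR_ge0.
  rewrite mul1e -EFinM lee_fin /wF -OE.
  have [->|/inO h] := eqVneq (\1_(Omega_ N) (ah (hb n) p t) : R) 0; first by rewrite mul0r !mulr0.
  have [_ h1] := weight_ratio n0 p0 h.
  by rewrite mulrC ler_wpM2l// expRN ler_pdivrMl ?expR_gt0.
have mI' : measurable_fun setT (fun t : mR => (\1_[set t : mR | t ^+ 2 <= c] t)%:E : \bar R).
  by apply/measurable_EFinP; exact: measurable_indic.
have k0' : (0 <= (expR (- kap) * w p)%:E :> \bar R)%E by rewrite lee_fin mulr_ge0 ?expR_ge0.
rewrite (ge0_integralZl _ measurableT mI' _ k0'); last by move=> t _; rewrite lee_fin.
rewrite integral_indic// setIT !muleA lee_wpmul2r// -!EFinM lee_fin /Cu expRN.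
have := expR_gt0 kap; move: (expR kap) => k kp.
by rewrite le_eqVlt; apply/orP; left; apply/eqP; field; rewrite gt_eqF.
Qed.

Section Below.
Variables (s del : R).
Hypothesis s0 : 0 < s.
Hypothesis del0 : 0 < del.
Hypothesis delN : del <= N.
Hypothesis sdel : 2 * s ^+ 2 <= del / 2.

(** The event on which the gap is large: a coordinate of order [s] and a norm so small that the
    quadratic error cannot cancel it. *)
Let G n : set (L2T R) := [set q | norm2 q <= del /\ s <= `|coef n q| <= 2 * s].
Let A : set (L2T R) := [set q | norm2 q <= del / 2].

Lemma gap_event_measurable n : measurable (G n).
Proof.
rewrite (_ : G n = [set q : L2T R | norm2 q <= del] `&` (fun q => `|coef n q|) @^-1` `[s, 2 * s]).
  apply: measurableI; first exact: norm2_le_measurable.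
  by rewrite -[X in measurable X]setTI; exact: mc.
by apply/seteqP; split=> q /=; rewrite in_itv.
Qed.

(** The mass of [A], which does not involve [n], is compared with that of [G n] on each line: for
    [p] in [A] the section of [G n] contains all [t] in [[s, 2 s]], because
    [t^2 / hw n <= 2 s^2 <= del / 2]. *)
Lemma gap_event_prob : exists2 c : R, 0 < c & forall n, n != 0 -> (c%:E <= nu (G n))%E.
Proof.
have Z0 := gibbs_Z_gt0 Hnu.
pose Ns := fine (Nm `[s, 2 * s]).
have Nfin : Nm `[s, 2 * s] \is a fin_num by exact: fin_num_measure.
have Ns0 : 0 < Ns.
  have s2 : s < 2 * s by rewrite ltr_pMl// ltr1n.
  by rewrite fine_gt0// (normal_itv_gt0 s2)/= ltey_eq Nfin.
have mA : measurable A by exact: norm2_le_measurable.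
pose a0 := (\int[gam]_q ((\1_A q)%:E * (w q)%:E))%E.
have mIw (B : set (L2T R)) : measurable B -> measurable_fun setT (fun q => (\1_B q)%:E * (w q)%:E : \bar R)%E.
  by move=> mB; apply: emeasurable_funM; apply/measurable_EFinP => //; exact: measurable_indic.
have Iw0 (B : set (L2T R)) q : (0 <= (\1_B q)%:E * (w q)%:E :> \bar R)%E.
  by rewrite -EFinM lee_fin mulr_ge0.
have a00 : (0 < a0)%E.
  (* [A] contains a ball around 0, which has positive Gaussian measure, and the weight is
     positive. *)
  rewrite lt0e integral_ge0 ?andbT; last by move=> q _; exact: Iw0.
  apply/eqP => h.
  have /(ae_eq_integral_abs gam measurableT (mIw _ mA)) [M [mM M0 sM]] :
      (\int[gam]_q `|(\1_A q)%:E * (w q)%:E| = 0)%E.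
    by rewrite -[RHS]h; apply: eq_integral => q _; rewrite gee0_abs.
  have e0 : 0 < Num.sqrt (del / 2) by rewrite sqrtr_gt0 divr_gt0.
  have := gam_ball_gt0 gam_dis gam_dense e0; apply/negP; rewrite -leNgt -M0.
  apply: le_measure; rewrite ?inE//; first exact: L2ball_measurable.
  move=> q /= hq; apply: sM => /= /(_ Logic.I) /eqP; rewrite -EFinM eqe mulf_eq0 [w q == 0]gt_eqF// orbF.
  rewrite indicE mem_set ?oner_eq0// /A/= norm2_dst.
  rewrite -(sqr_sqrtr (a := del / 2)) ?divr_ge0 ?(ltW del0)//.
  by rewrite lerXn2r ?nnegrE ?nrm_ge0 ?sqrtr_ge0//; exact: ltW.
have lower n : n != 0 -> (a0 <= (expR kap ^+ 2 / Ns)%:E * \int[gam]_q ((\1_(G n) q)%:E * (w q)%:E))%E.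
  move=> n0; have mG := gap_event_measurable n.
  apply: (disint_le gam_dis (n := n)) => //; [exact: mIw|exact: mIw| |].
    by rewrite divr_ge0 ?exprn_ge0 ?expR_ge0// ltW.
  (* If [norm2 p > del / 2] the whole line misses [A], since the norm only grows along it. *)
  move=> p p0; have [pd|pd] := leP (norm2 p) (del / 2); last first.
    rewrite integral0_eq ?mule_ge0 ?lee_fin ?divr_ge0 ?exprn_ge0 ?expR_ge0 ?(ltW Ns0)//.
      by apply: integral_ge0 => t _; exact: Iw0.
    move=> t _; rewrite indicE memNset ?mul0e// /A/= (norm2_ah n0 _ p0).
    apply/negP; rewrite -ltNge; apply: lt_le_trans pd _; rewrite lerDl divr_ge0 ?sqr_ge0// ltW// hw_gt0//.
  apply: (@le_trans _ _ (\int[Nm]_t ((expR kap * w p)%:E * (cst 1%E t)))%E).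
    apply: ge0_le_integral_nm => t _; first exact: Iw0.
    rewrite mule1 -EFinM lee_fin indicE; case: (boolP (_ \in A)) => [|_]; last by rewrite mul0r mulr_ge0 ?expR_ge0.
    rewrite inE /A/= mul1r => h; have [|h1 _] := @weight_ratio n p t n0 p0; last exact: h1.
    by apply: le_trans h (le_trans _ delN); rewrite ler_pdivrMr// ler_peMr ?ler1n// ltW.
  rewrite ge0_integralZl//; last by rewrite lee_fin mulr_ge0 ?expR_ge0.
  rewrite (_ : \int[_]_x cst 1%E x = 1)%E ?mule1; last first.
    by rewrite integral_cst// mul1e; exact: probability_setT.
  apply: (@le_trans _ _ ((expR kap ^+ 2 / Ns)%:E * \int[Nm]_t ((expR (- kap) * w p)%:E * (\1_(`[s, 2 * s]%classic : set mR) t)%:E))%E); last first.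
    rewrite lee_wpmul2l ?lee_fin ?divr_ge0 ?exprn_ge0 ?expR_ge0 ?(ltW Ns0)//; apply: ge0_le_integral_nm => t _.
      by rewrite -EFinM lee_fin !mulr_ge0// expR_ge0.
    rewrite -!EFinM lee_fin [\1_`[_, _] _]indicE; case: (boolP (t \in _)) => [|_]; last by rewrite mulr0 mulr_ge0.
    rewrite inE/= in_itv/= => /andP[ts t2]; rewrite mulr1.
    have t0 : 0 <= t by rewrite (le_trans _ ts)// ltW.
    have nd : norm2 (ah (hb n) p t) <= del.
      rewrite (norm2_ah n0 _ p0) (splitr del) lerD//; apply: le_trans sdel.
      rewrite ler_pdivrMr ?hw_gt0//; apply: (@le_trans _ _ (2 * s ^+ 2 * 2)); last first.
        by apply: ler_wpM2l; [rewrite mulr_ge0 ?sqr_ge0|exact: hw_ge2].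
      apply: (@le_trans _ _ ((2 * s) ^+ 2)); first by rewrite lerXn2r ?nnegrE// mulr_ge0// ltW.
      by rewrite exprMn; nra.
    rewrite indicE mem_set ?mul1r; last first.
      by split=> //; rewrite coef_ah eqxx mulr1 p0 add0r ger0_norm// ts.
    have [//|_ h1] := @weight_ratio n p t n0 p0; first exact: le_trans nd delN.
    by rewrite expRN ler_pdivrMl ?expR_gt0.
  have mI : measurable_fun setT (fun t : mR => (\1_(`[s, 2 * s]%classic : set mR) t)%:E : \bar R).
    by apply/measurable_EFinP; exact: measurable_indic.
  have k0 : (0 <= (expR (- kap) * w p)%:E :> \bar R)%E by rewrite lee_fin mulr_ge0 ?expR_ge0.
  rewrite (ge0_integralZl _ measurableT mI _ k0); last by move=> t _; rewrite lee_fin.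
  rewrite (_ : \int[_]_x (\1__ x)%:E = Ns%:E)%E; last first.
    by rewrite integral_indic ?setIT//; apply/esym; exact: fineK.
  rewrite -!EFinM lee_fin expRN.
  have := expR_gt0 kap; move: (expR kap) => k kp.
  by rewrite le_eqVlt; apply/orP; left; apply/eqP; field; rewrite !gt_eqF.
have nuG n : nu (G n) = ((fine (gibbs_Z gam N beta))^-1%:E * \int[gam]_q ((\1_(G n) q)%:E * (w q)%:E))%E.
  rewrite (Hnu (gap_event_measurable n)); congr (_ * _)%E.
  rewrite integral_mkcond; apply: eq_integral => q _; rewrite patchE !indicE.
  case: (boolP (q \in G n)) => [|_]; last by rewrite mul0e.
  rewrite inE => -[qd _]; rewrite mem_set ?mul1e//; apply/Omega_norm2; exact: le_trans qd delN.
have E0 : 0 < expR kap ^+ 2 / Ns by rewrite divr_gt0 ?exprn_gt0 ?expR_gt0.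
pose Cl := (fine (gibbs_Z gam N beta))^-1 / (expR kap ^+ 2 / Ns).
have Cl0 : 0 < Cl by rewrite divr_gt0 ?invr_gt0.
have nuG_ge n : n != 0 -> (Cl%:E * a0 <= nu (G n))%E.
  move=> n0; rewrite nuG /Cl EFinM -muleA lee_wpmul2l ?lee_fin ?invr_ge0 ?(ltW Z0)//.
  apply: (le_trans (lee_wpmul2l _ (lower _ n0))); first by rewrite lee_fin invr_ge0 ltW.
  by rewrite muleA -EFinM mulVf ?mul1e// gt_eqF.
have fin0 : (Cl%:E * a0)%E \is a fin_num.
  rewrite ge0_fin_numE ?mule_ge0 ?lee_fin ?(ltW Cl0) ?(ltW a00)//.
  apply: le_lt_trans (nuG_ge 1 isT) _; apply: le_lt_trans (probability_le1 _ (gap_event_measurable 1)) _.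
  exact: ltry.
exists (fine (Cl%:E * a0)).
  by rewrite fine_gt0// mule_gt0 ?lte_fin//= ltey_eq fin0.
by move=> n n0; rewrite fineK//; exact: nuG_ge.
Qed.

End Below.

Variable lam : L2T R -> nat -> R.
Hypothesis Hlam : forall q, is_periodic_spectrum q (lam q).
Hypothesis N1 : N < (wm / 8) ^+ 2.

(** From above, the means of the two coordinates are bounded and the quadratic term is at most a
    multiple of [N]; from below, the integral is restricted to the event [Gj], whose probability is
    bounded below uniformly in [j]. *)
Lemma gibbs_mean_gap : exists c C : R, [/\ 0 < c, 0 < C &
  forall j : nat, (1 <= j)%N ->
    ((c / j%:R)%:E <=
       \int[nu]_(q in Omega_ N) (lam q (2 * j)%N - lam q (2 * j - 1)%N)%:E
     <= (C / j%:R)%:E)%E].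
Proof.
have [K K0 gapK] := @gap_bounds R.
(* [del = s / (2 K)] makes the error [K * del] half of [s], so the gap on [Gj] is at least
   [s / (4 j)]. The first bound on [s] gives [2 s^2 <= del / 2], the second [del <= N]. *)
pose s : R := Num.min (8 * K)^-1 (2 * K * N).
pose del : R := s / (2 * K).
have K2 : 0 < 2 * K by rewrite mulr_gt0.
have K8 : 0 < 8 * K by rewrite mulr_gt0.
have s0 : 0 < s by rewrite lt_min invr_gt0 K8 mulr_gt0.
have s1 : s <= (8 * K)^-1 by rewrite ge_min lexx.
have s2 : s <= 2 * K * N by rewrite ge_min lexx orbT.
have del0 : 0 < del by rewrite divr_gt0.
have delN : del <= N by rewrite /del ler_pdivrMr// mulrC.
have sdel : 2 * s ^+ 2 <= del / 2.
  rewrite (_ : del / 2 = 2 * s * (8 * K)^-1); last by rewrite /del; field; rewrite gt_eqF.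
  by rewrite expr2 mulrA ler_wpM2l// mulr_ge0// ltW.
have [c c0 hc] := gap_event_prob s0 del0 delN sdel.
have Cu0 : 0 < Cu by rewrite mulr_gt0 ?exprn_gt0 ?expR_gt0 ?abs_moment_ratio_gt0.
exists (s / 4 * c), (2 * (Cu + Cu + 2 * K * N)); split.
- by rewrite mulr_gt0// divr_gt0.
- by rewrite mulr_gt0// !addr_gt0// mulr_gt0.
move=> j j1; have j0 : 0 < j%:R :> R by rewrite ltr0n.
have jz : j%:Z != 0 by case: j j1 {j0}.
have jz' : - j%:Z != 0 by rewrite oppr_eq0.
have gap q : norm2 q <= N -> _ := fun h => gapK q (lam q) j (Hlam q) (le_trans h (ltW N1)) j1.
apply/andP; split.
  set Gj := [set q : L2T R | norm2 q <= del /\ s <= `|coef j%:Z q| <= 2 * s].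
  apply: (@le_trans _ _ (\int[nu]_(q in Omega_ N) ((s / (4 * j%:R))%:E * (\1_Gj q)%:E))%E).
    have mGj : measurable Gj by exact: gap_event_measurable.
    have k0 : (0 <= (s / (4 * j%:R))%:E)%E by rewrite lee_fin divr_ge0 ?mulr_ge0// ltW.
    have m1 : measurable_fun (Omega_ N) (fun q : L2T R => (\1_Gj q)%:E : \bar R).
      by apply/measurable_EFinP/measurable_funTS; exact: measurable_indic.
    rewrite (ge0_integralZl nu mO m1 _ k0); last by move=> q _; rewrite lee_fin.
    rewrite integral_indic// (_ : Gj `&` Omega_ N = Gj); last first.
      apply/seteqP; split=> q; first by case.
      by move=> h; split=> //; apply/Omega_norm2; case: h => h _; exact: le_trans h delN.
    have -> : s / 4 * c / j%:R = s / (4 * j%:R) * c by field; rewrite gt_eqF.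
    by rewrite EFinM lee_wpmul2l ?lee_fin ?divr_ge0 ?mulr_ge0 ?(ltW s0) ?hc.
  apply: ge0_le_integral_nm => q /Omega_norm2 qN; first by rewrite -EFinM lee_fin mulr_ge0// divr_ge0 ?mulr_ge0// ltW.
  have [g0 _ g1] := gap q qN; rewrite -EFinM lee_fin indicE.
  case: (boolP (q \in Gj)) => [|_]; last by rewrite mulr0.
  rewrite inE mulr1 => -[qd /andP[cs _]]; apply: le_trans g1.
  rewrite (_ : s / (4 * j%:R) = (s - K * del) / (2 * j%:R)); last first.
    by rewrite /del; field; rewrite !gt_eqF.
  by rewrite ler_wpM2r ?invr_ge0 ?mulr_ge0// lerB// ler_wpM2l// ltW.
have mO' := @Omega_measurable R N.
apply: (@le_trans _ _ (\int[nu]_q ((2 / j%:R)%:E * (`|coef j%:Z q|%:E + `|coef (- j%:Z) q|%:E + (2 * K * N)%:E)))%E).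
  rewrite integral_mkcond; apply: ge0_le_integral_nm => q _; rewrite patchE; case: ifPn => //.
  - by rewrite inE => /Omega_norm2 /gap[g0 _ _]; rewrite lee_fin.
  - rewrite inE => /Omega_norm2 qN; have [_ g0 _] := gap q qN; rewrite -!EFinD -EFinM lee_fin.
    by apply: (le_trans g0); rewrite mulrAC ler_wpM2l ?divr_ge0// lerD2l ler_wpM2l// ltW.
  - by move=> _; rewrite -!EFinD -EFinM lee_fin !mulr_ge0 ?addr_ge0 ?mulr_ge0 ?invr_ge0// ltW//.
have mE n : measurable_fun setT (fun q : L2T R => `|coef n q|%:E : \bar R).
  by apply/measurable_EFinP; exact: mc.
have k0 : (0 <= (2 / j%:R)%:E :> \bar R)%E by rewrite lee_fin divr_ge0.
have m2 := emeasurable_funD (mE j%:Z) (mE (- j%:Z)).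
have m3 := emeasurable_funD m2 (@measurable_cst _ _ (L2T R) _ setT (2 * K * N)%:E).
rewrite (ge0_integralZl nu measurableT m3 _ k0); last first.
  by move=> q _; rewrite -!EFinD lee_fin !addr_ge0 ?mulr_ge0// ltW.
have -> : 2 * (Cu + Cu + 2 * K * N) / j%:R = 2 / j%:R * (Cu + Cu + 2 * K * N).
  by rewrite mulrAC.
rewrite [leRHS]EFinM; apply: lee_wpmul2l => //.
have c0' q : setT q -> (0 <= cst (2 * K * N)%:E (q : L2T R) :> \bar R)%E by rewrite lee_fin !mulr_ge0// ltW.
have a0 n q : setT q -> (0 <= `|coef n (q : L2T R)|%:E :> \bar R)%E by rewrite lee_fin.
have a2 q : setT q -> (0 <= `|coef j%:Z (q : L2T R)|%:E + `|coef (- j%:Z) q|%:E :> \bar R)%E.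
  by rewrite -EFinD lee_fin addr_ge0.
rewrite (ge0_integralD nu measurableT a2 m2 c0' (@measurable_cst _ _ _ _ _ _)).
rewrite (ge0_integralD nu measurableT (a0 j%:Z) (mE j%:Z) (a0 (- j%:Z)) (mE (- j%:Z))).
rewrite (_ : \int[_]_x cst (2 * K * N)%:E x = (2 * K * N)%:E)%E; last first.
  by rewrite integral_cst// -[RHS]mule1; congr (_ * _)%E; exact: probability_setT.
rewrite !EFinD.
by rewrite leeD// leeD//; exact: gibbs_coef_mean.
Qed.

End GibbsGap.

(** * Volterra equations on one period *)

Section Volterra.
Context {R : realType}.
Notation T := (pi *+ 2 : R).
Implicit Types (v y f : R -> R) (a b m M x : R).

(** Composing with this retraction onto [[0, T]] gives bounded continuous functions on the whole
    line, the setting of the fixed-point theorem. *)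
Definition clampT x : R := Num.min (Num.max x 0) T.

Lemma clampT_itv x : 0 <= clampT x <= T.
Proof. by rewrite /clampT le_min le_max lexx orbT T_ge0 /= ge_min lexx orbT. Qed.

Lemma clampT_id x : 0 <= x <= T -> clampT x = x.
Proof. by move=> /andP[x0 xT]; rewrite /clampT max_l// min_l. Qed.

Lemma clampTK x : clampT (clampT x) = clampT x.
Proof. exact: clampT_id (clampT_itv x). Qed.

Lemma clampT_cont : continuous clampT.
Proof.
move=> x.
have h : {for x, continuous ((@id R : R -> R^o) \max (fun=> 0 : R^o))}.
  by apply: continuous_max; [exact: cvg_id|exact: cvg_cst].
exact: (@continuous_min _ _ _ (fun=> T : R^o) x h (cvg_cst _)).
Qed.

Definition vol v y x := itg (itg (fun t => v t * y t) 0) 0 x.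

Let lvy v y : locint v -> continuous y -> locint (fun t => v t * y t).
Proof. exact: locintM. Qed.

Let cP v y : locint v -> continuous y -> continuous (itg (fun t => v t * y t) 0).
Proof. by move=> lv cy; apply: prim_continuous; exact: lvy. Qed.

Lemma D2_vol v y : locint v -> continuous y ->
  D2 (vol v y) (itg (fun t => v t * y t) 0) (fun t => v t * y t).
Proof.
move=> lv cy; split; first by move=> x; apply: itg_derive; exact: cP.
split; first exact: lvy.
by move=> a b; rewrite -(itg_chasles _ 0 a b) addrC addKr.
Qed.

Lemma vol_cont v y : locint v -> continuous y -> continuous (vol v y).
Proof. by move=> lv cy; exact: D2_cont (D2_vol lv cy). Qed.

Lemma volB v y z x : locint v -> continuous y -> continuous z ->
  vol v (fun t => y t - z t) x = vol v y x - vol v z x.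
Proof.
move=> lv cy cz; rewrite /vol -itgB; try exact: continuous_locint (cP _ _).
congr itg; apply/funext => s; rewrite -itgB; try exact: lvy.
by apply: eq_itg => t; rewrite mulrBr.
Qed.

Lemma volBl v v' y x : locint v -> locint v' -> continuous y ->
  vol (fun t => v t - v' t) y x = vol v y x - vol v' y x.
Proof.
move=> lv lv' cy; rewrite /vol -itgB; try exact: continuous_locint (cP _ _).
congr itg; apply/funext => s; rewrite -itgB; try exact: lvy.
by apply: eq_itg => t; rewrite mulrBl.
Qed.

Lemma itg_mul_le v y B s : locint v -> continuous y -> 0 <= s <= T ->
  (forall t, 0 <= t <= s -> `|y t| <= B) -> 
  `|itg (fun t => v t * y t) 0 s| <= itg (fun t => `|v t|) 0 T * B.
Proof.
move=> lv cy /andP[s0 sT] yB.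
have B0 : 0 <= B by apply: le_trans (normr_ge0 _) (yB 0 _); rewrite lexx.
apply: (@le_trans _ _ (itg (fun t => B * `|v t|) 0 s)).
  apply: itg_norm_le => //; [exact: lvy|by apply: locintZ; exact: locint_norm|].
  by move=> t ts; rewrite normrM mulrC ler_wpM2r// yB.
rewrite itgZ; last exact: locint_norm.
rewrite mulrC ler_wpM2r//; apply: itg_sub_le => //; exact: locint_norm.
Qed.

Lemma vol_le_bound v y B x : locint v -> continuous y -> 0 <= x <= T ->
  (forall t, 0 <= t <= T -> `|y t| <= B) -> `|vol v y x| <= T * (itg (fun t => `|v t|) 0 T * B).
Proof.
move=> lv cy /andP[x0 xT] yB.
have I0 : 0 <= itg (fun t => `|v t|) 0 T * B.
  rewrite mulr_ge0// ?itg_ge0// ?T_ge0//; first exact: locint_norm.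
  by apply: le_trans (normr_ge0 _) (yB 0 _); rewrite lexx T_ge0.
apply: (@le_trans _ _ (itg (fun=> itg (fun t => `|v t|) 0 T * B) 0 x)).
  apply: itg_norm_le => //; [exact: continuous_locint (cP _ _)|exact: locint_cst|].
  move=> s /andP[s0 sx]; apply: itg_mul_le => //; first by rewrite s0 (le_trans sx).
  by move=> t /andP[t0 ts]; apply: yB; rewrite t0 (le_trans ts)// (le_trans sx).
by rewrite itg_cst subr0 mulrC ler_wpM2r.
Qed.

Section Weight.
Variable m : R.
Hypothesis m0 : 0 < m.

(** An exponential weight in which the Volterra operator contracts, however large the potential. *)
Definition wgt x := expR (2 * m * clampT x).
Definition wgtT := expR (2 * m * T).

Lemma wgt_gt0 x : 0 < wgt x. Proof. exact: expR_gt0. Qed.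

Lemma wgt_ge1 x : 1 <= wgt x.
Proof. by rewrite -expR0 ler_expR mulr_ge0 ?mulr_ge0 ?(ltW m0)//; case/andP: (clampT_itv x). Qed.

Lemma wgt_le x : wgt x <= wgtT.
Proof. by rewrite ler_expR ler_wpM2l ?mulr_ge0 ?(ltW m0)//; case/andP: (clampT_itv x). Qed.

Section Potential.
Variable v : R -> R.
Hypothesis lv : locint v.
Hypothesis vm : itg (fun t => `|v t|) 0 T <= m.

(** The inner integral at [s] is at most [M m exp (2 m s)], whose integral over [[0, X]] is
    [M / 2 * (exp (2 m X) - 1)]. *)
Lemma vol_contract y M : continuous y -> 0 <= M -> (forall x, `|y x| <= M * wgt x) ->
  forall x, `|vol v y (clampT x)| <= M / 2 * wgt x.
Proof.
move=> cy M0 yM x; have /andP[x0 xT] := clampT_itv x; set X := clampT x in x0 xT *.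
have wE s : 0 <= s <= T -> wgt s = expR (2 * m * s) by move=> /clampT_id; rewrite /wgt => ->.
have de s : is_derive s (1 : R) (fun s : R => (2 * m)^-1 * expR (2 * m * s)) (expR (2 * m * s)).
  have d1 : is_derive s (1 : R) (fun s : R => expR (2 * m * s + 0)) (2 * m * expR (2 * m * s + 0)).
    exact: (@der_affine R expR _ (2 * m) 0 s (is_derive_expR _)).
  have := derZ (2 * m)^-1 d1.
  rewrite (_ : (fun s => _) = (fun s : R => (2 * m)^-1 * expR (2 * m * s))); last by apply/funext => r; rewrite addr0.
  by rewrite addr0 mulrA mulVf ?mul1r// gt_eqF// mulr_gt0.
have ce : continuous (fun s : R => expR (2 * m * s)).
  rewrite (_ : (fun s => _) = fun s => 2 * m * ((2 * m)^-1 * expR (2 * m * s))); last first.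
    by apply/funext => r; rewrite mulrA divff ?mul1r// gt_eqF// mulr_gt0.
  by apply: continuousZf; apply: is_derive_cont de.
apply: (@le_trans _ _ (itg (fun s => M * m * expR (2 * m * s)) 0 X)).
  apply: itg_norm_le => //; [exact: continuous_locint (cP _ _)|by apply: locintZ; exact: continuous_locint|].
  move=> s /andP[s0 sX]; have sT : 0 <= s <= T by rewrite s0 (le_trans sX).
  have h := @itg_mul_le v y (M * expR (2 * m * s)) s lv cy sT.
  apply: (le_trans (h _)).
    move=> t /andP[t0 ts]; apply: (le_trans (yM t)); rewrite ler_wpM2l//.
    rewrite wE ?ler_expR ?ler_wpM2l ?mulr_ge0 ?(ltW m0)// t0 (le_trans ts)//.
    by case/andP: sT.
  rewrite mulrA [M * m]mulrC -!mulrA; apply: ler_wpM2r => //.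
  by rewrite mulr_ge0 ?expR_ge0.
rewrite itgZ; last exact: continuous_locint.
rewrite (itg_FTC _ _ de)// mulr0 expR0 mulr1 /wgt -/X.
have e0 := expR_gt0 (2 * m * X); move: (expR _) e0 => e e0.
rewrite (_ : M * m * _ = M / 2 * (e - 1)); last by field; rewrite gt_eqF.
by rewrite ler_wpM2l ?divr_ge0// lerBlDr lerDl.
Qed.

(** The integral form of [y'' = v y] with [y(0) = a] and [y'(0) = b] on [[0, T]], extended by
    constants outside. *)
Definition is_sol a b y := continuous y /\
  forall x, y x = a + b * clampT x + vol v y (clampT x).

Let cu a b : continuous (fun x => a + b * clampT x).
Proof.
by apply: continuousDf; [exact: continuous_cst|apply: continuousZf; exact: clampT_cont].
Qed.

Let u_le a b x : `|a + b * clampT x| <= (`|a| + `|b| * T) * wgt x.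
Proof.
have /andP[x0 xT] := clampT_itv x.
apply: (@le_trans _ _ (`|a| + `|b| * T)).
  by apply: le_trans (ler_normD _ _) _; rewrite lerD2l normrM ler_wpM2l// ger0_norm.
by rewrite ler_peMr ?wgt_ge1// addr_ge0 ?mulr_ge0 ?T_ge0.
Qed.

Let ab0 a b : 0 <= `|a| + `|b| * T. Proof. by rewrite addr_ge0 ?mulr_ge0 ?T_ge0. Qed.

Let cV y : continuous y -> continuous (fun x => vol v y (clampT x)).
Proof. by move=> cy; apply: continuous_compf; [exact: vol_cont|exact: clampT_cont]. Qed.

Lemma vol_contraction_le f u M0 : continuous f -> (exists M, forall x, `|f x| <= M) -> 0 <= M0 ->
  (forall x, `|u x| <= M0 * wgt x) -> (forall x, f x = u x + vol v f (clampT x)) ->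
  forall x, `|f x| <= 2 * M0 * wgt x.
Proof.
move=> cf [M fM] M00 uM fE.
have M_ge0 : 0 <= M by exact: le_trans (normr_ge0 _) (fM 0).
apply: (@contraction_le R wgt (fun y x => vol v y (clampT x)) (fun=> True) wgt_gt0
  (fun f M Cf => vol_contract (proj1 Cf)) f u M M0) => //.
by move=> x; apply: (le_trans (fM x)); rewrite ler_peMr ?wgt_ge1.
Qed.

Lemma sol_exists a b : exists y, is_sol a b y.
Proof.
have VB f g : continuous f -> continuous g -> forall x,
    vol v (fun z => f z - g z) (clampT x) = vol v f (clampT x) - vol v g (clampT x).
  by move=> cf cg x; exact: volB.
have [f [[cf _] fE _]] := @contraction_fixpoint R wgt (fun y x => vol v y (clampT x)) (fun=> True) wgtT
  wgt_gt0 wgt_le (fun _ _ _ _ => Logic.I) (fun _ _ _ _ => Logic.I) (fun _ _ _ _ => Logic.I)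
  (fun y Cy => conj (cV (proj1 Cy)) Logic.I)
  (fun f g Cf Cg => VB f g (proj1 Cf) (proj1 Cg))
  (fun f M Cf => vol_contract (proj1 Cf)) _ _ (conj (@cu a b) Logic.I) (ab0 a b) (u_le a b).
by exists f.
Qed.

Lemma sol_clamp a b y x : is_sol a b y -> y (clampT x) = y x.
Proof. by move=> [_ h]; rewrite h clampTK -h. Qed.

Lemma sol_bounded a b y : is_sol a b y -> exists M, forall x, `|y x| <= M.
Proof.
move=> hy; have [M _ hM] := continuous_itv_bounded 0 T (proj1 hy).
by exists M => x; rewrite -(sol_clamp x hy) hM// clampT_itv.
Qed.

Lemma sol_le a b y : is_sol a b y -> forall x, `|y x| <= 2 * (`|a| + `|b| * T) * wgtT.
Proof.
move=> hy x; have h := vol_contraction_le (proj1 hy) (sol_bounded hy) (ab0 a b) (u_le a b) (proj2 hy) x.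
by apply: (le_trans h); rewrite ler_wpM2l ?wgt_le// mulr_ge0.
Qed.

End Potential.

(** The difference solves the equation for [v] with source [vol (v - v') y'], to which the
    contraction estimate applies. *)
Lemma sol_lip v v' a b y y' : locint v -> locint v' ->
  itg (fun t => `|v t|) 0 T <= m -> itg (fun t => `|v' t|) 0 T <= m ->
  is_sol v a b y -> is_sol v' a b y' ->
  forall x, `|y x - y' x| <= 4 * T * (`|a| + `|b| * T) * wgtT ^+ 2 * itg (fun t => `|v t - v' t|) 0 T.
Proof.
move=> lv lv' vm v'm hy hy' x; have [cy yE] := hy; have [cy' yE'] := hy'.
have lvv := locintB lv lv'.
have I0 : 0 <= itg (fun t => `|v t - v' t|) 0 T.
  by rewrite itg_ge0 ?T_ge0//; exact: locint_norm.
set K := 2 * (`|a| + `|b| * T) * wgtT.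
have K0 : 0 <= K by rewrite !mulr_ge0 ?addr_ge0 ?mulr_ge0 ?T_ge0 ?expR_ge0.
have bdd : exists M, forall x, `|y x - y' x| <= M.
  have [M hM] := sol_bounded hy; have [M' hM'] := sol_bounded hy'.
  by exists (M + M') => z; apply: le_trans (ler_normB _ _) (lerD _ _).
have B0 : 0 <= T * (itg (fun t => `|v t - v' t|) 0 T * K).
  by apply: mulr_ge0; [exact: T_ge0|exact: mulr_ge0].
have := @vol_contraction_le v lv vm (fun x => y x - y' x) (fun x => vol (fun t => v t - v' t) y' (clampT x))
  (T * (itg (fun t => `|v t - v' t|) 0 T * K)) (continuousBf cy cy') bdd.
have E (p V1 V2 V3 : R) : (p + V1) - (p + V2) = (V3 - V2) + (V1 - V3) by ring.
move=> h; have {h} : `|y x - y' x| <= 2 * (T * (itg (fun t => `|v t - v' t|) 0 T * K)) * wgt x.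
  apply: h.
  - exact: B0.
  - move=> z; apply: (@le_trans _ _ (T * (itg (fun t => `|v t - v' t|) 0 T * K))).
      by apply: vol_le_bound => //; [exact: clampT_itv|move=> t _; exact: (sol_le lv' v'm hy')].
    by rewrite ler_peMr ?wgt_ge1.
  - by move=> z; rewrite volB// volBl// [y z]yE [y' z]yE'; exact: E.
move/le_trans; apply; rewrite [leRHS](_ : _ = 2 * (T * (itg (fun t => `|v t - v' t|) 0 T * K)) * wgtT).
  by rewrite ler_wpM2l ?wgt_le// mulr_ge0.
by rewrite /K; ring.
Qed.

End Weight.

(** With zero data, [f] clamped to [[0, T]] satisfies the Volterra equation with zero source, and
    the contraction estimate gives 0. *)
Lemma sol_uniq v w f f1 : locint v -> D2 f f1 w ->
  (forall t, 0 <= t <= T -> w t = v t * f t) -> f 0 = 0 -> f1 0 = 0 ->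
  forall x, 0 <= x <= T -> f x = 0.
Proof.
move=> lv Df wE f0 f10 x xT; have cf := D2_cont Df.
pose g x := f (clampT x).
have cg : continuous g by apply: continuous_compf => //; exact: clampT_cont.
have fg s : 0 <= s <= T -> f s = g s by move=> sT; rewrite /g clampT_id.
pose m := itg (fun t => `|v t|) 0 T + 1.
have I0 : 0 <= itg (fun t => `|v t|) 0 T by rewrite itg_ge0 ?T_ge0//; exact: locint_norm.
have m0 : 0 < m by rewrite ltr_wpDl.
have [df [lf fE]] := Df.
have gE s : g s = (fun=> 0) s + vol v g (clampT s).
  rewrite add0r /g /vol; have sT := clampT_itv s; set S := clampT s in sT *.
  have -> : f S = itg f1 0 S by rewrite (itg_FTC _ _ df) ?f0 ?subr0//; exact: D2_cont1 Df.
  have /andP[S0 ST] := sT; apply: eq_itg_on => //.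
  - by apply: continuous_locint; exact: D2_cont1 Df.
  - by apply: continuous_locint; exact: cP.
  move=> t /andP[t0 tS]; have -> : f1 t = itg w 0 t by rewrite -fE f10 subr0.
  apply: eq_itg_on => //; first exact: lvy.
  move=> r /andP[r0 rt]; have rT : 0 <= r <= T by rewrite r0 (le_trans rt)// (le_trans tS).
  by rewrite wE// clampT_id.
have vm : itg (fun t => `|v t|) 0 T <= m by rewrite lerDl.
have gb : exists M, forall x, `|g x| <= M.
  have [M _ hM] := continuous_itv_bounded 0 T cf.
  by exists M => s; rewrite /g hM// clampT_itv.
have := @vol_contraction_le m m0 v lv vm g (fun=> 0) 0 cg gb (lexx 0) _ gE x.
rewrite mulr0 mul0r => h; apply/eqP; rewrite fg// -normr_le0; apply: h => s.
by rewrite normr0 mul0r.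
Qed.

Lemma D2_sol v a b y : locint v -> is_sol v a b y ->
  D2 (fun x => a + b * x + vol v y x) (fun x => b + itg (fun t => v t * y t) 0 x) (fun t => v t * y t).
Proof.
move=> lv [cy _].
have D1 : D2 (fun x => a + b * x) (fun=> b) (fun=> 0).
  have d1 x : is_derive x (1 : R) (fun x => a + b * x) b.
    by apply: der_eq (derD (der_cst a x) (derZ b (der_id x))) _; rewrite add0r mulr1.
  exact: (D2_smooth d1 (fun x => der_cst b x) (@continuous_cst _ 0)).
by apply: D2_ext (D2D D1 (D2_vol lv cy)) => x //; rewrite add0r.
Qed.

Lemma sol_itv v a b y x : is_sol v a b y -> 0 <= x <= T -> a + b * x + vol v y x = y x.
Proof. by move=> [_ h] xT; rewrite h clampT_id. Qed.

End Volterra.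

(** * Fundamental solutions and their dependence on q and l *)

Section HillFundamental.
Context {R : realType}.
Notation T := (pi *+ 2 : R).
Implicit Types (p q : L2T R) (l a b x : R).

Definition hv q l x : R := periodize q x - l.

Lemma hv_locint q l : locint (hv q l).
Proof. by apply: locintB; [exact: periodize_locint|exact: locint_cst]. Qed.

Definition fund a b q l : R -> R := xget (fun=> 0) [set y | is_sol (hv q l) a b y].

Lemma fundP a b q l : is_sol (hv q l) a b (fund a b q l).
Proof.
have I0 : 0 <= itg (fun t => `|hv q l t|) 0 T.
  by rewrite itg_ge0 ?T_ge0//; apply: locint_norm; exact: hv_locint.
have [y hy] := @sol_exists R (itg (fun t => `|hv q l t|) 0 T + 1) ltac:(by rewrite ltr_wpDl)
  (hv q l) (hv_locint q l) ltac:(by rewrite lerDl) a b.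
exact: (@xgetPex _ (fun=> 0) [set y | is_sol (hv q l) a b y] (ex_intro _ y hy)).
Qed.

Lemma fund_cont a b q l : continuous (fund a b q l).
Proof. by case: (fundP a b q l). Qed.

Lemma hv_norm q l : itg (fun t => `|hv q l t|) 0 T <= T * (nrm (L2fun q) + `|l|).
Proof.
have lp := periodize_locint q.
apply: (@le_trans _ _ (itg (fun t => `|periodize q t| + `|l|) 0 T)).
  apply: le_itg => [|||x _]; [exact: T_ge0|apply: locint_norm; exact: hv_locint| |exact: ler_normB].
  by apply: locintD; [exact: locint_norm|exact: locint_cst].
rewrite itgD; [|exact: locint_norm|exact: locint_cst].
rewrite itg_periodize_norm itg_cst subr0 [`|l| * _]mulrC -mulrDr ler_wpM2l ?T_ge0//.
by rewrite lerD2r; exact: avg_abs_le (L2fun_Lfun q).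
Qed.

Lemma hv_dist p q l l' :
  itg (fun t => `|hv p l t - hv q l' t|) 0 T <= T * (dst p q + `|l - l'|).
Proof.
have lp := periodize_locint p. have lq := periodize_locint q.
have lpq := locint_norm (locintB lp lq).
have lf := Lfun2B (L2fun_Lfun p) (L2fun_Lfun q).
apply: (@le_trans _ _ (itg (fun t => `|periodize p t - periodize q t| + `|l - l'|) 0 T)).
  apply: le_itg => [|||x _]; first exact: T_ge0.
  - by apply: locint_norm; apply: locintB; exact: hv_locint.
  - by apply: locintD => //; exact: locint_cst.
  - rewrite (_ : hv p l x - hv q l' x = (periodize p x - periodize q x) - (l - l')) ?ler_normB//.
    by rewrite /hv; ring.
rewrite itgD//; last exact: locint_cst.
rewrite itg_cst subr0 [`|_| * _]mulrC mulrDr lerD2r.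
have mpq : measurable_fun setT (fun x => `|L2fun p x - L2fun q x|).
  by apply: measurableT_comp => //; apply: measurable_funB; exact: L2fun_meas.
rewrite (@eq_itg_periodize _ _ (fun x => `|L2fun p x - L2fun q x|)); last 3 first.
- exact: locint_measT.
- exact: mpq.
- by move=> x hx; rewrite !periodize_eq.
have := avg_abs_le lf; rewrite avgE//; last by have := integrable_norm (Lfun2_int lf).
by rewrite ler_pdivrMl ?T_gt0.
Qed.

Lemma nrm_dst p q : nrm (L2fun p) <= nrm (L2fun q) + dst p q.
Proof. by rewrite -!dst_zero addrC; exact: dst_tri. Qed.

Lemma fund_lip a b q K : 0 <= K -> exists2 C : R, 0 <= C & forall p p' l l',
  dst p q <= 1 -> dst p' q <= 1 -> `|l| <= K -> `|l'| <= K ->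
  (forall x, `|fund a b p l x| <= C) /\
  forall x, `|fund a b p l x - fund a b p' l' x| <= C * (dst p p' + `|l - l'|).
Proof.
move=> K0; pose m : R := T * (nrm (L2fun q) + 1 + K) + 1.
have m0 : 0 < m by rewrite ltr_wpDl// mulr_ge0 ?T_ge0// !addr_ge0 ?nrm_ge0.
have hm p l : dst p q <= 1 -> `|l| <= K -> itg (fun t => `|hv p l t|) 0 T <= m.
  move=> pq lK; apply: (le_trans (hv_norm p l)); apply: (@le_trans _ _ (T * (nrm (L2fun q) + 1 + K))).
    rewrite ler_wpM2l ?T_ge0// lerD//; apply: le_trans (nrm_dst p q) _; by rewrite lerD2l.
  by rewrite lerDl.
set A := `|a| + `|b| * T.
have A0 : 0 <= A by rewrite addr_ge0 ?mulr_ge0 ?T_ge0.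
have W0 : 0 <= wgtT m :> R by exact: expR_ge0.
have C1 : 0 <= 2 * A * wgtT m by rewrite mulr_ge0 ?mulr_ge0.
have C2 : 0 <= 4 * T * A * wgtT m ^+ 2 * T.
  by rewrite mulr_ge0 ?T_ge0// mulr_ge0 ?exprn_ge0// mulr_ge0// mulr_ge0 ?T_ge0.
exists (2 * A * wgtT m + 4 * T * A * wgtT m ^+ 2 * T); first exact: addr_ge0.
move=> p p' l l' pq p'q lK l'K; split=> x.
  apply: le_trans (sol_le m0 (hv_locint p l) (hm p l pq lK) (fundP a b p l) x) _.
  by rewrite lerDl.
have := sol_lip m0 (hv_locint p l) (hv_locint p' l') (hm p l pq lK) (hm p' l' p'q l'K) (fundP a b p l) (fundP a b p' l') x.
move=> /le_trans; apply; apply: (@le_trans _ _ (4 * T * A * wgtT m ^+ 2 * (T * (dst p p' + `|l - l'|)))).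
  by apply: ler_wpM2l; [rewrite mulr_ge0 ?exprn_ge0// mulr_ge0// mulr_ge0 ?T_ge0|exact: hv_dist].
rewrite [leLHS]mulrA; apply: ler_wpM2r; last by rewrite lerDr.
by rewrite addr_ge0 ?nrm_ge0.
Qed.

(** Lipschitz on the unit ball around each [q] times each bounded range of [l]. The class is stable
    under sums and products and is strong enough for the compactness argument of
    [locLip_zero_measurable]. *)
Definition locLip (F : L2T R -> R -> R) := forall q K, 0 <= K -> exists2 C : R, 0 <= C &
  forall p p' l l', dst p q <= 1 -> dst p' q <= 1 -> `|l| <= K -> `|l'| <= K ->
  `|F p l - F p' l'| <= C * (dst p p' + `|l - l'|).

Let dl0 p q l l' : 0 <= dst p q + `|l - l'|.
Proof. by rewrite addr_ge0 ?nrm_ge0. Qed.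

Lemma locLip_bound F : locLip F -> forall q K, 0 <= K -> exists2 C : R, 0 <= C &
  forall p l, dst p q <= 1 -> `|l| <= K -> `|F p l| <= C.
Proof.
move=> hF q K K0; have [C C0 hC] := hF q K K0.
exists (`|F q 0| + C * (1 + K)); first by rewrite addr_ge0// mulr_ge0// addr_ge0.
move=> p l pq lK; have := hC p q l 0 pq _ lK _; rewrite dst_xx normr0 subr0 => /(_ ler01 K0) h.
have E : `|F p l| <= `|F q 0| + `|F p l - F q 0|.
  by rewrite -[in leLHS](subrK (F q 0) (F p l)) addrC ler_normD.
apply: (le_trans E); rewrite lerD2l; apply: (le_trans h); rewrite ler_wpM2l// lerD//.
Qed.

Lemma locLip_cst c : locLip (fun _ _ => c).
Proof.
by move=> q K K0; exists 0 => // p p' l l' _ _ _ _; rewrite subrr normr0 mul0r.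
Qed.

Lemma locLipD F G : locLip F -> locLip G -> locLip (fun q l => F q l + G q l).
Proof.
move=> hF hG q K K0; have [C C0 hC] := hF q K K0; have [D D0 hD] := hG q K K0.
exists (C + D); first exact: addr_ge0.
move=> p p' l l' h1 h2 h3 h4; rewrite opprD addrACA mulrDl.
by apply: le_trans (ler_normD _ _) (lerD _ _); [exact: hC|exact: hD].
Qed.

Lemma locLipM F G : locLip F -> locLip G -> locLip (fun q l => F q l * G q l).
Proof.
move=> hF hG q K K0; have [C C0 hC] := hF q K K0; have [D D0 hD] := hG q K K0.
have [B B0 hB] := locLip_bound hF q K0; have [E E0 hE] := locLip_bound hG q K0.
exists (B * D + E * C); first by rewrite addr_ge0 ?mulr_ge0.
move=> p p' l l' h1 h2 h3 h4.
have -> : F p l * G p l - F p' l' * G p' l' = F p l * (G p l - G p' l') + G p' l' * (F p l - F p' l') by ring.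
rewrite mulrDl; apply: le_trans (ler_normD _ _) (lerD _ _); rewrite normrM -mulrA.
  by apply: ler_pM => //; [exact: hB|exact: hD].
by apply: ler_pM => //; [exact: hE|exact: hC].
Qed.

Lemma locLipB F G : locLip F -> locLip G -> locLip (fun q l => F q l - G q l).
Proof.
move=> hF hG; have := locLipD hF (locLipM (locLip_cst (-1)) hG).
by congr locLip; apply/funext => q; apply/funext => l; rewrite mulN1r.
Qed.

Lemma locLip_norm F : locLip F -> locLip (fun q l => `|F q l|).
Proof.
move=> hF q K K0; have [C C0 hC] := hF q K K0; exists C => // p p' l l' h1 h2 h3 h4.
by apply: le_trans (ler_dist_dist _ _) _; exact: hC.
Qed.

Lemma locLip_cont F q : locLip F -> continuous (F q).
Proof.
move=> hF l; have [C C0 hC] := hF q (`|l| + 1) ltac:(by rewrite addr_ge0).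
have C1 : 0 < C + 1 by rewrite ltr_wpDl.
apply/cvgrPdist_lt => e e0; near=> l'.
have h1 : `|l - l'| < 1 by near: l'; apply: cvgr_dist_lt => //; exact: cvg_id.
have h2 : `|l - l'| < e / (C + 1).
  by near: l'; apply: cvgr_dist_lt; [exact: cvg_id|exact: divr_gt0].
have l'K : `|l'| <= `|l| + 1.
  have E : `|l'| <= `|l| + `|l' - l| by rewrite -[in leLHS](subrK l l') addrC ler_normD.
  by apply: (le_trans E); rewrite lerD2l distrC ltW.
have := hC q q l l' _ _ _ l'K; rewrite dst_xx add0r => /(_ ler01 ler01) h.
have lK : `|l| <= `|l| + 1 by rewrite lerDl.
apply: le_lt_trans (h lK) _; move: h2; rewrite ltr_pdivlMr// => h2.
by apply: le_lt_trans h2; rewrite mulrC ler_wpM2l// lerDl.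
Unshelve. all: by end_near. Qed.

(** The set is closed: if [F q] has no zero on the compact [[-K, K]] its minimum is positive, and
    the uniform Lipschitz bound keeps it positive for nearby potentials. *)
Lemma locLip_zero_measurable F K : locLip F -> (forall q l, 0 <= F q l) ->
  measurable [set q : L2T R | exists2 l, `|l| <= K & F q l = 0].
Proof.
move=> hF F0; have [K0|K0] := ltP K 0.
  rewrite (_ : [set q | _] = set0)//; apply/seteqP; split=> // q [l /le_lt_trans h _].
  by have := h _ K0; rewrite ltNge normr_ge0.
apply: closed_measurable_L2 => q nq.
have KK : - K <= K by rewrite ge0_cp.
have cF : {within `[- K, K], continuous (F q)}.
  by apply: continuous_subspaceT; exact: locLip_cont.
have [c cK hc] := EVT_min KK cF.
have c0 : 0 < F q c.
  rewrite lt0r F0 andbT; apply/eqP => h; apply: nq; exists c => //.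
  by move: cK; rewrite in_itv/= -ler_norml.
have [C C0 hC] := hF q K K0; have C1 : 0 < C + 1 by rewrite ltr_wpDl.
exists (Num.min 1 (F q c / (C + 1))); first by rewrite lt_min ltr01 divr_gt0.
move=> p; rewrite lt_min => /andP[p1]; rewrite ltr_pdivlMr// => p2 [l lK h].
have := hC q p l l _ (ltW p1) lK lK; rewrite dst_xx => /(_ ler01).
rewrite subrr normr0 addr0 h subr0 ger0_norm// => h3.
have h4 : F q c <= F q l by apply: hc; rewrite in_itv/= -ler_norml.
suff : F q c < F q c by rewrite ltxx.
apply: le_lt_trans (le_trans h4 h3) (le_lt_trans _ p2).
by rewrite dstC mulrC ler_wpM2l ?nrm_ge0// lerDl.
Qed.

Lemma fund_locLip a b x : locLip (fun q l => fund a b q l x).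
Proof.
move=> q K K0; have [C C0 hC] := fund_lip a b q K0; exists C => // p p' l l' h1 h2 h3 h4.
by have [_] := hC p p' l l' h1 h2 h3 h4; apply.
Qed.

(** The slope at [T]. *)
Definition fund' a b q l : R := b + itg (fun t => hv q l t * fund a b q l t) 0 T.

Lemma fund'_locLip a b : locLip (fund' a b).
Proof.
apply: locLipD; first exact: locLip_cst.
move=> q K K0; have [C C0 hC] := fund_lip a b q K0.
exists (T * (nrm (L2fun q) + 1 + K) * C + T * C).
  by rewrite addr_ge0 ?mulr_ge0 ?T_ge0// !addr_ge0 ?nrm_ge0.
move=> p p' l l' h1 h2 h3 h4; have [_ hd] := hC p p' l l' h1 h2 h3 h4.
have [hb _] := hC p' p l' l h2 h1 h4 h3.
set y := fund a b p l in hd *; set y' := fund a b p' l' in hb hd *.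
have cy : continuous y by exact: fund_cont. have cy' : continuous y' by exact: fund_cont.
have lv := hv_locint p l. have lv' := hv_locint p' l'.
rewrite -itgB; [|exact: locintM..].
rewrite (_ : (fun x => _) = fun x => hv p l x * (y x - y' x) + (hv p l x - hv p' l' x) * y' x); last first.
  by apply/funext => x; ring.
rewrite itgD; last 2 first.
- by apply: locintM => //; exact: continuousBf.
- by apply: locintM => //; exact: locintB.
have TT : 0 <= T <= T by rewrite T_ge0 lexx.
rewrite mulrDl; apply: le_trans (ler_normD _ _) (lerD _ _).
  apply: (le_trans (itg_mul_le lv (continuousBf cy cy') TT (fun t _ => hd t))).
  rewrite -mulrA; apply: ler_wpM2r; first by rewrite mulr_ge0.
  apply: (le_trans (hv_norm p l)); rewrite ler_wpM2l ?T_ge0// lerD//.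
  by apply: le_trans (nrm_dst p q) _; rewrite lerD2l.
apply: (le_trans (itg_mul_le (locintB lv lv') cy' TT (fun t _ => hb t))).
by rewrite -mulrA [C * _]mulrC mulrA; apply: ler_wpM2r => //; exact: hv_dist.
Qed.

End HillFundamental.

(** * Double eigenvalues and the monodromy matrix *)

Section DoubleEigenvalues.
Context {R : realType}.
Notation T := (pi *+ 2 : R).
Notation muT := (muT R).
Implicit Types (p q : L2T R) (l a b x s : R).

(** The monodromy matrix, which maps the data of a solution at 0 to its data at [T], is [s] times
    the identity. *)
Definition double s q l := [/\ fund 1 0 q l T = s, fund 0 1 q l T = 0,
  fund' 1 0 q l = 0 & fund' 0 1 q l = s].

Let lv q l := hv_locint q l.

Let TT : 0 <= T <= T. Proof. by rewrite T_ge0 lexx. Qed.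
Let T00 : 0 <= (0 : R) <= T. Proof. by rewrite lexx T_ge0. Qed.

Lemma fund0 a b q l : fund a b q l 0 = a.
Proof.
rewrite -(sol_itv (fundP a b q l) T00) mulr0 addr0 /vol itgxx addr0//.
Qed.

Lemma solution_repr q l f f1 : D2 f f1 (fun x => hv q l x * f x) ->
  (forall x, 0 <= x <= T -> f x = f 0 * fund 1 0 q l x + f1 0 * fund 0 1 q l x) /\
  f1 T = f 0 * fund' 1 0 q l + f1 0 * fund' 0 1 q l.
Proof.
move=> Df; set v := hv q l in Df *; have lv1 := lv q l.
have h1 := fundP 1 0 q l; have h2 := fundP 0 1 q l.
have D1 := D2_sol lv1 h1; have Dd := D2_sol lv1 h2.
have E x : 0 <= x <= T -> f x = f 0 * fund 1 0 q l x + f1 0 * fund 0 1 q l x.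
  move=> xT; apply/eqP; rewrite -subr_eq0 -(sol_itv h1 xT) -(sol_itv h2 xT); apply/eqP.
  apply: (sol_uniq lv1 (D2B Df (D2D (D2Z (f 0) D1) (D2Z (f1 0) Dd)))) xT => [t tT||].
  - by rewrite /= (sol_itv h1 tT) (sol_itv h2 tT) -/v; ring.
  - by rewrite /vol !itgxx; ring.
  - by rewrite !itgxx; ring.
split=> //.
have c1 := @fund_cont R 1 0 q l; have c2 := @fund_cont R 0 1 q l.
have [_ [lf fE]] := Df; rewrite -[LHS](subrK (f1 0)) fE /fund' -/v.
rewrite (@eq_itg_on _ _ (fun x => f 0 * (v x * fund 1 0 q l x) + f1 0 * (v x * fund 0 1 q l x))) ?T_ge0//.
- rewrite itgD; [|by apply: locintZ; exact: locintM..].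
  rewrite !itgZ; [|exact: locintM..].
  by ring.
- by apply: locintD; apply: locintZ; exact: locintM.
- by move=> x xT; rewrite E//; ring.
Qed.

Let eig s q l f := eigset s (periodize q) l f.

Lemma eig_repr s q l f : eig s q l f -> exists f1,
  [/\ D2 f f1 (fun x => hv q l x * f x), par s f,
      s * f 0 = f 0 * fund 1 0 q l T + f1 0 * fund 0 1 q l T &
      s * f1 0 = f 0 * fund' 1 0 q l + f1 0 * fund' 0 1 q l].
Proof.
move=> [pf [f1 Df]]; exists f1; have pf1 := derive_par (proj1 Df) pf.
have [h1 h2] := solution_repr Df.
split=> //; first by rewrite -h1// -pf add0r.
by rewrite -h2 -pf1 add0r.
Qed.

Lemma eig_zero s q l f f1 : `|s| = 1 -> D2 f f1 (fun x => hv q l x * f x) -> par s f ->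
  f 0 = 0 -> f1 0 = 0 -> forall x, f x = 0.
Proof.
move=> s1 Df pf f0 f10 x; have [y yT e] := par_reduce x s1 pf.
have [h _] := solution_repr Df.
by apply/eqP; rewrite -normr_eq0 e h// f0 f10 !mul0r addr0 normr0.
Qed.

Definition indep2 (f g : R -> R) :=
  forall a b, (forall x, a * f x + b * g x = 0) -> a = 0 /\ b = 0.

(** Independent solutions have independent data at 0; the monodromy matrix multiplies both data
    vectors by [s]. *)
Lemma eig_double s q l f g : `|s| = 1 -> eig s q l f -> eig s q l g -> indep2 f g ->
  double s q l.
Proof.
move=> s1 /eig_repr [f1 [Df pf f0 f10]] /eig_repr [g1 [Dg pg g0 g10]] ind.
have comb a b : a * f 0 + b * g 0 = 0 -> a * f1 0 + b * g1 0 = 0 -> a = 0 /\ b = 0.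
  move=> h0 h1; apply: ind; apply: (eig_zero (q := q) (l := l) s1) h0 h1.
    apply: D2_ext (D2D (D2Z a Df) (D2Z b Dg)) => // x; ring.
  by apply: parD; exact: parZ.
set al := f 0 in comb f0 f10 *; set be := f1 0 in comb f0 f10 *.
set ga := g 0 in comb g0 g10 *; set de := g1 0 in comb g0 g10 *.
have det : al * de - be * ga != 0.
  apply/eqP => d0.
  have [|a0 _] := @comb ga (- al) ltac:(ring); first by rewrite -[RHS]oppr0 -d0; ring.
  have [|d00 _] := @comb de (- be) _ ltac:(ring); first by rewrite -[RHS]d0; ring.
  have [_ /eqP] := @comb 0 1 ltac:(rewrite a0; ring) ltac:(rewrite d00; ring).
  by rewrite oner_eq0.
have solve (X Y : R) : al * X + be * Y = 0 -> ga * X + de * Y = 0 -> X = 0 /\ Y = 0.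
  move=> h1 h2; split; apply: (mulfI det); rewrite mulr0.
    have -> : (al * de - be * ga) * X = de * (al * X + be * Y) - be * (ga * X + de * Y) by ring.
    by rewrite h1 h2 !mulr0 subr0.
  have -> : (al * de - be * ga) * Y = al * (ga * X + de * Y) - ga * (al * X + be * Y) by ring.
  by rewrite h1 h2 !mulr0 subr0.
have ring1 (X Y a b c : R) : a * (X - c) + b * Y = (a * X + b * Y) - c * a by ring.
have ring2 (X Y a b c : R) : a * X + b * (Y - c) = (a * X + b * Y) - c * b by ring.
have [e1 e2] := @solve (fund 1 0 q l T - s) (fund 0 1 q l T)
  ltac:(by rewrite ring1 -f0 subrr) ltac:(by rewrite ring1 -g0 subrr).
have [e3 e4] := @solve (fund' 1 0 q l) (fund' 0 1 q l - s)
  ltac:(by rewrite ring2 -f10 subrr) ltac:(by rewrite ring2 -g10 subrr).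
by split=> //; apply/eqP; rewrite -subr_eq0; apply/eqP.
Qed.

(** Linearly dependent vectors fixed and negated by the same matrix: one of them is zero. *)
Let reflect_algebra (al be ga de A B C D : R) : al * de = be * ga ->
  al = al * A + be * B -> be = al * C + be * D ->
  - ga = ga * A + de * B -> - de = ga * C + de * D ->
  al = 0 /\ be = 0 \/ ga = 0 /\ de = 0.
Proof.
move=> W h1 h2 h3 h4.
have e1 : 2 * (al * ga) = ga * (al - (al * A + be * B)) - al * (- ga - (ga * A + de * B)) - B * (al * de - be * ga) by ring.
have e2 : 2 * (be * de) = de * (be - (al * C + be * D)) - be * (- de - (ga * C + de * D)) + C * (al * de - be * ga) by ring.
have e3 : 2 * (al * de) = ga * (be - (al * C + be * D)) - al * (- de - (ga * C + de * D)) + (1 - D) * (al * de - be * ga) by ring.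
rewrite -h1 -h3 W !subrr !mulr0 subrr subr0 in e1.
rewrite -h2 -h4 W !subrr !mulr0 subrr add0r in e2.
rewrite -h2 -h4 W !subrr !mulr0 subrr add0r in e3.
have z x y : 2 * (x * y) = 0 -> x != 0 -> y = 0.
  by move=> /eqP; rewrite !mulf_eq0 pnatr_eq0/= => /orP[->//|/eqP].
have [a0|a0] := eqVneq al 0; last first.
  by right; split; [exact: z e1 a0|apply: (z al de) a0; rewrite W].
have [b0|b0] := eqVneq be 0; first by left.
right; split; last exact: z e2 b0.
exact: z e3 b0.
Qed.

(* The monodromy matrix has determinant 1, so it cannot have both eigenvalues 1 and -1. *)
Lemma eig_opposite q l f g : eig 1 q l f -> eig (-1) q l g ->
  (exists x, f x != 0) -> (exists x, g x != 0) -> False.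
Proof.
move=> /eig_repr [f1 [Df pf f0 f10]] /eig_repr [g1 [Dg pg g0 g10]] [x fx] [y gy].
(* The Wronskian is constant, but the opposite multipliers change its sign over a period. *)
have W : f 0 * g1 0 = f1 0 * g 0.
  have := green 0 T Df Dg.
  rewrite (@eq_itg _ _ (fun=> 0)) ?itg_cst ?mul0r; last by move=> z; ring.
  have := derive_par (proj1 Df) pf 0; have := derive_par (proj1 Dg) pg 0.
  have := pf 0; have := pg 0; rewrite !add0r => -> -> -> -> h; lra.
have zf : f 0 = 0 -> f1 0 = 0 -> False.
  by move=> h1 h2; move: fx; rewrite (eig_zero (normr1 _) Df pf h1 h2) eqxx.
have zg : g 0 = 0 -> g1 0 = 0 -> False.
  by move=> h1 h2; move: gy; rewrite (eig_zero _ Dg pg h1 h2) ?eqxx// normrN normr1.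
move: W f0 f10 g0 g10 zf zg; move: (f 0) (f1 0) (g 0) (g1 0) => al be ga de W.
set A := fund 1 0 q l T; set B := fund 0 1 q l T; set C := fund' 1 0 q l; set D := fund' 0 1 q l.
rewrite !mul1r !mulN1r => f0 f10 g0 g10 zf zg.
by have [[/zf h /h]|[/zg h /h]] := reflect_algebra W f0 f10 g0 g10.
Qed.

(** Two independent elements of the eigenspace have either the same multiplier, which makes the
    eigenvalue double, or opposite ones, which [eig_opposite] excludes. *)
Lemma hill_dim_le1 q l n : ~ double 1 q l -> ~ double (-1) q l ->
  has_dim (hill_eigenspace q l) n -> (n <= 1)%N.
Proof.
move=> d1 d2; case: n => [//|[//|n]] [b [Eb lib _]]; exfalso.
pose i0 : 'I_n.+2 := ord0; pose i1 : 'I_n.+2 := lift ord0 ord0.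
have ind : indep2 (b i0) (b i1).
  move=> a c h; pose cc (i : 'I_n.+2) : R := if i == i0 then a else if i == i1 then c else 0.
  have hc : forall x, \sum_(i < n.+2) cc i * b i x = 0.
    move=> x; rewrite !big_ord_recl big1 ?addr0 => [|i _]; first by rewrite -(h x) /cc eqxx.
    by rewrite /cc; case: eqP => [/(congr1 val)//|_]; case: eqP => [/(congr1 val)//|_]; rewrite mul0r.
  by have := lib cc hc i0; have := lib cc hc i1; rewrite /cc eqxx.
have nz i : exists x, b i x != 0.
  apply: contrapT => h; have hb x : b i x = 0.
    by apply/eqP/negPn/negP => hx; apply: h; exists x.
  have hc : forall x, \sum_(k < n.+2) (k == i)%:R * b k x = 0.
    by move=> x; rewrite (bigD1 i)//= eqxx mul1r hb add0r big1// => k /negbTE ->; rewrite mul0r.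
  by have /eqP := lib _ hc i; rewrite eqxx oner_eq0.
have N1 : `|-1 : R| = 1 by rewrite normrN normr1.
have [/hill_eigset [e0|e0] /hill_eigset [e1|e1]] := (Eb i0, Eb i1).
- by apply: d1; exact: eig_double (normr1 _) e0 e1 ind.
- exact: eig_opposite e0 e1 (nz _) (nz _).
- exact: eig_opposite e1 e0 (nz _) (nz _).
- by apply: d2; exact: eig_double N1 e0 e1 ind.
Qed.

Lemma simple_spectrum q (lam : nat -> R) : is_periodic_spectrum q lam ->
  (forall l, ~ double 1 q l /\ ~ double (-1) q l) ->
  forall j, has_dim (hill_eigenspace q (lam j)) 1 /\ lam j < lam j.+1.
Proof.
move=> [nd spec] nb j; have [n [dn cn]] := spec (lam j).
have n1 : (n <= 1)%N by have [b1 b2] := nb (lam j); exact: hill_dim_le1 b1 b2 dn.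
have {n1} n1 : n = 1%N.
  case: n dn cn n1 => [|[|]]// _ + _.
  by rewrite II0 card_eq0 => /eqP h; have : [set i | lam i = lam j] j by []; rewrite h.
rewrite n1 in dn cn; split=> //; rewrite lt_neqAle nd// andbT; apply/eqP => e.
have [a ha] := card_eq_I1 cn.
have ja : j = a by apply/ha.
have : j.+1 = a by apply/ha; rewrite /= e.
by rewrite -ja => /eqP; rewrite eqn_leq ltnn.
Qed.

End DoubleEigenvalues.

(** * Completeness of the trigonometric system *)

Section TrigonometricCompleteness.
Context {R : realType}.
Notation T := (pi *+ 2 : R).

Lemma bernoulli_ineq (h : R) (m : nat) : 0 <= h -> 1 + m%:R * h <= (1 + h) ^+ m.
Proof.
move=> h0; elim: m => [|m IH]; first by rewrite mul0r addr0 expr0.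
have m0 : 0 <= m%:R :> R by rewrite ler0n.
rewrite exprS -(natr1 m).
apply: (@le_trans _ _ ((1 + h) * (1 + m%:R * h))); first by nra.
by rewrite ler_wpM2l// addr_ge0.
Qed.

Lemma exp_domination (a b C D : R) : 0 < b -> b < a -> 0 < C -> exists m : nat, D * b ^+ m < C * a ^+ m.
Proof.
move=> b0 ba C0; pose h := a / b - 1.
have h0 : 0 < h by rewrite subr_gt0 ltr_pdivlMr// mul1r.
have aE : a = (1 + h) * b by rewrite /h addrC subrK divfK// gt_eqF.
exists (Num.bound `|D / C / h|); set m := Num.bound _.
have hm : D / C / h < m%:R by apply: le_lt_trans (ler_norm _) (archi_boundP _).
apply: (@lt_le_trans _ _ (C * ((1 + m%:R * h) * b ^+ m))); last first.
  rewrite aE exprMn; apply: ler_wpM2l; first exact: ltW.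
  by apply: ler_wpM2r; [rewrite exprn_ge0// ltW|apply: bernoulli_ineq; exact: ltW].
rewrite mulrA ltr_pM2r ?exprn_gt0//.
move: hm; rewrite ltr_pdivrMr// ltr_pdivrMr// => hm; apply: (lt_trans hm).
by rewrite mulrC ltr_pM2l// ltrDr.
Qed.

Variables (F : R -> R) (x0 : R).
Hypothesis cF : continuous F.
Hypothesis bF : exists M : R, forall x, `|F x| <= M.
Hypothesis x00 : 0 < x0.
Hypothesis x0T : x0 < T.

Let cexp m (f : R -> R) : continuous f -> continuous (fun x => f x ^+ m).
Proof.
move=> cf; elim: m => [|m IH]; first exact: (@continuous_cst _ 1).
rewrite (_ : (fun x => _) = fun x => f x * f x ^+ m); last by apply/funext => x; rewrite exprS.
exact: continuousMf.
Qed.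

Let cker k : continuous (fun x : R => cos (k%:R * (x - x0))).
Proof.
apply: (@continuous_compf _ (fun y => cos (k%:R * y))); first exact: continuous_cosk.
by apply: continuousBf; [exact: continuous_idf|exact: continuous_cst].
Qed.

Let c x : R := 1 + cos (x - x0).

Let cc : continuous c.
Proof.
apply: continuousDf; first exact: continuous_cst.
have := @cker 1; rewrite (_ : (fun x => _) = (fun x => cos (x - x0)))//.
by apply/funext => x; rewrite mul1r.
Qed.

Section Orthogonal.
Hypothesis orth : forall n, avg (fun x => hb n x * F x) = 0.

Let orth_itg n : itg (fun x => F x * hb n x) 0 T = 0.
Proof.
have ch := @hb_cont R n.
have := orth n; rewrite avg_itg; last 2 first.
- exact: continuousMf.
- have [M hM] := bF; exists (1 * M) => x; rewrite normrM ler_pM//; exact: hb_le1.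
move/eqP; rewrite mulf_eq0 invr_eq0 gt_eqF ?T_gt0//= => /eqP h.
by rewrite -[RHS]h; apply: eq_itg => x; rewrite mulrC.
Qed.

Let orth_cos (k : nat) : itg (fun x => F x * cos (k%:R * x)) 0 T = 0.
Proof.
case: k => [|k].
  transitivity (itg (fun x => F x * hb 0 x) 0 T); last exact: orth_itg.
  apply: eq_itg => x; by rewrite mul0r cos0 /hb eqxx.
transitivity (k.+1%:R * itg (fun x => F x * hb k.+1%:Z x) 0 T); last by rewrite orth_itg mulr0.
rewrite -itgZ.
  by apply: eq_itg => x; rewrite hbP// mulrCA [k.+1%:R * (_ / _)]mulrC divfK ?pnatr_eq0.
by apply: continuous_locint; apply: continuousMf => //; exact: hb_cont.
Qed.

Let orth_sin (k : nat) : itg (fun x => F x * sin (k%:R * x)) 0 T = 0.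
Proof.
case: k => [|k].
  rewrite (@eq_itg _ _ (fun=> 0)) ?itg_cst ?mul0r// => x; by rewrite mul0r sin0 mulr0.
transitivity (k.+1%:R * itg (fun x => F x * hb (- k.+1%:Z) x) 0 T); last by rewrite orth_itg mulr0.
rewrite -itgZ.
  by apply: eq_itg => x; rewrite hbN// mulrCA [k.+1%:R * (_ / _)]mulrC divfK ?pnatr_eq0.
by apply: continuous_locint; apply: continuousMf => //; exact: hb_cont.
Qed.

(** Induction on [m]: multiplication by [c] turns frequency [k] into the frequencies [k], [k + 1]
    and [|k - 1|]. *)
Let orth_ker (m k : nat) : itg (fun x => F x * (c x ^+ m * cos (k%:R * (x - x0)))) 0 T = 0.
Proof.
have lI m' k' : locint (fun x => F x * (c x ^+ m' * cos (k'%:R * (x - x0)))).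
  by apply: continuous_locint; apply: continuousMf => //; apply: continuousMf => //; exact: cexp.
elim: m k => [|m IH] k.
  rewrite (@eq_itg _ _ (fun x => cos (k%:R * x0) * (F x * cos (k%:R * x)) + sin (k%:R * x0) * (F x * sin (k%:R * x)))).
    have l1 : locint (fun x => F x * cos (k%:R * x)).
      by apply: continuous_locint; apply: continuousMf => //; exact: continuous_cosk.
    have l2 : locint (fun x => F x * sin (k%:R * x)).
      by apply: continuous_locint; apply: continuousMf => //; exact: continuous_sink.
    by rewrite itgD ?itgZ ?orth_cos ?orth_sin ?mulr0 ?addr0//; exact: locintZ.
  by move=> x; rewrite expr0 mul1r mulrBr cosB; ring.
(* For [k = 0] the frequency [k - 1] is replaced by 1, the cosine being even. *)
have E x : F x * (c x ^+ m.+1 * cos (k%:R * (x - x0))) =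
    F x * (c x ^+ m * cos (k%:R * (x - x0))) +
    (2^-1 * (F x * (c x ^+ m * cos (k.+1%:R * (x - x0)))) +
     2^-1 * (F x * (c x ^+ m * cos ((if k is k'.+1 then k'%:R else 1) * (x - x0))))).
  set y := x - x0.
  have -> : c x ^+ m.+1 = c x ^+ m * (1 + cos y) by rewrite exprSr.
  have -> : cos (k.+1%:R * y) = cos (k%:R * y) * cos y - sin (k%:R * y) * sin y.
    by rewrite -natr1 mulrDl mul1r cosD.
  have -> : cos ((if k is k'.+1 then k'%:R else 1) * y) = cos (k%:R * y) * cos y + sin (k%:R * y) * sin y.
    case: k => [|k]; first by rewrite mul0r mul1r cos0 sin0; ring.
    have -> : k%:R * y = k.+1%:R * y - y by rewrite -(natr1 k); ring.
    by rewrite cosB.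
  by field.
rewrite (eq_itg _ _ E).
have E1 : (fun x => F x * (c x ^+ m * cos ((if k is k'.+1 then k'%:R else 1) * (x - x0)))) =
  (fun x => F x * (c x ^+ m * cos ((if k is k'.+1 then k' else 1)%:R * (x - x0)))) by case: k {E}.
rewrite itgD//; last by apply: locintD; apply: locintZ; rewrite ?E1.
rewrite itgD; [|exact: locintZ|by apply: locintZ; rewrite E1].
by rewrite !itgZ ?E1// !IH !mulr0 !addr0.
Qed.

Lemma orth_kernel m : itg (fun x => F x * c x ^+ m) 0 T = 0.
Proof. by rewrite -[RHS](orth_ker m 0); apply: eq_itg => x; rewrite mul0r cos0 mulr1. Qed.

End Orthogonal.

(* The kernels (1 + cos (x - x0))^m concentrate at x0. *)
Lemma kernel_peak : 0 < F x0 -> (forall m, itg (fun x => F x * c x ^+ m) 0 T = 0) -> False.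
Proof.
move=> F0 h; pose e := F x0 / 2.
have e0 : 0 < e by rewrite divr_gt0.
have [M hM] := bF; have M0 : 0 <= M by exact: le_trans (hM 0).
have /nbhs_ballP[d d0 hd] : \forall x \near x0, `|F x0 - F x| < e.
  by have /cvgrPdist_lt := @cF x0; apply.
(* The ball of radius [del] around [x0] stays in [[0, T]], [F >= e] on it, and [del < pi] keeps the
   cosine decreasing. *)
pose del := Num.min (d / 2) (Num.min x0 (Num.min (T - x0) 1)).
have del0 : 0 < del by rewrite !lt_min divr_gt0// x00 subr_gt0 x0T ltr01.
have del1 : del <= d / 2 by rewrite ge_min lexx.
have del2 : del <= x0 by rewrite !ge_min lexx orbT.
have del3 : del <= T - x0 by rewrite !ge_min lexx !orbT.
have del4 : del <= 1 by rewrite !ge_min lexx !orbT.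
have pi1 : 1 < pi :> R.
  by have := @pi_ge2 R; lra.
have Fe x : `|x - x0| <= del -> e <= F x.
  move=> hx; have := hd x; rewrite /ball/= distrC => /(_ _).
  have dd : `|x - x0| < d by apply: (le_lt_trans hx); lra.
  by move=> /(_ dd); rewrite ltr_norml /e; lra.
have in0 z : 0 <= z <= pi -> z \in `[0, pi] by rewrite in_itv.
pose a := 1 + cos (del / 2); pose b := 1 + cos del.
have b0 : 0 < b.
  have : cos pi < cos del by rewrite ltr_cos ?in0//; lra.
  rewrite cospi /b; lra.
have ba : b < a by rewrite ltrD2l ltr_cos ?in0//; lra.
have c0 x : 0 <= c x by rewrite /c; have := cos_geN1 (x - x0); lra.
have cosab (y : R) : cos y = cos `|y| by case: ger0P => _; rewrite ?cosN.
have ca x : `|x - x0| <= del / 2 -> a <= c x.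
  move=> hx; rewrite lerD2l (cosab (x - x0)); have y0 := normr_ge0 (x - x0).
  rewrite leNgt ltr_cos ?in0 -?leNgt//; lra.
have cb x : 0 <= x <= T -> del < `|x - x0| -> c x <= b.
  move=> /andP[x_0 xT] hx; rewrite lerD2l cosab.
  have yT : `|x - x0| <= T - del by rewrite ler_norml; lra.
  have [yp|yp] := leP `|x - x0| pi.
    by rewrite leNgt ltr_cos ?in0 -?leNgt//; lra.
  (* Points more than half a period from [x0] are handled by periodicity; [T - |x - x0|] is still at
     least [del]. *)
  have -> : cos `|x - x0| = cos (T - `|x - x0|).
    have c2 : cos T = 1 :> R by rewrite mulr2n cosD cospi sinpi; ring.
    have s2 : sin T = 0 :> R by rewrite mulr2n sinD cospi sinpi; ring.
    by rewrite cosB c2 s2; ring.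
  by rewrite leNgt ltr_cos ?in0 -?leNgt//; lra.
have lck m : locint (fun x => F x * c x ^+ m).
  by apply: continuous_locint; apply: continuousMf => //; exact: cexp.
(* Away from [x0] the kernel is at most [b ^+ m], so adding [M * b ^+ m] makes the integrand
   nonnegative; within [del / 2] of [x0] it is at least [e * a ^+ m]. As [b < a], large [m] gives a
   contradiction. *)
have key m : e * a ^+ m * del <= M * b ^+ m * T.
  have lD : locint (fun x => F x * c x ^+ m + M * b ^+ m) by apply: locintD => //; exact: locint_cst.
  have <- : itg (fun x => F x * c x ^+ m + M * b ^+ m) 0 T = M * b ^+ m * T.
    by rewrite itgD//; [rewrite h itg_cst subr0 add0r|exact: locint_cst].
  have Mb : 0 <= M * b ^+ m by rewrite mulr_ge0// exprn_ge0// ltW.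
  have pos x : 0 <= x <= T -> 0 <= F x * c x ^+ m + M * b ^+ m.
    move=> xT; have [xd|xd] := leP `|x - x0| del.
      rewrite addr_ge0// mulr_ge0 ?exprn_ge0//.
      by apply: le_trans (Fe _ xd); exact: ltW.
    have : `|F x * c x ^+ m| <= M * b ^+ m.
      rewrite normrM ler_pM// normrX ger0_norm// lerXn2r ?nnegrE ?(ltW b0)//.
      exact: cb.
    by rewrite ler_norml => /andP[+ _]; rewrite -subr_ge0 opprK.
  have dd : x0 - del / 2 <= x0 + del / 2 by lra.
  apply: (@le_trans _ _ (itg (fun x => F x * c x ^+ m + M * b ^+ m) (x0 - del / 2) (x0 + del / 2))); last first.
    by apply: itg_sub_le => //; lra.
  have -> : e * a ^+ m * del = itg (fun=> e * a ^+ m) (x0 - del / 2) (x0 + del / 2).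
    by rewrite itg_cst; field.
  apply: le_itg => //; first exact: locint_cst.
  move=> x /andP[x1 x2]; have xd : `|x - x0| <= del / 2 by rewrite ler_norml; apply/andP; split; lra.
  rewrite -[leLHS]addr0 lerD// ler_pM ?exprn_ge0 ?(ltW e0)//.
  - by rewrite (le_trans (ltW b0))// ltW.
  - by apply: Fe; lra.
  - by rewrite lerXn2r ?nnegrE ?ca// (le_trans (ltW b0))// ltW.
have ed0 : 0 < e * del by rewrite mulr_gt0.
have [m] := exp_domination (M * T) b0 ba ed0.
by rewrite ltNge => /negP; apply; have := key m; rewrite mulrAC [M * _ * _]mulrAC.
Qed.

End TrigonometricCompleteness.

Lemma trig_complete (R : realType) (F : R -> R) (x0 : R) : continuous F ->
  (exists M : R, forall x, `|F x| <= M) -> 0 < x0 -> x0 < pi *+ 2 ->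
  (forall n, avg (fun x => hb n x * F x) = 0) -> F x0 = 0.
Proof.
move=> cF bF x00 x0T orth; have ok := orth_kernel x0 cF bF orth.
have cN : continuous (fun x => - F x) by exact: continuousNf.
have bN : exists M : R, forall x, `|- F x| <= M.
  by have [M hM] := bF; exists M => x; rewrite normrN.
have [F0|F0|//] := ltgtP (F x0) 0; exfalso; last exact: (kernel_peak cF bF x00 x0T F0 ok).
apply: (kernel_peak cN bN x00 x0T); first by rewrite oppr_gt0.
have orthN n : avg (fun x => hb n x * - F x) = 0.
  rewrite (_ : (fun x => _) = fun x => -1 * (hb n x * F x)); last by apply/funext => x; ring.
  have [M hM] := bF.
  rewrite avgZ ?orth ?mulr0//; apply: Lfun2_mul_int; first exact: hb_Lfun.
  by apply: bdd_Lfun; [exact: continuous_measurable_fun|exists M].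
exact: (orth_kernel x0 cN bN orthN).
Qed.

(** * Families of functions depending on q and l *)

Section UniformFamilies.
Context {R : realType}.
Notation T := (pi *+ 2 : R).
Notation muT := (muT R).
Implicit Types (p q : L2T R) (l a b x s : R).

(** The version of [locLip] uniform in [x]: stable under products, and sent to [locLip] by
    averaging. *)
Definition locLipU (Y : L2T R -> R -> R -> R) :=
  (forall p l, continuous (Y p l)) /\
  forall q K, 0 <= K -> exists2 C : R, 0 <= C & forall p p' l l',
  dst p q <= 1 -> dst p' q <= 1 -> `|l| <= K -> `|l'| <= K ->
  (forall x, `|Y p l x| <= C) /\
  forall x, `|Y p l x - Y p' l' x| <= C * (dst p p' + `|l - l'|).

Lemma fund_U a b : locLipU (fund a b).
Proof. by split=> [p l|q K K0]; [exact: fund_cont|exact: fund_lip]. Qed.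

Lemma cst_U (g : R -> R) : continuous g -> (exists M : R, forall x, `|g x| <= M) ->
  locLipU (fun _ _ => g).
Proof.
move=> cg [M hM]; split=> // q K K0; exists M; first exact: le_trans (hM 0).
move=> p p' l l' _ _ _ _; split=> // x; rewrite subrr normr0 mulr_ge0 ?addr_ge0 ?nrm_ge0//.
exact: le_trans (hM 0).
Qed.

Lemma mul_U Y Z : locLipU Y -> locLipU Z -> locLipU (fun q l x => Y q l x * Z q l x).
Proof.
move=> [cY hY] [cZ hZ]; split=> [p l|q K K0]; first exact: continuousMf.
have [C C0 hC] := hY q K K0; have [D D0 hD] := hZ q K K0.
exists (C * D + C * D + C * D); first by rewrite !addr_ge0 ?mulr_ge0.
move=> p p' l l' h1 h2 h3 h4.
have [Yb Yd] := hC p p' l l' h1 h2 h3 h4; have [Zb Zd] := hD p p' l l' h1 h2 h3 h4.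
have [Zb' _] := hD p' p l' l h2 h1 h4 h3.
have CD0 : 0 <= C * D by rewrite mulr_ge0.
split=> x.
  rewrite normrM; apply: (@le_trans _ _ (C * D)); first exact: ler_pM.
  by rewrite lerDr addr_ge0.
have -> : Y p l x * Z p l x - Y p' l' x * Z p' l' x =
  Y p l x * (Z p l x - Z p' l' x) + Z p' l' x * (Y p l x - Y p' l' x) by ring.
have dl0 : 0 <= dst p p' + `|l - l'| by rewrite addr_ge0 ?nrm_ge0.
apply: le_trans (ler_normD _ _) _; rewrite -addrA [leRHS]mulrDl lerD//.
  by rewrite normrM -mulrA ler_pM.
rewrite [leRHS]mulrDl normrM -[leLHS]add0r lerD ?mulr_ge0//.
by rewrite [C * D]mulrC -mulrA ler_pM.
Qed.

Lemma contb_Lfun (f : R -> R) : continuous f -> (exists M : R, forall x, `|f x| <= M) ->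
  f \in Lfun muT 2%:E.
Proof. by move=> cf bf; apply: bdd_Lfun => //; exact: continuous_measurable_fun. Qed.

Lemma U_bounded Y q l : locLipU Y -> exists M : R, forall x, `|Y q l x| <= M.
Proof.
move=> [cY hY]; have [C C0 hC] := hY q `|l| (normr_ge0 l); exists C.
by have [] := hC q q l l; rewrite ?dst_xx.
Qed.

Lemma U_Lfun Y q l : locLipU Y -> Y q l \in Lfun muT 2%:E.
Proof. by move=> hY; apply: contb_Lfun; [exact: (proj1 hY)|exact: U_bounded]. Qed.

Lemma avg_U Y : locLipU Y -> locLip (fun q l => avg (Y q l)).
Proof.
move=> hY q K K0; have [C C0 hC] := (proj2 hY) q K K0; exists C => // p p' l l' h1 h2 h3 h4.
have [_ d] := hC p p' l l' h1 h2 h3 h4.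
have l1 := U_Lfun p l hY; have l2 := U_Lfun p' l' hY.
rewrite -avgB; [|exact: Lfun2_int..].
have l12 := Lfun2B l1 l2.
apply: le_trans (avg_norm (Lfun2_int l12)) _.
rewrite -[leRHS](@avg_cst R); apply: le_avg => //.
- by have := integrable_norm (Lfun2_int l12).
- by apply: Lfun2_int; exact: Lfun2_cst.
Qed.

End UniformFamilies.

(** * Double eigenvalues are isolated along lines *)

Section Degeneracy.
Context {R : realType}.
Notation T := (pi *+ 2 : R).
Notation muT := (muT R).
Implicit Types (p q : L2T R) (l a b x s t : R).

Let y1 q l := fund 1 0 q l.
Let y2 q l := fund 0 1 q l.

(* If l is double for q and l' is double for q' = q + t h_n, Green's identity for
   the pairs y1, y1 and y1, y2 over a period is a homogeneous linear system in
   (t, l' - l); this is its determinant. *)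
Definition detD n q l q' l' : R :=
  avg (fun x => hb n x * (y1 q l x * y1 q' l' x)) * avg (fun x => y1 q l x * y2 q' l' x) -
  avg (fun x => hb n x * (y1 q l x * y2 q' l' x)) * avg (fun x => y1 q l x * y1 q' l' x).

Let U1 := @fund_U R 1 0.
Let U2 := @fund_U R 0 1.
Let hbU n : @locLipU R (fun _ _ => hb n).
Proof. by apply: cst_U; [exact: hb_cont|exists 1 => x; exact: hb_le1]. Qed.

Let cstU a b q l : @locLipU R (fun _ _ => fund a b q l).
Proof. by apply: cst_U; [exact: fund_cont|exact: (U_bounded q l (@fund_U R a b))]. Qed.

Lemma detD_locLip n : @locLip R (fun q l => detD n q l q l).
Proof.
apply: locLipB; apply: locLipM; apply: avg_U.
- exact: (mul_U (hbU n) (mul_U U1 U1)).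
- exact: (mul_U U1 U2).
- exact: (mul_U (hbU n) (mul_U U1 U2)).
- exact: (mul_U U1 U1).
Qed.

Lemma detD_locLipr n q l : @locLip R (detD n q l).
Proof.
apply: locLipB; apply: locLipM; apply: avg_U.
- exact: (mul_U (hbU n) (mul_U (cstU 1 0 q l) U1)).
- exact: (mul_U (cstU 1 0 q l) U2).
- exact: (mul_U (hbU n) (mul_U (cstU 1 0 q l) U2)).
- exact: (mul_U (cstU 1 0 q l) U1).
Qed.

Let near0 q l : exists2 d : R, 0 < d & forall x, 0 <= x -> x < d -> 2^-1 < y1 q l x.
Proof.
have /nbhs_ballP[d d0 hd] : \forall x \near (0 : R), `|y1 q l 0 - y1 q l x| < 2^-1.
  by have /cvgrPdist_lt := @fund_cont R 1 0 q l 0; apply; rewrite invr_gt0.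
exists d => // x x0 xd; have := hd x; rewrite /ball/= sub0r normrN ger0_norm// => /(_ xd).
rewrite /y1 fund0 ltr_norml; lra.
Qed.

(** If all determinants vanish, [y1 (B y1 - A y2)] is orthogonal to every [hb n], hence zero. Near
    0, where [y1] is close to 1, this gives [B y1 = A y2]; at 0 it gives [B = 0], and [A > 0] then
    forces [y2 = 0] near 0, against its slope 1. *)
Lemma detD_nondegenerate q l : exists n, detD n q l q l != 0.
Proof.
apply: contrapT => h.
have {}h n : detD n q l q l = 0 by apply/eqP/negPn/negP => hn; apply: h; exists n.
set A := avg (fun x => y1 q l x * y1 q l x); set B := avg (fun x => y1 q l x * y2 q l x).
have c1 : continuous (y1 q l) by exact: fund_cont.
have c2 : continuous (y2 q l) by exact: fund_cont.
have [M1 hM1] := U_bounded q l U1; have [M2 hM2] := U_bounded q l U2.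
pose G x := y1 q l x * B - y2 q l x * A.
pose F x := y1 q l x * G x.
have cG : continuous G.
  by apply: continuousBf; apply: continuousMf => //; exact: continuous_cst.
have cF : continuous F by exact: continuousMf.
have bF : exists M : R, forall x, `|F x| <= M.
  exists (M1 * (M1 * `|B| + M2 * `|A|)) => x; rewrite normrM ler_pM//.
  by apply: le_trans (ler_normB _ _) _; rewrite !normrM lerD// ler_wpM2r.
have orth n : avg (fun x => hb n x * F x) = 0.
  have l1 := U_Lfun q l (mul_U (hbU n) (mul_U U1 U1)).
  have l2 := U_Lfun q l (mul_U (hbU n) (mul_U U1 U2)).
  rewrite (_ : (fun x => _) = fun x => B * (hb n x * (y1 q l x * y1 q l x)) - A * (hb n x * (y1 q l x * y2 q l x))); last first.
    by apply/funext => x; rewrite /F /G; ring.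
  rewrite avgB; [|by apply: Lfun2_int; exact: Lfun2Z..].
  rewrite !avgZ; [|exact: Lfun2_int..].
  by rewrite mulrC [A * _]mulrC; exact: h.
have [d d0 hd] := near0 q l.
pose e := Num.min d T.
have e0 : 0 < e by rewrite lt_min d0 T_gt0.
have G0 x : 0 < x -> x < e -> G x = 0.
  rewrite lt_min => x0 /andP[xd xT]; have := trig_complete cF bF x0 xT orth.
  move/eqP; rewrite mulf_eq0 => /orP[/eqP y0|/eqP//].
  by have := hd x (ltW x0) xd; rewrite y0 ltNge invr_ge0 ler0n.
have G00 : G 0 = 0.
  apply/eqP; rewrite -normr_le0; apply/ler_addgt0Pr => r r0; rewrite add0r.
  have /nbhs_ballP[k k0 hk] : \forall x \near (0 : R), `|G 0 - G x| < r.
    by have /cvgrPdist_lt := @cG 0; apply.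
  pose x := Num.min (k / 2) (e / 2).
  have x0 : 0 < x by rewrite lt_min !divr_gt0.
  have xk : x < k by rewrite /x gt_min; apply/orP; left; rewrite ltr_pdivrMr// ltr_pMr// ltr1n.
  have xe : x < e by rewrite /x gt_min; apply/orP; right; rewrite ltr_pdivrMr// ltr_pMr// ltr1n.
  have := hk x; rewrite /ball/= sub0r normrN gtr0_norm// => /(_ xk).
  by rewrite (G0 x x0 xe) subr0 => /ltW.
have B0 : B = 0 by move: G00; rewrite /G /y1 /y2 !fund0 mul1r mul0r subr0.
have e2 : 0 < e / 2 by rewrite divr_gt0.
have ee : e / 2 < e by rewrite ltr_pdivrMr// ltr_pMr// ltr1n.
have [ed eT] : e <= d /\ e <= T by rewrite /e !ge_min !lexx orbT.
have A0 : A != 0.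
  have bb : exists M : R, forall x, `|y1 q l x * y1 q l x| <= M by exact: (U_bounded q l (mul_U U1 U1)).
  have cyy : continuous (fun x => y1 q l x * y1 q l x) by exact: continuousMf.
  rewrite /A avg_itg// mulf_neq0 ?invr_neq0 ?gt_eqF ?T_gt0//.
  have lyy := continuous_locint cyy.
  apply: (@lt_le_trans _ _ (itg (fun=> 4^-1) 0 (e / 2))).
    by rewrite itg_cst subr0 mulr_gt0.
  apply: (@le_trans _ _ (itg (fun x => y1 q l x * y1 q l x) 0 (e / 2))).
    apply: le_itg; [exact: ltW|exact: locint_cst|by []|].
    move=> x /andP[x0 xe]; have := hd x x0 (le_lt_trans xe (lt_le_trans ee ed)).
    by move: (y1 q l x) => y hy; nra.
  apply: itg_sub_le => //; [exact: ltW|exact: le_trans (ltW ee) eT|].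
  by move=> x _; rewrite -expr2 sqr_ge0.
have z2 x : 0 <= x -> x < e -> y2 q l x = 0.
  rewrite le_eqVlt => /predU1P[<- _|x0 xe]; first exact: fund0.
  have := G0 x x0 xe; rewrite /G B0 mulr0 sub0r => /eqP; rewrite oppr_eq0 mulf_eq0 (negbTE A0) orbF.
  by move/eqP.
(* If [y2] vanishes up to [e / 2], its Volterra equation there reads [y2 (e / 2) = e / 2]. *)
have := z2 (e / 2) (ltW e2) ee.
have e2T : 0 <= e / 2 <= T by rewrite (ltW e2) (le_trans (ltW ee)).
rewrite /y2 -(sol_itv (fundP 0 1 q l) e2T) add0r mul1r /vol.
rewrite (@eq_itg_on _ _ (fun=> 0)) ?(ltW e2)//.
- by rewrite itg_cst mul0r addr0 => /eqP; rewrite gt_eqF.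
- by apply: continuous_locint; apply: prim_continuous; apply: locintM; [exact: hv_locint|exact: fund_cont].
- exact: locint_cst.
- move=> r /andP[r0 re]; rewrite (@eq_itg_on _ _ (fun=> 0)) ?itg_cst ?mul0r//.
  + by apply: locintM; [exact: hv_locint|exact: fund_cont].
  + exact: locint_cst.
  + move=> u /andP[u0 ur]; rewrite -/(y2 q l) z2 ?mulr0//.
    exact: le_lt_trans (le_trans ur re) ee.
Qed.

Lemma fund_D2 a b q l : exists Y Y1,
  [/\ D2 Y Y1 (fun t => hv q l t * fund a b q l t),
      forall x, 0 <= x <= T -> Y x = fund a b q l x, Y1 0 = b & Y1 T = fund' a b q l].
Proof.
have h := fundP a b q l; have D := D2_sol (hv_locint q l) h.
exists (fun x => a + b * x + vol (hv q l) (fund a b q l) x).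
exists (fun x => b + itg (fun t => hv q l t * fund a b q l t) 0 x); split=> //.
  by move=> x; exact: sol_itv h.
by rewrite itgxx addr0.
Qed.

Lemma green_double s q l q' l' a b c d : s * s = 1 ->
  fund a b q l T = s * a -> fund' a b q l = s * b ->
  fund c d q' l' T = s * c -> fund' c d q' l' = s * d ->
  itg (fun x => (hv q l x - hv q' l' x) * (fund a b q l x * fund c d q' l' x)) 0 T = 0.
Proof.
move=> ss e1 e2 e3 e4.
have lv := hv_locint q l; have lv' := hv_locint q' l'.
have [Y [Y1 [D YE Y0 YT]]] := fund_D2 a b q l.
have [Z [Z1 [D' ZE Z0 ZT]]] := fund_D2 c d q' l'.
have cy := @fund_cont R a b q l. have cy' := @fund_cont R c d q' l'.
have := green 0 T D D'.
have TT : 0 <= T <= T by rewrite T_ge0 lexx.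
have T00 : 0 <= (0 : R) <= T by rewrite lexx T_ge0.
rewrite Y0 YT Z0 ZT (YE _ TT) (ZE _ TT) (YE _ T00) (ZE _ T00) (fund0 a) (fund0 c) e1 e2 e3 e4.
have -> : s * b * (s * c) - s * a * (s * d) - (b * c - a * d) = (s * s - 1) * (b * c - a * d) by ring.
rewrite ss subrr mul0r => gr; rewrite -[RHS]gr {gr}.
move: YE ZE cy cy' D D'; set y := fund a b q l; set y' := fund c d q' l' => YE ZE cy cy' D D'.
apply: eq_itg_on; [exact: T_ge0| | |].
- by apply: locintM; [exact: locintB|exact: continuousMf].
- have cY := D2_cont D; have cZ := D2_cont D'.
  apply: locintB; first by apply: locintM => //; exact: locintM.
  rewrite (_ : (fun x => _) = (fun x => (hv q' l' x * y' x) * Y x)); last by apply/funext => x; rewrite mulrC.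
  by apply: locintM => //; exact: locintM.
- by move=> x xT; rewrite (YE x xT) (ZE x xT); ring.
Qed.

(** Monodromy [s] at both potentials cancels the boundary terms of Green's identity, and the two
    potentials differ by [t h_n - (l' - l)]. *)
Lemma green_shift s n q t l l' a b c d : s * s = 1 ->
  fund a b q l T = s * a -> fund' a b q l = s * b ->
  fund c d (ah (hb n) q t) l' T = s * c -> fund' c d (ah (hb n) q t) l' = s * d ->
  t * avg (fun x => hb n x * (fund a b q l x * fund c d (ah (hb n) q t) l' x)) =
  (l' - l) * avg (fun x => fund a b q l x * fund c d (ah (hb n) q t) l' x).
Proof.
move=> ss e1 e2 e3 e4; have := green_double ss e1 e2 e3 e4.
set q' := ah (hb n) q t; set y := fund a b q l; set y' := fund c d q' l'.
have cy : continuous y by exact: fund_cont. have cy' : continuous y' by exact: fund_cont.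
pose g x := y x * y' x; have cg : continuous g by exact: continuousMf.
have bg : exists M : R, forall x, `|g x| <= M.
  have [M hM] := U_bounded q l (@fund_U R a b); have [M' hM'] := U_bounded q' l' (@fund_U R c d).
  exists (M * M') => x; rewrite /g normrM.
  exact: ler_pM (normr_ge0 _) (normr_ge0 _) (hM x) (hM' x).
have lg := contb_Lfun cg bg.
have lpq := periodize_locint q; have lpq' := periodize_locint q'.
rewrite (@eq_itg _ _ (fun x => (periodize q x * g x - periodize q' x * g x) + (l' - l) * g x)); last first.
  by move=> x; rewrite /hv /g; ring.
rewrite itgD; last 2 first.
- by apply: locintB; exact: locintM.
- by apply: locintZ; exact: continuous_locint.
rewrite itgB; [|exact: locintM..].
rewrite itgZ; last exact: continuous_locint.
rewrite !itg_periodize//.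
have lh := @hb_Lfun R n.
have -> : avg (fun x => L2fun q' x * g x) = avg (fun x => L2fun q x * g x) + t * avg (fun x => hb n x * g x).
  rewrite -avgZ; last exact: Lfun2_mul_int.
  rewrite -avgD; last 2 first.
  - exact: Lfun2_mul_int (L2fun_Lfun q) lg.
  - by have := Lfun2_mul_int (Lfun2Z t lh) lg; apply: eq_integrable => // x _; rewrite /= mulrA.
  apply: avg_ae.
  - by apply: measurable_funM; [exact: L2fun_meas|exact: Lfun_meas lg].
  - have mg := Lfun_meas lg; have mh := Lfun_meas lh.
    apply: measurable_funD; first by apply: measurable_funM => //; exact: L2fun_meas.
    by apply: measurable_funM; [exact: measurable_cst|exact: measurable_funM].
  - by apply: ae_muT_imp (ahE lh q t) => x h xT; rewrite h//; ring.
have -> : itg g 0 T = T * avg g by rewrite avg_itg// mulrA divff ?mul1r// gt_eqF// T_gt0.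
rewrite -/(g _) => h.
have : T * ((l' - l) * avg g - t * avg (fun x => hb n x * g x)) = 0 by rewrite -[RHS]h; ring.
by move/eqP; rewrite mulf_eq0 gt_eqF ?T_gt0//= subr_eq0 => /eqP.
Qed.

(** The determinant is continuous in the second potential and eigenvalue, hence nonzero nearby,
    where the homogeneous system has only the zero solution. *)
Lemma double_isolated s n p t0 l0 : s * s = 1 ->
  double s (ah (hb n) p t0) l0 -> detD n (ah (hb n) p t0) l0 (ah (hb n) p t0) l0 != 0 ->
  exists2 e : R, 0 < e & forall t l, `|t - t0| < e -> `|l - l0| < e ->
    double s (ah (hb n) p t) l -> t = t0 /\ l = l0.
Proof.
move=> ss; set q := ah (hb n) p t0 => dq D0.
have lh := @hb_Lfun R n.
have [C C0 hC] := detD_locLipr n q l0 q (addr_ge0 (normr_ge0 l0) ler01).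
set D := detD n q l0 q l0 in D0 *.
have Dp : 0 < `|D| by rewrite normr_gt0.
have C2 : 0 < 2 * C + 1 by rewrite ltr_wpDl ?mulr_ge0.
(* The determinant then moves by less than [2 C |D| / (2 C + 1) < |D|]; the bound 1 keeps within the
   range of the Lipschitz constant. *)
exists (Num.min 1 (`|D| / (2 * C + 1))); first by rewrite lt_min ltr01 divr_gt0.
move=> t l; rewrite !lt_min => /andP[t1 t2] /andP[l1 l2] dq'.
have qE : ah (hb n) p t = ah (hb n) q (t - t0) by rewrite /q ah_ah// addrC subrK.
rewrite qE in dq'; set q' := ah (hb n) q (t - t0) in dq'.
have dqq : dst q' q <= `|t - t0|.
  rewrite /q' -{2}(ah0 lh q) dst_ah_move// subr0.
  by rewrite ler_piMr// nrm_hb.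
have lK : `|l| <= `|l0| + 1.
  have E : `|l| <= `|l0| + `|l - l0| by rewrite -[in leLHS](subrK l0 l) addrC ler_normD.
  by apply: (le_trans E); rewrite lerD2l ltW.
have lK0 : `|l0| <= `|l0| + 1 by rewrite lerDl.
have q1 : dst q' q <= 1 by exact: le_trans dqq (ltW t1).
have := hC q' q l l0 q1 _ lK lK0; rewrite dst_xx => /(_ ler01) hd.
have G0 : detD n q l0 q' l != 0.
  apply: contraTneq Dp => G0; move: hd; rewrite G0 sub0r normrN -/D -leNgt => hd.
  rewrite ltr_pdivlMr// in t2; rewrite ltr_pdivlMr// in l2.
  have : C * (dst q' q + `|l - l0|) <= C * (`|t - t0| + `|l - l0|) by rewrite ler_wpM2l// lerD2r.
  have := normr_ge0 (t - t0); have := normr_ge0 (l - l0); nra.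
have [d1 d2 d3 d4] := dq; have [d1' d2' d3' d4'] := dq'.
have g11 := @green_shift s n q (t - t0) l0 l 1 0 1 0 ss.
have g12 := @green_shift s n q (t - t0) l0 l 1 0 0 1 ss.
rewrite !mulr1 !mulr0 in g11 g12.
have {}g11 := g11 d1 d3 d1' d3'; have {}g12 := g12 d1 d3 d2' d4'.
rewrite -/q' in g11 g12.
(* Cramer's rule for the system [g11], [g12]. *)
have tG : (t - t0) * detD n q l0 q' l = 0.
  by rewrite /detD mulrBr !mulrA g11 g12; ring.
have lG : (l - l0) * detD n q l0 q' l = 0.
  rewrite /detD mulrBr [X in X - _]mulrCA [X in _ - X]mulrCA -g11 -g12; ring.
by split; apply/eqP; rewrite -subr_eq0;
  [move/eqP: tG|move/eqP: lG]; rewrite mulf_eq0 (negbTE G0) orbF.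
Qed.

End Degeneracy.

(** * The set of potentials with a double eigenvalue is null *)

Section NullSets.
Context {R : realType}.
Notation T := (pi *+ 2 : R).
Notation mR := (measurableTypeR R).

(** Each isolated point is coded by a rational square that contains it and no other point of [S]. *)
Lemma isolated_countable (S : set (R * R)) :
  (forall z, S z -> exists2 e : R, 0 < e & forall z', S z' ->
     `|z'.1 - z.1| < e -> `|z'.2 - z.2| < e -> z' = z) -> countable S.
Proof.
move=> iso.
have code z : exists c : (rat * rat) * rat, S z ->
    [/\ `|z.1 - ratr c.1.1| < ratr c.2, `|z.2 - ratr c.1.2| < ratr c.2 &
    forall z', S z' -> `|z'.1 - ratr c.1.1| < ratr c.2 ->
      `|z'.2 - ratr c.1.2| < ratr c.2 -> z' = z].
  have [Sz|nSz] := pselect (S z); last by exists (0, 0, 0).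
  have [e e0 he] := iso z Sz.
  have e2 : 0 < e / 2 by rewrite divr_gt0.
  have [r] := rat_in_itvoo e2; rewrite in_itv/= => /andP[r0 r2].
  have ap (y : R) : exists a : rat, `|y - ratr a| < ratr r.
    have yl : y - ratr r < y by rewrite ltrBlDr ltrDl.
    have [a] := rat_in_itvoo yl; rewrite in_itv/= => /andP[a1 a2].
    by exists a; rewrite ger0_norm ?subr_ge0 ?(ltW a2)//; lra.
  have [a ha] := ap z.1; have [b hb] := ap z.2.
  exists (a, b, r) => _; split=> //= z' Sz' h1 h2; apply: he => //.
    have -> : z'.1 - z.1 = (z'.1 - ratr a) - (z.1 - ratr a) by ring.
    by apply: le_lt_trans (ler_normB _ _) _; lra.
  have -> : z'.2 - z.2 = (z'.2 - ratr b) - (z.2 - ratr b) by ring.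
  by apply: le_lt_trans (ler_normB _ _) _; lra.
have [f hf] := choice code.
apply/countable_injP; exists (fun z => pickle (f z)) => z z'; rewrite !inE => Sz Sz' /(pcan_inj pickleK) ff.
have [_ _ h] := hf z' Sz'; have [h1 h2 _] := hf z Sz.
by apply: h => //; rewrite -ff.
Qed.

Lemma normal_countable_null (A B : set mR) : measurable A -> A `<=` B -> countable B ->
  normal_prob (0 : R) 1 A = 0%E.
Proof.
move=> mA AB cB; move/null_content_dominatesP: (@normal_prob_dominates R 0 1); apply => //.
by apply: countable_lebesgue_measure0; exact: sub_countable (subset_card_le AB) cB.
Qed.

(** All conditions in one nonnegative locally Lipschitz function. As [|x| + x] is twice the positive
    part of [x], the last summand vanishes exactly when [|detD| >= 1 / (k + 1)]. *)
Definition defect (s : R) (n : int) (k : nat) (q : L2T R) (l : R) : R :=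
  `|fund 1 0 q l T - s| + `|fund 0 1 q l T| + `|fund' 1 0 q l| + `|fund' 0 1 q l - s| +
  (`|k.+1%:R^-1 - `|detD n q l q l| | + (k.+1%:R^-1 - `|detD n q l q l|)).

Let pos0 (x : R) : 0 <= `|x| + x. Proof. by rewrite -[x in X in _ <= X]opprK subr_ge0 opprK -normrN ler_norm. Qed.

Lemma defect_ge0 s n k q l : 0 <= defect s n k q l.
Proof. by rewrite /defect addr_ge0 ?pos0// !addr_ge0. Qed.

Lemma defect_locLip s n k : locLip (defect s n k).
Proof.
have c := @locLip_cst R.
have d := locLip_norm (@detD_locLip R n).
have e := locLipB (c k.+1%:R^-1) d.
apply: locLipD; last by apply: locLipD => //; exact: locLip_norm.
apply: locLipD; [apply: locLipD; [apply: locLipD|]|]; apply: locLip_norm.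
- by apply: locLipB => //; exact: fund_locLip.
- exact: fund_locLip.
- exact: fund'_locLip.
- by apply: locLipB => //; exact: fund'_locLip.
Qed.

Lemma defect0 s n k q l : defect s n k q l = 0 <->
  double s q l /\ k.+1%:R^-1 <= `|detD n q l q l|.
Proof.
rewrite /defect /double; set D := `|detD n q l q l|; set a := _ - s; set b := fund 0 1 q l T.
set c := fund' 1 0 q l; set d := _ - s.
have az : a = 0 <-> fund 1 0 q l T = s by rewrite /a; split=> [/eqP|->]; rewrite ?subrr// subr_eq0 => /eqP.
have dz : d = 0 <-> fund' 0 1 q l = s by rewrite /d; split=> [/eqP|->]; rewrite ?subrr// subr_eq0 => /eqP.
have Dz : `|k.+1%:R^-1 - D| + (k.+1%:R^-1 - D) = 0 <-> k.+1%:R^-1 <= D.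
  have nz (y : R) : `|y| + y = 0 <-> y <= 0.
    by split=> [e|y0]; [have := normr_ge0 y; lra|rewrite ler0_norm// addNr].
  by rewrite nz subr_le0.
split=> [/eqP|[[/az -> -> -> /dz ->] /Dz ->]]; last by rewrite normr0 !addr0.
have sum0 (x1 x2 x3 x4 x5 : R) : 0 <= x1 -> 0 <= x2 -> 0 <= x3 -> 0 <= x4 -> 0 <= x5 ->
    x1 + x2 + x3 + x4 + x5 == 0 -> [/\ x1 = 0, x2 = 0, x3 = 0, x4 = 0 & x5 = 0].
  by move=> ? ? ? ? ? /eqP ?; split; lra.
move/(sum0 _ _ _ _ _ (normr_ge0 a) (normr_ge0 b) (normr_ge0 c) (normr_ge0 d) (pos0 _)).
case=> /normr0_eq0/az ? /normr0_eq0 ? /normr0_eq0 ? /normr0_eq0/dz ? /Dz ?.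
by [].
Qed.

(** A bounded range for [l] and a positive lower bound for the determinant make the condition
    closed, hence measurable; countably many such sets cover all potentials with a double
    eigenvalue. *)
Definition bad_set s n k (K : nat) : set (L2T R) :=
  [set q | exists2 l : R, `|l| <= K%:R & defect s n k q l = 0].

Lemma bad_set_measurable s n k K : measurable (bad_set s n k K).
Proof. by apply: locLip_zero_measurable; [exact: defect_locLip|exact: defect_ge0]. Qed.

Lemma double_bad s q l : double s q l -> exists n k K, bad_set s n k K q.
Proof.
move=> dq; have [n hn] := detD_nondegenerate q l.
have d0 : 0 < `|detD n q l q l| by rewrite normr_gt0.
exists n, (Num.bound `|detD n q l q l|^-1), (Num.bound `|l|), l.
  by apply: ltW; exact: archi_boundP.
apply/defect0; split=> //; rewrite invf_ple ?posrE//.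
apply: ltW; apply: lt_le_trans (archi_boundP _) _; first by rewrite invr_ge0 ltW.
by rewrite ler_nat.
Qed.

Section Gaussian.
Variable gam : probability (L2T R) R.
Hypothesis gam_dis : disintegrates gam.

(** On each line the section is contained in the projection of a set of isolated pairs [(t, l)],
    which is countable and thus normal null. *)
Lemma bad_set_null s n k K : s * s = 1 -> gam (bad_set s n k K) = 0%E.
Proof.
move=> ss; have mB := bad_set_measurable s n k K; set B := bad_set s n k K in mB *.
have [rho [_ dis]] := gam_dis n.
have mi : measurable_fun setT (fun q => (\1_B q)%:E : \bar R).
  by apply/measurable_EFinP; exact: measurable_indic.
have -> : gam B = (\int[gam]_q (\1_B q)%:E)%E by rewrite integral_indic// setIT.
rewrite (dis _ mi); last by move=> q; rewrite lee_fin.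
apply: integral0_eq => p _.
pose Sp : set mR := (fun t : mR => ah (hb n) p t) @^-1` B.
have mS : measurable Sp.
  rewrite -[X in measurable X]setTI.
  exact: (measurable_fun_pair2 p (ah_measurable (@hb_Lfun R n))).
have -> : (\int[normal_prob (0 : R) 1]_t (\1_B (ah (hb n) p t))%:E = normal_prob (0 : R) 1 Sp)%E.
  rewrite -[RHS](_ : \int[normal_prob (0 : R) 1]_t (\1_Sp t)%:E = _)%E //.
  by rewrite integral_indic ?setIT.
pose S : set (R * R) := [set z | double s (ah (hb n) p z.1) z.2 /\
  detD n (ah (hb n) p z.1) z.2 (ah (hb n) p z.1) z.2 != 0].
apply: (@normal_countable_null _ (fst @` S)) => //.
  move=> t [l lK /defect0 [dq kD]]; exists (t, l) => //; split=> //=.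
  by rewrite -normr_gt0; apply: lt_le_trans kD; rewrite invr_gt0.
apply: sub_countable (card_image_le _ _) _.
apply: isolated_countable => -[t0 l0] [/= d0 D0].
have [e e0 he] := double_isolated ss d0 D0.
exists e => // -[t l] [/= d1 _] h1 h2.
by have [-> ->] := he t l h1 h2 d1.
Qed.

Lemma gaussian_simple : {ae gam, forall q, forall l, ~ double 1 q l /\ ~ double (-1) q l}.
Proof.
pose A (i : (bool * int) * (nat * nat)) := bad_set ((-1) ^+ i.1.1) i.1.2 i.2.1 i.2.2.
have ss (b : bool) : (-1) ^+ b * (-1) ^+ b = 1 :> R by rewrite -expr2 sqrr_sign.
have : gam.-negligible (\bigcup_k [set q | exists2 i, unpickle k = Some i & A i q]).
  apply: negligible_bigcup => k; case uk : (@unpickle ((bool * int) * (nat * nat))%type k) => [i|].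
    exists (A i); split; [exact: bad_set_measurable|exact: bad_set_null|].
    by move=> q [i' [<-]].
  by exists set0; split=> // q [].
apply: negligibleS => q /= nq; apply: contrapT => h; apply: nq => l.
have bad (b : bool) : double ((-1) ^+ b) q l -> False.
  move=> /double_bad [n [k [K hb]]]; apply: h.
  by exists (pickle ((b, n), (k, K))) => //=; exists ((b, n), (k, K)); rewrite ?pickleK.
by split; [have := bad false|have := bad true]; rewrite ?expr0 ?expr1.
Qed.

End Gaussian.
End NullSets.

Theorem proposition2p3 (R : realType)
  (gam : probability (L2T R) R) (Hgam : is_gaussian_measure gam)
  (lam : L2T R -> nat -> R) (Hlam : forall q, is_periodic_spectrum q (lam q)) :
  (exists N1 : R, 0 < N1 /\
    forall beta N : R, 0 < beta -> 0 < N -> N < N1 ->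
    forall nu : probability (L2T R) R, is_gibbs_measure gam N beta nu ->
    exists c C : R, [/\ 0 < c, 0 < C &
      forall j : nat, (1 <= j)%N ->
        ((c / j%:R)%:E <=
           \int[nu]_(q in Omega_ N) (lam q (2 * j)%N - lam q (2 * j - 1)%N)%:E
         <= (C / j%:R)%:E)%E])
  /\
  (forall beta N : R, 0 < beta -> 0 < N ->
    forall nu : probability (L2T R) R, is_gibbs_measure gam N beta nu ->
    {ae nu, forall q : L2T R, forall j : nat,
      has_dim (hill_eigenspace q (lam q j)) 1 /\ lam q j < lam q j.+1}).
Proof.
have dis := gaussian_disintegrates Hgam; have dense := gaussian_densely_supported Hgam.
split.
  (* The range of validity of [spectral_gap]. *)
  exists ((wm / 8) ^+ 2); split.
    by rewrite exprn_gt0// divr_gt0// wm_gt0.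
  move=> beta N beta0 N0 NN1 nu Hnu.
  exact: (gibbs_mean_gap dis dense beta0 N0 Hnu Hlam NN1).
move=> beta N beta0 N0 nu Hnu.
(* The Gibbs measure is absolutely continuous with respect to [gam], so the same null set serves for
   all [beta] and [N]. *)
have [A [mA A0 sA]] := gaussian_simple dis.
exists A; split=> //; first exact: gibbs_dominates Hnu _ mA A0.
move=> q nq; apply: sA => h; apply: nq => j.
exact: (simple_spectrum (Hlam q) h j).
Qed.
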